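(* Let $X_t$ be a one-dimensional Lévy process whose Lévy--Khintchine exponent $\Psi$ is a nearly balanced Rogers function, and let $\kappa^{\uparrow}(\tau;\xi)$, $\kappa^{\downarrow}(\tau;\xi)$ be the Laplace exponents of the ascending and descending ladder processes of $X_t$. Then $\kappa^{\uparrow}(\tau;\xi)$ and $\kappa^{\downarrow}(\tau;\xi)$ are complete Bernstein functions of $\xi$ (for each fixed $\tau \ge 0$) and complete Bernstein functions of $\tau$ (for each fixed $\xi \ge 0$). Furthermore, if $0 \le \tau_1 \le \tau_2$ and $0 \le \xi_1 \le \xi_2$, then $$\frac{\kappa^{\uparrow}(\tau_1;\xi)}{\kappa^{\uparrow}(\tau_2;\xi)} \quad\text{and}\quad \frac{\kappa^{\downarrow}(\tau_1;\xi)}{\kappa^{\downarrow}(\tau_2;\xi)}$$ are complete Bernstein functions of $\xi$, and $$\frac{\kappa^{\uparrow}(\tau;\xi_1)}{\kappa^{\uparrow}(\tau;\xi_2)} \quad\text{and}\quad \frac{\kappa^{\downarrow}(\tau;\xi_1)}{\kappa^{\downarrow}(\tau;\xi_2)}$$ are complete Bernstein functions of $\tau$.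
   Context: Let $\mathbf{C}_\to = \{\xi \in \mathbf{C} : \operatorname{Re}\xi > 0\}$, and let $\operatorname{Arg}$ denote the principal argument. Complete Bernstein function: a holomorphic function $g$ on $\mathbf{C}\setminus(-\infty,0]$ with $\operatorname{Im} g(\xi) \ge 0$ whenever $\operatorname{Im}\xi > 0$ and $g(\xi) \in [0,\infty)$ for $\xi \in (0,\infty)$. A function on $(0,\infty)$ is called a complete Bernstein function if it extends to such a function. Rogers function: a holomorphic function $f$ on $\mathbf{C}_\to$ with $\operatorname{Re}(f(\xi)/\xi) \ge 0$ for all $\xi \in \mathbf{C}_\to$. Let $f$ be a nonconstant Rogers function. For each $r>0$ there is at most one $\zeta \in \mathbf{C}_\to$ with $|\zeta|=r$ and $f(\zeta) \in (0,\infty)$; if it exists, it is denoted by $\zeta_f(r)$, and $|\gamma_f| \subseteq (0,\infty)$ is the set of those $r$ for which it exists. The function $\zeta_f$ extends to a continuous function on $(0,\infty)$ with $\zeta_f(r) \in \{-ir, ir\}$ for $r \in (0,\infty)\setminus|\gamma_f|$. $f$ is balanced if $|\gamma_f| = (0,\infty)$, $\sup_{r>0}|\operatorname{Arg}\zeta_f(r)| < \frac{\pi}{2}$ and $\int_0^\infty |\zeta_f'(r)| (1+r^2)^{-1}\log(r+1/r)\,dr < \infty$. $f$ is nearly balanced if $|\gamma_f| = (r_0,r_\infty)$ for some $0 \le r_0 < r_\infty \le \infty$ and the Rogers function $g(\xi) = f(u(\xi))$ is balanced, where $\zeta_0 = \zeta_f(r_0)$ ($\zeta_0=0$ if $r_0=0$),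 $\zeta_\infty = \zeta_f(r_\infty)$ (complex infinity if $r_\infty=\infty$) and $$u(\xi) = \zeta_0 + \frac{(\zeta_\infty-\zeta_0)\xi}{\xi+(\zeta_\infty-\zeta_0)},$$ with $u(\xi) = \zeta_0+\xi$ if $\zeta_\infty$ is complex infinity. The Lévy--Khintchine exponent $\Psi$ of $X_t$ is defined by $\mathbf{E}e^{i\xi X_t} = e^{-t\Psi(\xi)}$ for $\xi\in\mathbf{R}$. ''$\Psi$ is a (nearly balanced) Rogers function'' means that $\Psi(\xi)=f(\xi)$ for all $\xi>0$ for some (nearly balanced) Rogers function $f$. The Laplace exponents of the ladder processes are, for $\tau \ge 0$ and $\operatorname{Re}\xi\ge 0$, $$\kappa^{\uparrow}(\tau;\xi) = \exp\left(\int_0^\infty\int_{(0,\infty)} \frac{e^{-t}-e^{-\tau t-\xi x}}{t}\,\mathbf{P}(X_t\in dx)\,dt\right),$$ $$\kappa^{\downarrow}(\tau;\xi) = \exp\left(\int_0^\infty\int_{(-\infty,0)} \frac{e^{-t}-e^{-\tau t+\xi x}}{t}\,\mathbf{P}(X_t\in dx)\,dt\right).$$ *)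

(* Defs.v *)
From HB Require Import structures.
From mathcomp Require Import all_boot all_order all_algebra.
From mathcomp Require Import complex.
From mathcomp Require Import all_classical all_reals all_analysis.

Set Implicit Arguments.
Unset Strict Implicit.
Unset Printing Implicit Defensive.

Import Order.TTheory GRing.Theory Num.Theory ComplexField.
Import numFieldNormedType.Exports.

Local Open Scope classical_set_scope.
Local Open Scope complex_scope.
Local Open Scope ring_scope.

(* The order of [R[i]] is the partial one: [0 <= z] (resp. [0 < z], [z <= 0])
   says that [z] is real and lies in [0, oo) (resp. (0, oo), (-oo, 0]). *)

Section complex_functions.
Variable R : realType.
Implicit Types (f g : R[i] -> R[i]) (z : R[i]).

Definition cexp z : R[i] :=
  (expR (complex.Re z) * cos (complex.Im z))
  +i* (expR (complex.Re z) * sin (complex.Im z)).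

(* Principal argument, with values in (-pi, pi]; meaningful for [z != 0]. *)
Definition Arg z : R :=
  let a := acos (complex.Re z / complex.Re `|z|) in
  if 0 <= complex.Im z then a else - a.

(* Complex differentiability at every point of [D]; used for open [D] only. *)
Definition holomorphic_on (D : set R[i]) f : Prop :=
  forall z, D z -> derivable (f : R[i]^o -> R[i]^o) z 1.

Definition right_half_plane : set R[i] := [set z | 0 < complex.Re z].

Definition slit_plane : set R[i] := ~` [set z | z <= 0].

Definition complete_bernstein g : Prop :=
  [/\ holomorphic_on slit_plane g,
      forall z, 0 < complex.Im z -> 0 <= complex.Im (g z)
    & forall x : R, 0 < x -> 0 <= g x%:C].

(* [h] is only looked at on (0, oo). *)
Definition is_complete_bernstein (h : R -> R[i]) : Prop :=
  exists2 g, complete_bernstein g & forall x : R, 0 < x -> g x%:C = h x.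

(* Values of [f] outside [right_half_plane] are irrelevant. *)
Definition rogers f : Prop :=
  holomorphic_on right_half_plane f /\
  forall z, right_half_plane z -> 0 <= complex.Re (f z / z).

Definition nonconstant_rogers f : Prop :=
  rogers f /\ ~ exists c, forall z, right_half_plane z -> f z = c.

(* The set |gamma_f|. *)
Definition gamma_dom f : set R :=
  [set r | 0 < r /\
    exists z, [/\ right_half_plane z, `|z| = r%:C & 0 < f z]].

(* [zeta] is the function zeta_f, extended continuously to (0, oo). When
   [gamma_dom f] is nonempty, this determines [zeta] on (0, oo), since the
   point of [gamma_dom] is unique for nonconstant Rogers functions and the
   choice of sign outside of [gamma_dom f] is forced by continuity. *)
Definition is_zeta f (zeta : R -> R[i]) : Prop :=
  [/\ forall r, gamma_dom f r ->
        [/\ right_half_plane (zeta r), `|zeta r| = r%:C & 0 < f (zeta r)],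
      forall r : R, 0 < r -> ~ gamma_dom f r ->
        zeta r = 0 +i* r \/ zeta r = 0 +i* (- r)
    & forall r : R, 0 < r -> {for r, continuous (zeta : R -> R[i]^o)}].

(* [`|zeta'(r)|] for a curve [zeta] in the complex plane. *)
Definition speed (zeta : R -> R[i]) (r : R) : R :=
  complex.Re `|derive1 (fun s => complex.Re (zeta s)) r
               +i* derive1 (fun s => complex.Im (zeta s)) r|.

Definition balanced f : Prop :=
  nonconstant_rogers f /\
  exists zeta, [/\ is_zeta f zeta,
    gamma_dom f = [set r | 0 < r],
    sup [set `|Arg (zeta r)| | r in [set r : R | 0 < r]] < pi / 2
  & (\int[lebesgue_measure]_(r in [set r : R | (0 < r)%R])
      (speed zeta r * (1 + r ^+ 2)^-1 * ln (r + r^-1))%:E < +oo)%E].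

(* The map u; [None] stands for zeta_oo = complex infinity. *)
Definition moebius_u (zeta0 : R[i]) (zetaoo : option R[i]) (z : R[i]) : R[i] :=
  if zetaoo is Some w
  then zeta0 + (w - zeta0) * z / (z + (w - zeta0))
  else zeta0 + z.

Definition nearly_balanced f : Prop :=
  nonconstant_rogers f /\
  exists (r0 : R) (roo : \bar R) (zeta : R -> R[i]),
    [/\ 0 <= r0, (r0%:E < roo)%E,
        gamma_dom f = [set r | r0 < r /\ (r%:E < roo)%E],
        is_zeta f zeta
      & let zeta0 := if r0 == 0 then 0 else zeta r0 in
        let zetaoo := if roo is r%:E then Some (zeta r) else None in
        balanced (f \o moebius_u zeta0 zetaoo)].

End complex_functions.

Section levy.
Variables (R : realType) (d : measure_display) (T : measurableType d).
Variable P : probability T R.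
Implicit Type X : R -> {RV P >-> R}.

(* Processes are indexed by [R]; negative times are never used. *)
Definition levy_process X : Prop :=
  [/\ P [set w | X 0 w = 0] = 1%E,
      (forall (n : nat) (t : nat -> R) (B : nat -> set R),
        0 <= t 0%N -> (forall i, t i <= t i.+1) ->
        (forall i, measurable (B i)) ->
        P (\bigcap_(i in `I_n) [set w | B i (X (t i.+1) w - X (t i) w)]) =
        (\prod_(i < n) P [set w | B i (X (t i.+1) w - X (t i) w)%R])%E),
      (forall (s t : R) (B : set R), 0 <= s -> 0 <= t -> measurable B ->
        P [set w | B (X (s + t) w - X s w)] = P [set w | B (X t w)])
    & (forall s eps : R, 0 <= s -> 0 < eps ->
        P [set w | eps < `|X t w - X s w|]
          @[t --> within [set t | 0 <= t] (nbhs s)] --> 0%E)].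

(* E e^{i xi Y}; both parts are expectations of bounded random variables. *)
Definition char_fun (Y : {RV P >-> R}) (xi : R) : R[i] :=
  fine 'E_P[fun w => cos (xi * Y w)] +i* fine 'E_P[fun w => sin (xi * Y w)].

Definition levy_khintchine_exponent X (Psi : R -> R[i]) : Prop :=
  forall t xi : R, 0 <= t -> char_fun (X t) xi = cexp (- (t%:C * Psi xi)).

(* Exponential of the iterated integral of [F t x] over [x] in [D] w.r.t.
   P(X_t in dx) and then over [t] in (0, oo). It is split into
   exp(real part) * exp(i * imaginary part) so that it vanishes when the real
   part is -oo, which may happen in [kappa_up 0 0] and [kappa_down 0 0]. *)
Definition exp_integral X (D : set R) (F : R -> R -> R[i]) : R[i] :=
  let I (part : R[i] -> R) : \bar R :=
    (\int[lebesgue_measure]_(t in [set t : R | (0 < t)%R])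
       \int[distribution P (X t)]_(x in D) (part (F t x))%:E)%E in
  (fine (expeR (I (@complex.Re R))))%:C
    * cexp (0 +i* fine (I (@complex.Im R))).

Definition kappa_up X (tau : R) (xi : R[i]) : R[i] :=
  exp_integral X [set x | 0 < x] (fun t x =>
    ((expR (- t))%:C - cexp (- (tau * t)%:C - xi * x%:C)) / t%:C).

Definition kappa_down X (tau : R) (xi : R[i]) : R[i] :=
  exp_integral X [set x | x < 0] (fun t x =>
    ((expR (- t))%:C - cexp (- (tau * t)%:C + xi * x%:C)) / t%:C).

End levy.

(* Main.v *)
Require Import Defs.
From HB Require Import structures.
From mathcomp Require Import all_boot all_order all_algebra.
From mathcomp Require Import complex.
From mathcomp Require Import all_classical all_reals all_analysis.
From mathcomp Require Import measurable_realfun.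
From mathcomp Require Import ring lra.

(* Let [K(v) = e^v / (x1 + i e^v) - e^v / (x2 + i e^v)] and let [f] be the Rogers function.
   Fourier inversion writes the difference of [E(e^(-x X_t); X_t > 0)] at [x = x1] and
   [x = x2] as [1/pi] times the integral over [r] in R of [Re (K(r) e^(-t f(e^r)))]. Hence
   the derivative in tau of [log kappa(tau; x1) - log kappa(tau; x2)] is
   [D(s) = 1/pi * \int_R Re (K(r) / (s + f(e^r))) dr] at [s = tau].
   Shifting the line R to [Im v = - pi/2], where [K] is purely imaginary, and integrating in
   [s] displays [log (kappa(tau1; x) / kappa(tau2; x))] as a Stieltjes integral in [x] whose
   density, being an increment of an arctangent divided by [pi], lies in [0, 1].
   Shifting it instead to the curve on which [f(e^v)] is positive, parametrised by an
   increasing function [lam], and integrating by parts turns [D(s)] into the integral of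
   [A / pi * lam' / (s + lam)^2], where the increment [A] of an argument lies in [0, pi];
   integration in [s] gives a Stieltjes integral in [tau], again with density in [0, 1].
   Exponentials of such integrals are complete Bernstein functions, and so are their
   pointwise limits. This allows one to replace [f] first by functions for which the
   contours are harmless, and covers the cases [tau = 0] and [xi = 0]. Only the Rogers
   property of [f] is needed. *)

Set Implicit Arguments.
Unset Strict Implicit.
Unset Printing Implicit Defensive.

Import Order.TTheory GRing.Theory Num.Theory ComplexField.
Import numFieldNormedType.Exports.

Local Open Scope classical_set_scope.
Local Open Scope complex_scope.
Local Open Scope ring_scope.

(** * Complex derivatives *)

(** Fourier inversion reaches only mixed second differences of log kappa, so the quotients come
    first; an exponent is recovered from them as a limit, after normalisation, when the second
    parameter tends to infinity. The regularised symbol is [e^v (N_eta(e^(a v)) + eps)] with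
    [N(z) = f(z) / z] and [N_eta = N / (1 + eta N)]: [a < 1] keeps [e^(a v)] inside the open
    half-plane up to the edges of the strip, [eta] makes the factor bounded, and [eps] gives
    [|s + E| >= eps e^r]. The same [a < 1], through a Schwarz-Pick bound, makes [Im E] cross zero
    only upwards on vertical segments, so that the curve where [E > 0] is a graph over [r]. The
    class of logarithms is a list of pointwise inequalities for a function and its candidate
    derivative; an ultrafilter limit of both therefore stays in the class. A separate obstacle is
    the factor [1/t] at [t = 0]. With [p(t, x) = E(e^(-x X_t); X_t > 0)] it is met by
    [p(t, 0) - p(t, x) = O(t^(1/4))], where the exponent 1/4 fits the growth
    [|f(e^r)| = O(1 + e^(2 r))]. *)

Section modulus.
Variable R : realType.
Implicit Types (z w : R[i]) (x y : R).

(** The norm of [R[i]] takes values in [R[i]], whose order is partial. A modulus with values in [R]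
    lets all estimates be carried out in an ordered field. *)
Definition nm z : R := Num.sqrt (complex.Re z ^+ 2 + complex.Im z ^+ 2).

Lemma normc_nm z : `|z| = (nm z)%:C.
Proof. exact: normc_def. Qed.

Lemma nm_ge0 z : 0 <= nm z.
Proof. exact: sqrtr_ge0. Qed.

Lemma nmM z w : nm (z * w) = nm z * nm w.
Proof. by apply: (@complexI R); rewrite rmorphM /= -!normc_nm normrM. Qed.

Lemma nmN z : nm (- z) = nm z.
Proof. by apply: (@complexI R); rewrite -!normc_nm normrN. Qed.

Lemma nmB z w : nm (z - w) = nm (w - z).
Proof. by rewrite -nmN opprB. Qed.

Lemma nmD z w : nm (z + w) <= nm z + nm w.
Proof. by rewrite -lecR rmorphD /= -!normc_nm ler_normD. Qed.

Lemma nmDB z w : nm (z - w) <= nm z + nm w.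
Proof. by rewrite -(nmN w) nmD. Qed.

Lemma nm_tri u z w : nm (z - w) <= nm (z - u) + nm (u - w).
Proof. by apply: le_trans (nmD _ _); rewrite addrA subrK. Qed.

Lemma nm0 : nm 0 = 0 :> R.
Proof. by apply: (@complexI R); rewrite -normc_nm normr0. Qed.

Lemma nm1 : nm 1 = 1 :> R.
Proof. by apply: (@complexI R); rewrite -normc_nm normr1. Qed.

Lemma nm_real x : nm x%:C = `|x|.
Proof. by rewrite /nm /= expr0n addr0 sqrtr_sqr. Qed.

Lemma nm_i x : nm (0 +i* x) = `|x|.
Proof. by rewrite /nm /= expr0n add0r sqrtr_sqr. Qed.

Lemma nm_eq0 z : (nm z == 0) = (z == 0).
Proof. by rewrite -(normr_eq0 z) normc_nm -(inj_eq (@complexI R)). Qed.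

Lemma nm_gt0 z : (0 < nm z) = (z != 0).
Proof. by rewrite lt_def nm_ge0 nm_eq0 andbT. Qed.

Lemma nmV z : nm z^-1 = (nm z)^-1.
Proof.
apply: (@complexI R); rewrite -normc_nm normfV normc_nm.
by rewrite (fmorphV (real_complex R)).
Qed.

Lemma nmX z n : nm (z ^+ n) = nm z ^+ n.
Proof. by elim: n => [|n IH]; rewrite ?expr0 ?nm1 // !exprS nmM IH. Qed.

Lemma nm_sq z : nm z ^+ 2 = complex.Re z ^+ 2 + complex.Im z ^+ 2.
Proof. by rewrite sqr_sqrtr // addr_ge0 ?sqr_ge0. Qed.

Lemma Re_nm z : `|complex.Re z| <= nm z.
Proof. by rewrite -sqrtr_sqr ler_wsqrtr // lerDl sqr_ge0. Qed.

Lemma Im_nm z : `|complex.Im z| <= nm z.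
Proof. by rewrite -sqrtr_sqr ler_wsqrtr // lerDr sqr_ge0. Qed.

Lemma nm_le_ReIm z : nm z <= `|complex.Re z| + `|complex.Im z|.
Proof.
have -> : z = (complex.Re z)%:C + (0 +i* complex.Im z).
  by case: z => a b /=; simpc.
by apply: (le_trans (nmD _ _)); rewrite nm_real nm_i /= addr0 add0r.
Qed.

Lemma Re_add z w : complex.Re (z + w) = complex.Re z + complex.Re w.
Proof. by case: z w => [? ?] []. Qed.
Lemma Im_add z w : complex.Im (z + w) = complex.Im z + complex.Im w.
Proof. by case: z w => [? ?] []. Qed.
Lemma Re_opp z : complex.Re (- z) = - complex.Re z.
Proof. by case: z. Qed.
Lemma Im_opp z : complex.Im (- z) = - complex.Im z.
Proof. by case: z. Qed.
Lemma Re_mul z w : complex.Re (z * w) =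
  complex.Re z * complex.Re w - complex.Im z * complex.Im w.
Proof. by case: z w => [? ?] []. Qed.
Lemma Im_mul z w : complex.Im (z * w) =
  complex.Re z * complex.Im w + complex.Im z * complex.Re w.
Proof. by case: z w => [? ?] []. Qed.
Lemma Re_inv z : complex.Re z^-1 = complex.Re z / nm z ^+ 2.
Proof. by rewrite nm_sq; case: z. Qed.
Lemma Im_inv z : complex.Im z^-1 = - complex.Im z / nm z ^+ 2.
Proof. by rewrite nm_sq mulNr; case: z. Qed.

Definition ReImE := (Re_add, Im_add, Re_opp, Im_opp, Re_mul, Im_mul).

Lemma complex_ext z w : complex.Re z = complex.Re w ->
  complex.Im z = complex.Im w -> z = w.
Proof. by case: z w => [a b] [c d] /= -> ->. Qed.

Lemma gt0_complexP (e : R[i]) : 0 < e -> exists2 x : R, 0 < x & e = x%:C.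
Proof.
case: e => a b; rewrite ltcE /= => /andP[/eqP b0 a0]; exists a => //.
by rewrite b0.
Qed.

End modulus.

Section derivative.
Variable R : realType.
Implicit Types (f g : R[i] -> R[i]) (z w c : R[i]) (F : R -> R[i]) (t : R).

Definition cder f z c := is_derive (z : R[i]^o) (1 : R[i]^o)
  (f : R[i]^o -> R[i]^o) (c : R[i]^o).

Lemma nbhs_nmP z (A : set R[i]) : nbhs (z : R[i]^o) A <->
  exists2 d : R, 0 < d & forall w, nm (w - z) < d -> A w.
Proof.
split.
  move=> /nbhs_ballP[e /= /gt0_complexP[x x0 ->] h]; exists x => // w wz.
  by apply: h; rewrite -ball_normE /= distrC normc_nm ltcR.
move=> [d d0 h]; apply/nbhs_ballP; exists d%:C; first by rewrite /= ltcR.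
by move=> w; rewrite -ball_normE /= distrC normc_nm ltcR; apply: h.
Qed.

(** Written without a quotient, the first-order expansion has no exceptional point [w = z], and
    complex and real difference bounds can be chained. *)
Lemma cderP f z c : cder f z c <-> forall e : R, 0 < e ->
  exists2 d : R, 0 < d & forall w, nm (w - z) < d ->
    nm (f w - f z - c * (w - z)) <= e * nm (w - z).
Proof.
split.
- move=> [df dc] e e0.
  have : (h^-1 *: ((f (h *: 1 + z) : R[i]^o) - f z)) @[h --> (0 : R[i]^o)^'] --> (c : R[i]^o).
    by rewrite -dc; exact: df.
  move/cvgrPdist_le => /(_ e%:C); rewrite ltcR => /(_ e0).
  rewrite /at_right /dnbhs near_withinE => /nbhs_nmP[d d0 h].
  exists d => // w wz; have [->|wNz] := eqVneq w z.
    by rewrite !subrr mulr0 subr0 nm0 mulr0.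
  have := h (w - z); rewrite subr0 subr_eq0 => /(_ wz wNz).
  rewrite scaler1 subrK normc_nm lecR => h1.
  rewrite -lter_pdivrMr ?nm_gt0 ?subr_eq0 // -nmV -nmM.
  apply: le_trans h1; rewrite [leRHS]nmB /=.
  rewrite le_eqVlt; apply/orP; left; apply/eqP; congr nm.
  rewrite mulrBl mulfK ?subr_eq0 //.
  by congr (_ - _); exact: mulrC.
- move=> h.
  have lim : (h^-1 *: ((f (h *: 1 + z) : R[i]^o) - f z)) @[h --> (0 : R[i]^o)^'] -->
      (c : R[i]^o).
    apply/cvgrPdist_le => e /gt0_complexP[x x0 ->].
    have [d d0 hd] := h _ x0.
    rewrite near_withinE; apply/nbhs_nmP; exists d => // u.
    rewrite subr0 => ud u0; have := hd (u + z); rewrite addrK => /(_ ud) hu.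
    rewrite normc_nm lecR nmB scaler1.
    rewrite -(ler_pM2r (x := nm u)) ?nm_gt0 // -nmM.
    apply: le_trans hu; rewrite le_eqVlt; apply/orP; left; apply/eqP.
    congr nm; rewrite mulrBl; congr (_ - _).
    by rewrite (_ : _ *: _ = u^-1 * (f (u + z) - f z)) // mulrAC mulVf // mul1r.
  apply: (@DeriveDef _ _ _ _ _ (f : R[i]^o -> R[i]^o)).
    by apply/cvg_ex; exists (c : R[i]^o).
  exact: cvg_lim lim.
Qed.

Lemma cder_derivable f z c : cder f z c -> derivable (f : R[i]^o -> R[i]^o) z 1.
Proof. by case. Qed.

Lemma derivable_cder f z : derivable (f : R[i]^o -> R[i]^o) z 1 ->
  exists c, cder f z c.
Proof. by move=> /derivableP h; exists ('D_1 (f : R[i]^o -> R[i]^o) z). Qed.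

Lemma cder_eq f z c c' : cder f z c -> c = c' -> cder f z c'.
Proof. by move=> ? <-. Qed.

Lemma cder_cst a z : cder (fun=> a) z 0.
Proof. exact: is_derive_cst. Qed.

Lemma cder_id z : cder id z 1.
Proof. exact: is_derive_id. Qed.

Lemma cderD f g z a b : cder f z a -> cder g z b ->
  cder (fun w => f w + g w) z (a + b).
Proof. exact: is_deriveD. Qed.

Lemma cderN f z a : cder f z a -> cder (fun w => - f w) z (- a).
Proof. exact: is_deriveN. Qed.

Lemma cderB f g z a b : cder f z a -> cder g z b ->
  cder (fun w => f w - g w) z (a - b).
Proof. exact: is_deriveB. Qed.

Lemma cderM f g z a b : cder f z a -> cder g z b ->
  cder (fun w => f w * g w) z (f z * b + g z * a).
Proof. exact: is_deriveM. Qed.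

Lemma cderV f z a : f z != 0 -> cder f z a ->
  cder (fun w => (f w)^-1) z (- a / f z ^+ 2).
Proof.
move=> fz0 [df da]; apply: DeriveDef; first exact: derivableV.
rewrite deriveV // da (_ : _ *: _ = - (f z) ^- 2 * a) //.
by rewrite mulNr mulrC -mulNr.
Qed.

Lemma cder_comp f g z a b : cder f (g z) a -> cder g z b ->
  cder (fun w => f (g w)) z (a * b).
Proof.
move=> hf hg; apply/cderP => e e0.
pose M := nm b + 1.
have M0 : 0 < M by rewrite ltr_wpDl ?nm_ge0.
have A0 : 0 < nm a + 1 by rewrite ltr_wpDl ?nm_ge0.
have e1 : 0 < e / 2 / M by rewrite !divr_gt0.
have [d1 d10 h1] := (cderP f (g z) a).1 hf _ e1.
have e2 : 0 < Num.min 1 (e / 2 / (nm a + 1)) by rewrite lt_min ltr01 !divr_gt0.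
have [d2 d20 h2] := (cderP g z b).1 hg _ e2.
exists (Num.min d2 (d1 / M)); first by rewrite lt_min d20 divr_gt0.
move=> w; rewrite lt_min => /andP[wd2 wd1].
have hw := h2 _ wd2.
have hwM : nm (g w - g z) <= M * nm (w - z).
  have -> : g w - g z = (g w - g z - b * (w - z)) + b * (w - z) by rewrite subrK.
  apply: (le_trans (nmD _ _)); rewrite nmM /M mulrDl addrC mul1r lerD2l.
  apply: le_trans hw _; rewrite ler_piMl ?nm_ge0 //.
  by rewrite ge_min lexx.
have hw1 : nm (g w - g z) < d1.
  by apply: (le_lt_trans hwM); rewrite mulrC -ltr_pdivlMr.
have hfw := h1 _ hw1.
have -> : f (g w) - f (g z) - a * b * (w - z) =
  (f (g w) - f (g z) - a * (g w - g z)) + a * (g w - g z - b * (w - z)) by ring.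
apply: (le_trans (nmD _ _)); rewrite nmM.
have -> : e * nm (w - z) = e / 2 * nm (w - z) + e / 2 * nm (w - z) by field.
apply: lerD.
  apply: (le_trans hfw); apply: (le_trans (ler_wpM2l (ltW e1) hwM)).
  by rewrite mulrA divfK // gt_eqF.
apply: (@le_trans _ _ ((nm a + 1) * (e / 2 / (nm a + 1) * nm (w - z)))).
  apply: ler_pM; rewrite ?nm_ge0 // ?lerDl //.
  apply: (le_trans hw); apply: ler_wpM2r; first exact: nm_ge0.
  by rewrite ge_min lexx orbT.
by rewrite mulrA [X in X * _]mulrC divfK // gt_eqF.
Qed.

Lemma cder_cont f z c : cder f z c -> forall e : R, 0 < e ->
  exists2 d : R, 0 < d & forall w, nm (w - z) < d -> nm (f w - f z) < e.
Proof.
move=> /cderP /(_ 1 ltr01) [d d0 h] e e0.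
have M0 : 0 < 2 + nm c by rewrite ltr_wpDr ?nm_ge0.
exists (Num.min d (e / (2 + nm c))).
  by rewrite lt_min d0 divr_gt0.
move=> w; rewrite lt_min => /andP[/h hw hw2].
have -> : f w - f z = (f w - f z - c * (w - z)) + c * (w - z) by rewrite subrK.
apply: (le_lt_trans (nmD _ _)); rewrite nmM.
apply: (@le_lt_trans _ _ ((1 + nm c) * nm (w - z))).
  by rewrite mulrDl lerD2r.
apply: (@le_lt_trans _ _ ((2 + nm c) * nm (w - z))).
  by apply: ler_wpM2r; rewrite ?nm_ge0 // lerD2r ler1n.
by rewrite mulrC -ltr_pdivlMr.
Qed.

(** Derivative of a curve in the plane, kept componentwise so that the real mean value theorem and
    the real fundamental theorem of calculus apply to each part. *)
Definition rder F t c :=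
  is_derive t 1 (fun s => complex.Re (F s)) (complex.Re c) /\
  is_derive t 1 (fun s => complex.Im (F s)) (complex.Im c).

Lemma is_deriveP (g : R -> R) t a : is_derive t 1 g a <->
  forall e : R, 0 < e -> exists2 d : R, 0 < d & forall s, `|s - t| < d ->
    `|g s - g t - a * (s - t)| <= e * `|s - t|.
Proof.
split.
- move=> [df dc] e e0.
  have : (h^-1 *: ((g (h *: 1 + t)) - g t)) @[h --> (0 : R)^'] --> a.
    by rewrite -dc; exact: df.
  move/cvgrPdist_le => /(_ e e0).
  rewrite near_withinE => /nbhs_ballP[d /= d0 h].
  exists d => // s st; have [->|sNt] := eqVneq s t.
    by rewrite !subrr mulr0 subr0 normr0 mulr0.
  have := h (s - t); rewrite -ball_normE /= sub0r normrN subr_eq0 => /(_ st sNt).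
  rewrite scaler1 subrK => h1.
  have st0 : s - t != 0 by rewrite subr_eq0.
  rewrite -ler_pdivrMr ?normr_gt0 // -normfV -normrM.
  apply: le_trans h1; rewrite distrC.
  rewrite le_eqVlt; apply/orP; left; apply/eqP; congr (`| _ |).
  by rewrite [_ *: _]/(_ * _) mulrBl mulfK // mulrC.
- move=> h.
  have lim : (h^-1 *: ((g (h *: 1 + t)) - g t)) @[h --> (0 : R)^'] --> a.
    apply/cvgrPdist_le => x x0.
    have [d d0 hd] := h _ x0.
    rewrite near_withinE; apply/nbhs_ballP; exists d => // u.
    rewrite -ball_normE /= sub0r normrN => ud u0.
    have := hd (u + t); rewrite addrK => /(_ ud) hu.
    rewrite distrC scaler1 -(ler_pM2r (x := `|u|)) ?normr_gt0 // -normrM.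
    apply: le_trans hu; rewrite le_eqVlt; apply/orP; left; apply/eqP.
    by congr (`| _ |); rewrite [_ *: _]/(_ * _) mulrBl mulrAC mulVf // mul1r.
  by apply: DeriveDef; [exact: (cvgP _ lim)|exact: cvg_lim].
Qed.

Lemma rderP F t c : rder F t c <-> forall e : R, 0 < e ->
  exists2 d : R, 0 < d & forall s, `|s - t| < d ->
    nm (F s - F t - c * (s - t)%:C) <= e * `|s - t|.
Proof.
split.
- move=> [/is_deriveP h1 /is_deriveP h2] e e0.
  have e2 : 0 < e / 2 by rewrite divr_gt0.
  have [d1 d10 hd1] := h1 _ e2; have [d2 d20 hd2] := h2 _ e2.
  exists (Num.min d1 d2); first by rewrite lt_min d10.
  move=> s; rewrite lt_min => /andP[/hd1 s1 /hd2 s2].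
  apply: (le_trans (nm_le_ReIm _)).
  rewrite !ReImE /= !mulr0 subr0 add0r.
  have -> : e * `|s - t| = e / 2 * `|s - t| + e / 2 * `|s - t| by field.
  by rewrite lerD.
- move=> h; split; apply/is_deriveP => e e0; have [d d0 hd] := h _ e0;
    exists d => // s /hd; apply: le_trans.
    by apply: le_trans (Re_nm _); rewrite !ReImE /= !mulr0 subr0.
  by apply: le_trans (Im_nm _); rewrite !ReImE /= !mulr0 add0r.
Qed.

Lemma rder_comp f F t a b : cder f (F t) a -> rder F t b ->
  rder (fun s => f (F s)) t (a * b).
Proof.
move=> hf hg; apply/rderP => e e0.
pose M := nm b + 1.
have M0 : 0 < M by rewrite ltr_wpDl ?nm_ge0.
have A0 : 0 < nm a + 1 by rewrite ltr_wpDl ?nm_ge0.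
have e1 : 0 < e / 2 / M by rewrite !divr_gt0.
have [d1 d10 h1] := (cderP f (F t) a).1 hf _ e1.
have e2 : 0 < Num.min 1 (e / 2 / (nm a + 1)) by rewrite lt_min ltr01 !divr_gt0.
have [d2 d20 h2] := (rderP F t b).1 hg _ e2.
exists (Num.min d2 (d1 / M)); first by rewrite lt_min d20 divr_gt0.
move=> w; rewrite lt_min => /andP[wd2 wd1].
have hw := h2 _ wd2.
have hwM : nm (F w - F t) <= M * `|w - t|.
  have -> : F w - F t = (F w - F t - b * (w - t)%:C) + b * (w - t)%:C by rewrite subrK.
  apply: (le_trans (nmD _ _)); rewrite nmM nm_real /M mulrDl addrC mul1r lerD2l.
  apply: le_trans hw _; rewrite ler_piMl ?normr_ge0 //.
  by rewrite ge_min lexx.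
have hw1 : nm (F w - F t) < d1.
  by apply: (le_lt_trans hwM); rewrite mulrC -ltr_pdivlMr.
have hfw := h1 _ hw1.
have -> : f (F w) - f (F t) - a * b * (w - t)%:C =
  (f (F w) - f (F t) - a * (F w - F t)) + a * (F w - F t - b * (w - t)%:C) by ring.
apply: (le_trans (nmD _ _)); rewrite nmM.
have -> : e * `|w - t| = e / 2 * `|w - t| + e / 2 * `|w - t| by field.
apply: lerD.
  apply: (le_trans hfw); apply: (le_trans (ler_wpM2l (ltW e1) hwM)).
  by rewrite mulrA divfK // gt_eqF.
apply: (@le_trans _ _ ((nm a + 1) * (e / 2 / (nm a + 1) * `|w - t|))).
  apply: ler_pM; rewrite ?nm_ge0 // ?lerDl //.
  apply: (le_trans hw); apply: ler_wpM2r; first exact: normr_ge0.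
  by rewrite ge_min lexx orbT.
by rewrite mulrA [X in X * _]mulrC divfK // gt_eqF.
Qed.

Lemma rder_eq F t c c' : rder F t c -> c = c' -> rder F t c'.
Proof. by move=> ? <-. Qed.

Lemma rder_cst a t : rder (fun=> a) t 0.
Proof. by split; exact: is_derive_cst. Qed.

Lemma rderD F G t a b : rder F t a -> rder G t b ->
  rder (fun s => F s + G s) t (a + b).
Proof.
move=> [h1 h2] [h3 h4]; split; rewrite !ReImE.
  have -> : (fun s => complex.Re (F s + G s)) =
    (fun s => complex.Re (F s)) + (fun s => complex.Re (G s)).
    by apply/funext => s; rewrite !ReImE.
  exact: is_deriveD.
have -> : (fun s => complex.Im (F s + G s)) =
  (fun s => complex.Im (F s)) + (fun s => complex.Im (G s)).
  by apply/funext => s; rewrite !ReImE.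
exact: is_deriveD.
Qed.

Lemma rderZ F t a c : rder F t a -> rder (fun s => c * F s) t (c * a).
Proof.
move=> h; apply: (@rder_comp (fun w => c * w)) => //.
apply: cder_eq (cderM (cder_cst c _) (cder_id _)) _.
by rewrite mulr1 mulr0 addr0.
Qed.

Lemma rderB F G t a b : rder F t a -> rder G t b ->
  rder (fun s => F s - G s) t (a - b).
Proof.
move=> h1 h2; rewrite -[- b]mulN1r.
have -> : (fun s => F s - G s) = (fun s => F s + (-1) * G s).
  by apply/funext => s; rewrite mulN1r.
exact: rderD h1 (rderZ _ h2).
Qed.

Lemma rder_hline y t : rder (fun s => s +i* y) t 1.
Proof. by split => /=; [exact: is_derive_id|exact: is_derive_cst]. Qed.

Lemma rder_vline x t : rder (fun s => x +i* s) t (0 +i* 1).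
Proof. by split => /=; [exact: is_derive_cst|exact: is_derive_id]. Qed.

Lemma is_derive_cont (g : R -> R) t a : is_derive t 1 g a -> {for t, continuous g}.
Proof. by move=> [h _]; apply/differentiable_continuous/derivable1_diffP. Qed.

Lemma real_mvt (g g' : R -> R) (a b : R) : a <= b ->
  (forall t, a <= t <= b -> is_derive t 1 g (g' t)) ->
  exists2 t, a <= t <= b & g b - g a = g' t * (b - a).
Proof.
move=> ab h.
have [||t] := @MVT_segment R g g' a b ab.
- by move=> x; rewrite in_itv /= => /andP[x1 x2]; apply: h; rewrite !ltW.
- apply/continuous_in_subspaceT => x; rewrite inE /= in_itv /= => hx.
  exact: is_derive_cont (h _ hx).
- by rewrite in_itv /= => tab e; exists t.
Qed.

(** A complex-valued curve has no intermediate point. Multiplying by a unimodular [u] that turns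
    [F b - F a] into its modulus reduces the inequality to the real mean value theorem for
    [Re (u * F)]. *)
Lemma rder_mvt F F' (a b m : R) : a <= b ->
  (forall t, a <= t <= b -> rder F t (F' t)) ->
  (forall t, a <= t <= b -> nm (F' t) <= m) ->
  nm (F b - F a) <= m * (b - a).
Proof.
move=> ab h hm.
have [->|N0] := eqVneq (F b - F a) 0.
  rewrite nm0 mulr_ge0 ?subr_ge0 //; apply: le_trans (hm a _); rewrite ?nm_ge0 //.
  by rewrite lexx ab.
pose u := (F b - F a)^*%C / (nm (F b - F a))%:C.
have N1 : 0 < nm (F b - F a) by rewrite nm_gt0.
have nu : nm u = 1.
  rewrite /u nmM nmV nm_real ger0_norm ?nm_ge0 //.
  have -> : nm (F b - F a)^*%C = nm (F b - F a).
    by apply: (@complexI R); rewrite -!normc_nm normcJ.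
  by rewrite divff // gt_eqF.
have e1 : u * (F b - F a) = (nm (F b - F a))%:C.
  rewrite /u mulrAC [X in X / _]mulrC -sqr_normc normc_nm.
  by rewrite expr2 mulfK // eq_complex /= eqxx andbT gt_eqF.
have [t tab] := @real_mvt (fun s => complex.Re (u * F s))
  (fun s => complex.Re (u * F' s)) a b ab
  (fun t ht => (rderZ u (h t ht)).1).
rewrite -Re_opp -Re_add -mulrN -mulrDr e1 /= => ->.
rewrite ler_wpM2r ?subr_ge0 //.
apply: (le_trans (ler_norm _)); apply: (le_trans (Re_nm _)).
by rewrite nmM nu mul1r; exact: hm.
Qed.

Lemma rder_mvt_affine F F' c (a b m : R) : a <= b ->
  (forall t, a <= t <= b -> rder F t (F' t)) ->
  (forall t, a <= t <= b -> nm (F' t - c) <= m) ->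
  nm (F b - F a - c * (b - a)%:C) <= m * (b - a).
Proof.
move=> ab h hm.
have := @rder_mvt (fun s => F s - c * s%:C) (fun s => F' s - c) a b m ab.
have -> : F b - c * b%:C - (F a - c * a%:C) = F b - F a - c * (b - a)%:C.
  by rewrite rmorphB /=; ring.
apply => // t ht; apply: rderB; first exact: h.
rewrite -[X in rder _ _ X]mulr1; apply: rderZ.
exact: rder_hline.
Qed.

End derivative.

(** * Primitives of holomorphic functions *)

Section primitive.
Variable R : realType.
Implicit Types (I J : set R) (z w : R[i]).

Definition open_interval I := is_interval I /\
  forall x, I x -> exists2 d : R, 0 < d & forall y, `|y - x| < d -> I y.

Lemma open_interval_lt I x : open_interval I -> I x -> exists2 y, y < x & I y.
Proof.
move=> [_ oI] /oI[d d0 h]; exists (x - d / 2); first by lra.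
by apply: h; rewrite addrC addKr normrN gtr0_norm; lra.
Qed.

Lemma open_interval_gt I x : open_interval I -> I x -> exists2 y, x < y & I y.
Proof.
move=> [_ oI] /oI[d d0 h]; exists (x + d / 2); first by lra.
by apply: h; rewrite addrC addKr gtr0_norm; lra.
Qed.

Lemma is_deriveB_fun (f g : R -> R) (x a b : R) : is_derive x 1 f a ->
  is_derive x 1 g b -> is_derive x 1 (fun y => f y - g y) (a - b).
Proof. exact: is_deriveB. Qed.

(** The integral from [a] to [x] is differentiated for [x > a], and an open interval has no least
    point. The base point therefore moves with [x]; normalising at [x0] makes the result independent
    of it. *)
Lemma real_primitive I (g : R -> R) : open_interval I -> I !=set0 ->
  (forall x, I x -> {for x, continuous g}) ->
  exists G : R -> R, forall x, I x -> is_derive x 1 G (g x).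
Proof.
move=> oI [x0 Ix0] cg.
pose F a x := (\int[lebesgue_measure]_(t in [set` `[a, x]]) g t)%R.
have dF a x : I a -> a < x -> I x -> is_derive x 1 (F a) (g x).
  move=> Ia ax Ix; have [u xu Iu] := open_interval_gt oI Ix.
  have [|d e] := @continuous_FTC1_closed R g a x u xu _ ax (cg _ Ix).
    apply: continuous_compact_integrable; first exact: segment_compact.
    apply/continuous_in_subspaceT => y; rewrite inE /= in_itv /= => hy.
    by apply: cg; apply: (oI.1 a u).
  by apply: DeriveDef => //; rewrite -derive1E.
have dFF a a' x y : I a -> I a' -> a < x -> a' < x -> a < y -> a' < y ->
    I x -> I y -> F a x - F a y = F a' x - F a' y.
  move=> Ia Ia'; wlog xy : x y / x <= y.
    move=> h ax a'x ay a'y Ix Iy; have [xy|yx] := leP x y; first exact: h.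
    by have := h y x (ltW yx) ay a'y ax a'x Iy Ix; lra.
  move=> ax a'x ay a'y Ix Iy.
  have [|t txy] := @real_mvt R (fun t => F a t - F a' t) (fun t => g t - g t) x y xy.
    move=> t /andP[xt ty]; have It : I t by apply: (oI.1 x y) => //; rewrite xt.
    by apply: is_deriveB_fun; apply: dF => //; [exact: lt_le_trans xt|exact: lt_le_trans xt].
  by rewrite subrr mul0r; lra.
have hex x : exists a, I x -> [/\ I a, a < x & a < x0].
  have [Ix|nIx] := pselect (I x); last by exists x.
  have [a1 a1x Ia1] := open_interval_lt oI Ix.
  have [a2 a2x Ia2] := open_interval_lt oI Ix0.
  exists (Num.min a1 a2) => _; split.
  - by rewrite /Num.min; case: ifP.
  - by rewrite gt_min a1x.
  - by rewrite gt_min a2x orbT.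
have [a ha] := choice hex.
exists (fun x => F (a x) x - F (a x) x0) => x Ix.
have [Ia ax ax0] := ha _ Ix.
apply: (@near_eq_is_derive _ _ _ (fun y => F (a x) y - F (a x) x0)).
  have [d d0 hd] := oI.2 _ Ix.
  have m0 : 0 < Num.min d (x - a x) by rewrite lt_min d0 subr_gt0.
  apply/nbhs_ballP; exists (Num.min d (x - a x)) => // y.
  rewrite -ball_normE /= lt_min => /andP[yd ya].
  have Iy : I y by apply: hd; rewrite distrC.
  have [Iay ayy ay0] := ha _ Iy.
  have axy : a x < y by have := ler_norm (x - y); lra.
  exact: dFF.
rewrite -[g x]subr0; apply: is_deriveB_fun; first exact: dF.
Qed.

Lemma rder_primitive I (F : R -> R[i]) : open_interval I -> I !=set0 ->
  (forall x, I x -> {for x, continuous (fun y => complex.Re (F y))} /\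
                   {for x, continuous (fun y => complex.Im (F y))}) ->
  exists G : R -> R[i], forall x, I x -> rder G x (F x).
Proof.
move=> oI I0 cF.
have [G1 h1] := real_primitive oI I0 (fun x Ix => (cF x Ix).1).
have [G2 h2] := real_primitive oI I0 (fun x Ix => (cF x Ix).2).
by exists (fun x => G1 x +i* G2 x) => x Ix; split => /=; [exact: h1|exact: h2].
Qed.

Lemma rder_continuous (F : R -> R[i]) t c : rder F t c ->
  {for t, continuous (fun y => complex.Re (F y))} /\
  {for t, continuous (fun y => complex.Im (F y))}.
Proof. by move=> [h1 h2]; split; exact: is_derive_cont. Qed.

Lemma rder_affine_le (F F' : R -> R[i]) c (s t m : R) :
  (forall u, Num.min s t <= u <= Num.max s t -> rder F u (F' u)) ->
  (forall u, Num.min s t <= u <= Num.max s t -> nm (F' u - c) <= m) ->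
  nm (F t - F s - c * (t - s)%:C) <= m * `|t - s|.
Proof.
have [st|/ltW st] := leP s t => h1 h2.
  rewrite ger0_norm ?subr_ge0 //.
  exact: rder_mvt_affine st h1 h2.
have -> : F t - F s - c * (t - s)%:C = - (F s - F t - c * (s - t)%:C).
  by rewrite !rmorphB /=; ring.
rewrite nmN distrC ger0_norm ?subr_ge0 //.
exact: rder_mvt_affine st h1 h2.
Qed.

(** Goursat's bisection for an arbitrary additive function of rectangles. One quarter always keeps
    at least a quarter of the modulus; the nested rectangles shrink to a point, where the last
    hypothesis makes [Q] small compared with the square of the size. *)
Lemma rectangle_bisection (Q : R -> R -> R -> R -> R[i]) (a0 b0 c0 d0 : R) :
  (forall a m b c d, Q a b c d = Q a m c d + Q m b c d) ->
  (forall a b c m d, Q a b c d = Q a b c m + Q a b m d) ->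
  a0 <= b0 -> c0 <= d0 ->
  (forall x y, a0 <= x <= b0 -> c0 <= y <= d0 -> forall e, 0 < e ->
     exists2 del : R, 0 < del & forall a b c d,
       a0 <= a -> b <= b0 -> c0 <= c -> d <= d0 ->
       a <= x <= b -> c <= y <= d -> b - a < del -> d - c < del ->
       nm (Q a b c d) <= e * ((b - a) + (d - c)) ^+ 2) ->
  Q a0 b0 c0 d0 = 0.
Proof.
move=> Qh Qv ab cd loc; apply/eqP; rewrite -nm_eq0; apply/negPn/negP => q00.
set q0 := nm _ in q00; have {q00} q0_gt0 : 0 < q0 by rewrite lt_def q00 nm_ge0.
pose w := b0 - a0; pose h := d0 - c0; pose hf : R := 2^-1.
have w0 : 0 <= w by rewrite subr_ge0.
have h0 : 0 <= h by rewrite subr_ge0.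
have hf0 : 0 < hf by rewrite invr_gt0.
have hfn n : 0 < hf ^+ n by rewrite exprn_gt0.
have hfS n : hf ^+ n = hf ^+ n.+1 + hf ^+ n.+1 by rewrite exprS /hf; field.
(* The rectangle with lower left corner [p] and sides scaled by [2^-n] lies in the initial one and
   carries modulus at least [q0 / 4^n]. *)
pose P n (p : R * R) := [/\ a0 <= p.1 /\ p.1 + w * hf ^+ n <= b0,
  c0 <= p.2 /\ p.2 + h * hf ^+ n <= d0 &
  q0 * (hf ^+ n) ^+ 2 <= nm (Q p.1 (p.1 + w * hf ^+ n) p.2 (p.2 + h * hf ^+ n))].
pose S n (p p' : R * R) := [/\ P n.+1 p',
  p.1 <= p'.1 /\ p'.1 <= p.1 + w * hf ^+ n.+1 &
  p.2 <= p'.2 /\ p'.2 <= p.2 + h * hf ^+ n.+1].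
have step (x : nat * (R * R)) : exists p', P x.1 x.2 -> S x.1 x.2 p'.
  case: x => n [a c] /=.
  have [[/= [aa ab'] [ca cb'] hq]|nP] := pselect (P n (a, c)); last by exists (a, c).
  move: ab' cb' hq; rewrite hfS !mulrDr => ab' cb' hq.
  set w' := w * hf ^+ n.+1 in ab' cb' hq *; set h' := h * hf ^+ n.+1 in ab' cb' hq *.
  have w'0 : 0 <= w' by rewrite mulr_ge0 // ltW.
  have h'0 : 0 <= h' by rewrite mulr_ge0 // ltW.
  pose cand p := S n (a, c) p.
  have hc p : p.1 = a \/ p.1 = a + w' -> p.2 = c \/ p.2 = c + h' ->
      q0 * (hf ^+ n.+1) ^+ 2 <= nm (Q p.1 (p.1 + w') p.2 (p.2 + h')) -> cand p.
    case: p => p1 p2 /= h1 h2 hp; rewrite /cand /S /P /= -/w' -/h'.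
    by case: h1 => h1; case: h2 => h2; do !split => //; lra.
  have [h1|h1] := leP (q0 * (hf ^+ n.+1) ^+ 2) (nm (Q a (a + w') c (c + h'))).
    by exists (a, c) => _; apply: hc; auto.
  have [h2|h2] := leP (q0 * (hf ^+ n.+1) ^+ 2) (nm (Q (a + w') (a + w' + w') c (c + h'))).
    by exists (a + w', c) => _; apply: hc; auto.
  have [h3|h3] := leP (q0 * (hf ^+ n.+1) ^+ 2) (nm (Q a (a + w') (c + h') (c + h' + h'))).
    by exists (a, c + h') => _; apply: hc; auto.
  have [h4|h4] := leP (q0 * (hf ^+ n.+1) ^+ 2)
      (nm (Q (a + w') (a + w' + w') (c + h') (c + h' + h'))).
    by exists (a + w', c + h') => _; apply: hc; auto.
  (* With all four quarters below the threshold, the triangle inequality contradicts the bound for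
     the parent rectangle. *)
  exfalso; move: hq.
  rewrite (Qv _ _ _ (c + h')) (Qh a (a + w')) (Qh a (a + w') _ (c + h')) !addrA.
  apply/negP; rewrite -ltNge.
  apply: le_lt_trans (nmD _ _) _.
  apply: le_lt_trans (lerD (nmD _ _) (lexx _)) _.
  have t3 := nmD (Q a (a + w') c (c + h')) (Q (a + w') (a + w' + w') c (c + h')).
  have -> : q0 * (hf ^+ n.+1 + hf ^+ n.+1) ^+ 2 = q0 * hf ^+ n.+1 ^+ 2 +
    q0 * hf ^+ n.+1 ^+ 2 + q0 * hf ^+ n.+1 ^+ 2 + q0 * hf ^+ n.+1 ^+ 2 by ring.
  lra.
have [st hst] := choice step.
pose fix u n := if n is n'.+1 then st (n', u n') else (a0, c0).
have uP n : P n (u n).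
  elim: n => [|n IH]; last by have [] := hst (n, u n) IH.
  rewrite /P /= !expr0 !mulr1 /w /h !lexx !expr1n mulr1 ![_ + (_ - _)]addrC !subrK.
  by split.
have uS n : S n (u n) (u n.+1) by exact: (hst (n, u n) (uP n)).
have lim (v : nat -> R) (l : R) : 0 <= l -> (forall n, v n <= v n.+1) ->
    (forall n, v n.+1 + l * hf ^+ n.+1 <= v n + l * hf ^+ n) ->
    exists x, forall n, v n <= x <= v n + l * hf ^+ n.
  move=> l0 v1 v2.
  have mono : {homo v : m n / (m <= n)%N >-> m <= n} by apply/nondecreasing_seqP.
  have mono2 m n : (m <= n)%N -> v n + l * hf ^+ n <= v m + l * hf ^+ m.
    by elim: n => [|n IH]; [rewrite leqn0 => /eqP ->|
      rewrite leq_eqVlt => /predU1P[->//|/IH]; apply: le_trans].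
  have ub m n : v m <= v n + l * hf ^+ n.
    have [mn|nm] := leqP m n.
      by apply: (le_trans (mono _ _ mn)); rewrite lerDl mulr_ge0 // ltW.
    by apply: le_trans (mono2 _ _ (ltnW nm)); rewrite lerDl mulr_ge0 // ltW.
  exists (sup (range v)) => n; apply/andP; split.
    apply: ub_le_sup; last by exists n.
    by exists (v 0%N + l * hf ^+ 0) => _ [m _ <-].
  by apply: ge_sup; [exists (v 0%N), 0%N|move=> _ [m _ <-]].
have [x hx] : exists x, forall n, (u n).1 <= x <= (u n).1 + w * hf ^+ n.
  apply: lim => // n; have [_ [h1 h2] _] := uS n; first by [].
  by rewrite [in leRHS]hfS mulrDr addrA lerD2r.
have [y hy] : exists y, forall n, (u n).2 <= y <= (u n).2 + h * hf ^+ n.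
  apply: lim => // n; have [_ _ [h1 h2]] := uS n; first by [].
  by rewrite [in leRHS]hfS mulrDr addrA lerD2r.
pose K := (w + h) ^+ 2 + 1.
have K0 : 0 < K by rewrite ltr_wpDl ?sqr_ge0.
(* At scale [2^-n] the local bound reads [e (w + h)^2 / 4^n]; since [(w + h)^2 < K], this [e] keeps
   it below [q0 / 4^n]. *)
have e0 : 0 < q0 / 2 / K by rewrite !divr_gt0.
have [||del del0 hdel] := loc x y _ _ _ e0.
- by have := hx 0%N; rewrite /= expr0 mulr1 /w addrC subrK.
- by have := hy 0%N; rewrite /= expr0 mulr1 /h addrC subrK.
have [n hn] : exists n, (w + h + 1) * hf ^+ n < del.
  pose N := Num.bound ((w + h + 1) / del).
  exists N; rewrite /hf exprVn ltr_pdivrMr ?exprn_gt0 // mulrC -ltr_pdivrMr //.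
  have := archi_boundP (ltW (divr_gt0 (_ : 0 < w + h + 1) del0)).
  rewrite -/N => lN; apply: lt_le_trans (lN _) _; first lra.
  by rewrite -natrX ler_nat ltnW // ltn_expl.
have [[a1 a2] [c1 c2] hq] := uP n.
have wn : w * hf ^+ n < del.
  by apply: le_lt_trans hn; rewrite ler_wpM2r ?ltW //; lra.
have hn' : h * hf ^+ n < del.
  by apply: le_lt_trans hn; rewrite ler_wpM2r ?ltW //; lra.
have := hdel _ _ _ _ a1 a2 c1 c2 (hx n) (hy n).
rewrite ![_ + _ * _ - _]addrAC !subrr !add0r => /(_ wn hn').
apply/negP; rewrite -ltNge; apply: lt_le_trans hq.
rewrite -mulrDl exprMn mulrA ltr_pM2r ?exprn_gt0 //.
rewrite -mulrA; have : K^-1 * (w + h) ^+ 2 <= 1.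
  by rewrite mulrC ler_pdivrMr // mul1r /K lerDl.
move=> /(ler_wpM2l (ltW q0_gt0)); lra.
Qed.

Section rectangles.
Variables (I J : set R) (f : R[i] -> R[i]).
Hypotheses (oI : open_interval I) (oJ : open_interval J).
Hypothesis df : forall x y, I x -> J y -> exists c, cder f (x +i* y) c.

Variables (H K : R -> R -> R[i]).
Hypothesis HP : forall x y, I x -> J y -> rder (H y) x (f (x +i* y)).
Hypothesis KP : forall x y, I x -> J y -> rder (K x) y (f (x +i* y)).

Let ii : R[i] := 0 +i* 1.
(** The counterclockwise contour integral of [f] over the boundary of the rectangle, written with
    the primitives [H y] along horizontal and [K x] along vertical lines. *)
Let rect a b c d := (H c b - H c a) + ii * (K b d - K b c) - (H d b - H d a)
  - ii * (K a d - K a c).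

(** The affine function has the quadratic primitive [P], whose increments around the rectangle
    cancel. Only the deviation of [f] from its affine approximation contributes. *)
Let rect_small p al be a b c d m : I a -> I b -> J c -> J d -> a <= b -> c <= d ->
  (forall x y, a <= x <= b -> c <= y <= d ->
     nm (f (x +i* y) - (al + be * ((x +i* y) - p))) <= m) ->
  nm (rect a b c d) <= m * ((b - a) + (d - c)) *+ 2.
Proof.
move=> Ia Ib Jc Jd ab cd hm.
pose P z := al * z + be * ((z - p) * (z - p)) / 2.
have dP z : cder P z (al + be * (z - p)).
  have hz : cder (fun z => z - p) z (1 - 0) by apply: cderB; [exact: cder_id|exact: cder_cst].
  have h := cderD (cderM (cder_cst al z) (cder_id z))
    (cderM (cderM (cder_cst be z) (cderM hz hz)) (cder_cst 2^-1 z)).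
  by apply: cder_eq h _; rewrite /=; field.
have hor y : c <= y <= d ->
    nm (H y b - H y a - (P (b +i* y) - P (a +i* y))) <= m * (b - a).
  move=> ycd; have -> : H y b - H y a - (P (b +i* y) - P (a +i* y)) =
    (H y b - P (b +i* y)) - (H y a - P (a +i* y)) by ring.
  have Jy : J y by apply: (oJ.1 c d).
  apply: (@rder_mvt R (fun x => H y x - P (x +i* y))
    (fun x => f (x +i* y) - (al + be * ((x +i* y) - p)))) => // x xab.
    have Ix : I x by apply: (oI.1 a b).
    apply: rderB; first exact: HP.
    by rewrite -[X in rder _ _ X]mulr1; apply: rder_comp (dP _) (rder_hline _ _).
  exact: hm.
have ver x : a <= x <= b ->
    nm (ii * (K x d - K x c) - (P (x +i* d) - P (x +i* c))) <= m * (d - c).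
  move=> xab; have -> : ii * (K x d - K x c) - (P (x +i* d) - P (x +i* c)) =
    (ii * K x d - P (x +i* d)) - (ii * K x c - P (x +i* c)) by ring.
  have Ix : I x by apply: (oI.1 a b).
  apply: (@rder_mvt R (fun y => ii * K x y - P (x +i* y))
    (fun y => ii * (f (x +i* y) - (al + be * ((x +i* y) - p))))) => // y ycd.
    have Jy : J y by apply: (oJ.1 c d).
    rewrite mulrBr; apply: rderB; first by apply: rderZ; exact: KP.
    by rewrite [X in rder _ _ X]mulrC; apply: rder_comp (dP _) (rder_vline _ _).
  by rewrite nmM nm_i normr1 mul1r; exact: hm.
have -> : rect a b c d = (H c b - H c a - (P (b +i* c) - P (a +i* c)))
  + (ii * (K b d - K b c) - (P (b +i* d) - P (b +i* c)))
  - (H d b - H d a - (P (b +i* d) - P (a +i* d)))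
  - (ii * (K a d - K a c) - (P (a +i* d) - P (a +i* c))) by rewrite /rect; ring.
have h1 := hor c; have h2 := hor d; have h3 := ver a; have h4 := ver b.
rewrite !lexx cd ab /= in h1 h2 h3 h4.
apply: (le_trans (nmDB _ _)).
apply: (le_trans (lerD (nmDB _ _) (lexx _))).
apply: (le_trans (lerD (lerD (nmD _ _) (lexx _)) (lexx _))).
have {}h1 := h1 isT; have {}h2 := h2 isT; have {}h3 := h3 isT; have {}h4 := h4 isT.
by rewrite mulr2n (mulrDr m); lra.
Qed.

Let rect0 a b c d : I a -> I b -> J c -> J d -> a <= b -> c <= d -> rect a b c d = 0.
Proof.
move=> Ia Ib Jc Jd ab cd; apply: rectangle_bisection => //.
- by move=> *; rewrite /rect; ring.
- by move=> *; rewrite /rect; ring.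
move=> x y xab ycd e e0.
have Ix : I x by apply: (oI.1 a b).
have Jy : J y by apply: (oJ.1 c d).
have [be hbe] := df Ix Jy.
have e2 : 0 < e / 2 by rewrite divr_gt0.
have [del del0 hd] := (cderP f _ _).1 hbe _ e2.
exists (del / 2); first by rewrite divr_gt0.
move=> a1 b1 c1 d1 h1 h2 h3 h4 /andP[x1 x2] /andP[y1 y2] hw hh.
have Ia1 : I a1 by apply: (oI.1 a b) => //; apply/andP; split; lra.
have Ib1 : I b1 by apply: (oI.1 a b) => //; apply/andP; split; lra.
have Jc1 : J c1 by apply: (oJ.1 c d) => //; apply/andP; split; lra.
have Jd1 : J d1 by apply: (oJ.1 c d) => //; apply/andP; split; lra.
have := @rect_small (x +i* y) (f (x +i* y)) be a1 b1 c1 d1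
  (e / 2 * ((b1 - a1) + (d1 - c1))) Ia1 Ib1 Jc1 Jd1.
have -> : e / 2 * (b1 - a1 + (d1 - c1)) * (b1 - a1 + (d1 - c1)) *+ 2 =
  e * (b1 - a1 + (d1 - c1)) ^+ 2 by rewrite mulr2n; field.
apply; [lra|lra|move=> s t /andP[s1 s2] /andP[t1 t2]].
have hst : nm ((s +i* t) - (x +i* y)) <= b1 - a1 + (d1 - c1).
  apply: (le_trans (nm_le_ReIm _)) => /=; apply: lerD; rewrite ler_norml; lra.
rewrite opprD addrA; apply: (le_trans (hd _ _)); first by lra.
by rewrite ler_wpM2l // ltW.
Qed.

Let rect0' a b c d : I a -> I b -> J c -> J d -> rect a b c d = 0.
Proof.
move=> Ia Ib Jc Jd.
have s1 a' b' c' d' : rect b' a' c' d' = - rect a' b' c' d' by rewrite /rect; ring.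
have s2 a' b' c' d' : rect a' b' d' c' = - rect a' b' c' d' by rewrite /rect; ring.
have [ab|/ltW ab] := leP a b; have [cd|/ltW cd] := leP c d.
- exact: rect0.
- by rewrite s2 rect0 ?oppr0.
- by rewrite s1 rect0 ?oppr0.
- by rewrite s1 s2 rect0 ?oppr0.
Qed.

(** [W] integrates along the height [y0] and then vertically. To differentiate it at [z], the
    vanishing contour integral moves the horizontal leg to the height of [z], so that only short
    segments near [z] remain. *)
Lemma primitive_of_sides x0 y0 : I x0 -> J y0 ->
  exists W, forall z, I (complex.Re z) -> J (complex.Im z) -> cder W z (f z).
Proof.
move=> Ix0 Jy0.
exists (fun z => (H y0 (complex.Re z) - H y0 x0) +
  ii * (K (complex.Re z) (complex.Im z) - K (complex.Re z) y0)).
move=> [x y] /= Ix Jy; apply/cderP => e e0.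
have [c hc] := df Ix Jy.
have e2 : 0 < e / 2 by rewrite divr_gt0.
have [d1 d10 hd1] := cder_cont hc e2.
have [d2 d20 hd2] := oI.2 _ Ix; have [d3 d30 hd3] := oJ.2 _ Jy.
have m0 : 0 < Num.min (d1 / 2) (Num.min d2 d3) by rewrite !lt_min d20 d30 divr_gt0.
exists (Num.min (d1 / 2) (Num.min d2 d3)) => //.
move=> [x' y']; rewrite !lt_min => /and3P[w1 w2 w3] /=.
have hre := Re_nm ((x' +i* y') - (x +i* y)).
have him := Im_nm ((x' +i* y') - (x +i* y)).
rewrite /= in hre him.
have Ix' : I x' by apply: hd2; apply: le_lt_trans w2.
have Jy' : J y' by apply: hd3; apply: le_lt_trans w3.
have -> : H y0 x' - H y0 x0 + ii * (K x' y' - K x' y0) -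
   (H y0 x - H y0 x0 + ii * (K x y - K x y0)) =
   (H y x' - H y x) + ii * (K x' y' - K x' y) + rect x x' y0 y.
  by rewrite /rect; ring.
rewrite rect0' // addr0.
have -> : H y x' - H y x + ii * (K x' y' - K x' y) -
    f (x +i* y) * ((x' +i* y') - (x +i* y)) =
  (H y x' - H y x - f (x +i* y) * (x' - x)%:C) +
  ii * (K x' y' - K x' y - f (x +i* y) * (y' - y)%:C).
  have -> : (x' +i* y') - (x +i* y) = (x' - x)%:C + ii * (y' - y)%:C.
    by rewrite /ii; simpc.
  by ring.
have bet (s t u : R) : Num.min s t <= u <= Num.max s t -> `|u - s| <= `|t - s|.
  have [st|st] := leP s t => /andP[u1 u2]; first by rewrite !ger0_norm ?subr_ge0 // lerD2r.
  by rewrite !ler0_norm; lra.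
have hH : nm (H y x' - H y x - f (x +i* y) * (x' - x)%:C) <= e / 2 * `|x' - x|.
  apply: (@rder_affine_le (H y) (fun u => f (u +i* y))) => u /bet hu.
    by apply: HP => //; apply: hd2; lra.
  apply/ltW/hd1; apply: (le_lt_trans (nm_le_ReIm _)) => /=.
  by rewrite subrr normr0 addr0; have := nm_ge0 ((x' +i* y') - (x +i* y)); lra.
have hK : nm (K x' y' - K x' y - f (x +i* y) * (y' - y)%:C) <= e / 2 * `|y' - y|.
  apply: (@rder_affine_le (K x') (fun u => f (x' +i* u))) => u /bet hu.
    by apply: KP => //; apply: hd3; lra.
  by apply/ltW/hd1; apply: (le_lt_trans (nm_le_ReIm _)) => /=; lra.
apply: (le_trans (nmD _ _)); rewrite nmM nm_i normr1 mul1r.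
apply: (le_trans (lerD hH hK)); rewrite -mulrDr -mulrA.
by apply: ler_wpM2l; [exact: ltW|lra].
Qed.

End rectangles.

(* Goursat's theorem: the rectangle integrals of a function which is complex
   differentiable at every point vanish, without any continuity assumption on
   the derivative. *)
Theorem holomorphic_primitive I J (f : R[i] -> R[i]) : open_interval I ->
  open_interval J -> I !=set0 -> J !=set0 ->
  (forall z, I (complex.Re z) -> J (complex.Im z) -> exists c, cder f z c) ->
  exists W, forall z, I (complex.Re z) -> J (complex.Im z) -> cder W z (f z).
Proof.
move=> oI oJ I0 J0 df.
have [H HP] : exists H : R -> R -> R[i], forall y x, I x -> J y ->
    rder (H y) x (f (x +i* y)).
  suff : forall y, exists Hy : R -> R[i], forall x, I x -> J y -> rder Hy x (f (x +i* y)).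
    by move=> /choice[H h]; exists H.
  move=> y; have [Jy|nJ] := pselect (J y); last by exists (fun=> 0).
  have [Hy h] := @rder_primitive I (fun x => f (x +i* y)) oI I0 (fun x Ix =>
    rder_continuous (rder_comp (projT2 (cid (df (x +i* y) Ix Jy))) (rder_hline y x))).
  by exists Hy => x Ix _; exact: h.
have [K KP] : exists K : R -> R -> R[i], forall x y, I x -> J y ->
    rder (K x) y (f (x +i* y)).
  suff : forall x, exists Kx : R -> R[i], forall y, I x -> J y -> rder Kx y (f (x +i* y)).
    by move=> /choice[K h]; exists K.
  move=> x; have [Ix|nI] := pselect (I x); last by exists (fun=> 0).
  have [Kx h] := @rder_primitive J (fun y => f (x +i* y)) oJ J0 (fun y Jy =>
    rder_continuous (rder_comp (projT2 (cid (df (x +i* y) Ix Jy))) (rder_vline x y))).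
  by exists Kx => y _ Jy; exact: h.
have [[x0 Ix0] [y0 Jy0]] := (I0, J0).
apply: (@primitive_of_sides I J f oI oJ _ H K _ _ x0 y0) => //.
- by move=> x y Ix Jy; apply: df.
- by move=> x y Ix Jy; apply: HP.
Qed.

End primitive.

(** * Cauchy estimates and the Schwarz-Pick inequality *)

Section cauchy.
Variable R : realType.
Implicit Types (f g : R[i] -> R[i]) (z w : R[i]).

Lemma is_derive_eq1 (f : R -> R) (x a b : R) :
  is_derive x 1 f a -> a = b -> is_derive x 1 f b.
Proof. by move=> ? <-. Qed.

Lemma is_deriveM1 (f g : R -> R) (x a b : R) :
  is_derive x 1 f a -> is_derive x 1 g b ->
  is_derive x 1 (fun y => f y * g y) (f x * b + g x * a).
Proof. exact: is_deriveM. Qed.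

Lemma is_derive_comp1 (f g : R -> R) (x a b : R) :
  is_derive (g x) 1 f a -> is_derive x 1 g b ->
  is_derive x 1 (fun y => f (g y)) (a * b).
Proof. exact: is_derive1_comp. Qed.

Lemma is_deriveMr1 (k x : R) : is_derive x 1 (fun y => y * k) k.
Proof.
apply: is_derive_eq1 (is_deriveM1 (is_derive_id _ _) (is_derive_cst k _ _)) _.
by rewrite mulr0 mulr1 add0r.
Qed.

Lemma cexpD z w : cexp (z + w) = cexp z * cexp w.
Proof.
rewrite /cexp !ReImE expRD cosD sinD; apply: complex_ext; rewrite ReImE /=; ring.
Qed.

Lemma cexp0 : cexp 0 = 1 :> R[i].
Proof. by rewrite /cexp /= expR0 cos0 sin0 mulr1 mulr0. Qed.

Lemma cexp_real (x : R) : cexp x%:C = (expR x)%:C.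
Proof. by rewrite /cexp /= cos0 sin0 mulr1 mulr0. Qed.

Lemma nm_cexp z : nm (cexp z) = expR (complex.Re z).
Proof.
rewrite /nm /cexp /= !exprMn -mulrDr cos2Dsin2 mulr1 sqrtr_sqr.
by rewrite ger0_norm // expR_ge0.
Qed.

Lemma cexp_neq0 z : cexp z != 0.
Proof. by rewrite -nm_gt0 nm_cexp expR_gt0. Qed.

Lemma cexpN z : cexp (- z) = (cexp z)^-1.
Proof.
apply: (mulfI (cexp_neq0 z)).
by rewrite -cexpD subrr cexp0 divff // cexp_neq0.
Qed.

Lemma cexp_period z : cexp (z + (0 +i* (pi *+ 2))) = cexp z.
Proof. by rewrite cexpD {2}/cexp /= cos2pi sin2pi expR0 mulr0 !mulr1. Qed.

Lemma rder_cexp_line z (t : R) : rder (fun s => cexp (s%:C * z)) t (z * cexp (t%:C * z)).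
Proof.
case: z => a b.
have e1 : is_derive t 1 (fun s : R => expR (s * a)) (expR (t * a) * a).
  by apply: is_derive_comp1; exact: is_deriveMr1.
have e2 : is_derive t 1 (fun s : R => cos (s * b)) (- sin (t * b) * b).
  by apply: is_derive_comp1; exact: is_deriveMr1.
have e3 : is_derive t 1 (fun s : R => sin (s * b)) (cos (t * b) * b).
  by apply: is_derive_comp1; exact: is_deriveMr1.
have re s : complex.Re (s%:C * (a +i* b)) = s * a by rewrite ReImE /=; ring.
have im s : complex.Im (s%:C * (a +i* b)) = s * b by rewrite ReImE /=; ring.
split.
  have -> : (fun s => complex.Re (cexp (s%:C * (a +i* b)))) =
      fun s : R => expR (s * a) * cos (s * b).
    by apply/funext => s; rewrite /cexp re im.
  apply: is_derive_eq1 (is_deriveM1 e1 e2) _.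
  by rewrite ReImE /cexp re im /=; ring.
have -> : (fun s => complex.Im (cexp (s%:C * (a +i* b)))) =
    fun s : R => expR (s * a) * sin (s * b).
  by apply/funext => s; rewrite /cexp re im.
apply: is_derive_eq1 (is_deriveM1 e1 e3) _.
by rewrite ReImE /cexp re im /=; ring.
Qed.

Lemma nm_cexp_sub1 z : nm (cexp z - 1) <= nm z * expR (nm z).
Proof.
have -> : cexp z - 1 = cexp (1%:C * z) - cexp (0%:C * z) by rewrite mul1r mul0r cexp0.
have -> : nm z * expR (nm z) = nm z * expR (nm z) * (1 - 0) by rewrite subr0 mulr1.
apply: (@rder_mvt R (fun s => cexp (s%:C * z)) (fun s => z * cexp (s%:C * z))) => //.
  by move=> t _; exact: rder_cexp_line.
move=> t /andP[t0 t1]; rewrite nmM nm_cexp ler_wpM2l ?nm_ge0 // ler_expR.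
apply: le_trans (ler_norm _) _; apply: le_trans (Re_nm _) _.
by rewrite nmM nm_real ger0_norm // ler_piMl ?nm_ge0.
Qed.

Lemma nm_cexp_sub1_id z : nm (cexp z - 1 - z) <= nm z ^+ 2 * expR (nm z).
Proof.
have -> : cexp z - 1 - z = cexp (1%:C * z) - cexp (0%:C * z) - z * (1 - 0)%:C.
  by rewrite mul1r mul0r cexp0 subr0 mulr1.
have -> : nm z ^+ 2 * expR (nm z) = nm z ^+ 2 * expR (nm z) * (1 - 0) by rewrite subr0 mulr1.
apply: (@rder_mvt_affine R (fun s => cexp (s%:C * z)) (fun s => z * cexp (s%:C * z))) => //.
  by move=> t _; exact: rder_cexp_line.
move=> t /andP[t0 t1]; have -> : z * cexp (t%:C * z) - z = z * (cexp (t%:C * z) - 1) by ring.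
rewrite nmM expr2 -mulrA.
rewrite ler_wpM2l ?nm_ge0 //; apply: (le_trans (nm_cexp_sub1 _)).
have tz : nm (t%:C * z) <= nm z.
  by rewrite nmM nm_real ger0_norm // ler_piMl ?nm_ge0.
by apply: ler_pM; rewrite ?nm_ge0 ?expR_ge0 // ler_expR.
Qed.

Lemma cder_cexp z : cder (@cexp R) z (cexp z).
Proof.
apply/cderP => e e0.
have K0 : 0 < nm (cexp z) * expR 1 by rewrite mulr_gt0 ?expR_gt0 // nm_cexp expR_gt0.
exists (Num.min 1 (e / (nm (cexp z) * expR 1))).
  by rewrite lt_min ltr01 divr_gt0.
move=> w; rewrite lt_min => /andP[h1 h2].
have -> : cexp w - cexp z - cexp z * (w - z) = cexp z * (cexp (w - z) - 1 - (w - z)).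
  have -> : cexp w = cexp z * cexp (w - z) by rewrite -cexpD addrC subrK.
  by ring.
rewrite nmM; apply: (@le_trans _ _ (nm (cexp z) * (nm (w - z) ^+ 2 * expR 1))).
  rewrite ler_wpM2l ?nm_ge0 //; apply: le_trans (nm_cexp_sub1_id _) _.
  by rewrite ler_wpM2l ?sqr_ge0 // ler_expR ltW.
rewrite expr2 -mulrA mulrCA [e * _]mulrC ler_wpM2l ?nm_ge0 //.
by rewrite mulrCA -ler_pdivlMr // ltW.
Qed.

Lemma rder_cder_hline f (x y : R) c : cder f (x +i* y) c -> rder (fun s => f (s +i* y)) x c.
Proof. by move=> h; rewrite -[c]mulr1; apply: rder_comp h (rder_hline _ _). Qed.

Lemma rder_cder_vline f (x y : R) c : cder f (x +i* y) c ->
  rder (fun s => f (x +i* s)) y (c * (0 +i* 1)).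
Proof. by move=> h; apply: rder_comp h (rder_vline _ _). Qed.

Lemma cder_segment_le f (f' : R[i] -> R[i]) z w (m : R) :
  (forall s : R, 0 <= s <= 1 -> cder f (z + s%:C * (w - z)) (f' (z + s%:C * (w - z)))) ->
  (forall s : R, 0 <= s <= 1 -> nm (f' (z + s%:C * (w - z))) <= m) ->
  nm (f w - f z) <= m * nm (w - z).
Proof.
move=> h hm.
have := @rder_mvt R (fun s => f (z + s%:C * (w - z)))
  (fun s => f' (z + s%:C * (w - z)) * (w - z)) 0 1 (m * nm (w - z)) ler01.
rewrite mul1r mul0r addr0 [z + (w - z)]addrC subrK subr0 mulr1.
apply => [t ht|t ht].
  have hl : rder (fun s : R => z + s%:C * (w - z)) t (w - z).
    rewrite -[X in rder _ _ X]add0r; apply: rderD; first exact: rder_cst.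
    have -> : (fun s : R => s%:C * (w - z)) = fun s => (w - z) * s%:C.
      by apply/funext => s; rewrite mulrC.
    by rewrite -[X in rder _ _ X]mulr1; apply: rderZ; exact: rder_hline.
  exact: rder_comp (h t ht) hl.
by rewrite nmM ler_wpM2r ?nm_ge0 //; exact: hm.
Qed.

(** * Circle integrals on the unit disc through the exponential covering *)

Section disc.
Variable g : R[i] -> R[i].
Hypothesis dg : forall z, nm z < 1 -> exists c, cder g z c.

(** With [z = e^v] one has [dv = dz / z], so [F k] pulls [g(z) z^(k-1) dz] back to the half-plane
    [Re v < 0], where it has a primitive [V k]. The increment [per k u] over a period is the
    integral over the circle of radius [e^u]. *)
Let F (k : R) v := g (cexp v) * cexp (k%:C * v).

Let cexp_disc (u t : R) : u < 0 -> nm (cexp (u +i* t)) < 1.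
Proof. by move=> u0; rewrite nm_cexp /= expR_lt1. Qed.

Let F_primitive k : exists V, forall u t : R, u < 0 ->
  cder V (u +i* t) (F k (u +i* t)).
Proof.
have [||||z Iz _|V hV] := @holomorphic_primitive R [set x | x < 0] setT (F k).
- split => /= [x y x0 y0 z /andP[_ zy]|x x0]; first exact: le_lt_trans y0.
  exists (- x); rewrite ?oppr_gt0 // => y yx.
  by have := ler_norm (y - x); lra.
- by split => // x _; exists 1.
- by exists (-1) => /=; lra.
- by exists 0.
- have [c hc] : exists c, cder g (cexp z) c.
    by apply: dg; case: z Iz => u t /=; exact: cexp_disc.
  have := cderM (cder_comp hc (cder_cexp z)) (cder_comp (cder_cexp (k%:C * z))
    (cderM (cder_cst k%:C z) (cder_id z))).
  by exact: ex_intro.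
by exists V => u t u0; apply: hV.
Qed.

Let V k := projT1 (cid (F_primitive k)).
Let VP k u t : u < 0 -> cder (V k) (u +i* t) (F k (u +i* t)).
Proof. exact: (projT2 (cid (F_primitive k))). Qed.

Let per k u := V k (u +i* (pi *+ 2)) - V k (u +i* 0).

(** For these integers [k] the integrand has period [2 pi i], so the derivative of [per k] in the
    radial variable is zero. *)
Let per_cst k u u' : k = 0 \/ k = 1 \/ k = -1 -> u < 0 -> u' < 0 -> per k u = per k u'.
Proof.
move=> hk; wlog uu' : u u' / u <= u'.
  by move=> h u0 u'0; have [uu'|/ltW uu'] := leP u u'; [exact: h|symmetry; apply: h].
move=> u0 u'0; apply/eqP; rewrite eq_sym -subr_eq0 -nm_eq0 eq_le nm_ge0 andbT.
have -> : 0 = 0 * (u' - u) by rewrite mul0r.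
have step t : u <= t <= u' -> F k (t +i* (pi *+ 2)) = F k (t +i* 0).
  move=> _; have -> : t +i* (pi *+ 2) = (t +i* 0) + (0 +i* (pi *+ 2)) :> R[i] by simpc.
  rewrite /F cexp_period; congr (_ * _); rewrite mulrDr.
  case: hk => [->|[->|->]].
  - by rewrite !mul0r addr0.
  - by rewrite !mul1r cexp_period.
  - rewrite rmorphN1 !mulN1r -opprD !cexpN; congr (_^-1).
    exact: cexp_period.
apply: (@rder_mvt R (per k) (fun t => F k (t +i* (pi *+ 2)) - F k (t +i* 0))) => //.
  move=> t /andP[_ tu']; have t0 : t < 0 by exact: le_lt_trans u'0.
  by apply: rderB; apply: rder_cder_hline; exact: VP.
by move=> t ht; rewrite step // subrr nm0.
Qed.

Let pi2 : 0 < pi *+ 2 :> R.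
Proof. by rewrite mulrn_wgt0 // pi_gt0. Qed.

Let circle_le k u c m : u < 0 -> (forall t, nm (F k (u +i* t) - c) <= m) ->
  nm (per k u - (0 +i* (pi *+ 2)) * c) <= m * (pi *+ 2).
Proof.
move=> u0 hm.
have := @rder_mvt_affine R (fun t => V k (u +i* t)) (fun t => F k (u +i* t) * (0 +i* 1))
  (c * (0 +i* 1)) 0 (pi *+ 2) m (ltW pi2).
rewrite subr0 /per.
have -> : c * (0 +i* 1) * (pi *+ 2)%:C = (0 +i* (pi *+ 2)) * c.
  by rewrite -mulrA mulrC; congr (_ * _); simpc.
apply => t _; first by apply: rder_cder_vline; exact: VP.
by rewrite -mulrBl nmM nm_i normr1 mulr1.
Qed.

Let lnr (r : R) : 0 < r -> exists2 u : R, u < 0 & expR u <= r.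
Proof.
move=> r0; exists (Num.min (-1) (ln r)); first by rewrite gt_min; apply/orP; left; lra.
by rewrite -[leRHS]lnK ?posrE // ler_expR ge_min lexx orbT.
Qed.

Let small_eq c c' : (forall e : R, 0 < e -> nm (c - c') <= e) -> c = c'.
Proof.
move=> h; apply/eqP; rewrite -subr_eq0 -nm_eq0; apply/negPn/negP => n0.
have n1 : 0 < nm (c - c') by rewrite lt_def n0 nm_ge0.
by have := h (nm (c - c') / 2); rewrite divr_gt0 // => /(_ isT); lra.
Qed.

Let per0 u : u < 0 -> per 0 u = (0 +i* (pi *+ 2)) * g 0.
Proof.
move=> u0; apply: small_eq => e e0.
have [c hc] : exists c, cder g 0 c by apply: dg; rewrite nm0.
have e1 : 0 < e / (pi *+ 2) by rewrite divr_gt0.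
have [d d0 hd] := cder_cont hc e1.
have [u' u'0 u'd] : exists2 u' : R, u' < 0 & expR u' <= d / 2 by apply: lnr; rewrite divr_gt0.
rewrite (@per_cst 0 u u'); auto.
have -> : e = e / (pi *+ 2) * (pi *+ 2) by rewrite divfK // gt_eqF.
apply: circle_le => // t; apply/ltW.
rewrite /F mul0r cexp0 mulr1; apply: hd.
by rewrite subr0 nm_cexp /=; lra.
Qed.

Let per1 u : u < 0 -> per 1 u = 0.
Proof.
move=> u0; apply: small_eq => e e0; rewrite subr0.
have [c hc] : exists c, cder g 0 c by apply: dg; rewrite nm0.
have [d d0 hd] := cder_cont hc ltr01.
have K0 : 0 < nm (g 0) + 1 by rewrite ltr_wpDl ?nm_ge0.
have e1 : 0 < e / (pi *+ 2) / (nm (g 0) + 1) by rewrite !divr_gt0.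
have [u' u'0] : exists2 u' : R, u' < 0 & expR u' <= Num.min (d / 2) (e / (pi *+ 2) / (nm (g 0) + 1)).
  by apply: lnr; rewrite lt_min e1 divr_gt0.
rewrite le_min => /andP[u'd u'e].
rewrite (@per_cst 1 u u'); auto.
have := @circle_le 1 u' 0 (e / (pi *+ 2)) u'0.
rewrite mulr0 subr0 divfK ?gt_eqF //; apply => t.
rewrite /F mul1r subr0 nmM nm_cexp /=.
have -> : e / (pi *+ 2) = (nm (g 0) + 1) * (e / (pi *+ 2) / (nm (g 0) + 1)).
  by rewrite [RHS]mulrC divfK // gt_eqF.
apply: ler_pM; rewrite ?nm_ge0 ?expR_ge0 //.
have := hd (cexp (u' +i* t)); rewrite subr0 nm_cexp /= => h.
have -> : g (cexp (u' +i* t)) = g 0 + (g (cexp (u' +i* t)) - g 0) by rewrite addrC subrK.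
apply: (le_trans (nmD _ _)); rewrite lerD2l ltW //; apply: h; lra.
Qed.

Let perN1 u a : cder g 0 a -> u < 0 -> per (-1) u = (0 +i* (pi *+ 2)) * a.
Proof.
move=> ha u0; apply: small_eq => e e0.
have e1 : 0 < e / (pi *+ 2) by rewrite divr_gt0.
have [d d0 hd] := (cderP g 0 a).1 ha _ e1.
have [u' u'0 u'd] : exists2 u' : R, u' < 0 & expR u' <= d / 2 by apply: lnr; rewrite divr_gt0.
rewrite (@per_cst (-1) u u'); auto.
(* The added term is periodic and leaves the period unchanged, while it replaces [g] by [g - g 0] in
   the derivative; divided by [z], this is close to [a] on small circles. *)
pose V' v := V (-1) v + g 0 * cexp (- v).
have -> : per (-1) u' = V' (u' +i* (pi *+ 2)) - V' (u' +i* 0).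
  rewrite /V' /per.
  have -> : cexp (- (u' +i* (pi *+ 2))) = cexp (- (u' +i* 0)).
    rewrite !cexpN; congr (_^-1).
    by rewrite -[RHS]cexp_period; congr cexp; simpc.
  by ring.
have dV' t : cder V' (u' +i* t) ((g (cexp (u' +i* t)) - g 0) * cexp (- (u' +i* t))).
  have h := cderD (VP (-1) t u'0) (cderM (cder_cst (g 0) _)
    (cder_comp (cder_cexp (- (u' +i* t))) (cderN (cder_id _)))).
  apply: cder_eq h _.
  by rewrite /F rmorphN1 mulN1r; ring.
have := @rder_mvt_affine R (fun t => V' (u' +i* t))
  (fun t => (g (cexp (u' +i* t)) - g 0) * cexp (- (u' +i* t)) * (0 +i* 1))
  (a * (0 +i* 1)) 0 (pi *+ 2) (e / (pi *+ 2)) (ltW pi2).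
rewrite subr0 divfK ?gt_eqF //.
have -> : a * (0 +i* 1) * (pi *+ 2)%:C = (0 +i* (pi *+ 2)) * a.
  by rewrite -mulrA mulrC; congr (_ * _); simpc.
apply => t _; first by apply: rder_cder_vline; exact: dV'.
rewrite -mulrBl nmM nm_i normr1 mulr1.
have := hd (cexp (u' +i* t)); rewrite subr0 => h.
have {}h := h _; rewrite -(ler_pM2r (x := nm (cexp (u' +i* t)))) ?nm_gt0 ?cexp_neq0 //.
rewrite -nmM mulrBl cexpN mulfVK ?cexp_neq0 //.
by apply: h; rewrite nm_cexp /=; lra.
Qed.

Lemma cauchy_estimate_disc a (M : R) : cder g 0 a ->
  (forall z, nm z < 1 -> nm (g z) <= M) -> nm a <= M.
Proof.
move=> ha hM.
(* The integral of [g / z^2] over the circle of radius [e^u] is [2 pi i a]; the bound by [M] costs a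
   factor [e^(-u)], which tends to 1 as [u] tends to 0. *)
have key u : u < 0 -> nm a * expR u <= M.
  move=> u0; have := @circle_le (-1) u 0 (M * expR (- u)) u0.
  rewrite mulr0 subr0 (perN1 ha u0) nmM nm_i gtr0_norm // => h.
  have {}h : pi *+ 2 * nm a <= M * expR (- u) * (pi *+ 2).
    apply: h => t; rewrite subr0 /F rmorphN1 mulN1r nmM nm_cexp /=.
    by rewrite ler_wpM2r ?expR_ge0 //; apply: hM; exact: cexp_disc.
  move: h; rewrite mulrC ler_pM2r // expRN => h.
  by rewrite -ler_pdivlMr ?expR_gt0.
apply/ler_addgt0Pr => e e0.
have [->|a0] := eqVneq a 0.
  rewrite nm0; apply: addr_ge0 (ltW e0).
  by apply: le_trans (hM 0 _); rewrite ?nm_ge0 ?nm0.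
have na : 0 < nm a by rewrite nm_gt0.
have := key (- (e / nm a)); rewrite oppr_lt0 divr_gt0 // => /(_ isT) h.
have := expR_ge1Dx (- (e / nm a)) => h2.
have h3 : nm a * (1 - e / nm a) <= M.
  by apply: le_trans h; rewrite ler_wpM2l // ltW.
by move: h3; rewrite mulrBr mulr1 mulrCA divff ?gt_eqF // mulr1; lra.
Qed.

(** [Re g] is integrated over a circle against the nonnegative weight [1 + Re q], where [q] rotates
    once. Only the Taylor coefficients of order 0 and 1 survive, and the phase [om] with
    [om * a = - |a|] gives [0 <= Re (g 0) - e^u |a| / 2]. *)
Lemma schwarz_pick_disc a : cder g 0 a ->
  (forall z, nm z < 1 -> 0 <= complex.Re (g z)) -> nm a <= 2 * complex.Re (g 0).
Proof.
move=> ha hRe.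
have [->|a0] := eqVneq a 0; first by rewrite nm0 mulr_ge0 // hRe // nm0.
have na : 0 < nm a by rewrite nm_gt0.
pose om := - (a^*%C / (nm a)%:C).
have nom : nm om = 1.
  rewrite /om nmN nmM nmV nm_real ger0_norm ?nm_ge0 //.
  have -> : nm a^*%C = nm a by apply: (@complexI R); rewrite -!normc_nm normcJ.
  by rewrite divff // gt_eqF.
have oma : om * a = - (nm a)%:C.
  rewrite /om mulNr mulrAC [X in X / _]mulrC -sqr_normc normc_nm.
  by rewrite expr2 mulfK // eq_complex /= eqxx andbT gt_eqF.
have key u : u < 0 -> nm a * expR u <= 2 * complex.Re (g 0).
  move=> u0.
  (* [S] is a primitive, in the angle, of [g (1 + Re q)]; its three terms produce the periods of
     index 0, 1 and -1, and the factor [-i] turns [d(it)] into [dt]. *)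
  pose S (v : R[i]) := - (0 +i* 1) * (V 0 v + 2^-1 * om^*%C * (expR (- u))%:C * V 1 v
    + 2^-1 * om * (expR u)%:C * V (-1) v).
  have dS t : rder (fun t => S (u +i* t)) t
    (F 0 (u +i* t) + 2^-1 * om^*%C * (expR (- u))%:C * F 1 (u +i* t)
    + 2^-1 * om * (expR u)%:C * F (-1) (u +i* t)).
    have h k := rder_cder_vline (VP k t u0).
    apply: rder_eq (rderZ _ (rderD (rderD (h 0) (rderZ _ (h 1))) (rderZ _ (h (-1))))) _.
    have i2 : (0 +i* 1) * (0 +i* 1) = -1 :> R[i] by simpc.
    set X := F 0 _; set Y := F 1 _; set Z := F (-1) _.
    set ii := 0 +i* 1 in i2 *.
    transitivity (- (ii * ii) * (X + 2^-1 * om^*%C * (expR (- u))%:C * Y +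
      2^-1 * om * (expR u)%:C * Z)); first by ring.
    by rewrite i2 opprK mul1r.
  have Sre t : 0 <= complex.Re (F 0 (u +i* t) + 2^-1 * om^*%C * (expR (- u))%:C * F 1 (u +i* t)
    + 2^-1 * om * (expR u)%:C * F (-1) (u +i* t)).
    set w := cexp (u +i* t).
    set q := om * cexp (- (0 +i* t)).
    have nq : nm q = 1 by rewrite /q nmM nom nm_cexp /= oppr0 expR0 mulr1.
    have qc : q^*%C = om^*%C * cexp (0 +i* t).
      rewrite /q rmorphM /=; congr (_ * _); rewrite /cexp /= oppr0 cosN sinN.
      by rewrite expR0 !mul1r opprK.
    have -> : F 0 (u +i* t) + 2^-1 * om^*%C * (expR (- u))%:C * F 1 (u +i* t)
      + 2^-1 * om * (expR u)%:C * F (-1) (u +i* t) = g w * (1 + 2^-1 * (q^*%C + q)).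
      have wE : w = (expR u)%:C * cexp (0 +i* t).
        by rewrite /w -cexp_real -cexpD; congr cexp; simpc.
      have w0 : (expR u)%:C != 0 :> R[i] by rewrite eq_complex /= eqxx andbT gt_eqF ?expR_gt0.
      rewrite /F rmorphN1 mulN1r mul1r mul0r cexp0 -/w cexpN -/w qc /q cexpN.
      rewrite expRN (fmorphV (real_complex R)) /=.
      have e0 := cexp_neq0 (0 +i* t).
      set gw := g w; rewrite wE.
      by field; rewrite w0 e0.
    have -> : 1 + 2^-1 * (q^*%C + q) = (1 + complex.Re q)%:C.
      have h2 : (2 : R[i]) = (2 : R)%:C by rewrite rmorph_nat.
      have -> : q^*%C + q = (2 * complex.Re q)%:C.
        by case: (q) => x y /=; simpc; rewrite addNr mulr_natl mulr2n.
      rewrite h2 -(fmorphV (real_complex R)) -rmorphM /= -(rmorph1 (real_complex R)) -rmorphD /=.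
      by congr (_%:C); field.
    rewrite ReImE /= mulr0 subr0 mulr_ge0 ?hRe //; first exact: cexp_disc.
    have := Re_nm q; rewrite nq ler_norml; lra.
  have [t _ e] := @real_mvt R (fun t => complex.Re (S (u +i* t))) _ 0 (pi *+ 2) (ltW pi2)
    (fun t _ => (dS t).1).
  have : 0 <= complex.Re (S (u +i* (pi *+ 2)) - S (u +i* 0)).
    by rewrite Re_add Re_opp e mulr_ge0 // subr0 ltW.
  have -> : S (u +i* (pi *+ 2)) - S (u +i* 0) = - (0 +i* 1) * (per 0 u
    + 2^-1 * om^*%C * (expR (- u))%:C * per 1 u + 2^-1 * om * (expR u)%:C * per (-1) u).
    by rewrite /S /per; ring.
  rewrite per0 // per1 // (perN1 ha) // mulr0 addr0.
  have -> : - (0 +i* 1) * ((0 +i* (pi *+ 2)) * g 0 + 2^-1 * om * (expR u)%:C *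
     ((0 +i* (pi *+ 2)) * a)) = (pi *+ 2)%:C * (g 0 - (2^-1 * expR u * nm a)%:C).
    have -> : (0 +i* (pi *+ 2)) = (0 +i* 1) * (pi *+ 2)%:C :> R[i] by simpc.
    have i2 : (0 +i* 1) * (0 +i* 1) = -1 :> R[i] by simpc.
    have h2 : (2^-1 * expR u * nm a)%:C = - (2^-1 * (expR u)%:C * (om * a)) :> R[i].
      have h2 : (2 : R[i]) = (2 : R)%:C by rewrite rmorph_nat.
      by rewrite oma mulrN opprK h2 -(fmorphV (real_complex R)) -!rmorphM.
    rewrite h2.
    transitivity (- ((0 +i* 1) * (0 +i* 1)) * (pi *+ 2)%:C * (g 0 + 2^-1 * (expR u)%:C * (om * a))).
      by ring.
    by rewrite i2 opprK mul1r opprK.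
  rewrite Re_mul /= mul0r subr0 pmulr_rge0 // Re_add Re_opp /=; lra.
apply/ler_addgt0Pr => e e0.
have := key (- (e / nm a)); rewrite oppr_lt0 divr_gt0 // => /(_ isT) h.
have := expR_ge1Dx (- (e / nm a)) => h2.
have h3 : nm a * (1 - e / nm a) <= 2 * complex.Re (g 0).
  by apply: le_trans h; rewrite ler_wpM2l // ltW.
by move: h3; rewrite mulrBr mulr1 mulrCA divff ?gt_eqF // mulr1; lra.
Qed.

End disc.

Lemma cauchy_estimate f z (r M : R) a : 0 < r ->
  (forall w, nm (w - z) < r -> exists c, cder f w c) ->
  (forall w, nm (w - z) < r -> nm (f w) <= M) ->
  cder f z a -> nm a * r <= M.
Proof.
move=> r0 df hM ha.
have sc u : nm u < 1 -> nm (z + r%:C * u - z) < r.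
  by move=> u1; rewrite addrC addKr nmM nm_real gtr0_norm // gtr_pMr.
have hl u : cder (fun u => z + r%:C * u) u r%:C.
  apply: cder_eq (cderD (cder_cst z u) (cderM (cder_cst r%:C u) (cder_id u))) _.
  by rewrite mulr0 addr0 add0r mulr1.
have := @cauchy_estimate_disc (fun u => f (z + r%:C * u)) _ (a * r%:C) M.
rewrite nmM nm_real gtr0_norm //; apply.
- move=> u u1; have [c hc] := df _ (sc _ u1).
  by exists (c * r%:C); apply: cder_comp (hl u).
- by apply: cder_comp (hl 0); rewrite mulr0 addr0.
- by move=> u u1; apply: hM; exact: sc.
Qed.

(** The Cauchy estimate is applied to [f (u + (w - z)) - f u] as a function of [u]: its derivative
    at [z] is [f' w - f' z], and its size is at most [M / s * |w - z|] by a first use of the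
    estimate on [f]. *)
Lemma cder_continuous f (f' : R[i] -> R[i]) z (r : R) : 0 < r ->
  (forall w, nm (w - z) < r -> cder f w (f' w)) ->
  forall e : R, 0 < e -> exists2 d : R, 0 < d &
    forall w, nm (w - z) < d -> nm (f' w - f' z) < e.
Proof.
move=> r0 df e e0.
have [r1 r10 hr1] : exists2 r1 : R, 0 < r1 & forall w, nm (w - z) < r1 -> nm (f w - f z) < 1.
  by apply: (cder_cont (df z _)); rewrite // subrr nm0.
(* Within [4 s] the function [f] is differentiable and bounded, hence [f'] is bounded within [2 s],
   which contains all segments from [u] to [u + (w - z)]. *)
pose s := Num.min r r1 / 4.
have s0 : 0 < s by rewrite divr_gt0 // lt_min r0.
have sr w : nm (w - z) < 4 * s -> cder f w (f' w) /\ nm (f w) <= nm (f z) + 1.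
  rewrite /s mulrC divfK // lt_min => /andP[h1 h2]; split; first exact: df.
  have -> : f w = f z + (f w - f z) by rewrite addrC subrK.
  by apply: (le_trans (nmD _ _)); rewrite lerD2l ltW // hr1.
set M := nm (f z) + 1 in sr.
have M0 : 0 < M by rewrite ltr_wpDl ?nm_ge0.
have f'M w : nm (w - z) < 2 * s -> nm (f' w) <= M / s.
  move=> hw; rewrite ler_pdivlMr //; apply: (@cauchy_estimate f w) => //.
  - move=> w1 h1; exists (f' w1); apply: (sr _ _).1.
    by have := nm_tri w w1 z; lra.
  - move=> w1 h1; apply: (sr _ _).2.
    by have := nm_tri w w1 z; lra.
  - by apply: (sr _ _).1; lra.
exists (Num.min s (e * s / (M / s) / 2)).
  by rewrite lt_min s0 /=; apply: divr_gt0 => //; apply: divr_gt0; [exact: mulr_gt0|exact: divr_gt0].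
move=> w; rewrite lt_min => /andP[ws we].
have cu (h : R[i]) u c : cder f (u + h) c -> cder (fun v => f (v + h)) u c.
  move=> hc; rewrite -[c]mulr1; apply: (@cder_comp R f (fun v => v + h) u) hc _.
  by apply: cder_eq (cderD (cder_id u) (cder_cst h u)) _; rewrite addr0.
have h : nm (f' w - f' z) * s <= M / s * nm (w - z).
  apply: (@cauchy_estimate (fun u => f (u + (w - z)) - f u) z s) => //.
  - move=> u us; exists (f' (u + (w - z)) - f' u); apply: cderB.
      apply: cu; apply: (sr _ _).1.
      have -> : u + (w - z) - z = (u - z) + (w - z) by ring.
      by have := nmD (u - z) (w - z); lra.
    by apply: (sr _ _).1; lra.
  - move=> u us.
    have {2}-> : w - z = u + (w - z) - u by ring.
    have seg (t : R) : 0 <= t <= 1 -> nm (u + t%:C * (u + (w - z) - u) - z) < 2 * s.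
      move=> /andP[t0 t1].
      have -> : u + t%:C * (u + (w - z) - u) - z = (u - z) + t%:C * (w - z) by ring.
      have := nmD (u - z) (t%:C * (w - z)); rewrite nmM nm_real ger0_norm //.
      have : t * nm (w - z) <= nm (w - z) by rewrite ler_piMl ?nm_ge0.
      lra.
    apply: (@cder_segment_le f f') => t ht.
      by apply: (sr _ _).1; have := seg t ht; lra.
    by apply: f'M; exact: seg.
  - apply: cderB; last by apply: df; rewrite subrr nm0.
    have zw : z + (w - z) = w by ring.
    by apply: cu; rewrite zw; apply: (sr _ _).1; lra.
rewrite -(ltr_pM2r s0); apply: le_lt_trans h _.
have Ms : 0 < M / s by rewrite divr_gt0.
apply: (@lt_le_trans _ _ (M / s * (e * s / (M / s) / 2))).
  by rewrite ltr_pM2l.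
have -> : M / s * (e * s / (M / s) / 2) = e * s / 2.
  by field; rewrite !gt_eqF.
have : 0 < e * s by rewrite mulr_gt0.
lra.
Qed.

Lemma schwarz_pick_half_plane f z a : 0 < complex.Re z ->
  (forall w, 0 < complex.Re w -> exists c, cder f w c) ->
  (forall w, 0 < complex.Re w -> 0 <= complex.Re (f w)) ->
  cder f z a -> nm a * complex.Re z <= complex.Re (f z).
Proof.
move=> z0 df hf ha.
(* The Cayley map of the disc into the right half-plane with [m 0 = z] and derivative [2 Re z] at
   0. *)
pose m (u : R[i]) := (z + z^*%C * u) / (1 - u).
have u1N (u : R[i]) : nm u < 1 -> 1 - u != 0.
  by move=> u1; apply/negP; rewrite subr_eq0 => /eqP e; move: u1; rewrite -e nm1 ltxx.
have mRe u : nm u < 1 -> 0 < complex.Re (m u).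
  move=> u1; have n0 : 0 < nm (1 - u) ^+ 2 by rewrite exprn_gt0 // nm_gt0 u1N.
  have u2 : nm u ^+ 2 < 1 by rewrite expr_lt1 // nm_ge0.
  rewrite /m Re_mul Re_inv Im_inv; case: z z0 u1 n0 u2 {ha m} => x y /= x0.
  case: u => p q; rewrite !nm_sq /= => _ n0 u2.
  set D := (1 - p) ^+ 2 + (0 - q) ^+ 2 in n0 *.
  have -> : (x + (x * p - - y * q)) * ((1 - p) / D) -
    (y + (x * q + - y * p)) * (- (0 - q) / D) = x * (1 - (p ^+ 2 + q ^+ 2)) / D.
    by field; rewrite gt_eqF.
  by rewrite divr_gt0 // mulr_gt0 // subr_gt0.
have dm u : nm u < 1 -> cder m u (((1 - u) * z^*%C + (z + z^*%C * u)) / (1 - u) ^+ 2).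
  move=> u1; have h1 := cderD (cder_cst z u) (cderM (cder_cst z^*%C u) (cder_id u)).
  have h2 := @cderV R (fun w => 1 - w) u _ (u1N _ u1) (cderB (cder_cst 1 u) (cder_id u)).
  apply: cder_eq (cderM h1 h2) _.
  by field; exact: u1N.
have m0 : m 0 = z by rewrite /m mulr0 addr0 subr0 divr1.
have := @schwarz_pick_disc (fun u => f (m u)) _ (a * (2 * complex.Re z)%:C).
rewrite m0 nmM nm_real gtr0_norm ?mulr_gt0 // mulrCA ler_pM2l //; apply.
- move=> u u1; have [c hc] := df _ (mRe _ u1).
  by exists (c * (((1 - u) * z^*%C + (z + z^*%C * u)) / (1 - u) ^+ 2)); apply: cder_comp (dm _ u1).
- have -> : (2 * complex.Re z)%:C = ((1 - 0) * z^*%C + (z + z^*%C * 0)) / (1 - 0) ^+ 2.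
    rewrite mulr0 addr0 subr0 mul1r expr1n divr1 addrC addcJ.
    by rewrite rmorphM rmorph_nat.
  by apply: cder_comp; [rewrite m0|apply: dm; rewrite nm0].
- by move=> u u1; apply: hf; exact: mRe.
Qed.

End cauchy.

(** * Integrable real functions *)

Section integration.
Context d (T : measurableType d) (R : realType) (mu : {measure set T -> \bar R}).
Variable D : set T.
Hypothesis mD : measurable D.
Implicit Types f g : T -> R.

Definition rintegrable f := mu.-integrable D (EFin \o f).

Lemma rintegrable_meas f : rintegrable f -> measurable_fun D f.
Proof. by move=> /integrableP[/measurable_EFinP]. Qed.

Lemma rintegrable_le f g : measurable_fun D f -> (forall x, D x -> `|f x| <= g x) ->
  rintegrable g -> rintegrable f.
Proof.
move=> mf fg; apply: le_integrable => //; first exact/measurable_EFinP.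
by move=> x Dx /=; rewrite lee_fin; apply: le_trans (ler_norm _); exact: fg.
Qed.

Lemma rintegrable_eq f g : (forall x, D x -> f x = g x) -> rintegrable f -> rintegrable g.
Proof. by move=> fg; apply: eq_integrable => // x; rewrite inE /= => /fg ->. Qed.

Lemma rintegrable_abs f : rintegrable f -> rintegrable (fun x => `|f x|).
Proof.
move=> hf; have := integrable_abse hf; apply: eq_integrable => // x _ /=.
Qed.

Lemma rintegrableD f g : rintegrable f -> rintegrable g -> rintegrable (fun x => f x + g x).
Proof. by move=> hf hg; have := integrableD mD hf hg. Qed.

Lemma rintegrableB f g : rintegrable f -> rintegrable g -> rintegrable (fun x => f x - g x).
Proof. by move=> hf hg; have := integrableB mD hf hg. Qed.

Lemma rintegrableZ k f : rintegrable f -> rintegrable (fun x => k * f x).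
Proof. by move=> hf; have := integrableZl mD k hf. Qed.

Lemma Rintegral_EFin f : rintegrable f ->
  (\int[mu]_(x in D) (f x)%:E)%E = (\int[mu]_(x in D) f x)%:E.
Proof. by move=> hf; rewrite /Rintegral fineK //; exact: integrable_fin_num. Qed.

Lemma Rintegral_norm_le f g : rintegrable f -> rintegrable g ->
  (forall x, D x -> `|f x| <= g x) -> `|\int[mu]_(x in D) f x| <= \int[mu]_(x in D) g x.
Proof.
move=> hf hg h; apply: (le_trans (le_normr_Rintegral mD hf)).
by apply: le_Rintegral => //; exact: rintegrable_abs.
Qed.

Lemma rintegrable_lin a b f g : rintegrable f -> rintegrable g ->
  rintegrable (fun x => a * f x + b * g x).
Proof. by move=> hf hg; apply: rintegrableD; exact: rintegrableZ. Qed.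

Lemma Rintegral_lin a b f g : rintegrable f -> rintegrable g ->
  \int[mu]_(x in D) (a * f x + b * g x) =
  a * \int[mu]_(x in D) f x + b * \int[mu]_(x in D) g x.
Proof.
move=> hf hg; rewrite RintegralD //; [|exact: rintegrableZ|exact: rintegrableZ].
by rewrite !RintegralZl.
Qed.

Lemma RintegralZ k f : rintegrable f ->
  \int[mu]_(x in D) (k * f x) = k * \int[mu]_(x in D) f x.
Proof. by move=> hf; rewrite RintegralZl. Qed.

Lemma Rdominated_cvg (f_ : nat -> T -> R) f g :
  (forall n, measurable_fun D (f_ n)) -> measurable_fun D f -> rintegrable g ->
  (forall n x, D x -> `|f_ n x| <= g x) ->
  (forall x, D x -> f_ ^~ x @ \oo --> f x) ->
  \int[mu]_(x in D) f_ n x @[n --> \oo] --> \int[mu]_(x in D) f x.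
Proof.
move=> mf_ mf hg fg ff.
have [] := @dominated_convergence _ _ _ mu D mD (fun n => EFin \o f_ n) (EFin \o f) (EFin \o g).
- by move=> n; exact/measurable_EFinP.
- exact/measurable_EFinP.
- by apply: aeW => x Dx; apply: cvg_EFin; [exact: nearW|exact: ff].
- exact: hg.
- by apply: aeW => x n Dx /=; rewrite lee_fin fg.
move=> hf _ h; apply: fine_cvg.
by rewrite (_ : (fine _)%:E = (\int[mu]_(x in D) (EFin \o f) x)%E) // fineK // integrable_fin_num.
Qed.

End integration.

(** * Exchange of integrals under a product bound *)

Section fubini.
Context d1 d2 (T1 : measurableType d1) (T2 : measurableType d2) (R : realType).
Variable m1 : {sigma_finite_measure set T1 -> \bar R}.
Variable m2 : {sigma_finite_measure set T2 -> \bar R}.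

Let fubiniT (F : T1 -> T2 -> R) (g : T1 -> R) (h : T2 -> R) :
  measurable_fun setT (fun p : T1 * T2 => F p.1 p.2) ->
  rintegrable m1 setT g -> rintegrable m2 setT h ->
  (forall x y, `|F x y| <= g x * h y) ->
  [/\ rintegrable m1 setT (fun x => \int[m2]_y F x y),
      rintegrable m2 setT (fun y => \int[m1]_x F x y) &
      \int[m1]_x \int[m2]_y F x y = \int[m2]_y \int[m1]_x F x y].
Proof.
move=> mF ig ih hF.
pose f (p : T1 * T2) : \bar R := (F p.1 p.2)%:E.
have mf : measurable_fun setT f by exact/measurable_EFinP.
have hx x : rintegrable m2 setT (F x).
  apply: (@rintegrable_le _ _ _ _ _ _ _ (fun y => g x * h y)) => //.
    have := measurableT_comp mF (measurable_pair1 x); exact.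
  exact: rintegrableZ.
have hy y : rintegrable m1 setT (F^~ y).
  apply: (@rintegrable_le _ _ _ _ _ _ _ (fun x => h y * g x)) => //.
  - have := measurableT_comp mF (measurable_pair2 y); exact.
  - by move=> x _; rewrite mulrC.
  exact: rintegrableZ.
have imf : (m1 \x m2)%E.-integrable setT f.
  apply/integrable12ltyP => //.
  apply: (@le_lt_trans _ _ (\int[m1]_x (g x * \int[m2]_y h y)%:E)%E).
    apply: ge0_le_integral => //.
    - by move=> x _; apply: integral_ge0.
    - apply: (measurable_fun_fubini_tonelli_F (fun p => `|f p|%E)) => //=.
      by apply/measurable_EFinP; apply: measurableT_comp.
    - by apply/measurable_EFinP; apply: measurable_funM => //; exact: rintegrable_meas ig.
    move=> x _; rewrite -RintegralZl // -Rintegral_EFin; last exact: rintegrableZ.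
    apply: ge0_le_integral => //=.
    - by do 2 apply: measurableT_comp => //; exact: rintegrable_meas (hx x).
    - by apply/measurable_EFinP; apply: measurable_funM => //; exact: rintegrable_meas ih.
    - by move=> y _; rewrite lee_fin.
    exact: measurableT.
  have igh : rintegrable m1 setT (fun x => g x * \int[m2]_y h y).
    apply: rintegrable_eq (rintegrableZ _ (\int[m2]_y h y) ig) => //.
    by move=> x _; rewrite mulrC.
  by rewrite Rintegral_EFin // ltry.
split.
- have := integrable_fubini_F imf; apply: eq_integrable => // x _ /=.
  by rewrite /fubini_F /f /= Rintegral_EFin.
- have mf' : measurable_fun setT (f \o @unstable.swap T2 T1).
    by apply: measurableT_comp => //; exact: measurable_swap.
  have imf' : (m2 \x m1)%E.-integrable setT (f \o @unstable.swap T2 T1).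
    apply/integrable12ltyP => //.
    change (\int[m2]_y \int[m1]_x `|f (x, y)| < +oo)%E.
    exact/integrable21ltyP.
  have := integrable_fubini_F imf'; apply: eq_integrable => // y _ /=.
  by rewrite /fubini_F /f /= Rintegral_EFin.
have := Fubini imf; rewrite /f /= => e.
rewrite /Rintegral; congr fine.
transitivity (\int[m1]_x \int[m2]_y (F x y)%:E)%E.
  by apply: eq_integral => x _; rewrite -Rintegral_EFin.
by rewrite e; apply: eq_integral => y _; rewrite -Rintegral_EFin.
Qed.

(** A bound by a product [g x * h y] yields integrability on the product space at once, so no
    iterated integral has to be estimated by the caller. Extension by zero reduces the sets to the
    whole spaces. *)
Lemma Rfubini (D1 : set T1) (D2 : set T2) (F : T1 -> T2 -> R) g h :
  measurable D1 -> measurable D2 ->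
  measurable_fun (D1 `*` D2) (fun p : T1 * T2 => F p.1 p.2) ->
  rintegrable m1 D1 g -> rintegrable m2 D2 h ->
  (forall x y, D1 x -> D2 y -> `|F x y| <= g x * h y) ->
  [/\ rintegrable m1 D1 (fun x => \int[m2]_(y in D2) F x y),
      rintegrable m2 D2 (fun y => \int[m1]_(x in D1) F x y) &
      \int[m1]_(x in D1) \int[m2]_(y in D2) F x y =
      \int[m2]_(y in D2) \int[m1]_(x in D1) F x y].
Proof.
move=> mD1 mD2 mF ig ih hF.
pose F' x y := ((fun p : T1 * T2 => F p.1 p.2) \_ (D1 `*` D2)) (x, y).
have rest d (T : measurableType d) (mu : {measure set T -> \bar R}) D (f : T -> R) :
    measurable D -> rintegrable mu D f <-> rintegrable mu setT (f \_ D).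
  by move=> mD; rewrite /rintegrable integrable_mkcond // restrict_EFin.
have F'1 x : (fun y => F' x y) = if x \in D1 then F x \_ D2 else cst 0.
  apply/funext => y; rewrite /F' !patchE in_setX /=.
  by case: (x \in D1) => //=; rewrite patchE.
have F'2 y : (fun x => F' x y) = if y \in D2 then (F^~ y) \_ D1 else cst 0.
  apply/funext => x; rewrite /F' !patchE in_setX /= andbC.
  by case: (y \in D2) => //=; rewrite patchE.
have e1 : (fun x => \int[m2]_y F' x y) = (fun x => \int[m2]_(y in D2) F x y) \_ D1.
  apply/funext => x; rewrite F'1 patchE; case: ifP => _.
    by rewrite -Rintegral_mkcond.
  by rewrite Rintegral_cst // mul0r.
have e2 : (fun y => \int[m1]_x F' x y) = (fun y => \int[m1]_(x in D1) F x y) \_ D2.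
  apply/funext => y; rewrite F'2 patchE; case: ifP => _.
    by rewrite -Rintegral_mkcond.
  by rewrite Rintegral_cst // mul0r.
have [||||] := @fubiniT F' (g \_ D1) (h \_ D2).
- have -> : (fun p => F' p.1 p.2) = (fun p : T1 * T2 => F p.1 p.2) \_ (D1 `*` D2).
    by apply/funext => -[].
  exact: (measurable_restrictT _ (measurableX mD1 mD2)).1.
- exact: (rest _ _ _ _ _ mD1).1.
- exact: (rest _ _ _ _ _ mD2).1.
- move=> x y; rewrite /F' !patchE in_setX /=.
  case: (boolP (x \in D1)) => /= [|_]; last by rewrite normr0 mul0r.
  case: (boolP (y \in D2)) => /= [|_ _]; last by rewrite normr0 mulr0.
  by rewrite !inE => yD xD; exact: hF.
rewrite e1 e2 => h1 h2 h3.
split; [exact: (rest _ _ _ _ _ mD1).2|exact: (rest _ _ _ _ _ mD2).2|].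
by rewrite [LHS]Rintegral_mkcond [RHS]Rintegral_mkcond; exact: h3.
Qed.

End fubini.

Section real_line.
Variable R : realType.
Notation mu := (@lebesgue_measure R).
Implicit Types f F : R -> R.

Definition centered_itv (n : nat) : set R := `[- n%:R, n%:R]%classic.

Lemma centered_itv_bigcup : \bigcup_n centered_itv n = setT.
Proof.
rewrite -subTset => x _; exists (Num.bound x) => //=.
rewrite /centered_itv /= in_itv /= -ler_norml.
by apply/ltW; have := archi_boundP (normr_ge0 x); rewrite /Num.bound normr_id.
Qed.

Lemma measurable_centered_itv n : measurable (centered_itv n).
Proof. exact: measurable_itv. Qed.

Lemma integral_itv_FTC f F (a b : R) : a <= b ->
  (forall x, a <= x <= b -> is_derive x 1 F (f x)) ->
  (forall x, a <= x <= b -> {for x, continuous f}) ->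
  (\int[mu]_(x in `[a, b]) (f x)%:E)%E = (F b - F a)%:E.
Proof.
move=> ab dF cf.
have [->|aNb] := eqVneq a b; first by rewrite set_itv1 integral_set1 subrr.
have {aNb}ab' : a < b by rewrite lt_neqAle aNb.
have cF x : a <= x <= b -> {for x, continuous F} by move=> /dF; exact: is_derive_cont.
rewrite EFinB; apply: continuous_FTC2 => //.
- apply/continuous_in_subspaceT => x; rewrite inE /= in_itv /=; exact: cf.
- split.
  + by move=> x; rewrite in_itv /= => /andP[x1 x2]; case: (dF x) => //; rewrite !ltW.
  + by apply: cvg_at_right_filter; apply: cF; rewrite lexx.
  + by apply: cvg_at_left_filter; apply: cF; rewrite lexx ab.
- move=> x; rewrite in_itv /= => /andP[x1 x2]; rewrite derive1E.
  by case: (dF x); rewrite ?ltW.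
Qed.

Lemma Rintegral_itv_FTC f F (a b : R) : a <= b ->
  (forall x, a <= x <= b -> is_derive x 1 F (f x)) ->
  (forall x, a <= x <= b -> {for x, continuous f}) ->
  \int[mu]_(x in `[a, b]) f x = F b - F a.
Proof. by move=> ab dF cf; rewrite /Rintegral (integral_itv_FTC ab dF cf). Qed.

Lemma centered_le (n : nat) : - n%:R <= n%:R :> R.
Proof. have := ler0n R n; lra. Qed.

Lemma Rintegral_centered_cvg f : rintegrable mu setT f ->
  \int[mu]_(x in centered_itv n) f x @[n --> \oo] --> \int[mu]_x f x.
Proof.
move=> hf; under eq_fun do rewrite Rintegral_mkcond.
apply: (@Rdominated_cvg _ _ _ mu setT measurableT _ _ (fun x => `|f x|)) => //.
- move=> n; apply: (measurable_restrictT _ (measurable_centered_itv n)).1.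
  by apply: measurable_funTS; exact: rintegrable_meas hf.
- exact: rintegrable_meas hf.
- exact: rintegrable_abs.
- by move=> n x _; rewrite patchE; case: ifP; rewrite ?normr0.
move=> x _; apply: cvg_near_cst; exists (Num.bound x) => // n /= xn.
rewrite patchE mem_set // /centered_itv /= in_itv /= -ler_norml.
apply/ltW; have := archi_boundP (normr_ge0 x); rewrite /Num.bound normr_id => h.
by apply: lt_le_trans h _; rewrite ler_nat.
Qed.

Lemma Rintegral_FTC f F (l : R) : rintegrable mu setT f -> continuous f ->
  (forall x : R, is_derive x 1 F (f x)) ->
  (F n%:R - F (- n%:R) @[n --> \oo] --> l) -> \int[mu]_x f x = l.
Proof.
move=> hf cf dF hl; have h := Rintegral_centered_cvg hf.
have e : (fun n => \int[mu]_(x in centered_itv n) f x) = (fun n => F n%:R - F (- n%:R)).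
  apply/funext => n; apply: (@Rintegral_itv_FTC f F); first exact: centered_le.
  by move=> x _; exact: cf.
by rewrite e in h; rewrite -(cvg_lim _ hl) // (cvg_lim _ h).
Qed.

(** Monotone convergence over [[-n, n]]: an antiderivative of bounded oscillation suffices, and no
    limit at infinity has to be computed. The majorants [sech] and [poisson] are treated in this
    way. *)
Lemma Rintegral_ge0_FTC f F (C : R) : continuous f -> (forall x, 0 <= f x) ->
  (forall x : R, is_derive x 1 F (f x)) -> (forall x y, F x - F y <= C) ->
  rintegrable mu setT f /\ \int[mu]_x f x <= C.
Proof.
move=> cf f0 dF FC.
have mf : measurable_fun setT f by exact: continuous_measurable_fun.
have h := @ge0_nondecreasing_set_cvg_integral _ (measurableTypeR R) R centered_itv (EFin \o f) mu _
  measurable_centered_itv _ _.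
have {}h : (\int[mu]_(x in centered_itv n) (f x)%:E @[n --> \oo] --> \int[mu]_x (f x)%:E)%E.
  rewrite -centered_itv_bigcup; apply: h.
  - apply/nondecreasing_seqP => n; apply/subsetPset => x.
    rewrite /centered_itv /= !in_itv /= => /andP[x1 x2].
    have nS : n%:R <= n.+1%:R :> R by rewrite ler_nat.
    by apply/andP; split; lra.
  - by move=> n; apply/measurable_EFinP; exact: measurable_funTS.
  - by move=> n x _ /=; rewrite lee_fin.
have hC : (\int[mu]_x (f x)%:E <= C%:E)%E.
  rewrite -(cvg_lim _ h) //; apply: lime_le; first by apply/cvg_ex; eexists; exact: h.
  apply: nearW => n; rewrite /centered_itv (@integral_itv_FTC f F) ?centered_le //;
    last by move=> x _; exact: cf.
  by rewrite lee_fin.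
have hf : rintegrable mu setT f.
  apply/integrableP; split; first exact/measurable_EFinP.
  apply: le_lt_trans (ltry C); apply: le_trans hC.
  by under eq_integral do rewrite /= ger0_norm //.
by split => //; rewrite -lee_fin -Rintegral_EFin.
Qed.

(* Smooth majorant of exponentially decaying functions. *)
Definition sech (c x : R) : R := (expR (c * x) + expR (- (c * x)))^-1.

Lemma sech_gt0 c x : 0 < sech c x.
Proof. by rewrite invr_gt0 addr_gt0 // expR_gt0. Qed.

Lemma is_derive_expRM (c x : R) : is_derive x 1 (fun y => expR (c * y)) (expR (c * x) * c).
Proof.
apply: is_derive_comp1.
apply: is_derive_eq1 (is_deriveM1 (is_derive_cst c _ _) (is_derive_id _ _)) _.
by rewrite mulr1 mulr0 addr0.
Qed.

Lemma continuous_sech c : continuous (sech c).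
Proof.
move=> x; apply: cvgV; first by rewrite gt_eqF // addr_gt0 // expR_gt0.
apply: cvgD; first exact: is_derive_cont (is_derive_expRM c x).
have -> : (fun y => expR (- (c * y))) = (fun y => expR (- c * y)).
  by apply/funext => y; rewrite mulNr.
by rewrite -mulNr; exact: is_derive_cont (is_derive_expRM (- c) x).
Qed.

Lemma sech_integrable c : 0 < c -> rintegrable mu setT (sech c).
Proof.
move=> c0; have [||||//] := @Rintegral_ge0_FTC (sech c) (fun x => c^-1 * atan (expR (c * x))) (c^-1 * pi).
- exact: continuous_sech.
- by move=> x; apply/ltW/sech_gt0.
- move=> x.
  have h1 := is_derive_expRM c x.
  have h2 : is_derive x 1 (fun x => atan (expR (c * x)))
    ((1 + expR (c * x) ^+ 2)^-1 * (expR (c * x) * c)) by exact: is_derive_comp1.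
  apply: is_derive_eq1 (is_deriveM1 (is_derive_cst c^-1 _ _) h2) _.
  rewrite mulr0 addr0 /sech expRN.
  have e0 := expR_gt0 (c * x).
  by rewrite /cst; field; rewrite !gt_eqF //= ?ltr_wpDl ?sqr_ge0 //.
move=> x y; rewrite -mulrBr ler_wpM2l ?invr_ge0 ?(ltW c0) //.
have := atan_ltpi2 (expR (c * x)); have := atan_gtNpi2 (expR (c * y)); lra.
Qed.

End real_line.

(** * Logarithms of complete Bernstein functions *)

Section cbf_log.
Variable R : realType.
Notation mu := (@lebesgue_measure R).
Implicit Types (L D : R[i] -> R[i]) (z w : R[i]).

(** A constant with [slit_const z * (1 + s) <= |z + s|] for all [s >= 0]. Here [del] bounds
    [|z + s|] from below, and [1 + s <= |z + s| + |1 - z| <= |z + s| (1 + |1 - z| / del)]. *)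
Definition slit_const z : R :=
  let del := if complex.Im z == 0 then complex.Re z else `|complex.Im z| in
  (1 + nm (1 - z) / del)^-1.

Lemma slitP z : slit_plane z -> complex.Im z != 0 \/ 0 < complex.Re z.
Proof.
rewrite /slit_plane /= => /negP; rewrite lecE /= eq_sym negb_and -ltNge => /orP[|]; auto.
Qed.

Lemma slit_const_gt0 z : slit_plane z -> 0 < slit_const z.
Proof.
move=> /slitP hz; rewrite invr_gt0 ltr_wpDr // divr_ge0 ?nm_ge0 //.
by case: eqVneq hz => [_ [//|/ltW//]|_ _].
Qed.

Lemma slit_constP z (s : R) : slit_plane z -> 0 <= s ->
  slit_const z * (1 + s) <= nm (z + s%:C).
Proof.
move=> hz s0; rewrite /slit_const.
set del := if _ then _ else _.
have del0 : 0 < del.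
  rewrite /del; have [i0|i0] := eqVneq; last by rewrite normr_gt0.
  by case: (slitP hz); rewrite ?i0 ?eqxx.
have dn : del <= nm (z + s%:C).
  rewrite /del; case: eqVneq => [i0|_].
    by apply: le_trans (Re_nm _); rewrite Re_add /= ger0_norm; case: (slitP hz); rewrite ?i0 ?eqxx //; lra.
  by apply: le_trans (Im_nm _); rewrite Im_add /= addr0.
have K0 : 0 < 1 + nm (1 - z) / del by rewrite ltr_wpDr // divr_ge0 ?nm_ge0 // ltW.
rewrite mulrC ler_pdivrMr // mulrDr mulr1.
have -> : 1 + s = nm (1 + s%:C : R[i]).
  by rewrite -(rmorph1 (real_complex R)) -rmorphD /= nm_real ger0_norm // addr_ge0.
have -> : 1 + s%:C = (z + s%:C) + (1 - z) by ring.
apply: (le_trans (nmD _ _)); rewrite lerD2l mulrCA -{1}[nm (1 - z)]mulr1.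
by rewrite ler_wpM2l ?nm_ge0 // ler_pdivlMr // mul1r.
Qed.

Lemma slit_near z w : slit_plane z -> nm (w - z) <= slit_const z / 2 ->
  slit_plane w /\ forall s : R, 0 <= s -> slit_const z / 2 * (1 + s) <= nm (w + s%:C).
Proof.
move=> hz hw; have c0 := slit_const_gt0 hz.
have hs (s : R) : 0 <= s -> slit_const z / 2 * (1 + s) <= nm (w + s%:C).
  move=> s0; have h := slit_constP hz s0.
  have -> : w + s%:C = (z + s%:C) - (z - w) by ring.
  have := nmD ((z + s%:C) - (z - w)) (z - w); rewrite subrK (nmB z) => h2.
  have : 0 <= slit_const z * s by rewrite mulr_ge0 // ltW.
  lra.
split => //; rewrite /slit_plane /=; move: hs; case: w {hw} => a b hs.
rewrite lecE /= => /andP[/eqP b0 a0].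
have := hs (- a); rewrite oppr_ge0 => /(_ a0).
have -> : (a +i* b) + (- a)%:C = 0 by apply: complex_ext; rewrite /= ?subrr // -b0 addr0.
rewrite nm0; apply/negP; rewrite -ltNge mulr_gt0 ?divr_gt0 //; lra.
Qed.

(* [L] is a logarithm of a complete Bernstein function normalised at [1], and [D]
   its derivative; the bounds are uniform, so that they survive pointwise limits. *)
Definition tame L D :=
  [/\ forall z, slit_plane z -> nm (L z) <= nm (z - 1) / slit_const z,
      forall z, slit_plane z -> nm (D z) <= (slit_const z ^+ 2)^-1,
      forall z w, slit_plane z -> nm (w - z) <= slit_const z / 2 ->
        nm (L w - L z - D z * (w - z)) <= 2 / slit_const z ^+ 3 * nm (w - z) ^+ 2,
      forall z, 0 < complex.Im z -> 0 <= complex.Im (L z) <= pi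
    & forall x : R, 0 < x -> complex.Im (L x%:C) = 0 /\
        Num.min 0 (ln x) <= complex.Re (L x%:C) <= Num.max 0 (ln x)].

Definition cbf_log (l : R -> R) := exists L D, tame L D /\
  forall x, 0 < x -> complex.Re (L x%:C) = l x.

(** The factor [c] is kept apart and may be zero, because a logarithm normalised at 1 cannot express
    the zero function, which can occur as a limit. *)
Definition cbf (h : R -> R) := exists c l, [/\ 0 <= c, cbf_log l &
  forall x, 0 < x -> h x = c * expR (l x)].

Lemma tame_cder L D z : tame L D -> slit_plane z -> cder L z (D z).
Proof.
move=> [_ _ h _ _] hz; have c0 := slit_const_gt0 hz; apply/cderP => e e0.
have K0 : 0 < 2 / slit_const z ^+ 3 by rewrite divr_gt0 // exprn_gt0.
exists (Num.min (slit_const z / 2) (e / (2 / slit_const z ^+ 3))).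
  by rewrite lt_min !divr_gt0 // exprn_gt0.
move=> w; rewrite lt_min => /andP[w1 w2].
apply: (le_trans (h _ _ hz (ltW w1))); rewrite expr2 mulrA ler_wpM2r ?nm_ge0 //.
by rewrite mulrC -ler_pdivlMr // ltW.
Qed.

(** On the upper half-plane the argument of [e^L] is [Im L], which lies in [[0, pi]], so the sine is
    nonnegative. *)
Lemma cbf_complete_bernstein h : cbf h -> is_complete_bernstein (fun x => (h x)%:C).
Proof.
move=> [c [l [c0 [L [D [tLD Ll]]] hE]]].
exists (fun z => c%:C * cexp (L z)); first split.
- move=> z hz; have h1 := cder_comp (cder_cexp (L z)) (tame_cder tLD hz).
  exact: cder_derivable (cderM (cder_cst c%:C z) h1).
- move=> z z0; case: tLD => _ _ _ /(_ z z0) /andP[i0 ipi] _.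
  rewrite Im_mul /= mul0r addr0 mulr_ge0 // mulr_ge0 ?expR_ge0 //.
  by apply: sin_ge0_pi; rewrite i0.
- move=> x x0; case: tLD => _ _ _ _ /(_ x x0) [i0 _].
  have -> : L x%:C = (complex.Re (L x%:C))%:C by apply: complex_ext.
  by rewrite cexp_real -rmorphM /= ler0c mulr_ge0 ?expR_ge0.
move=> x x0; rewrite hE //.
case: tLD => _ _ _ _ /(_ x x0) [i0 _].
have -> : L x%:C = (l x)%:C by apply: complex_ext => //; exact: Ll.
by rewrite cexp_real -rmorphM.
Qed.

Lemma tame0 : tame (fun=> 0) (fun=> 0).
Proof.
split.
- by move=> z hz; rewrite nm0 divr_ge0 ?nm_ge0 // ltW // slit_const_gt0.
- by move=> z hz; rewrite nm0 invr_ge0 sqr_ge0.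
- move=> z w hz _; rewrite subrr mul0r subr0 nm0 mulr_ge0 ?sqr_ge0 // divr_ge0 //.
  by rewrite exprn_ge0 // ltW // slit_const_gt0.
- by move=> z _; rewrite lexx pi_ge0.
- by move=> x _; rewrite ge_min le_max !lexx.
Qed.

Section ultralimit.
Variable U : set_system nat.
Context {UU : UltraFilter U}.

(** The limit is the supremum of the levels that the sequence reaches on a set of the ultrafilter;
    maximality of [U] decides on which side of a higher level the sequence stays. *)
Lemma ultralimit_real (x : nat -> R) (B : R) : (forall n, `|x n| <= B) ->
  exists l : R, forall e, 0 < e -> U [set n | `|x n - l| < e].
Proof.
move=> hB; pose S := [set a | U [set n | a <= x n]].
have S0 : S (- B).
  apply: filterS filterT => n _ /=; by have := hB n; rewrite ler_norml => /andP[].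
have ubS : ubound S B.
  move=> a Sa; have [n] := filter_ex Sa; rewrite /= => an.
  by apply: (le_trans an); apply: (le_trans (ler_norm _)).
have hS : has_sup S by split; [exists (- B)|exists B].
exists (sup S) => e e0.
have [a Sa ae] := sup_adherent e0 hS.
have : U [set n | ~ (sup S + e <= x n)].
  case: (in_ultra_setVsetC [set n | sup S + e <= x n] UU) => // h.
  have : sup S + e <= sup S by apply: ub_le_sup => //; case: hS.
  lra.
apply: filterS2 Sa => n /= xa /negP; rewrite -ltNge => xn.
rewrite ltr_norml; lra.
Qed.

Lemma ultralimit (x : nat -> R[i]) (B : R) : (forall n, nm (x n) <= B) ->
  exists l : R[i], forall e : R, 0 < e -> U [set n | nm (x n - l) < e].
Proof.
move=> hB.
have [a ha] := @ultralimit_real (fun n => complex.Re (x n)) B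
  (fun n => le_trans (Re_nm _) (hB n)).
have [b hb] := @ultralimit_real (fun n => complex.Im (x n)) B
  (fun n => le_trans (Im_nm _) (hB n)).
exists (a +i* b) => e e0; have e2 : 0 < e / 2 by rewrite divr_gt0.
apply: filterS2 (ha _ e2) (hb _ e2) => n /= h1 h2.
apply: le_lt_trans (nm_le_ReIm _) _; rewrite !ReImE /=; lra.
Qed.
End ultralimit.

Lemma le_eps_mul (a b K : R) : 0 <= K -> (forall e, 0 < e -> e <= 1 -> a <= b + K * e) -> a <= b.
Proof.
move=> K0 h; apply/ler_addgt0Pr => e e0.
have K1 : 0 < K + 1 by lra.
have d0 : 0 < Num.min 1 (e / (K + 1)) by rewrite lt_min ltr01 divr_gt0.
have d1 : Num.min 1 (e / (K + 1)) <= 1 by rewrite ge_min lexx.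
apply: (le_trans (h _ d0 d1)); rewrite lerD2l.
apply: (@le_trans _ _ (K * (e / (K + 1)))).
  by rewrite ler_wpM2l // ge_min lexx orbT.
by rewrite mulrCA ler_piMr ?ltW // ltr_pdivrMr // mul1r ltrDl.
Qed.

(** Takes the place of a normal families argument. At each [z] the values and the candidate
    derivatives are bounded, hence converge along one ultrafilter, and every clause of [tame]
    involves at most two points. The quadratic remainder bound makes the limit holomorphic without
    uniform convergence. *)
Lemma tame_limit (L_ D_ : nat -> R[i] -> R[i]) : (forall n, tame (L_ n) (D_ n)) ->
  exists L D, tame L D /\ forall z, slit_plane z -> forall (e : R) N, 0 < e ->
    exists2 n, (N <= n)%N & nm (L_ n z - L z) < e.
Proof.
move=> hT.
have [U [UU Uoo]] := @ultraFilterLemma nat \oo _.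
have hL z : exists l, slit_plane z -> forall e : R, 0 < e -> U [set n | nm (L_ n z - l) < e].
  have [hz|nz] := pselect (slit_plane z); last by exists 0.
  have [l hl] := @ultralimit U UU (L_ ^~ z) _ (fun n => let: And5 h _ _ _ _ := hT n in h z hz).
  by exists l.
have hD z : exists l, slit_plane z -> forall e : R, 0 < e -> U [set n | nm (D_ n z - l) < e].
  have [hz|nz] := pselect (slit_plane z); last by exists 0.
  have [l hl] := @ultralimit U UU (D_ ^~ z) _ (fun n => let: And5 _ h _ _ _ := hT n in h z hz).
  by exists l.
have [L LP] := choice hL; have [D DP] := choice hD.
have near z w (e : R) N : slit_plane z -> slit_plane w -> 0 < e ->
    exists n, [/\ (N <= n)%N, nm (L_ n z - L z) < e, nm (L_ n w - L w) < e & nm (D_ n z - D z) < e].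
  move=> hz hw e0.
  have hN : U [set n | (N <= n)%N] by apply: Uoo; exists N.
  have [n [[h1 h2] [h3 h4]]] := filter_ex
    (filterI (filterI (LP z hz e e0) (LP w hw e e0)) (filterI (DP z hz e e0) hN)).
  by exists n.
exists L, D; split; last first.
  by move=> z hz e N e0; have [n [h1 h2 _ _]] := near z z e N hz hz e0; exists n.
have im_slit z : 0 < complex.Im z -> slit_plane z.
  move=> i0; rewrite /slit_plane /= lecE /= => /andP[/eqP e _].
  by move: i0; rewrite -e ltxx.
have re_slit (x : R) : 0 < x -> slit_plane x%:C.
  by move=> x0; rewrite /slit_plane /= lecR => x1; move: x0; rewrite ltNge x1.
split.
- move=> z hz; apply: (@le_eps_mul _ _ 1) => // e e0 _; rewrite mul1r.
  have [n [_ h _ _]] := near z z e 0%N hz hz e0; have [hb _ _ _ _] := hT n.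
  have -> : L z = L_ n z - (L_ n z - L z) by ring.
  apply: (le_trans (nmDB _ _)); apply: lerD; [exact: hb|exact: ltW].
- move=> z hz; apply: (@le_eps_mul _ _ 1) => // e e0 _; rewrite mul1r.
  have [n [_ _ _ h]] := near z z e 0%N hz hz e0; have [_ hb _ _ _] := hT n.
  have -> : D z = D_ n z - (D_ n z - D z) by ring.
  apply: (le_trans (nmDB _ _)); apply: lerD; [exact: hb|exact: ltW].
- move=> z w hz hw; have [sw _] := slit_near hz hw.
  apply: (@le_eps_mul _ _ (2 + nm (w - z))) => [|e e0 _].
    by rewrite addr_ge0 ?nm_ge0.
  have [n [_ h1 h2 h3]] := near z w e 0%N hz sw e0; have [_ _ hb _ _] := hT n.
  have -> : L w - L z - D z * (w - z) = (L_ n w - L_ n z - D_ n z * (w - z))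
    + ((L_ n z - L z) - (L_ n w - L w) + (D_ n z - D z) * (w - z)) by ring.
  apply: (le_trans (nmD _ _)); apply: lerD; first exact: hb.
  apply: (le_trans (nmD _ _)); rewrite nmM mulrDl [nm (w - z) * e]mulrC.
  apply: lerD; last by rewrite ler_wpM2r ?nm_ge0 // ltW.
  apply: (le_trans (nmDB _ _)); lra.
- move=> z z0; have hz := im_slit z z0; apply/andP; split.
    apply: (@le_eps_mul _ _ 1) => // e e0 _; rewrite mul1r.
    have [n [_ h _ _]] := near z z e 0%N hz hz e0; have [_ _ _ /(_ z z0) /andP[i1 i2] _] := hT n.
    have := Im_nm (L_ n z - L z); rewrite Im_add Im_opp ler_norml; lra.
  apply: (@le_eps_mul _ _ 1) => // e e0 _; rewrite mul1r.
  have [n [_ h _ _]] := near z z e 0%N hz hz e0; have [_ _ _ /(_ z z0) /andP[i1 i2] _] := hT n.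
  have := Im_nm (L_ n z - L z); rewrite Im_add Im_opp ler_norml; lra.
- move=> x x0; have hz := re_slit x x0; split.
    have h0 : `|complex.Im (L x%:C)| <= 0.
      apply: (@le_eps_mul _ _ 1) => // e e0 _; rewrite mul1r add0r.
      have [n [_ h _ _]] := near _ _ e 0%N hz hz e0; have [_ _ _ _ /(_ x x0) [i0 _]] := hT n.
      have := Im_nm (L_ n x%:C - L x%:C); rewrite Im_add Im_opp i0 sub0r normrN => h1.
      by apply/ltW; apply: le_lt_trans h1 _.
    by apply/eqP; rewrite -normr_le0.
  apply/andP; split.
    apply: (@le_eps_mul _ _ 1) => // e e0 _; rewrite mul1r.
    have [n [_ h _ _]] := near _ _ e 0%N hz hz e0; have [_ _ _ _ /(_ x x0) [_ /andP[i1 i2]]] := hT n.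
    have := Re_nm (L_ n x%:C - L x%:C); rewrite Re_add Re_opp ler_norml; lra.
  apply: (@le_eps_mul _ _ 1) => // e e0 _; rewrite mul1r.
  have [n [_ h _ _]] := near _ _ e 0%N hz hz e0; have [_ _ _ _ /(_ x x0) [_ /andP[i1 i2]]] := hT n.
  have := Re_nm (L_ n x%:C - L x%:C); rewrite Re_add Re_opp ler_norml; lra.
Qed.

Lemma cbf_log_bounds l x : cbf_log l -> 0 < x -> Num.min 0 (ln x) <= l x <= Num.max 0 (ln x).
Proof. by move=> [L [D [[_ _ _ _ h] e]]] x0; rewrite -e //; case: (h x x0). Qed.

Lemma cbf_log_limit (l_ : nat -> R -> R) l : (forall n, cbf_log (l_ n)) ->
  (forall x, 0 < x -> l_ ^~ x @ \oo --> l x) -> cbf_log l.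
Proof.
move=> hl hcv.
have [L_ hL] := choice hl; have [D_ hLD] := choice hL.
have [L [D [tLD hn]]] := @tame_limit L_ D_ (fun n => (hLD n).1).
exists L, D; split => // x x0; apply/eqP; rewrite -subr_eq0 -normr_le0.
apply: (@le_eps_mul _ _ 2) => // e e0 _; rewrite add0r.
have /cvgrPdist_lt /(_ e e0) [N _ hN] := hcv x x0.
have sx : slit_plane (x%:C : R[i]).
  by rewrite /slit_plane /= lecR => x1; move: x0; rewrite ltNge x1.
have [n Nn h] := hn _ sx e N e0.
have h1 := hN n Nn; rewrite /= -(hLD n).2 // in h1.
have := Re_nm (L_ n x%:C - L x%:C); rewrite Re_add Re_opp => h2.
by move: h1 (le_lt_trans h2 h); rewrite !ltr_norml ler_norml; lra.
Qed.

Lemma cvgn_le (u v : nat -> R) (a b : R) : u @ \oo --> a -> v @ \oo --> b ->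
  (forall n, u n <= v n) -> a <= b.
Proof. by move=> ua vb uv; apply: (@ler_cvg_to nat \oo _ R u v) => //; exact: nearW. Qed.

(** A normalised logarithm vanishes at 1, so the constants are [h_ n 1] and converge. The bounds
    between [c min(1, x)] and [c max(1, x)] leave two cases: the limit vanishes at 1 and then
    everywhere, or the logarithms converge. *)
Lemma cbf_limit (h_ : nat -> R -> R) h : (forall n, cbf (h_ n)) ->
  (forall x, 0 < x -> h_ ^~ x @ \oo --> h x) -> cbf h.
Proof.
move=> hh hcv.
have [c_ hc] := choice hh; have [l_ hl] := choice hc.
have l1 n : l_ n 1 = 0.
  have [_ hln _] := hl n; have := cbf_log_bounds hln ltr01.
  by rewrite ln1 minxx maxxx => h01; apply/eqP; rewrite eq_le andbC.
have c1 n : h_ n 1 = c_ n by have [_ _ ->] := hl n; rewrite // l1 expR0 mulr1.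
have hc1 : c_ @ \oo --> h 1.
  by rewrite (_ : c_ = h_ ^~ 1); [exact: hcv|apply/funext => n; rewrite c1].
have c0 n : 0 <= c_ n by case: (hl n).
have h10 : 0 <= h 1.
  exact: cvgn_le (cvg_cst 0) hc1 c0.
have hup n x : 0 < x -> h_ n x <= c_ n * expR (Num.max 0 (ln x)).
  move=> x0; have [_ hln ->] := hl n; rewrite // ler_wpM2l // ler_expR.
  by have /andP[] := cbf_log_bounds hln x0.
have hlo n x : 0 < x -> c_ n * expR (Num.min 0 (ln x)) <= h_ n x.
  move=> x0; have [_ hln ->] := hl n; rewrite // ler_wpM2l // ler_expR.
  by have /andP[] := cbf_log_bounds hln x0.
have cM (K : R) : c_ n * K @[n --> \oo] --> h 1 * K by apply: cvgM => //; exact: cvg_cst.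
have hub x : 0 < x -> h x <= h 1 * expR (Num.max 0 (ln x)).
  by move=> x0; apply: cvgn_le (hcv x x0) (cM _) _ => n; exact: hup.
have hlb x : 0 < x -> h 1 * expR (Num.min 0 (ln x)) <= h x.
  by move=> x0; apply: cvgn_le (cM _) (hcv x x0) _ => n; exact: hlo.
have [h1|h1] := eqVneq (h 1) 0.
  exists 0, (fun=> 0); split => //.
    by exists (fun=> 0), (fun=> 0); split => //; exact: tame0.
  move=> x x0; rewrite mul0r; apply/eqP; rewrite eq_le.
  by have := hub x x0; have := hlb x x0; rewrite h1 !mul0r => -> ->.
have {}h10 : 0 < h 1 by rewrite lt_def h1.
exists (h 1), (fun x => ln (h x / h 1)); split; first exact: ltW.
  apply: (@cbf_log_limit l_) => [n|x x0]; first by case: (hl n).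
  have hx0 : 0 < h x by apply: lt_le_trans (hlb x x0); rewrite mulr_gt0 ?expR_gt0.
  have cv : h_ n x / c_ n @[n --> \oo] --> h x / h 1.
    by apply: cvgM; [exact: hcv|exact: cvgV].
  have cl : ln (h_ n x / c_ n) @[n --> \oo] --> ln (h x / h 1).
    by apply: (continuous_cvg _ (continuous_ln _) cv); rewrite divr_gt0.
  apply: cvg_trans cl; apply: near_eq_cvg.
  have /cvgrPdist_lt /(_ _ h10) := hc1.
  apply: filterS => n; rewrite ltr_norml => /andP[_ cn].
  have cn0 : 0 < c_ n by lra.
  have [_ _ ->] := hl n; rewrite // mulrAC divff ?gt_eqF // mul1r expRK.
  by [].
move=> x x0; rewrite lnK ?posrE ?divr_gt0 //; last first.
  by apply: lt_le_trans (hlb x x0); rewrite mulr_gt0 ?expR_gt0.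
by rewrite mulrC divfK.
Qed.

End cbf_log.

(** * Stieltjes integrals with density in [0, 1], parametrised by a curve *)

Section stieltjes_class.
Variable R : realType.
Notation mu := (@lebesgue_measure R).

Variables lam lam' w : R -> R.
Hypothesis lam_gt0 : forall r, 0 < lam r.
Hypothesis dlam : forall r, is_derive r (1 : R) lam (lam' r).
Hypothesis clam' : continuous lam'.
Hypothesis cw : continuous w.
Hypothesis hw : forall r, 0 <= w r <= lam' r.

Let clam : continuous lam.
Proof. by move=> r; exact: is_derive_cont (dlam r). Qed.

Let w0 r : 0 <= w r. Proof. by case/andP: (hw r). Qed.
Let wl r : w r <= lam' r. Proof. by case/andP: (hw r). Qed.

(** Comparison with [lam' * Psi (lam)], the derivative of [Phi (lam)]: since [w <= lam'], the
    integral is bounded by the oscillation of a primitive in [s = lam r]. *)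
Let J_gen (phi Phi Psi : R -> R) (C : R) : (forall s : R, 0 < s -> {for s, continuous phi}) ->
  (forall s : R, 0 < s -> `|phi s| <= Psi s) -> (forall s : R, 0 < s -> {for s, continuous Psi}) ->
  (forall s : R, 0 < s -> is_derive s 1 Phi (Psi s)) ->
  (forall s t : R, 0 < s -> 0 < t -> Phi s - Phi t <= C) ->
  rintegrable mu setT (fun r => w r * phi (lam r)) /\
  `|\int[mu]_r (w r * phi (lam r))| <= C.
Proof.
move=> cphi hphi cPsi dPhi hC.
have cc (g : R -> R) : (forall s : R, 0 < s -> {for s, continuous g}) ->
    continuous (fun r => g (lam r)).
  by move=> cg r; apply: (@continuous_comp _ _ _ lam g); [exact: clam|exact: cg].
have Psi0 s : 0 < s -> 0 <= Psi s by move=> s0; apply: le_trans (hphi s s0).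
have [|r|r|r s|iP hP] := @Rintegral_ge0_FTC R (fun r => lam' r * Psi (lam r)) (fun r => Phi (lam r)) C.
- by move=> r; apply: cvgM; [exact: clam'|exact: (cc Psi)].
- by rewrite mulr_ge0 ?Psi0 // (le_trans (w0 r)).
- by rewrite mulrC; apply: is_derive_comp1; exact: dPhi.
- exact: hC.
have le1 r : `|w r * phi (lam r)| <= lam' r * Psi (lam r).
  by rewrite normrM ger0_norm // ler_pM // hphi.
have mf : measurable_fun setT (fun r => w r * phi (lam r)).
  apply: continuous_measurable_fun => r; apply: cvgM; [exact: cw|exact: (cc phi)].
have iphi : rintegrable mu setT (fun r => w r * phi (lam r)).
  by apply: rintegrable_le iP => // r _; exact: le1.
by split => //; apply: le_trans hP; apply: Rintegral_norm_le => // r _; exact: le1.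
Qed.

Let J (phi : R -> R) := \int[mu]_r (w r * phi (lam r)).

Let inv1 (x : R) (s : R) : 0 < s -> 0 <= x ->
  is_derive s 1 (fun s => - (x + s)^-1) ((x + s) ^- 2).
Proof.
move=> s0 x0; have xs : x + s != 0 by rewrite gt_eqF // ltr_wpDl.
have h : is_derive s 1 (fun s : R => x + s) 1.
  have := is_deriveD (is_derive_cst x s (1 : R)) (is_derive_id s (1 : R)).
  by rewrite add0r.
have := is_deriveN (is_deriveV xs h).
by rewrite scaleNr opprK [_ *: _]mulr1.
Qed.

(** The quadratic decay matches the primitive [- 1 / (1 + s)], whose oscillation on the half-line is
    at most 1, so the bound [C] passes to the integral [JC F] without loss. *)
Let ok C (F : R[i] -> R[i]) := (forall s : R, 0 < s -> exists c, cder F s%:C c) /\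
  forall s : R, 0 < s -> nm (F s%:C) <= C / (1 + s) ^+ 2.

Let okc C F : ok C F -> forall s : R, 0 < s ->
  {for s, continuous (fun s : R => complex.Re (F s%:C))} /\
  {for s, continuous (fun s : R => complex.Im (F s%:C))}.
Proof.
move=> [dF _] s /dF[c hc].
by have [h1 h2] := rder_cder_hline hc; split; [exact: is_derive_cont h1|exact: is_derive_cont h2].
Qed.

Let J_ok C (phi : R -> R) : 0 <= C -> (forall s : R, 0 < s -> {for s, continuous phi}) ->
  (forall s : R, 0 < s -> `|phi s| <= C / (1 + s) ^+ 2) ->
  rintegrable mu setT (fun r => w r * phi (lam r)) /\ `|J phi| <= C.
Proof.
move=> C0 cphi hphi.
have d1 (s : R) : 0 < s -> is_derive s 1 (fun s => C * - (1 + s)^-1) (C / (1 + s) ^+ 2).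
  move=> s0; apply: is_derive_eq1 (is_deriveM1 (is_derive_cst C s (1 : R)) (inv1 s0 ler01)) _.
  by rewrite mulr0 addr0.
apply: (@J_gen phi (fun s => C * - (1 + s)^-1) (fun s => C / (1 + s) ^+ 2)) => //.
- move=> s s0; apply: cvgM; first exact: cvg_cst.
  have s1 : 1 + s != 0 by rewrite gt_eqF // ltr_wpDl.
  apply: cvgV; first by rewrite expf_neq0.
  have h : (fun t : R => 1 + t) @ s --> 1 + s by apply: cvgD; [exact: cvg_cst|exact: cvg_id].
  by rewrite expr2; under eq_fun do rewrite expr2; apply: cvgM.
- move=> s t s0 t0; have := invr_gt0 (1 + s); have h : (1 + t)^-1 <= 1.
    by rewrite invf_le1; lra.
  have : 0 < (1 + s)^-1 by rewrite invr_gt0; lra.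
  by rewrite -mulrBr opprK => s1 _; rewrite ler_piMr //; lra.
Qed.

Let JC (F : R[i] -> R[i]) : R[i] :=
  J (fun s => complex.Re (F s%:C)) +i* J (fun s => complex.Im (F s%:C)).

Let ok_ge0 C F : ok C F -> 0 <= C.
Proof.
move=> [_ /(_ 1 ltr01)]; move=> /(le_trans (nm_ge0 _)).
by rewrite pmulr_lge0 // invr_gt0 exprn_gt0 // addr_gt0.
Qed.

Let ok_int C F : ok C F ->
  rintegrable mu setT (fun r => w r * complex.Re (F (lam r)%:C)) /\
  rintegrable mu setT (fun r => w r * complex.Im (F (lam r)%:C)).
Proof.
move=> oF; have C0 := ok_ge0 oF; split.
  apply: (@J_ok C (fun s => complex.Re (F s%:C)) C0 _ _).1 => s s0.
    by case: (okc oF s0).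
  by apply: le_trans (Re_nm _) _; apply: oF.2.
apply: (@J_ok C (fun s => complex.Im (F s%:C)) C0 _ _).1 => s s0.
  by case: (okc oF s0).
by apply: le_trans (Im_nm _) _; apply: oF.2.
Qed.

Let JC_lin C C' F G a b : ok C F -> ok C' G ->
  JC (fun s => a * F s + b * G s) = a * JC F + b * JC G.
Proof.
move=> oF oG; have [f1 f2] := ok_int oF; have [g1 g2] := ok_int oG.
case: a b => a1 a2 [b1 b2]; apply: complex_ext; rewrite !ReImE /= /J.
  have h := Rintegral_lin measurableT 1 1 (rintegrable_lin measurableT a1 (- a2) f1 f2)
    (rintegrable_lin measurableT b1 (- b2) g1 g2).
  rewrite (Rintegral_lin measurableT a1 (- a2) f1 f2) (Rintegral_lin measurableT b1 (- b2) g1 g2) in h.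
  rewrite !mul1r !mulNr in h; rewrite -h.
  by apply: eq_Rintegral => r _; rewrite !ReImE /=; ring.
have h := Rintegral_lin measurableT 1 1 (rintegrable_lin measurableT a1 a2 f2 f1)
  (rintegrable_lin measurableT b1 b2 g2 g1).
rewrite (Rintegral_lin measurableT a1 a2 f2 f1) (Rintegral_lin measurableT b1 b2 g2 g1) in h.
rewrite !mul1r in h; rewrite -h.
by apply: eq_Rintegral => r _; rewrite !ReImE /=; ring.
Qed.

Let okZ C F a : ok C F -> ok (nm a * C) (fun s => a * F s).
Proof.
move=> [dF hF]; split => s s0.
  have [c hc] := dF s s0; exists (a * c).
  by apply: cder_eq (cderM (cder_cst a _) hc) _; rewrite mulr0 addr0.
by rewrite nmM -mulrA ler_wpM2l ?nm_ge0 // hF.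
Qed.

Let JC_le C F : ok C F -> nm (JC F) <= C.
Proof.
move=> oF; have C0 := ok_ge0 oF.
have [->|J0] := eqVneq (JC F) 0; first by rewrite nm0.
have nJ : 0 < nm (JC F) by rewrite nm_gt0.
pose u := (JC F)^*%C / (nm (JC F))%:C.
have nu : nm u = 1.
  rewrite /u nmM nmV nm_real ger0_norm ?nm_ge0 //.
  have -> : nm (JC F)^*%C = nm (JC F).
    by apply: (@complexI R); rewrite -!normc_nm normcJ.
  by rewrite divff // gt_eqF.
have e1 : u * JC F = (nm (JC F))%:C.
  rewrite /u mulrAC [X in X / _]mulrC -sqr_normc normc_nm.
  by rewrite expr2 mulfK // eq_complex /= eqxx andbT gt_eqF.
have ou : ok C (fun s => u * F s) by have := okZ u oF; rewrite nu mul1r.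
have e2 : u * JC F = JC (fun s => u * F s).
  have := JC_lin u 0 oF oF; rewrite mul0r addr0 => <-.
  by congr JC; apply/funext => s; rewrite mul0r addr0.
have -> : nm (JC F) = complex.Re (JC (fun s => u * F s)) by rewrite -e2 e1.
apply: le_trans (ler_norm _) _.
apply: (@J_ok C (fun s => complex.Re (u * F s%:C)) C0 _ _).2 => s s0.
  by case: (okc ou s0).
by apply: le_trans (Re_nm _) _; apply: ou.2.
Qed.

Let q z s : R[i] := (1 + s)^-1 - (z + s)^-1.
Let q' z s : R[i] := (z + s) ^- 2.

Let qE (x s : R) : q x%:C s%:C = ((1 + s)^-1 - (x + s)^-1)%:C.
Proof.
by rewrite /q rmorphB /= -(rmorph1 (real_complex R)) -!rmorphD /= !(fmorphV (real_complex R)).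
Qed.

Let zs0 z (s : R) : slit_plane z -> 0 <= s -> z + s%:C != 0.
Proof.
move=> hz s0; rewrite -nm_gt0; apply: lt_le_trans (slit_constP hz s0).
by rewrite mulr_gt0 ?slit_const_gt0 //; lra.
Qed.

Let slit1 : slit_plane (1 : R[i]).
Proof. by rewrite /slit_plane /= lecE /= ler10 andbF. Qed.

Let dinv z (s : R) : slit_plane z -> 0 <= s -> cder (fun s => (z + s)^-1) s%:C (- (z + s%:C) ^- 2).
Proof.
move=> hz s0.
have h := cderD (cder_cst z s%:C) (cder_id s%:C).
apply: cder_eq (@cderV R (fun s => z + s) _ _ (zs0 hz s0) h) _.
by rewrite add0r mulN1r.
Qed.

Let nm1s (s : R) : 0 <= s -> nm (1 + s%:C : R[i]) = 1 + s.
Proof.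
by move=> s0; rewrite -(rmorph1 (real_complex R)) -rmorphD /= nm_real ger0_norm // addr_ge0.
Qed.

Let q_ok z : slit_plane z -> ok (nm (z - 1) / slit_const z) (q z).
Proof.
move=> hz; have c0 := slit_const_gt0 hz; split => s s0.
  eexists; apply: cderB; [exact: (dinv slit1 (ltW s0))|exact: (dinv hz (ltW s0))].
have s1 : 0 < 1 + s by lra.
have h1 := zs0 slit1 (ltW s0); have h2 := zs0 hz (ltW s0).
have -> : q z s%:C = (z - 1) * ((1 + s%:C) * (z + s%:C))^-1 by rewrite /q; field; rewrite h1 h2.
rewrite nmM nmV nmM nm1s ?(ltW s0) // -mulrA ler_wpM2l ?nm_ge0 //.
have -> : (slit_const z)^-1 / (1 + s) ^+ 2 = ((1 + s) * (slit_const z * (1 + s)))^-1.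
  by field; rewrite !gt_eqF.
rewrite lef_pV2 ?posrE ?mulr_gt0 // ?nm_gt0 //.
by rewrite ler_wpM2l ?slit_constP // ltW.
Qed.

Let q'_ok z : slit_plane z -> ok (slit_const z ^+ 2)^-1 (q' z).
Proof.
move=> hz; have c0 := slit_const_gt0 hz; split => s s0.
  have h := dinv hz (ltW s0); have h1 := cderM h h.
  eexists; move: h1; rewrite (_ : (fun w => _) = q' z); first exact.
  by apply/funext => t; rewrite /q' expr2 invfM.
have s1 : 0 < 1 + s by lra.
have h2 := zs0 hz (ltW s0).
rewrite /q' nmV nmX -invfM lef_pV2 ?posrE ?mulr_gt0 ?exprn_gt0 ?nm_gt0 //.
rewrite -exprMn ler_sqr ?nnegrE ?nm_ge0 ?mulr_ge0 //; try lra.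
exact: slit_constP (ltW s0).
Qed.

Let lim_tame : tame (fun z => JC (q z)) (fun z => JC (q' z)).
Proof.
split.
- by move=> z hz; exact: JC_le (q_ok hz).
- by move=> z hz; exact: JC_le (q'_ok hz).
- move=> z w1 hz hw1; have c0 := slit_const_gt0 hz; have [sw hws] := slit_near hz hw1.
  (* The first-order remainder of [q] in its first argument, arranged as a linear combination for
     [JC_lin]; it equals [- (w1 - z)^2 / ((z + s)^2 (w1 + s))]. *)
  pose F s := 1 * (1 * q w1 s + (-1) * q z s) + (- (w1 - z)) * q' z s.
  have FE s : 0 < s -> F s%:C = - (w1 - z) ^+ 2 * ((z + s%:C) ^+ 2 * (w1 + s%:C))^-1.
    move=> s0; have h1 := zs0 slit1 (ltW s0); have h2 := zs0 hz (ltW s0).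
    have h3 := zs0 sw (ltW s0).
    by rewrite /F /q /q'; field; rewrite h1 h2 h3.
  have oF : ok (2 / slit_const z ^+ 3 * nm (w1 - z) ^+ 2) F.
    split => s s0.
      have [a ha] := (q_ok sw).1 s s0; have [b hb] := (q_ok hz).1 s s0.
      have [c hc] := (q'_ok hz).1 s s0.
      eexists; apply: cderD; apply: cderM; [exact: cder_cst| |exact: cder_cst|exact: hc].
      by apply: cderD; apply: cderM; [exact: cder_cst|exact: ha|exact: cder_cst|exact: hb].
    have s1 : 0 < 1 + s by lra.
    rewrite FE // nmM nmN nmX nmV nmM nmX.
    rewrite [X in _ <= X]mulrAC [X in _ <= X]mulrC ler_wpM2l ?sqr_ge0 //.
    apply: (@le_trans _ _ ((slit_const z * (1 + s)) ^+ 2 * (slit_const z / 2 * (1 + s)))^-1).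
      rewrite lef_pV2 ?posrE; first last.
      - by rewrite mulr_gt0 ?exprn_gt0 ?mulr_gt0 // divr_gt0.
      - by rewrite !mulr_gt0 ?nm_gt0 // ?zs0 // ltW.
      apply: ler_pM; rewrite ?sqr_ge0 ?mulr_ge0 ?divr_ge0 ?(ltW c0) ?(ltW s1) //.
        rewrite ler_sqr ?nnegrE ?nm_ge0 ?mulr_ge0 ?(ltW c0) ?(ltW s1) //.
        exact: slit_constP (ltW s0).
      exact: hws (ltW s0).
    have -> : ((slit_const z * (1 + s)) ^+ 2 * (slit_const z / 2 * (1 + s)))^-1 =
      2 / slit_const z ^+ 3 / (1 + s) ^+ 2 * (1 + s)^-1 by field; rewrite !gt_eqF.
    rewrite ler_piMr //; last by rewrite invf_le1; lra.
    by rewrite divr_ge0 ?sqr_ge0 // divr_ge0 // exprn_ge0 // ltW.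
  suff <- : JC F = JC (q w1) - JC (q z) - JC (q' z) * (w1 - z) by exact: JC_le.
  have o1 : ok (nm (1 : R[i]) * (nm (w1 - 1) / slit_const w1) + nm (-1 : R[i]) * (nm (z - 1) / slit_const z))
      (fun s => 1 * q w1 s + (-1) * q z s).
    have [d1 hd1] := okZ 1 (q_ok sw); have [d2 hd2] := okZ (-1) (q_ok hz).
    split => s s0.
      have [a ha] := d1 s s0; have [b hb] := d2 s s0.
      by eexists; apply: cderD; [exact: ha|exact: hb].
    by apply: (le_trans (nmD _ _)); rewrite mulrDl; apply: lerD; [exact: hd1|exact: hd2].
  rewrite /F (JC_lin _ _ o1 (q'_ok hz)) (JC_lin _ _ (q_ok sw) (q_ok hz)); ring.
- move=> z z0.
  have hz : slit_plane z.
    rewrite /slit_plane /= lecE /= => /andP[/eqP e _].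
    by move: z0; rewrite -e ltxx.
  have E s : 0 <= s -> complex.Im (q z s%:C) =
      complex.Im z / ((complex.Re z + s) ^+ 2 + complex.Im z ^+ 2).
    move=> s0; rewrite /q Im_add Im_opp !Im_inv !nm_sq !ReImE /= !addr0 oppr0 mul0r add0r.
    by rewrite mulNr opprK.
  have D0 s : 0 < (complex.Re z + s) ^+ 2 + complex.Im z ^+ 2.
    by rewrite ltr_wpDl ?sqr_ge0 // exprn_gt0.
  apply/andP; split.
    apply: Rintegral_ge0 => r _; rewrite mulr_ge0 // E ?(ltW (lam_gt0 r)) //.
    by rewrite divr_ge0 // ltW.
  (* [Im (q z s)] is the derivative in [s] of [atan ((Re z + s) / Im z)], whose oscillation is at
     most [pi]: a density at most 1 yields an argument at most [pi]. *)
  apply: le_trans (ler_norm _) _.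
  apply: (@J_gen _ (fun s => atan ((complex.Re z + s) / complex.Im z))
    (fun s => complex.Im (q z s%:C)) pi _ _ _ _ _).2.
  + by move=> s s0; case: (okc (q_ok hz) s0).
  + by move=> s s0; rewrite E ?(ltW s0) // ger0_norm // divr_ge0 // ltW.
  + by move=> s s0; case: (okc (q_ok hz) s0).
  + move=> s s0; rewrite E ?(ltW s0) //.
    have h1 : is_derive s 1 (fun s : R => (complex.Re z + s) / complex.Im z) (complex.Im z)^-1.
      have h := is_deriveD (is_derive_cst (complex.Re z) s (1 : R)) (is_derive_id s (1 : R)).
      apply: is_derive_eq1 (is_deriveM1 h (is_derive_cst (complex.Im z)^-1 s (1 : R))) _.
      by rewrite mulr0 add0r add0r /cst mulr1.
    have h2 := @is_derive_comp1 R (@atan R) (fun s : R => (complex.Re z + s) / complex.Im z) s _ _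
      (is_derive1_atan _) h1.
    apply: is_derive_eq1 h2 _.
    have D1 := D0 s; have i0 : complex.Im z != 0 by rewrite gt_eqF.
    have -> : 1 + ((complex.Re z + s) / complex.Im z) ^+ 2 =
      ((complex.Re z + s) ^+ 2 + complex.Im z ^+ 2) / complex.Im z ^+ 2 by field.
    by field; rewrite i0 gt_eqF.
  + move=> s t _ _; have := atan_ltpi2 ((complex.Re z + s) / complex.Im z).
    by have := atan_gtNpi2 ((complex.Re z + t) / complex.Im z); lra.
- move=> x x0.
  have hz : slit_plane (x%:C : R[i]).
    by rewrite /slit_plane /= lecR => x1; move: x0; rewrite ltNge x1.
  have dln (a : R) (s : R) : 0 < a -> 0 < s -> is_derive s 1 (fun s => ln (a + s)) (a + s)^-1.
    move=> a0 s0; have h : is_derive s 1 (fun s : R => a + s) 1.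
      have := is_deriveD (is_derive_cst a s (1 : R)) (is_derive_id s (1 : R)).
      by rewrite add0r.
    have as0 : 0 < a + s by rewrite addr_gt0.
    by apply: is_derive_eq1 (@is_derive_comp1 R (@ln R) (fun s : R => a + s) s _ _ (is_derive1_ln as0) h) _;
      rewrite mulr1.
  split.
    transitivity (\int[mu]_r (0 : R)); last by rewrite Rintegral_cst // mul0r.
    by apply: eq_Rintegral => r _; rewrite qE mulr0.
  have cR s : 0 < s -> {for s, continuous (fun s : R => complex.Re (q x%:C s%:C))}.
    by move=> s0; case: (okc (q_ok hz) s0).
  (* For real [x] a primitive of [q] in [s] is [ln (1 + s) - ln (x + s)], of oscillation at most
     [|ln x|]; the sign of [q] is that of [x - 1], whence the two cases. *)
  have lnb s : 0 < s -> 1 <= x -> 0 <= ln (x + s) - ln (1 + s) <= ln x.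
    move=> s0 x1; have h1 : ln (1 + s) <= ln (x + s) by rewrite ler_ln ?posrE; lra.
    have h2 : ln (x + s) <= ln (x * (1 + s)).
      by rewrite ler_ln ?posrE ?mulr_gt0; rewrite ?mulrDr; try lra; nra.
    by rewrite lnM ?posrE in h2; lra.
  have lnb2 s : 0 < s -> x <= 1 -> 0 <= ln (1 + s) - ln (x + s) <= - ln x.
    move=> s0 x1; have h1 : ln (x + s) <= ln (1 + s) by rewrite ler_ln ?posrE; lra.
    have h2 : ln (x * (1 + s)) <= ln (x + s).
      by rewrite ler_ln ?posrE ?mulr_gt0; rewrite ?mulrDr; try lra; nra.
    by rewrite lnM ?posrE in h2; lra.
  have qs s : 0 < s -> complex.Re (q x%:C s%:C) = (x - 1) * ((1 + s) * (x + s))^-1.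
    by move=> s0; rewrite qE /=; field; rewrite !gt_eqF //; lra.
  have qp s : 0 < s -> 0 < ((1 + s) * (x + s))^-1.
    by move=> s0; rewrite invr_gt0 mulr_gt0 //; lra.
  have [x1|/ltW x1] := leP 1 x.
    have lx : 0 <= ln x by rewrite -(ln1 R) ler_ln // posrE.
    rewrite min_l // max_r //; apply/andP; split.
      apply: Rintegral_ge0 => r _; rewrite mulr_ge0 // qs // mulr_ge0 //; first lra.
      by rewrite ltW // qp.
    apply: le_trans (ler_norm _) _.
    apply: (@J_gen _ (fun s => ln (1 + s) - ln (x + s))
      (fun s => complex.Re (q x%:C s%:C)) (ln x) _ _ _ _ _).2 => //.
    + move=> s s0; rewrite ger0_norm // qs // mulr_ge0 //; first lra.
      by rewrite ltW // qp.
    + by move=> s s0; rewrite qE /=; apply: is_deriveB; apply: dln.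
    + move=> s t s0 t0; have := lnb s s0 x1; have := lnb t t0 x1; lra.
  have lx : ln x <= 0 by rewrite -(ln1 R) ler_ln // posrE.
  rewrite min_r // max_l //.
  have hJ : `|J (fun s => complex.Re (q x%:C s%:C))| <= - ln x.
    apply: (@J_gen _ (fun s => ln (x + s) - ln (1 + s))
      (fun s => - complex.Re (q x%:C s%:C)) (- ln x) _ _ _ _ _).2 => //.
    + move=> s s0; rewrite ler0_norm // qs // mulr_le0_ge0 //; first lra.
      by rewrite ltW // qp.
    + by move=> s s0; apply: cvgN; exact: cR.
    + by move=> s s0; rewrite qE /= opprB; apply: is_deriveB; apply: dln.
    + move=> s t s0 t0; have := lnb2 s s0 x1; have := lnb2 t t0 x1; lra.
  have J0 : J (fun s => complex.Re (q x%:C s%:C)) <= 0.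
    rewrite -oppr_ge0 -mulN1r /J -RintegralZl //; last exact: (ok_int (q_ok hz)).1.
    apply: Rintegral_ge0 => r _; rewrite mulN1r oppr_ge0; apply: mulr_ge0_le0 => //.
    by rewrite qs //; apply: mulr_le0_ge0; [lra|exact: ltW (qp _ (lam_gt0 r))].
  apply/andP; split; last exact: J0.
  by move: hJ; rewrite ler_norml opprK => /andP[].
Qed.

(** Substituting [s = lam r] gives a density [w / lam'] in [[0, 1]] against
    [1 / (1 + s) - 1 / (x + s)], the exponential representation of complete Bernstein functions. The
    parametrised form avoids inverting [lam]. *)
Lemma cbf_log_stieltjes :
  cbf_log (fun x => \int[mu]_r (w r * ((1 + lam r)^-1 - (x + lam r)^-1))).
Proof.
exists (fun z => JC (q z)), (fun z => JC (q' z)); split; first exact: lim_tame.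
by move=> x x0; apply: eq_Rintegral => r _; rewrite qE.
Qed.

End stieltjes_class.

(** * Contour shifts in a strip *)

Section strip.
Variable R : realType.
Notation mu := (@lebesgue_measure R).
Implicit Types (Phi : R[i] -> R[i]) (r t : R).

Definition strip_holomorphic Phi := forall r t, `|t| < pi / 2 ->
  exists c, cder Phi (r +i* t) c.

Lemma pihalf_gt0 : 0 < pi / 2 :> R.
Proof. by rewrite divr_gt0 // pi_gt0. Qed.

Lemma strip_primitive Phi : strip_holomorphic Phi ->
  exists W, forall r t, `|t| < pi / 2 -> cder W (r +i* t) (Phi (r +i* t)).
Proof.
move=> hPhi.
have [|||||W hW] := @holomorphic_primitive R setT [set t | `|t| < pi / 2] Phi.
- by split => // x _; exists 1.
- split => /= [x y hx hy z /andP[xz zy]|x hx].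
    by rewrite /= !ltr_norml in hx hy *; lra.
  exists (pi / 2 - `|x|); rewrite ?subr_gt0 // => y yx.
  by have := ler_normD x (y - x); rewrite addrC subrK; lra.
- by exists 0.
- by exists 0; rewrite /= normr0 pihalf_gt0.
- by case=> r t _ /= ht; exact: hPhi.
by exists W => r t ht; apply: hW.
Qed.

Lemma sech_small c (e : R) : 0 < c -> 0 < e -> exists N : nat, forall n, (N <= n)%N ->
  sech c n%:R <= e /\ sech c (- n%:R) <= e.
Proof.
move=> c0 e0; exists (Num.bound ((c * e)^-1)) => n Nn.
have -> : sech c (- n%:R) = sech c n%:R by rewrite /sech mulrN opprK addrC.
suff h : sech c n%:R <= e by [].
have h1 : (c * e)^-1 < n%:R.
  apply: lt_le_trans (archi_boundP _) _; first by rewrite invr_ge0 mulr_ge0 // ltW.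
  by rewrite ler_nat.
have h2 : e^-1 <= expR (c * n%:R).
  apply: le_trans (expR_ge1Dx _); apply: ltW.
  have : e^-1 < c * n%:R.
    by rewrite -ltr_pdivrMl // mulrC -invfM mulrC.
  lra.
rewrite /sech -[e]invrK lef_pV2 ?posrE ?invr_gt0 ?addr_gt0 ?expR_gt0 //.
by apply: (le_trans h2); rewrite lerDl expR_ge0.
Qed.

Lemma hline_continuous Phi t : (forall r, exists c, cder Phi (r +i* t) c) ->
  continuous (fun r => complex.Re (Phi (r +i* t))).
Proof. by move=> h r; have [c hc] := h r; exact: is_derive_cont (rder_cder_hline hc).1. Qed.

Lemma hline_measurable Phi t : (forall r, exists c, cder Phi (r +i* t) c) ->
  measurable_fun setT (fun r => complex.Re (Phi (r +i* t))).
Proof. by move=> h; apply: continuous_measurable_fun; exact: hline_continuous. Qed.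

Lemma hline_integrable Phi t c C : (forall r, exists c, cder Phi (r +i* t) c) -> 0 < c ->
  (forall r, nm (Phi (r +i* t)) <= C * sech c r) ->
  rintegrable mu setT (fun r => complex.Re (Phi (r +i* t))).
Proof.
move=> h c0 hC.
have iC : rintegrable mu setT (fun r => C * sech c r).
  by apply: rintegrableZ => //; exact: sech_integrable.
apply: rintegrable_le iC => //; first exact: hline_measurable.
by move=> r _; apply: le_trans (Re_nm _) _.
Qed.

Lemma hline_integral_itv Phi W t (n : nat) : (forall r, cder W (r +i* t) (Phi (r +i* t))) ->
  (forall r, exists c, cder Phi (r +i* t) c) ->
  \int[mu]_(r in centered_itv n) complex.Re (Phi (r +i* t)) =
  complex.Re (W (n%:R +i* t)) - complex.Re (W ((- n%:R) +i* t)).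
Proof.
move=> hW h; apply: (@Rintegral_itv_FTC R (fun r => complex.Re (Phi (r +i* t)))
  (fun r => complex.Re (W (r +i* t)))); first exact: centered_le.
  by move=> r _; exact: (rder_cder_hline (hW r)).1.
by move=> r _; exact: hline_continuous.
Qed.

(** Both integrals are limits of increments of one primitive [W]. They differ by the increments of
    [W] along the vertical sides at [n] and [-n], which the [sech] bound makes negligible. *)
Lemma strip_shift_line Phi c C t : strip_holomorphic Phi -> 0 < c -> `|t| < pi / 2 ->
  (forall r u, Num.min 0 t <= u <= Num.max 0 t -> nm (Phi (r +i* u)) <= C * sech c r) ->
  \int[mu]_r complex.Re (Phi (r +i* t)) = \int[mu]_r complex.Re (Phi (r +i* 0)).
Proof.
move=> hPhi c0 ht hC.
have [W hW] := strip_primitive hPhi.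
have t0 : `|0 : R| < pi / 2 by rewrite normr0 pihalf_gt0.
have i1 : rintegrable mu setT (fun r => complex.Re (Phi (r +i* t))).
  apply: (hline_integrable (fun r => hPhi r t ht) c0) => r.
  by apply: hC; rewrite ge_min le_max !lexx !orbT.
have i2 : rintegrable mu setT (fun r => complex.Re (Phi (r +i* 0))).
  apply: (hline_integrable (fun r => hPhi r 0 t0) c0) => r.
  by apply: hC; rewrite ge_min le_max !lexx.
have l1 := Rintegral_centered_cvg i1; have l2 := Rintegral_centered_cvg i2.
have C0 : 0 <= C.
  have := hC 0 0; rewrite ge_min le_max !lexx /= => /(_ isT) /(le_trans (nm_ge0 _)).
  by rewrite pmulr_lge0 // sech_gt0.
have vert r : nm (W (r +i* t) - W (r +i* 0)) <= C * sech c r * `|t|.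
  have := @rder_affine_le R (fun u => W (r +i* u)) (fun u => Phi (r +i* u) * (0 +i* 1)) 0 0 t
    (C * sech c r).
  rewrite mul0r !subr0; apply => u hu.
    apply: rder_cder_vline; apply: hW.
    move: hu ht; case: (leP 0 t) => t0' /andP[u1 u2].
      by rewrite !ger0_norm //; lra.
    by rewrite !ler0_norm //; lra.
  by rewrite subr0 nmM nm_i normr1 mulr1; exact: hC.
have dif n : `|\int[mu]_(r in centered_itv n) complex.Re (Phi (r +i* t)) -
    \int[mu]_(r in centered_itv n) complex.Re (Phi (r +i* 0))| <=
    C * pi * sech c n%:R.
  rewrite !(hline_integral_itv n (fun r => hW r _ _) (fun r => hPhi r _ _)) //.
  have h1 := le_trans (Re_nm _) (vert n%:R); have h2 := le_trans (Re_nm _) (vert (- n%:R)).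
  rewrite !Re_add !Re_opp in h1 h2.
  have -> : sech c n%:R = sech c (- n%:R) by rewrite /sech mulrN opprK addrC.
  have e1 : sech c (- n%:R) = sech c n%:R by rewrite /sech mulrN opprK addrC.
  rewrite e1 in h2 *; have K : C * sech c n%:R * `|t| <= C * sech c n%:R * (pi / 2).
    by rewrite ler_wpM2l ?(ltW ht) // mulr_ge0 // ltW // sech_gt0.
  move: h1 h2; rewrite !ler_norml; lra.
have l3 : (\int[mu]_(r in centered_itv n) complex.Re (Phi (r +i* t)) -
    \int[mu]_(r in centered_itv n) complex.Re (Phi (r +i* 0))) @[n --> \oo] -->
    \int[mu]_r complex.Re (Phi (r +i* t)) - \int[mu]_r complex.Re (Phi (r +i* 0)).
  exact: cvgB.
have l4 : (\int[mu]_(r in centered_itv n) complex.Re (Phi (r +i* t)) -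
    \int[mu]_(r in centered_itv n) complex.Re (Phi (r +i* 0))) @[n --> \oo] --> (0 : R).
  apply/cvgrPdist_le => e e0.
  have K0 : 0 < C * pi + 1 by rewrite ltr_wpDl // mulr_ge0 // pi_ge0.
  have [N hN] := @sech_small c (e / (C * pi + 1)) c0 (divr_gt0 e0 K0).
  exists N => // n /= /hN [h _]; rewrite sub0r normrN.
  apply: (le_trans (dif n)).
  have s0 := ltW (sech_gt0 c n%:R).
  apply: (@le_trans _ _ ((C * pi + 1) * sech c n%:R)).
    by rewrite ler_wpM2r //; lra.
  by rewrite mulrC -ler_pdivlMr.
apply/eqP; rewrite -subr_eq0; apply/eqP.
by rewrite -(cvg_lim _ l3) // (cvg_lim _ l4).
Qed.

Definition edge (n : nat) : R := pi / 2 * (1 - n.+1%:R^-1).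

Lemma edge_ge0 n : 0 <= edge n.
Proof. by rewrite mulr_ge0 ?(ltW pihalf_gt0) // subr_ge0 invf_le1 ?ler1n ?ltr0n. Qed.

Lemma edge_lt n : edge n < pi / 2.
Proof. by rewrite gtr_pMr ?pihalf_gt0 // ltrBlDr ltrDl invr_gt0 ltr0n. Qed.

Lemma edge_cvg : edge @ \oo --> pi / 2.
Proof.
rewrite -[X in _ --> X]mulr1; apply: cvgM; first exact: cvg_cst.
rewrite -[X in _ --> X]subr0; apply: cvgB; [exact: cvg_cst|exact: cvg_harmonic].
Qed.

Lemma Rdominated_cvg_ae d (T : measurableType d) (nu : {measure set T -> \bar R}) (D : set T)
    (f_ : nat -> T -> R) (f g : T -> R) : measurable D ->
  (forall n, measurable_fun D (f_ n)) -> measurable_fun D f -> rintegrable nu D g ->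
  (forall n x, D x -> `|f_ n x| <= g x) ->
  {ae nu, forall x, D x -> f_ ^~ x @ \oo --> f x} ->
  rintegrable nu D f /\
  \int[nu]_(x in D) f_ n x @[n --> \oo] --> \int[nu]_(x in D) f x.
Proof.
move=> mD mf_ mf hg fg ff.
have [] := @dominated_convergence _ _ _ nu D mD (fun n => EFin \o f_ n) (EFin \o f) (EFin \o g).
- by move=> n; exact/measurable_EFinP.
- exact/measurable_EFinP.
- by apply: filterS ff => x h Dx; apply: cvg_EFin; [exact: nearW|exact: h].
- exact: hg.
- by apply: aeW => x n Dx /=; rewrite lee_fin fg.
move=> hf _ h; split => //; apply: fine_cvg.
by rewrite (_ : (fine _)%:E = (\int[nu]_(x in D) (EFin \o f) x)%E) // fineK // integrable_fin_num.
Qed.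

(** Lines inside the strip approach the edge under a common [sech] majorant, so [Phi] itself need
    not extend to the edge. The sign [s] selects the edge, and the limit may fail at one point [p],
    which leaves room for a removable singularity. *)
Lemma strip_shift_edge Phi (phi : R -> R) (s c C p : R) : strip_holomorphic Phi -> 0 < c ->
  s = 1 \/ s = -1 -> measurable_fun setT phi ->
  (forall r t, 0 <= t < pi / 2 -> nm (Phi (r +i* (s * t))) <= C * sech c r) ->
  (forall r, r != p -> complex.Re (Phi (r +i* (s * edge n))) @[n --> \oo] --> phi r) ->
  rintegrable mu setT phi /\ \int[mu]_r complex.Re (Phi (r +i* 0)) = \int[mu]_r phi r.
Proof.
move=> hPhi c0 hs mphi hC hl.
have ht n : `|s * edge n| < pi / 2.
  case: hs => ->; rewrite ?mul1r ?mulN1r ?normrN ger0_norm ?edge_ge0 //; exact: edge_lt.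
have hb n r : nm (Phi (r +i* (s * edge n))) <= C * sech c r.
  by apply: hC; rewrite edge_ge0 edge_lt.
have [||||iphi hcv] := @Rdominated_cvg_ae _ _ mu setT
  (fun n r => complex.Re (Phi (r +i* (s * edge n)))) phi (fun r => C * sech c r) measurableT _ mphi.
- by move=> n; apply: hline_measurable => r; exact: hPhi.
- by apply: rintegrableZ => //; exact: sech_integrable.
- by move=> n r _; apply: le_trans (Re_nm _) _.
- exists [set p]; split => //; first exact: lebesgue_measure_set1.
  move=> r /=; apply: contra_notP => /eqP rp _; exact: hl.
split => //; rewrite -(cvg_lim _ hcv) //; apply/esym/cvg_lim => //.
apply: cvg_near_cst; apply: nearW => n; apply: (@strip_shift_line Phi c C) => // r u hu.
have -> : u = s * (s * u) by case: hs => ->; rewrite ?mul1r // !mulN1r opprK.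
apply: hC; have := edge_lt n; have := edge_ge0 n; move: hu.
case: hs => ->; rewrite ?mul1r ?mulN1r => + e0.
  by rewrite min_l ?max_r // => /andP[u1 u2] e1; apply/andP; split; lra.
by rewrite min_r ?max_l ?oppr_le0 // => /andP[u1 u2] e1; apply/andP; split; lra.
Qed.

Lemma edge_limit Phi r s : s = 1 \/ s = -1 ->
  (exists c, cder Phi (r +i* (s * (pi / 2))) c) ->
  complex.Re (Phi (r +i* (s * edge n))) @[n --> \oo] --> complex.Re (Phi (r +i* (s * (pi / 2)))).
Proof.
move=> hs [c hc].
have h : {for s * (pi / 2), continuous (fun t => complex.Re (Phi (r +i* t)))}.
  exact: is_derive_cont (rder_cder_vline hc).1.
apply: (continuous_cvg _ h); apply: cvgM; [exact: cvg_cst|exact: edge_cvg].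
Qed.

End strip.

(** * The Fourier kernel *)

Section kernel.
Variable R : realType.
Notation mu := (@lebesgue_measure R).
Implicit Types (z v : R[i]) (x r t : R).
Let ii : R[i] := 0 +i* 1.

Lemma Re_cexp r t : complex.Re (cexp (r +i* t)) = expR r * cos t.
Proof. by []. Qed.

Lemma Im_cexp r t : complex.Im (cexp (r +i* t)) = expR r * sin t.
Proof. by []. Qed.

Lemma nm_cexp_line r t : nm (cexp (r +i* t)) = expR r.
Proof. exact: nm_cexp. Qed.

Lemma strip_cos_gt0 t : `|t| < pi / 2 -> 0 < cos t.
Proof. by rewrite ltr_norml => h; exact: cos_gt0_pihalf. Qed.

Lemma strip_Re_gt0 r t : `|t| < pi / 2 -> 0 < complex.Re (cexp (r +i* t)).
Proof. by move=> ht; rewrite Re_cexp mulr_gt0 ?expR_gt0 // strip_cos_gt0. Qed.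

Lemma lower_Im_le0 r t : 0 <= t <= pi / 2 -> complex.Im (cexp (r +i* (-1 * t))) <= 0.
Proof.
move=> /andP[t0 t1]; rewrite Im_cexp mulN1r sinN mulrN oppr_le0 mulr_ge0 ?expR_ge0 //.
by apply: sin_ge0_pi; rewrite t0 /=; have := pi_gt0 R; lra.
Qed.

Lemma upper_Im_ge0 r t : 0 <= t <= pi / 2 -> 0 <= complex.Im (cexp (r +i* (1 * t))).
Proof.
move=> /andP[t0 t1]; rewrite Im_cexp mul1r mulr_ge0 ?expR_ge0 //.
by apply: sin_ge0_pi; rewrite t0 /=; have := pi_gt0 R; lra.
Qed.

Lemma Re_shift x z : complex.Re (x%:C + ii * z) = x - complex.Im z.
Proof. by rewrite !ReImE /=; ring. Qed.

Lemma Im_shift x z : complex.Im (x%:C + ii * z) = complex.Re z.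
Proof. by rewrite !ReImE /=; ring. Qed.

Lemma nm_shift_sq x z : nm (x%:C + ii * z) ^+ 2 = x ^+ 2 + nm z ^+ 2 - 2 * x * complex.Im z.
Proof. by rewrite nm_sq Re_shift Im_shift nm_sq; ring. Qed.

Lemma shift_neq0 x z : 0 < complex.Re z -> x%:C + ii * z != 0.
Proof.
move=> z0; apply/negP => /eqP e; have := Im_shift x z; rewrite e /= => h.
by move: z0; rewrite -h ltxx.
Qed.

(** [|x + i z|^2 = x^2 + |z|^2 - 2 x Im z], and the last term only helps in the lower half-plane.
    This keeps [kerK] bounded down to the lower edge. *)
Lemma shift_low x z : 0 < x -> complex.Im z <= 0 ->
  Num.min x 1 ^+ 2 * (1 + nm z ^+ 2) <= nm (x%:C + ii * z) ^+ 2.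
Proof.
move=> x0 z0; rewrite nm_shift_sq.
have m0 : 0 < Num.min x 1 by rewrite lt_min x0 ltr01.
have mx : Num.min x 1 <= x by rewrite ge_min lexx.
have m1 : Num.min x 1 <= 1 by rewrite ge_min lexx orbT.
set m := Num.min x 1 in m0 mx m1 *.
have h1 : m ^+ 2 <= x ^+ 2 by rewrite ler_sqr ?nnegrE ?(ltW m0) ?(ltW x0).
have h2 : m ^+ 2 * nm z ^+ 2 <= nm z ^+ 2.
  by rewrite ler_piMl ?sqr_ge0 // expr_le1 // ltW.
have h3 : 0 <= x * - complex.Im z by rewrite mulr_ge0 ?oppr_ge0 // ltW.
by rewrite mulrDr mulr1; lra.
Qed.

Lemma shift_low_neq0 x z : 0 < x -> complex.Im z <= 0 -> x%:C + ii * z != 0.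
Proof.
move=> x0 z0; rewrite -nm_gt0 -(@ltr_pXn2r _ 2) ?nnegrE ?nm_ge0 // expr0n /=.
apply: lt_le_trans (shift_low x0 z0).
apply: mulr_gt0; first by rewrite exprn_gt0 // lt_min x0 ltr01.
by rewrite ltr_pwDl // sqr_ge0.
Qed.

Lemma sech1E r : sech 1 r = expR r / (1 + expR r ^+ 2).
Proof.
rewrite /sech mul1r expRN; have e0 := expR_gt0 r.
by field; rewrite !gt_eqF // ltr_wpDl // sqr_ge0.
Qed.

(** In [z = e^v] this is the difference of the Fourier transforms [1 / (x1 + i z)] and
    [1 / (x2 + i z)] of two exponentials, with [dz = z dv] absorbed. The difference decays like
    [e^(-|r|)] at both ends; a single term does not decay at plus infinity. *)
Definition kerK (x1 x2 : R) v : R[i] :=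
  cexp v / (x1%:C + ii * cexp v) - cexp v / (x2%:C + ii * cexp v).

Lemma kerKE (x1 x2 : R) v : x1%:C + ii * cexp v != 0 -> x2%:C + ii * cexp v != 0 ->
  kerK x1 x2 v = (x2 - x1)%:C * cexp v / ((x1%:C + ii * cexp v) * (x2%:C + ii * cexp v)).
Proof. by move=> h1 h2; rewrite /kerK rmorphB /=; field; rewrite h1 h2. Qed.

Definition kerKC (x1 x2 : R) := `|x2 - x1| / (Num.min x1 1 * Num.min x2 1).

Lemma kerK_bound (x1 x2 : R) r t : 0 < x1 -> 0 < x2 ->
  complex.Im (cexp (r +i* t)) <= 0 ->
  nm (kerK x1 x2 (r +i* t)) <= kerKC x1 x2 * sech 1 r.
Proof.
move=> x10 x20 hz; set z := cexp (r +i* t) in hz.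
have n1 := shift_low_neq0 x10 hz; have n2 := shift_low_neq0 x20 hz.
rewrite (kerKE n1 n2) -/z !nmM nmV nmM nm_real nm_cexp_line sech1E /kerKC.
have m1 : 0 < Num.min x1 1 by rewrite lt_min x10 ltr01.
have m2 : 0 < Num.min x2 1 by rewrite lt_min x20 ltr01.
have e1 : 0 < 1 + expR r ^+ 2 by rewrite ltr_pwDl // sqr_ge0.
have -> : `|x2 - x1| / (Num.min x1 1 * Num.min x2 1) * (expR r / (1 + expR r ^+ 2)) =
  `|x2 - x1| * expR r * ((Num.min x1 1 * Num.min x2 1) * (1 + expR r ^+ 2))^-1.
  by field; rewrite !gt_eqF.
rewrite ler_wpM2l ?mulr_ge0 ?expR_ge0 //.
rewrite lef_pV2 ?posrE ?mulr_gt0 ?nm_gt0 //.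
rewrite -(@ler_pXn2r _ 2) ?nnegrE ?mulr_ge0 ?nm_ge0 ?(ltW m1) ?(ltW m2) ?(ltW e1) //.
have h1 := shift_low x10 hz; have h2 := shift_low x20 hz.
rewrite !nm_cexp_line in h1 h2.
rewrite !exprMn.
have -> : Num.min x1 1 ^+ 2 * Num.min x2 1 ^+ 2 * (1 + expR r ^+ 2) ^+ 2 =
  (Num.min x1 1 ^+ 2 * (1 + expR r ^+ 2)) * (Num.min x2 1 ^+ 2 * (1 + expR r ^+ 2)) by ring.
by apply: ler_pM => //; rewrite mulr_ge0 ?sqr_ge0 // ltW.
Qed.

Lemma cder_shift x v : cder (fun v => x%:C + ii * cexp v) v (ii * cexp v).
Proof.
apply: cder_eq (cderD (cder_cst x%:C v) (cderM (cder_cst ii v) (cder_cexp v))) _.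
by rewrite mulr0 addr0 add0r.
Qed.

Lemma cder_kerK (x1 x2 : R) v : x1%:C + ii * cexp v != 0 -> x2%:C + ii * cexp v != 0 ->
  exists c, cder (kerK x1 x2) v c.
Proof.
move=> h1 h2; eexists; apply: cderB; apply: cderM; try exact: cder_cexp.
  exact: (@cderV R (fun v => x1%:C + ii * cexp v) v _ h1 (cder_shift _ _)).
exact: (@cderV R (fun v => x2%:C + ii * cexp v) v _ h2 (cder_shift _ _)).
Qed.

Lemma kerK_strip (x1 x2 : R) : strip_holomorphic (kerK x1 x2).
Proof. by move=> r t ht; apply: cder_kerK; apply: shift_neq0; exact: strip_Re_gt0. Qed.

Lemma cexp_lower r : cexp (r +i* (-1 * (pi / 2))) = 0 +i* (- expR r) :> R[i].
Proof. by rewrite /cexp /= mulN1r cosN sinN cos_pihalf sin_pihalf mulr0 mulrN1. Qed.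

Lemma cexp_upper r : cexp (r +i* (1 * (pi / 2))) = 0 +i* expR r :> R[i].
Proof. by rewrite /cexp /= mul1r cos_pihalf sin_pihalf mulr0 mulr1. Qed.

Lemma kerK_lower (x1 x2 : R) r : kerK x1 x2 (r +i* (-1 * (pi / 2))) =
  0 +i* (- (expR r * ((x1 + expR r)^-1 - (x2 + expR r)^-1))).
Proof.
rewrite /kerK cexp_lower.
have h x : x%:C + ii * (0 +i* (- expR r)) = (x + expR r)%:C.
  by apply: complex_ext; rewrite !ReImE /=; ring.
rewrite !h -!(fmorphV (real_complex R)).
by apply: complex_ext; rewrite !ReImE /=; ring.
Qed.

Lemma lower_shift_neq0 x r t : 0 < x -> 0 <= t <= pi / 2 ->
  x%:C + ii * cexp (r +i* (-1 * t)) != 0.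
Proof. by move=> x0 ht; apply: shift_low_neq0 => //; exact: lower_Im_le0. Qed.

(** On the lower edge [kerK] is purely imaginary, so the real part of the product retains only
    [Im g]. *)
Lemma kerK_shift_lower (x1 x2 C : R) (g : R[i] -> R[i]) : 0 < x1 -> 0 < x2 ->
  strip_holomorphic g ->
  (forall r, exists c, cder g (r +i* (-1 * (pi / 2))) c) ->
  (forall r t, 0 <= t < pi / 2 -> nm (g (r +i* (-1 * t))) <= C) ->
  let phi r := expR r * ((x1 + expR r)^-1 - (x2 + expR r)^-1) *
    complex.Im (g (r +i* (-1 * (pi / 2)))) in
  rintegrable mu setT phi /\
  \int[mu]_r complex.Re (kerK x1 x2 (r +i* 0) * g (r +i* 0)) = \int[mu]_r phi r.
Proof.
move=> x10 x20 hg eg hC phi.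
have pe : 0 <= (pi / 2 : R) <= pi / 2 by rewrite lexx andbT ltW // pihalf_gt0.
have edg r : exists c, cder (fun v => kerK x1 x2 v * g v) (r +i* (-1 * (pi / 2))) c.
  have [a ha] : exists c, cder (kerK x1 x2) (r +i* (-1 * (pi / 2))) c.
    by apply: cder_kerK; apply: lower_shift_neq0.
  by have [b hb] := eg r; eexists; exact: cderM ha hb.
have phiE r : complex.Re (kerK x1 x2 (r +i* (-1 * (pi / 2))) * g (r +i* (-1 * (pi / 2)))) = phi r.
  by rewrite kerK_lower Re_mul /phi [complex.Re (0 +i* _)]/= [complex.Im (0 +i* _)]/=; ring.
have C0 : 0 <= C.
  by apply: le_trans (hC 0 0 _); rewrite ?nm_ge0 // lexx pihalf_gt0.
apply: (@strip_shift_edge R (fun v => kerK x1 x2 v * g v) phi (-1) 1 (kerKC x1 x2 * C) 0) => //.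
- move=> r t ht; have [a ha] := kerK_strip x1 x2 r ht; have [b hb] := hg r t ht.
  by eexists; exact: cderM ha hb.
- by right.
- have := @hline_measurable R (fun v => kerK x1 x2 v * g v) (-1 * (pi / 2)) edg.
  by congr (measurable_fun _ _); apply/funext => r; exact: phiE.
- move=> r t ht; rewrite nmM mulrAC; apply: ler_pM; rewrite ?nm_ge0 //; last exact: hC.
  by apply: kerK_bound => //; apply: lower_Im_le0; case/andP: ht => -> /ltW ->.
- by move=> r _; rewrite -phiE; apply: edge_limit (edg r); right.
Qed.

Lemma nm_cexp_le1 (x : R) z : 0 <= x * complex.Im z -> nm (cexp (x%:C * (ii * z))) <= 1.
Proof. by move=> h; rewrite nm_cexp expR_le1 !ReImE /=; lra. Qed.

Lemma cder_osc (x : R) v : cder (fun v => cexp (x%:C * (ii * cexp v))) v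
  (cexp (x%:C * (ii * cexp v)) * (x%:C * (ii * cexp v))).
Proof.
have h := cderM (cder_cst x%:C v) (cderM (cder_cst ii v) (cder_cexp v)).
by apply: cder_eq (cder_comp (cder_cexp _) h) _; ring.
Qed.

(** For [x <= 0] the oscillating factor is bounded by 1 in the lower half-plane and real on the
    lower edge, so the shifted integrand vanishes identically. *)
Lemma kerK_fourier_neg (x1 x2 x : R) : 0 < x1 -> 0 < x2 -> x <= 0 ->
  \int[mu]_r complex.Re (kerK x1 x2 (r +i* 0) * cexp (x%:C * (ii * cexp (r +i* 0)))) = 0.
Proof.
move=> x10 x20 x0.
have [|||_ ->] := @kerK_shift_lower x1 x2 1 (fun v => cexp (x%:C * (ii * cexp v))) x10 x20.
- by move=> r t ht; eexists; exact: cder_osc.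
- by move=> r; eexists; exact: cder_osc.
- move=> r t /andP[t0 t1]; apply: nm_cexp_le1; rewrite mulr_le0 //.
  by apply: lower_Im_le0; rewrite t0 ltW.
transitivity (\int[mu]_r (0 : R)); last by rewrite Rintegral_cst // mul0r.
apply: eq_Rintegral => r _; rewrite cexp_lower.
have -> : x%:C * (ii * (0 +i* - expR r)) = (x * expR r)%:C.
  by apply: complex_ext; rewrite !ReImE /=; ring.
by rewrite cexp_real /= mulr0.
Qed.

(** The Poisson kernel [x / (x^2 + y^2) dy] in the variable [y = e^r]; it is also the real part of
    [e^r / (x + i e^r)]. *)
Definition poisson (x : R) r := x * expR r / (x ^+ 2 + expR r ^+ 2).

Lemma poisson_den_gt0 x r : 0 < x -> 0 < x ^+ 2 + expR r ^+ 2.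
Proof. by move=> x0; rewrite addr_gt0 // exprn_gt0 // expR_gt0. Qed.

Lemma expR_line r : cexp (r +i* 0) = (expR r)%:C :> R[i].
Proof. exact: cexp_real. Qed.

Lemma Re_kerK_line (x1 x2 : R) r : 0 < x1 -> 0 < x2 ->
  complex.Re (kerK x1 x2 (r +i* 0)) = poisson x1 r - poisson x2 r.
Proof.
move=> x10 x20; rewrite /kerK expR_line.
have h x : 0 < x -> complex.Re ((expR r)%:C / (x%:C + ii * (expR r)%:C)) = poisson x r.
  move=> x0; have p := poisson_den_gt0 r x0.
  have e : nm (x%:C + ii * (expR r)%:C) ^+ 2 = x ^+ 2 + expR r ^+ 2.
    by rewrite nm_sq !ReImE /=; ring.
  rewrite Re_mul Re_inv Im_inv e !ReImE /= /poisson.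
  by field; rewrite gt_eqF.
by rewrite Re_add Re_opp !h.
Qed.

Lemma continuous_poisson x : 0 < x -> continuous (poisson x).
Proof.
move=> x0 r; apply: cvgM.
  by apply: cvgM; [exact: cvg_cst|exact: continuous_expR].
apply: cvgV; first by rewrite gt_eqF // poisson_den_gt0.
apply: cvgD; first exact: cvg_cst.
by under eq_fun do rewrite expr2; rewrite expr2; apply: cvgM; exact: continuous_expR.
Qed.

Lemma poisson_ge0 x r : 0 < x -> 0 <= poisson x r.
Proof.
move=> x0; rewrite divr_ge0 ?mulr_ge0 ?expR_ge0 // ltW //; exact: poisson_den_gt0.
Qed.

Lemma is_derive_poisson x r : 0 < x -> is_derive r 1 (fun r => atan (expR r / x)) (poisson x r).
Proof.
move=> x0; have h : is_derive r 1 (fun r : R => expR r / x) (expR r / x).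
  apply: is_derive_eq1 (is_deriveM1 (is_derive_expR r) (is_derive_cst x^-1 r (1 : R))) _.
  by rewrite mulr0 add0r mulrC.
apply: is_derive_eq1 (@is_derive_comp1 R (@atan R) (fun r : R => expR r / x) r _ _
  (is_derive1_atan _) h) _.
have p := poisson_den_gt0 r x0; rewrite /poisson.
have -> : 1 + (expR r / x) ^+ 2 = (x ^+ 2 + expR r ^+ 2) / x ^+ 2 by field; rewrite gt_eqF.
by field; rewrite !gt_eqF.
Qed.

Lemma poisson_integrable x : 0 < x -> rintegrable mu setT (poisson x).
Proof.
move=> x0; have [|r||r s|] := @Rintegral_ge0_FTC R (poisson x) (fun r => atan (expR r / x)) pi.
- exact: continuous_poisson.
- exact: poisson_ge0.
- by move=> r; exact: is_derive_poisson.
- by have := atan_ltpi2 (expR r / x); have := atan_gtNpi2 (expR s / x); lra.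
- by [].
Qed.

Lemma expR_nat_cvg : (expR n%:R)^-1 @[n --> \oo] --> (0 : R).
Proof.
apply/cvgrPdist_le => e e0; exists (Num.bound e^-1) => // n /= Nn.
rewrite sub0r normrN ger0_norm ?invr_ge0 ?expR_ge0 //.
rewrite -[e]invrK lef_pV2 ?posrE ?invr_gt0 ?expR_gt0 //.
have h : e^-1 < n%:R.
  by apply: lt_le_trans (archi_boundP _) _; rewrite ?invr_ge0 ?(ltW e0) // ler_nat.
by apply: (le_trans (ltW h)); apply: le_trans (expR_ge1Dx _); rewrite lerDr.
Qed.

Lemma poisson_integral x : 0 < x -> \int[mu]_r poisson x r = pi / 2.
Proof.
move=> x0; apply: (@Rintegral_FTC R (poisson x) (fun r => atan (expR r / x))).
- exact: poisson_integrable.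
- exact: continuous_poisson.
- by move=> r; exact: is_derive_poisson.
have ainv y : 0 < y -> atan y = pi / 2 - atan y^-1 :> R.
  move=> y0; have ya : 0 < atan y by rewrite -[X in X < _](atan0 R) lt_atan.
  have yb := atan_ltpi2 y.
  have c1 : cos (pi / 2 - atan y) = sin (atan y) by rewrite cosB cos_pihalf sin_pihalf mul0r mul1r add0r.
  have s1 : sin (pi / 2 - atan y) = cos (atan y) by rewrite sinB cos_pihalf sin_pihalf mul0r mul1r subr0.
  have -> : y^-1 = tan (pi / 2 - atan y).
    have : tan (atan y) = y by exact: atanK.
    by rewrite /tan c1 s1 => h; rewrite -{1}h invf_div.
  have hin : pi / 2 - atan y \in `](- (pi / 2)), (pi / 2 : R)[.
    by rewrite in_itv /=; apply/andP; split; lra.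
  by rewrite (tanK hin); lra.
have cv k : 0 < k -> atan ((expR n%:R)^-1 * k) @[n --> \oo] --> (0 : R).
  move=> k0; rewrite -[X in _ --> X](atan0 R).
  apply: (continuous_cvg _ (@continuous_atan R 0)).
  by rewrite -(mul0r k); apply: cvgM; [exact: expR_nat_cvg|exact: cvg_cst].
have -> : (fun n => atan (expR n%:R / x) - atan (expR (- n%:R) / x)) =
  (fun n => (pi / 2 - atan ((expR n%:R)^-1 * x)) - atan ((expR n%:R)^-1 * x^-1)).
  apply/funext => n; rewrite (ainv (expR n%:R / x)) ?divr_gt0 ?expR_gt0 //.
  by rewrite invf_div expRN (mulrC x).
rewrite -[X in _ --> X]subr0 -[X in _ --> X - _]subr0.
apply: cvgB; last by apply: cv; rewrite invr_gt0.
by apply: cvgB; [exact: cvg_cst|exact: cv].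
Qed.

Lemma cexp_lipschitz (w1 w2 : R[i]) : complex.Re w1 <= 0 -> complex.Re w2 <= 0 ->
  nm (cexp w2 - cexp w1) <= nm (w2 - w1).
Proof.
move=> h1 h2; rewrite -[leRHS]mul1r; apply: (@cder_segment_le R (@cexp R) (@cexp R)).
  by move=> s _; exact: cder_cexp.
move=> s /andP[s0 s1]; rewrite nm_cexp expR_le1 !ReImE /= mul0r subr0.
have -> : complex.Re w1 + s * (complex.Re w2 - complex.Re w1) =
  (1 - s) * complex.Re w1 + s * complex.Re w2 by ring.
have : 0 <= (1 - s) * - complex.Re w1 by rewrite mulr_ge0 //; lra.
have : 0 <= s * - complex.Re w2 by rewrite mulr_ge0 //; lra.
lra.
Qed.

(** The cosine transform of the Poisson kernel, by a shift to the upper edge. Subtracting the value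
    [e^(-xi x)] at the pole [e^v = i xi] makes the singularity removable, and the real part on the
    edge is then zero; the subtracted constant contributes [e^(-xi x) pi / 2]. *)
Lemma poisson_fourier (xi x : R) : 0 < xi -> 0 <= x ->
  rintegrable mu setT (fun r => cos (x * expR r) * poisson xi r) /\
  \int[mu]_r (cos (x * expR r) * poisson xi r) = expR (- (xi * x)) * (pi / 2).
Proof.
move=> xi0 x0.
pose Phi v := (cexp (x%:C * (ii * cexp v)) - (expR (- (xi * x)))%:C) *
  (xi%:C * cexp v) / ((xi%:C + ii * cexp v) * (xi%:C + ii * (- cexp v))).
have dPhi v : xi%:C + ii * cexp v != 0 -> xi%:C + ii * (- cexp v) != 0 ->
    exists c, cder Phi v c.
  move=> n1 n2.
  have d2 : cder (fun v => xi%:C + ii * - cexp v) v (- (ii * cexp v)).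
    apply: cder_eq (cderD (cder_cst xi%:C v) (cderM (cder_cst ii v) (cderN (cder_cexp v)))) _.
    by rewrite mulr0 addr0 add0r mulrN.
  have d3 := cderM (cder_shift xi v) d2.
  have n3 : (xi%:C + ii * cexp v) * (xi%:C + ii * - cexp v) != 0 by rewrite mulf_neq0.
  have d4 := @cderV R (fun v => (xi%:C + ii * cexp v) * (xi%:C + ii * - cexp v)) v _ n3 d3.
  have d5 := cderM (cderB (cder_osc x v) (cder_cst (expR (- (xi * x)))%:C v))
    (cderM (cder_cst xi%:C v) (cder_cexp v)).
  by eexists; exact: cderM d5 d4.
have hPhi : strip_holomorphic Phi.
  move=> r t ht; have z0 := strip_Re_gt0 r ht; apply: dPhi; first exact: shift_neq0.
  apply/negP => /eqP e; have := Im_shift xi (- cexp (r +i* t)); rewrite e Re_opp /= => h.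
  by move: z0; rewrite /= in h *; lra.
pose m := Num.min xi 1.
have m0 : 0 < m by rewrite lt_min xi0 ltr01.
pose C := (x * (1 + xi) + 2) * xi / m.
have C0 : 0 <= C by rewrite !mulr_ge0 ?invr_ge0 ?(ltW m0) ?(ltW xi0) // addr_ge0 // mulr_ge0 //; lra.
have bPhi r t : 0 <= t < pi / 2 -> nm (Phi (r +i* (1 * t))) <= C * sech 1 r.
  move=> /andP[t0 t1]; have iz := @upper_Im_ge0 r t; rewrite t0 (ltW t1) in iz.
  have {}iz := iz isT.
  have rz : 0 < complex.Re (cexp (r +i* (1 * t))).
    by apply: strip_Re_gt0; rewrite mul1r ger0_norm.
  set z := cexp _ in iz rz; rewrite /Phi -/z !nmM nmV nmM nm_real.
  have nz : nm z = expR r by rewrite nm_cexp_line.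
  clearbody z.
  set N := nm (_ - _); set A := nm (xi%:C + ii * z); set B := nm (xi%:C + ii * - z).
  have A0 : 0 < A by rewrite nm_gt0 shift_neq0.
  have iNz : complex.Im (- z) <= 0 by rewrite Im_opp oppr_le0.
  have B0 : 0 < B by rewrite nm_gt0 shift_low_neq0.
  have hB : m ^+ 2 * (1 + expR r ^+ 2) <= B ^+ 2.
    by have := shift_low xi0 iNz; rewrite nmN nz.
  have re1 : complex.Re (x%:C * (ii * z)) <= 0.
    have h : 0 <= x * complex.Im z by rewrite mulr_ge0.
    by rewrite !ReImE /=; lra.
  have re2 : complex.Re (- (xi * x)%:C) <= 0.
    by rewrite /= oppr_le0 mulr_ge0 // ltW.
  have E2 : (expR (- (xi * x)))%:C = cexp (- (xi * x)%:C) :> R[i].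
    by rewrite -rmorphN cexp_real.
  (* Two bounds for the numerator: [N <= 2] serves for large [e^r], and [N <= x * A] cancels the
     factor [A] that vanishes at the pole. *)
  have N2 : N <= 2.
    apply: (le_trans (nmDB _ _)); rewrite E2 !nm_cexp.
    have : expR (complex.Re (x%:C * (ii * z))) <= 1 by rewrite expR_le1.
    have : expR (complex.Re (- (xi * x)%:C)) <= 1 by rewrite expR_le1.
    lra.
  have NA : N <= x * A.
    rewrite /N E2; apply: (le_trans (cexp_lipschitz re2 re1)).
    have -> : x%:C * (ii * z) - - (xi * x)%:C = x%:C * (xi%:C + ii * z) by rewrite rmorphM /=; ring.
    by rewrite nmM nm_real ger0_norm.
  have zA : expR r <= A + xi.
    have -> : expR r = nm (ii * z) by rewrite nmM nm_i normr1 mul1r nz.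
    have -> : ii * z = (xi%:C + ii * z) - xi%:C by ring.
    by apply: (le_trans (nmDB _ _)); rewrite nm_real gtr0_norm.
  have N0 : 0 <= N by exact: nm_ge0.
  have er := expR_gt0 r.
  have er1 : 0 < 1 + expR r by lra.
  have h1 : N * (1 + expR r) <= (x * (1 + xi) + 2) * A.
    have h2 : N * (1 + expR r) <= N * (1 + xi) + N * A.
      by rewrite -mulrDr ler_wpM2l //; lra.
    have h3 : N * (1 + xi) <= x * A * (1 + xi) by rewrite ler_wpM2r //; lra.
    have h4 : N * A <= 2 * A by rewrite ler_wpM2r // ltW.
    by apply: (le_trans h2); rewrite mulrDl; nra.
  have e2 : 0 < 1 + expR r ^+ 2 by rewrite ltr_pwDl // sqr_ge0.
  have h2 : m * (1 + expR r ^+ 2) <= (1 + expR r) * B.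
    rewrite -(@ler_pXn2r _ 2) ?nnegrE ?mulr_ge0 ?(ltW m0) ?(ltW B0) ?(ltW e2) ?(ltW er1) //.
    rewrite !exprMn.
    have -> : m ^+ 2 * (1 + expR r ^+ 2) ^+ 2 = (1 + expR r ^+ 2) * (m ^+ 2 * (1 + expR r ^+ 2)) by ring.
    apply: ler_pM; rewrite ?mulr_ge0 ?sqr_ge0 ?(ltW m0) ?(ltW e2) //.
    by nra.
  rewrite gtr0_norm // nz sech1E /C.
  have -> : N * (xi * expR r) / (A * B) = (N * (1 + expR r)) * (xi * expR r) /
    (A * ((1 + expR r) * B)).
    by field; rewrite !gt_eqF.
  have -> : (x * (1 + xi) + 2) * xi / m * (expR r / (1 + expR r ^+ 2)) =
    ((x * (1 + xi) + 2) * A) * (xi * expR r) / (A * (m * (1 + expR r ^+ 2))).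
    by field; rewrite !gt_eqF.
  apply: ler_pM; rewrite ?invr_ge0 ?mulr_ge0 ?(ltW er) ?(ltW xi0) ?(ltW A0) ?(ltW B0) ?(ltW er1) //.
    by apply: ler_pM => //; rewrite mulr_ge0 ?(ltW er) ?(ltW xi0) ?(ltW er1).
  rewrite lef_pV2 ?posrE ?mulr_gt0 //.
  by rewrite ler_wpM2l // ltW.
have eE r : complex.Re (Phi (r +i* (1 * (pi / 2)))) = 0.
  rewrite /Phi cexp_upper.
  have -> : x%:C * (ii * (0 +i* expR r)) = (- (x * expR r))%:C.
    by apply: complex_ext; rewrite !ReImE /=; ring.
  have -> : xi%:C + ii * (0 +i* expR r) = (xi - expR r)%:C.
    by apply: complex_ext; rewrite !ReImE /=; ring.
  have -> : xi%:C + ii * - (0 +i* expR r) = (xi + expR r)%:C.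
    by apply: complex_ext; rewrite !ReImE /=; ring.
  rewrite cexp_real -rmorphM -(fmorphV (real_complex R)) -rmorphB /=.
  by rewrite !mulr0 !mul0r; ring.
have [||||_] := @strip_shift_edge R Phi (fun=> 0) 1 1 C (ln xi) hPhi ltr01.
- by left.
- exact: measurable_cst.
- exact: bPhi.
(* The edge passes through the pole only at [r = ln xi]; at all other points [Phi] is
   differentiable. *)
- move=> r rx; rewrite -(eE r); apply: edge_limit; first by left.
  apply: dPhi; rewrite cexp_upper.
    have -> : xi%:C + ii * (0 +i* expR r) = (xi - expR r)%:C.
      by apply: complex_ext; rewrite !ReImE /=; ring.
    rewrite eq_complex /= eqxx andbT subr_eq0; apply: contra rx => /eqP ->.
    by rewrite expRK.
  have -> : xi%:C + ii * - (0 +i* expR r) = (xi + expR r)%:C.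
    by apply: complex_ext; rewrite !ReImE /=; ring.
  by rewrite eq_complex /= eqxx andbT gt_eqF // addr_gt0 // expR_gt0.
have PhiE r : complex.Re (Phi (r +i* 0)) =
    cos (x * expR r) * poisson xi r + (- expR (- (xi * x))) * poisson xi r.
  rewrite /Phi expR_line.
  have -> : (xi%:C + ii * (expR r)%:C) * (xi%:C + ii * - (expR r)%:C) = (xi ^+ 2 + expR r ^+ 2)%:C.
    by apply: complex_ext; rewrite !ReImE /=; ring.
  have -> : x%:C * (ii * (expR r)%:C) = 0 +i* (x * expR r).
    by apply: complex_ext; rewrite !ReImE /=; ring.
  rewrite -(fmorphV (real_complex R)) /cexp /= expR0 !mul1r /= /poisson; ring.
under eq_Rintegral do rewrite PhiE.
rewrite (Rintegral_cst _ measurableT) mul0r => e.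
have ip := poisson_integrable xi0.
have ic : rintegrable mu setT (fun r => cos (x * expR r) * poisson xi r).
  apply: rintegrable_le ip => //.
    apply: continuous_measurable_fun => r; apply: cvgM; last exact: continuous_poisson.
    have h : (fun r : R => x * expR r) @ r --> x * expR r.
      by apply: cvgM; [exact: cvg_cst|exact: continuous_expR].
    exact: (continuous_cvg _ (@continuous_cos R _) h).
  move=> r _; rewrite normrM [X in _ * X]ger0_norm ?poisson_ge0 // ler_piMl ?poisson_ge0 //.
  by rewrite ler_norml cos_geN1 cos_le1.
split=> //.
have := Rintegral_lin measurableT 1 (- expR (- (xi * x))) ic ip.
rewrite mul1r poisson_integral //.
under eq_Rintegral do rewrite mul1r.
by rewrite e mulNr => /eqP; rewrite eq_sym subr_eq0 => /eqP.
Qed.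

Definition half_line_exp (x1 x2 x : R) : R :=
  if 0 < x then expR (- (x1 * x)) - expR (- (x2 * x)) else 0.

Lemma Re_osc (x : R) (w : R[i]) r : complex.Re (w * cexp (x%:C * (ii * cexp (r +i* 0)))) =
  complex.Re w * cos (x * expR r) - complex.Im w * sin (x * expR r).
Proof.
rewrite expR_line.
have -> : x%:C * (ii * (expR r)%:C) = 0 +i* (x * expR r).
  by apply: complex_ext; rewrite !ReImE /=; ring.
by rewrite Re_mul /cexp /= expR0 !mul1r.
Qed.

Lemma kerK_line_bound (x1 x2 : R) r : 0 < x1 -> 0 < x2 ->
  nm (kerK x1 x2 (r +i* 0)) <= kerKC x1 x2 * sech 1 r.
Proof. by move=> x10 x20; apply: kerK_bound; rewrite // expR_line. Qed.

Lemma kerK_osc_integrable (x1 x2 x : R) : 0 < x1 -> 0 < x2 ->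
  rintegrable mu setT (fun r => complex.Re (kerK x1 x2 (r +i* 0) * cexp (x%:C * (ii * cexp (r +i* 0))))).
Proof.
move=> x10 x20.
apply: (@hline_integrable R (fun v => kerK x1 x2 v * cexp (x%:C * (ii * cexp v))) 0 1 (kerKC x1 x2)) => //.
  have t0 : `|0 : R| < pi / 2 by rewrite normr0 pihalf_gt0.
  move=> r; have [a ha] := kerK_strip x1 x2 r t0.
  by eexists; exact: cderM ha (cder_osc x _).
move=> r; rewrite nmM; have := kerK_line_bound r x10 x20.
have : nm (cexp (x%:C * (ii * cexp (r +i* 0)))) <= 1.
  by apply: nm_cexp_le1; rewrite expR_line /= mulr0.
by move=> h1; apply: le_trans; rewrite ler_piMr ?nm_ge0.
Qed.

(* Fourier inversion for the function [half_line_exp]. *)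
Lemma kerK_fourier (x1 x2 x : R) : 0 < x1 -> 0 < x2 ->
  \int[mu]_r complex.Re (kerK x1 x2 (r +i* 0) * cexp (x%:C * (ii * cexp (r +i* 0)))) =
  pi * half_line_exp x1 x2 x.
Proof.
move=> x10 x20; rewrite /half_line_exp; have [x0|x0] := ltP 0 x; last first.
  by rewrite mulr0; exact: kerK_fourier_neg.
(* Adding the vanishing integral for [- x] cancels the sine terms and doubles the cosine terms, so
   that only the Poisson kernels in [Re kerK] remain. *)
have hN := @kerK_fourier_neg x1 x2 (- x) x10 x20.
rewrite oppr_le0 in hN; have {}hN := hN (ltW x0).
have i1 := kerK_osc_integrable x x10 x20; have i2 := kerK_osc_integrable (- x) x10 x20.
have [p1 e1] := poisson_fourier x10 (ltW x0); have [p2 e2] := poisson_fourier x20 (ltW x0).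
have := Rintegral_lin measurableT 1 1 i1 i2; rewrite hN mulr0 addr0 mul1r => <-.
have := Rintegral_lin measurableT 2 (-2) p1 p2; rewrite e1 e2.
move=> h; transitivity (2 * (expR (- (x1 * x)) * (pi / 2)) + -2 * (expR (- (x2 * x)) * (pi / 2)));
  last by field.
rewrite -h; apply: eq_Rintegral => r _.
by rewrite !Re_osc mulNr cosN sinN Re_kerK_line //; ring.
Qed.

End kernel.

(** * Measurability and oriented intervals *)

Section measurable_tools.
Context d (T : measurableType d) (R : realType).
Implicit Types (f g : T -> R) (D : set T).

(** Pointwise limit of continuous functions that vanish at 0, in agreement with [0^-1 = 0]. *)
Lemma measurable_invr : measurable_fun setT (fun x : R => x^-1).
Proof.
apply: (@measurable_fun_cvg _ _ R setT (fun n (x : R) => x / (x ^+ 2 + n.+1%:R^-1)) (fun x : R => x^-1)).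
  move=> n; apply: continuous_measurable_fun => x.
  have p : 0 < x ^+ 2 + n.+1%:R^-1 by rewrite ltr_wpDl ?sqr_ge0 // invr_gt0 ltr0n.
  apply: cvgM; first exact: cvg_id.
  apply: cvgV; first by rewrite gt_eqF.
  apply: cvgD; last exact: cvg_cst.
  by under eq_fun do rewrite expr2; rewrite expr2; apply: cvgM; exact: cvg_id.
move=> x _; have [->|x0] := eqVneq x 0.
  by rewrite invr0; under eq_fun do rewrite mul0r; exact: cvg_cst.
have -> : x^-1 = x / (x ^+ 2 + 0) by field.
apply: cvgM; first exact: cvg_cst.
apply: cvgV; first by rewrite addr0 expf_neq0.
by apply: cvgD; [exact: cvg_cst|exact: cvg_harmonic].
Qed.

Lemma measurable_funVr D f : measurable_fun D f -> measurable_fun D (fun x => (f x)^-1).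
Proof. by move=> mf; apply: measurableT_comp mf; exact: measurable_invr. Qed.

Lemma measurable_Rsum D f g : measurable_fun D f -> measurable_fun D g ->
  measurable_fun D (fun x => f x + g x).
Proof. exact: measurable_funD. Qed.

Lemma measurable_Rmul D f g : measurable_fun D f -> measurable_fun D g ->
  measurable_fun D (fun x => f x * g x).
Proof. exact: measurable_funM. Qed.

Lemma measurable_Ropp D f : measurable_fun D f -> measurable_fun D (fun x => - f x).
Proof. by move=> mf; apply: measurableT_comp mf; exact: oppr_measurable. Qed.

Lemma measurable_continuous_comp D (h : R -> R) f : continuous h -> measurable_fun D f ->
  measurable_fun D (fun x => h (f x)).
Proof. by move=> ch mf; apply: measurableT_comp mf; exact: continuous_measurable_fun. Qed.

Lemma measurable_Im_inv D (F : T -> R[i]) : measurable_fun D (fun x => complex.Re (F x)) ->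
  measurable_fun D (fun x => complex.Im (F x)) ->
  measurable_fun D (fun x => complex.Im (F x)^-1).
Proof.
move=> m1 m2; under eq_fun do rewrite Im_inv nm_sq !expr2.
apply: measurable_Rmul; first exact: measurable_Ropp.
by apply: measurable_funVr; apply: measurable_Rsum; exact: measurable_Rmul.
Qed.

End measurable_tools.

Section signed_interval.
Variable R : realType.
Notation mu := (@lebesgue_measure R).
Implicit Types (a b s : R).

(* The integrand of [\int_a^b], for [a] and [b] in any order. *)
Definition chi a b s : R := (s \in `[a, b])%:R - (s \in `[b, a])%:R.

Lemma chi_supp a b s : chi a b s != 0 -> Num.min a b <= s <= Num.max a b.
Proof.
apply: contraR => h; rewrite /chi !in_itv /=.
have -> : (a <= s <= b) = false.
  by apply/negbTE; apply: contra h => /andP[h1 h2]; rewrite ge_min h1 /= le_max h2 orbT.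
have -> : (b <= s <= a) = false.
  by apply/negbTE; apply: contra h => /andP[h1 h2]; rewrite ge_min h1 orbT /= le_max h2.
by rewrite subrr.
Qed.

Lemma chi_gt0 a b s : 0 < a -> 0 < b -> chi a b s != 0 -> 0 < s.
Proof.
move=> a0 b0 /chi_supp /andP[h _]; apply: lt_le_trans h.
by rewrite lt_min a0.
Qed.

Lemma chiN a b s : chi b a s = - chi a b s.
Proof. by rewrite /chi opprB. Qed.

Lemma measurable_chi a b : measurable_fun setT (chi a b).
Proof.
have h c e : measurable_fun setT (fun s : R => (s \in `[c, e])%:R : R).
  have := @measurable_indic _ _ R setT `[c, e]%classic (measurable_itv _).
  congr (measurable_fun _ _); apply/funext => s; rewrite indicE; congr (_%:R).
  by rewrite mem_setE.
by apply: measurable_Rsum; [|apply: measurable_Ropp]; exact: h.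
Qed.

Lemma measurable_chi_comp d (T : measurableType d) (D : set T) (f : T -> R) a b :
  measurable_fun D f -> measurable_fun D (fun x => chi a b (f x)).
Proof. by move=> mf; apply: measurableT_comp mf; exact: measurable_chi. Qed.

Lemma chi_FTC_le (g G : R -> R) a b : 0 < a -> a <= b ->
  (forall s, 0 < s -> is_derive s 1 G (g s)) ->
  (forall s, 0 < s -> {for s, continuous g}) ->
  rintegrable mu setT (fun s => chi a b s * g s) /\
  \int[mu]_s (chi a b s * g s) = G b - G a.
Proof.
move=> a0; rewrite le_eqVlt => /orP[/eqP ->|ab] dG cg.
  have h s : chi b b s * g s = 0 by rewrite /chi subrr mul0r.
  split; last by rewrite subrr; under eq_Rintegral do rewrite h; rewrite Rintegral_cst // mul0r.
  apply: (@rintegrable_eq _ _ _ _ _ measurableT (fun=> 0)) => //.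
  exact: integrable0.
have e s : chi a b s * g s = (g \_ `[a, b]) s.
  rewrite /chi patchE mem_setE; have -> : (s \in `[b, a]) = false.
    rewrite in_itv /=; apply/negbTE/negP => /andP[h1 h2]; have := le_trans h1 h2.
    by rewrite leNgt ab.
  by case: (s \in _); rewrite subr0 ?mul1r ?mul0r.
have hp s : a <= s <= b -> 0 < s by case/andP => h _; exact: lt_le_trans h.
split; last first.
  under eq_Rintegral do rewrite e.
  rewrite -Rintegral_mkcond; apply: Rintegral_itv_FTC; first exact: ltW.
    by move=> s /hp; exact: dG.
  by move=> s /hp; exact: cg.
suff h : rintegrable mu setT (g \_ `[a, b]).
  by apply: (rintegrable_eq measurableT _ h) => s _; rewrite e.
have : mu.-integrable `[a, b] (EFin \o g).
  apply: continuous_compact_integrable; first exact: segment_compact.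
  by apply: continuous_in_subspaceT => s; rewrite inE /= in_itv /= => /hp; exact: cg.
move=> h; have := (@integrable_mkcond _ (measurableTypeR R) R mu `[a, b]%classic (EFin \o g) (measurable_itv _)).1 h.
by congr (_.-integrable _ _); apply/funext => s; rewrite /= restrict_EFin.
Qed.

Lemma chi_FTC (g G : R -> R) a b : 0 < a -> 0 < b ->
  (forall s, 0 < s -> is_derive s 1 G (g s)) ->
  (forall s, 0 < s -> {for s, continuous g}) ->
  rintegrable mu setT (fun s => chi a b s * g s) /\
  \int[mu]_s (chi a b s * g s) = G b - G a.
Proof.
move=> a0 b0 dG cg; have [ab|/ltW ba] := leP a b; first exact: chi_FTC_le.
have [h1 h2] := chi_FTC_le b0 ba dG cg.
have e s : chi a b s * g s = -1 * (chi b a s * g s) by rewrite chiN; ring.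
split; first by apply: rintegrable_eq (rintegrableZ measurableT (-1) h1) => // s _; rewrite e.
by under eq_Rintegral do rewrite e; rewrite RintegralZl // h2; ring.
Qed.

Lemma chi_integrable a b : 0 < a -> 0 < b -> rintegrable mu setT (fun s => `|chi a b s|).
Proof.
move=> a0 b0; have [|h _] := @chi_FTC (fun=> 1) id a b a0 b0.
  by move=> s _; exact: cvg_cst.
by apply: rintegrable_abs => //; apply: rintegrable_eq h => // s _; rewrite mulr1.
Qed.

End signed_interval.

Lemma is_derive_atan_line (R : realType) (p b s : R) : 0 < b ->
  is_derive s 1 (fun s => atan ((s + p) / b)) (b / ((s + p) ^+ 2 + b ^+ 2)).
Proof.
move=> b0; have h : is_derive s 1 (fun s : R => (s + p) / b) b^-1.
  apply: is_derive_eq1 (is_deriveM1 (is_deriveD (is_derive_id s (1 : R)) (is_derive_cst p s (1 : R)))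
    (is_derive_cst b^-1 s (1 : R))) _.
  by rewrite mulr0 add0r addr0 mulr1.
apply: is_derive_eq1 (@is_derive_comp1 R (@atan R) (fun s : R => (s + p) / b) s _ _
  (is_derive1_atan _) h) _.
have q : 0 < (s + p) ^+ 2 + b ^+ 2 by rewrite ltr_wpDl ?sqr_ge0 ?exprn_gt0.
have -> : 1 + ((s + p) / b) ^+ 2 = ((s + p) ^+ 2 + b ^+ 2) / b ^+ 2 by field; rewrite gt_eqF.
by field; rewrite !gt_eqF.
Qed.

Lemma continuous_atan_line (R : realType) (p b : R) : 0 < b ->
  continuous (fun s : R => b / ((s + p) ^+ 2 + b ^+ 2)).
Proof.
move=> b0 s; apply: cvgM; first exact: cvg_cst.
have q : 0 < (s + p) ^+ 2 + b ^+ 2 by rewrite ltr_wpDl ?sqr_ge0 ?exprn_gt0.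
apply: cvgV; first by rewrite gt_eqF.
apply: cvgD; last exact: cvg_cst.
have h : (fun s : R => s + p) @ s --> s + p by apply: cvgD; [exact: cvg_id|exact: cvg_cst].
by under eq_fun do rewrite expr2; rewrite expr2; apply: cvgM.
Qed.

Lemma cbf_log_eq (R : realType) (l l' : R -> R) : cbf_log l ->
  (forall x, 0 < x -> l x = l' x) -> cbf_log l'.
Proof. by move=> [L [D [h e]]] ll; exists L, D; split => // x x0; rewrite e // ll. Qed.

(** Zeros are crossed upwards only. Past a point [a'] with [g a' > 0], the infimum of the points
    where [g <= 0] would be a zero approached from positive values, against the local sign pattern
    at zeros. *)
Lemma increasing_zeros (R : realType) (g g' : R -> R) (a b : R) : a < b ->
  (forall t, a <= t <= b -> is_derive t 1 g (g' t)) ->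
  (forall t, a <= t <= b -> g t = 0 -> 0 < g' t) ->
  0 <= g a -> 0 < g b.
Proof.
move=> ab dg zg ga.
have step t : a <= t <= b -> g t = 0 -> exists2 d : R, 0 < d & forall u, `|u - t| < d ->
    (u < t -> g u < 0) /\ (t < u -> 0 < g u).
  move=> ht gt; have p := zg _ ht gt.
  have [d d0 hd] := (is_deriveP g t (g' t)).1 (dg _ ht) (g' t / 2) (divr_gt0 p (ltr0Sn R 1)).
  exists d => // u /hd; rewrite gt subr0 ler_norml => /andP[h1 h2]; split=> ut.
    by move: h1 h2; rewrite ltr0_norm ?subr_lt0 // => h1 h2; nra.
  by move: h1 h2; rewrite gtr0_norm ?subr_gt0 // => h1 h2; nra.
have cont t : a <= t <= b -> g t != 0 -> exists2 d : R, 0 < d & forall u, `|u - t| < d ->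
    (0 < g u) = (0 < g t).
  move=> ht gt; have /cvgrPdist_lt /(_ `|g t|) := is_derive_cont (dg _ ht).
  rewrite normr_gt0 => /(_ gt) /nbhs_ballP[d /= d0 hd]; exists d => // u ud.
  have := hd u; rewrite /ball /= distrC => /(_ ud); rewrite ltr_norml => /andP[h1 h2].
  have [g0|g0|g0] := ltgtP (g t) 0; last by rewrite g0 eqxx in gt.
    by move: h1 h2; rewrite ltr0_norm // => h1 h2; apply/negbTE; rewrite -leNgt; lra.
  by move: h1 h2; rewrite gtr0_norm // => h1 h2; lra.
have [a' [aa' a'b ga']] : exists a', [/\ a <= a', a' < b & 0 < g a'].
  have [g0|g0] := eqVneq (g a) 0; last by exists a; rewrite lexx ab lt_neqAle eq_sym g0.
  have ha : a <= a <= b by rewrite lexx ltW.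
  have [d d0 hd] := step a ha g0.
  pose e := Num.min (d / 2) ((b - a) / 2).
  have e0 : 0 < e by rewrite lt_min !divr_gt0 ?subr_gt0.
  have ed : e <= d / 2 by rewrite ge_min lexx.
  have eb : e <= (b - a) / 2 by rewrite ge_min lexx orbT.
  exists (a + e); split; [lra|lra|]; apply: (hd (a + e) _).2; last lra.
  by rewrite addrAC subrr add0r gtr0_norm //; lra.
rewrite ltNge; apply/negP => gb.
pose S := [set t | a' <= t <= b /\ g t <= 0].
have Sb : S b by split; rewrite ?lexx ?(ltW a'b).
have hS : has_inf S by split; [exists b|exists a' => t [/andP[]]].
pose s := inf S.
have sa : a' <= s by apply: lb_le_inf; [exists b|move=> t [/andP[]]].
have sb : s <= b by exact: (ge_inf hS.2 Sb).
have hs : a <= s <= b by rewrite (le_trans aa' sa).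
have near d : 0 < d -> exists2 t, S t & t < s + d.
  by move=> d0; have [t St h] := @inf_adherent _ S d d0 hS; exists t.
have [gs|gs] := eqVneq (g s) 0.
  have [d d0 hd] := step s hs gs.
  have as' : a' < s by rewrite lt_neqAle sa andbT; apply: contraTneq ga' => ->; rewrite gs ltxx.
  pose e := Num.min (d / 2) ((s - a') / 2).
  have e0 : 0 < e by rewrite lt_min !divr_gt0 ?subr_gt0.
  have ed : e <= d / 2 by rewrite ge_min lexx.
  have eb : e <= (s - a') / 2 by rewrite ge_min lexx orbT.
  have gn : g (s - e) < 0.
    by apply: (hd (s - e) _).1; [rewrite addrAC subrr add0r normrN gtr0_norm //; lra|lra].
  have : s <= s - e by apply: (ge_inf hS.2); split; [apply/andP; split; lra|exact: ltW].
  lra.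
have [d d0 hd] := cont s hs gs; have [gp|gn] := ltP 0 (g s).
  have [t [/andP[t1 t2] gt] td] := near d d0.
  have st : s <= t by apply: (ge_inf hS.2); split => //; rewrite t1.
  have : 0 < g t by rewrite hd // ger0_norm ?subr_ge0 //; lra.
  by rewrite ltNge gt.
have as' : a' < s by rewrite lt_neqAle sa andbT; apply: contraTneq ga' => ->; rewrite -leNgt.
pose e := Num.min (d / 2) ((s - a') / 2).
have e0 : 0 < e by rewrite lt_min !divr_gt0 ?subr_gt0.
have ed : e <= d / 2 by rewrite ge_min lexx.
have eb : e <= (s - a') / 2 by rewrite ge_min lexx orbT.
have : s <= s - e.
  apply: (ge_inf hS.2); split; first by apply/andP; split; lra.
  rewrite leNgt hd -?leNgt // addrAC subrr add0r normrN gtr0_norm //; lra.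
lra.
Qed.

Lemma atan_inv (R : realType) (y : R) : 0 < y -> atan y = pi / 2 - atan y^-1.
Proof.
move=> y0; have ya : 0 < atan y by rewrite -[X in X < _](atan0 R) lt_atan.
have yb := atan_ltpi2 y.
have c1 : cos (pi / 2 - atan y) = sin (atan y) by rewrite cosB cos_pihalf sin_pihalf mul0r mul1r add0r.
have s1 : sin (pi / 2 - atan y) = cos (atan y) by rewrite sinB cos_pihalf sin_pihalf mul0r mul1r subr0.
have -> : y^-1 = tan (pi / 2 - atan y).
  have : tan (atan y) = y by exact: atanK.
  by rewrite /tan c1 s1 => h; rewrite -{1}h invf_div.
have hin : pi / 2 - atan y \in `](- (pi / 2)), (pi / 2 : R)[.
  by rewrite in_itv /=; apply/andP; split; lra.
by rewrite (tanK hin); lra.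
Qed.

Lemma atan_le_id (R : realType) (y : R) : 0 <= y -> atan y <= y.
Proof.
move=> y0; have [t _] := @real_mvt R (@atan R) (fun t => (1 + t ^+ 2)^-1) 0 y y0
  (fun t _ => is_derive1_atan t).
rewrite atan0 !subr0 => ->; rewrite ler_piMl // invf_le1 ?lerDl ?sqr_ge0 //.
by rewrite ltr_pwDl // sqr_ge0.
Qed.

(** Boundary terms are estimated only after multiplication by factors such as [x1 - e^r]; once these
    have a positive limit, they can be divided out. *)
Lemma cvg0_of_mul_le (R : realType) (u b c : nat -> R) (l : R) : 0 < l ->
  (forall n, 0 <= u n) -> (forall n, u n * b n <= c n) ->
  b @ \oo --> l -> c @ \oo --> (0 : R) -> u @ \oo --> (0 : R).
Proof.
move=> l0 u0 ub bl c0; apply: (@squeeze_cvgr _ _ _ _ (fun=> 0) (fun n => c n / (l / 2))).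
- have /cvgrPdist_lt /(_ (l / 2) (divr_gt0 l0 (ltr0Sn R 1))) := bl.
  apply: filterS => n; rewrite ltr_norml => /andP[_ h]; rewrite u0 /=.
  rewrite ler_pdivlMr ?divr_gt0 //; apply: le_trans (ub n).
  by apply: ler_wpM2l => //; lra.
- exact: cvg_cst.
rewrite -(mul0r (l / 2)^-1); apply: cvgM => //; exact: cvg_cst.
Qed.

Lemma is_deriveV1 (R : realType) (f : R -> R) (x a : R) : f x != 0 ->
  is_derive x 1 f a -> is_derive x 1 (fun y => (f y)^-1) (- a / f x ^+ 2).
Proof.
move=> n h; have d : derivable (fun y => (f y)^-1) x 1 by apply: derivableV.
apply: DeriveDef => //; rewrite deriveV //.
have -> : 'D_1 f x = a by exact: derive_val.
by rewrite /GRing.scale /= !mulNr mulrC.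
Qed.

Lemma chi_inv_sq (R : realType) (l x : R) : 0 < l -> 0 < x ->
  rintegrable (@lebesgue_measure R) setT (fun s => chi 1 x s * ((s + l) ^+ 2)^-1) /\
  \int[@lebesgue_measure R]_s (chi 1 x s * ((s + l) ^+ 2)^-1) = (1 + l)^-1 - (x + l)^-1.
Proof.
move=> l0 x0.
have -> : (1 + l)^-1 - (x + l)^-1 = - (x + l)^-1 - - (1 + l)^-1 by ring.
apply: (@chi_FTC R (fun s => ((s + l) ^+ 2)^-1) (fun s => - (s + l)^-1) 1 x ltr01 x0).
  move=> s s0; have n : s + l != 0 by rewrite gt_eqF // addr_gt0.
  have h := @is_deriveV1 R (fun s => s + l) s _ n
    (is_deriveD (is_derive_id s (1 : R)) (is_derive_cst l s (1 : R))).
  by apply: is_derive_eq1 (is_deriveN h) _; rewrite addr0 mulN1r opprK.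
move=> s s0; apply: cvgV; first by rewrite gt_eqF // exprn_gt0 // addr_gt0.
have h : (fun s => s + l) @ s --> s + l by apply: cvgD; [exact: cvg_id|exact: cvg_cst].
by under eq_fun do rewrite expr2; rewrite expr2; exact: cvgM.
Qed.

(** * Regularised symbols *)

Section approximant.
Variable R : realType.
Notation mu := (@lebesgue_measure R).
Implicit Types (v : R[i]) (r t s x : R).
(* [E] plays the role of [f(e^v)], with [f(z) = z (N(z) + eps)] and [M(v) = N(e^(a v))] for
   some [a < 1], so that [E] extends beyond the closed strip [|Im v| <= pi/2]. *)
Variables (M M' : R[i] -> R[i]) (a eps C : R).
Hypotheses (a0 : 0 < a) (a1 : a < 1) (eps0 : 0 < eps).
Hypothesis dM : forall r t, `|t| <= pi / 2 -> cder M (r +i* t) (M' (r +i* t)).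
Hypothesis RM : forall r t, `|t| <= pi / 2 -> 0 <= complex.Re (M (r +i* t)).
Hypothesis bM : forall r t, `|t| <= pi / 2 -> nm (M (r +i* t)) <= C.
Hypothesis sM : forall r t, `|t| <= pi / 2 ->
  nm (M' (r +i* t)) * cos t <= a * complex.Re (M (r +i* t)).

Let E v := cexp v * (M v + eps%:C).
Let E' v := E v + cexp v * M' v.

Let dE r t : `|t| <= pi / 2 -> cder E (r +i* t) (E' (r +i* t)).
Proof.
move=> ht; apply: cder_eq (cderM (cder_cexp _) (cderD (dM r ht) (cder_cst eps%:C _))) _.
by rewrite addr0 /E' /E; ring.
Qed.

Let C0 : 0 <= C.
Proof. by apply: le_trans (bM 0 (t := 0) _); rewrite ?nm_ge0 // normr0 ltW // pihalf_gt0. Qed.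

Let cos0 t : `|t| <= pi / 2 -> 0 <= cos t.
Proof. by rewrite ler_norml => h; exact: cos_ge0_pihalf. Qed.

Let E_up r t : `|t| <= pi / 2 -> nm (E (r +i* t)) <= (C + eps) * expR r.
Proof.
move=> ht; rewrite nmM nm_cexp_line mulrC ler_wpM2r ?expR_ge0 //.
apply: (le_trans (nmD _ _)); rewrite nm_real gtr0_norm // lerD2r; exact: bM.
Qed.

(** After [e^v] is factored out, the summands [s e^(-v)], [M] and [eps] have nonnegative real part
    in the closed strip, so the real part is at least [eps]. *)
Let E_low1 r t s : `|t| <= pi / 2 -> 0 <= s -> eps * expR r <= nm (s%:C + E (r +i* t)).
Proof.
move=> ht s0; set v := r +i* t.
have -> : s%:C + E v = cexp v * (s%:C * cexp (- v) + (M v + eps%:C)).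
  rewrite cexpN /E; have := cexp_neq0 v; move: (cexp v) => z z0; by field.
rewrite nmM nm_cexp_line mulrC ler_wpM2l ?expR_ge0 //.
apply: le_trans (Re_nm _); apply: le_trans (ler_norm _).
rewrite !ReImE /= cosN mul0r subr0.
have h1 := RM r ht; have h2 : 0 <= s * (expR (- r) * cos t).
  by rewrite mulr_ge0 // mulr_ge0 ?expR_ge0 // cos0.
by rewrite -/v in h1 *; lra.
Qed.

(** For small [e^r] the term [s] dominates, for large [e^r] the previous bound does. Adding
    [s - (C + eps) e^r] and [eps e^r] with weights [eps] and [C + eps] eliminates [e^r] and yields
    the constant. *)
Let E_low r t s : `|t| <= pi / 2 -> 0 < s ->
  s * eps / (C + 2 * eps) <= nm (s%:C + E (r +i* t)).
Proof.
move=> ht s0; have h1 := E_low1 r ht (ltW s0); have h2 := E_up r ht.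
have h3 : s - nm (E (r +i* t)) <= nm (s%:C + E (r +i* t)).
  have := nmDB (s%:C + E (r +i* t)) (E (r +i* t)); rewrite addrK nm_real gtr0_norm //; lra.
have C2 : 0 < C + 2 * eps by apply: ltr_wpDl; rewrite ?mulr_gt0.
rewrite ler_pdivrMr //.
set n := nm (_ + _) in h1 h3 *; set x := expR r in h1 h2.
have k1 : eps * (s - (C + eps) * x) <= eps * n by rewrite ler_wpM2l ?(ltW eps0) //; lra.
have k2 : (C + eps) * (eps * x) <= (C + eps) * n by rewrite ler_wpM2l // addr_ge0 // ltW.
by lra.
Qed.

Let E_neq0 r t s : `|t| <= pi / 2 -> 0 <= s -> s%:C + E (r +i* t) != 0.
Proof.
move=> ht s0; rewrite -nm_gt0; apply: lt_le_trans (E_low1 r ht s0).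
by rewrite mulr_gt0 ?expR_gt0.
Qed.

Let half_pi : `|pi / 2 : R| <= pi / 2.
Proof. by rewrite ger0_norm // ltW // pihalf_gt0. Qed.

Let half_Npi : `|- (pi / 2) : R| <= pi / 2.
Proof. by rewrite normrN. Qed.

(** On the edge [e^v = i e^r], hence [Im E = e^r (Re M + eps)]; the summand [eps] makes the sign
    strict. *)
Let E_upper r : 0 < complex.Im (E (r +i* (pi / 2))).
Proof.
rewrite /E !ReImE /= cos_pihalf sin_pihalf mulr0 mulr1 mul0r add0r.
by rewrite mulr_gt0 ?expR_gt0 // ltr_wpDl // RM.
Qed.

Let E_lower r : complex.Im (E (r +i* (- (pi / 2)))) < 0.
Proof.
rewrite /E !ReImE /= cosN sinN cos_pihalf sin_pihalf mulr0 mulrN1 mul0r add0r mulNr oppr_lt0.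
by rewrite mulr_gt0 ?expR_gt0 // ltr_wpDl // RM.
Qed.

(* At a point where [E] is real, [Re (M + eps)] equals [E * e^(-r) * cos t], so that
   the Schwarz-Pick bound [sM] makes [E'] close to [E]. *)
Let E_real r t : `|t| <= pi / 2 -> complex.Im (E (r +i* t)) = 0 ->
  [/\ `|t| < pi / 2, 0 < complex.Re (E (r +i* t)) &
      (1 - a) * complex.Re (E (r +i* t)) <= complex.Re (E' (r +i* t))].
Proof.
move=> ht h0; have ep := eps0.
have h1 := RM r ht; have h3 := sM r ht; have c0 := cos0 ht; have cs := cos2Dsin2 t.
have er := expR_gt0 r.
have : complex.Re (E (r +i* t)) * cos t = expR r * (complex.Re (M (r +i* t)) + eps).
  move: h0; rewrite /E !ReImE /=; set p := _ + eps; set q := _ + 0 => h0.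
  have : (expR r * cos t * p - expR r * sin t * q) * cos t =
    expR r * p * (cos t ^+ 2 + sin t ^+ 2) -
    (expR r * cos t * q + expR r * sin t * p) * sin t by ring.
  by rewrite cs h0 mul0r subr0 mulr1.
set lam := complex.Re (E _) => e.
have p0 : 0 < lam * cos t by rewrite e mulr_gt0 //; lra.
have c1 : 0 < cos t by rewrite lt_neqAle c0 andbT; apply: contraTneq p0 => <-; rewrite mulr0 ltxx.
have l0 : 0 < lam by rewrite -(pmulr_lgt0 _ c1).
have tn : `|t| < pi / 2.
  rewrite lt_neqAle ht andbT; apply: contraTneq c1 => ht'.
  have : cos `|t| = 0 by rewrite ht' cos_pihalf.
  by rewrite cos_norm => ->; rewrite ltxx.
split => //.
have : expR r * nm (M' (r +i* t)) <= a * lam.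
  rewrite -(ler_pM2r c1) -mulrA -(mulrA a) e [leRHS]mulrCA ler_wpM2l ?(ltW er) //.
  by apply: (le_trans h3); rewrite ler_wpM2l ?(ltW a0) //; lra.
have := Re_nm (cexp (r +i* t) * M' (r +i* t)); rewrite nmM nm_cexp_line ler_norml => /andP[h5 _] h6.
by rewrite /E' Re_add -/lam; lra.
Qed.


Definition apD (x1 x2 s : R) :=
  pi^-1 * \int[mu]_r complex.Re (kerK x1 x2 (r +i* 0) * (s%:C + E (r +i* 0))^-1).

Let low_edge r := E (r +i* (-1 * (pi / 2))).

Let ht_low : `|-1 * (pi / 2) : R| <= pi / 2.
Proof. by rewrite mulN1r. Qed.

Let Im_low r : 0 < - complex.Im (low_edge r).
Proof. by rewrite oppr_gt0 /low_edge mulN1r. Qed.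

Let low_cont : continuous (fun r => complex.Re (low_edge r)) /\
  continuous (fun r => complex.Im (low_edge r)).
Proof.
have h r := rder_continuous (rder_cder_hline (dE r ht_low)).
by split=> r; have [] := h r.
Qed.

Let dEinv r t s : `|t| <= pi / 2 -> 0 <= s ->
  exists c, cder (fun v => (s%:C + E v)^-1) (r +i* t) c.
Proof.
move=> ht s0; have n := E_neq0 r ht s0.
have h := @cderV R (fun v => s%:C + E v) (r +i* t) _ n (cderD (cder_cst _ _) (dE r ht)).
by eexists; exact: h.
Qed.

Let k (x r : R) := expR r * ((1 + expR r)^-1 - (x + expR r)^-1).

Let k_cont x : 0 < x -> continuous (k x).
Proof.
move=> x0 r; have h y : 0 < y -> (fun r : R => (y + expR r)^-1) @ r --> (y + expR r)^-1.
  move=> y0; apply: cvgV; first by rewrite gt_eqF // addr_gt0 // expR_gt0.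
  by apply: cvgD; [exact: cvg_cst|exact: continuous_expR].
by apply: cvgM; [exact: continuous_expR|apply: cvgB; exact: h].
Qed.

Let k_bound x r : 0 < x -> `|k x r| <= kerKC 1 x * sech 1 r.
Proof.
move=> x0; have : complex.Im (cexp (r +i* (-1 * (pi / 2)))) <= 0.
  by apply: lower_Im_le0; rewrite lexx andbT ltW // pihalf_gt0.
move=> /(kerK_bound ltr01 x0); rewrite kerK_lower nm_i normrN.
exact.
Qed.

Let Im_low_inv r s : complex.Im (s%:C + low_edge r)^-1 =
  - complex.Im (low_edge r) / ((s + complex.Re (low_edge r)) ^+ 2 + (- complex.Im (low_edge r)) ^+ 2).
Proof. by rewrite Im_inv nm_sq !ReImE /= add0r sqrrN. Qed.

(** On the lower edge [- Im E > 0], so [Im (1 / (s + E))] is the derivative in [s] of an arctangent.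
    Exchanging the integrals leaves its increment from [s1] to [s2], divided by [pi]: this is the
    density [c], integrated against the Stieltjes kernel in [x] with [lam r = e^r]. *)
Lemma approx_xi s1 s2 : 0 < s1 -> s1 <= s2 ->
  cbf_log (fun x => \int[mu]_s (chi s1 s2 s * apD 1 x s)).
Proof.
move=> s10 s12; have s20 := lt_le_trans s10 s12; have ep := eps0.
pose c r := pi^-1 * (atan ((s2 + complex.Re (low_edge r)) / (- complex.Im (low_edge r))) -
  atan ((s1 + complex.Re (low_edge r)) / (- complex.Im (low_edge r)))).
pose w r := expR r * c r.
have [rc ic] := low_cont.
have cc : continuous c.
  move=> r; apply: cvgM; first exact: cvg_cst.
  have h s : (fun r => atan ((s + complex.Re (low_edge r)) / (- complex.Im (low_edge r)))) @ r -->
      atan ((s + complex.Re (low_edge r)) / (- complex.Im (low_edge r))).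
    apply: (continuous_cvg _ (@continuous_atan R _)); apply: cvgM.
      by apply: cvgD; [exact: cvg_cst|exact: rc].
    by apply: cvgV; [rewrite gt_eqF|apply: cvgN; exact: ic].
  by apply: cvgB; exact: h.
have c01 r : 0 <= c r <= 1.
  have p0 := pi_gt0 R; have b0 := Im_low r.
  rewrite /c; set u := atan _; set u' := atan _; apply/andP; split.
    apply: mulr_ge0; first by rewrite invr_ge0 ltW.
    rewrite subr_ge0 /u /u'.
    have : (s1 + complex.Re (low_edge r)) / - complex.Im (low_edge r) <=
      (s2 + complex.Re (low_edge r)) / - complex.Im (low_edge r).
      by rewrite ler_pM2r ?invr_gt0 // lerD2r.
    by rewrite le_eqVlt => /orP[/eqP ->//|h]; rewrite ltW // lt_atan.
  rewrite mulrC ler_pdivrMr // mul1r.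
  have h1 : u < pi / 2 by exact: atan_ltpi2.
  have h2 : - (pi / 2) < u' by exact: atan_gtNpi2.
  lra.
have cw : continuous w by move=> r; apply: cvgM; [exact: continuous_expR|exact: cc].
have hw r : 0 <= w r <= expR r.
  have /andP[c0 c1] := c01 r; rewrite /w mulr_ge0 ?expR_ge0 //=.
  by rewrite ler_piMr ?expR_ge0.
have dl (r : R) : is_derive r 1 (@expR R) (expR r) by exact: is_derive_expR.
have ce : continuous (@expR R) by exact: continuous_expR.
apply: cbf_log_eq (@cbf_log_stieltjes R (@expR R) (@expR R) w (@expR_gt0 R) dl ce cw hw) _.
move=> x x0; pose K := (s1 * eps / (C + 2 * eps))^-1.
have C2 : 0 < C + 2 * eps by apply: ltr_wpDl; rewrite ?mulr_gt0.
have cs0 s : 0 < s -> 0 < s * eps / (C + 2 * eps) by move=> s0; rewrite divr_gt0 ?mulr_gt0.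
have inv_le r t s : `|t| <= pi / 2 -> 0 < s ->
    nm (s%:C + E (r +i* t))^-1 <= (s * eps / (C + 2 * eps))^-1.
  move=> ht s0; rewrite nmV lef_pV2 ?posrE ?nm_gt0 ?E_neq0 ?(ltW s0) ?cs0 //.
  exact: E_low.
have K0 : 0 < K by rewrite invr_gt0 cs0.
have DE s : 0 < s -> rintegrable mu setT (fun r => k x r * complex.Im (s%:C + low_edge r)^-1) /\
    apD 1 x s = pi^-1 * \int[mu]_r (k x r * complex.Im (s%:C + low_edge r)^-1).
  move=> s0; have [|||hi he] := @kerK_shift_lower R 1 x (s * eps / (C + 2 * eps))^-1
     (fun v => (s%:C + E v)^-1) ltr01 x0.
  - by move=> r t ht; apply: dEinv; rewrite ltW.
  - by move=> r; apply: dEinv; rewrite ?ht_low ?ltW.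
  - move=> r t /andP[t0 t1]; apply: inv_le => //.
    by rewrite mulN1r normrN ger0_norm // ltW.
  by split; [exact: hi|rewrite /apD he].
have chi_s s : chi s1 s2 s != 0 -> s1 <= s.
  by move=> /chi_supp; rewrite (min_idPl s12) => /andP[].
pose F s r := chi s1 s2 s * (pi^-1 * (k x r * complex.Im (s%:C + low_edge r)^-1)).
have [||||_ _ e] := @Rfubini _ _ _ _ R mu mu setT setT F (fun s => `|chi s1 s2 s|)
    (fun r => pi^-1 * K * (kerKC 1 x * sech 1 r)) measurableT measurableT.
- rewrite setXTT; apply: measurable_Rmul.
    by apply: measurable_chi_comp; exact: measurable_fst.
  apply: measurable_Rmul => //; apply: measurable_Rmul.
    by apply: measurable_continuous_comp; [exact: k_cont|exact: measurable_snd].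
  apply: measurable_Im_inv.
    under eq_fun do rewrite Re_add; apply: measurable_Rsum; first exact: measurable_fst.
    by apply: (measurable_continuous_comp (h := fun r => complex.Re (low_edge r))); [exact: rc|exact: measurable_snd].
  under eq_fun do rewrite Im_add [complex.Im (_%:C)]/= add0r.
  by apply: (measurable_continuous_comp (h := fun r => complex.Im (low_edge r))); [exact: ic|exact: measurable_snd].
- exact: chi_integrable.
- by apply: rintegrableZ => //; apply: rintegrableZ => //; exact: sech_integrable.
- move=> s r _ _; rewrite /F normrM; have [->|/chi_s s1s] := eqVneq (chi s1 s2 s) 0.
    by rewrite normr0 !mul0r.
  have pp : 0 < pi^-1 :> R by rewrite invr_gt0 pi_gt0.
  rewrite ler_wpM2l // normrM gtr0_norm // -mulrA ler_wpM2l ?(ltW pp) // normrM mulrC.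
  have s0 := lt_le_trans s10 s1s.
  apply: ler_pM => //; last exact: k_bound.
  apply: (le_trans (Im_nm _)); apply: (le_trans (inv_le _ _ _ ht_low s0)).
  have le1 : s1 * eps / (C + 2 * eps) <= s * eps / (C + 2 * eps).
    by apply: ler_pM; rewrite ?invr_ge0 ?(ltW C2) // ?mulr_ge0 ?(ltW s10) ?(ltW ep) // ler_wpM2r ?(ltW ep).
  have := cs0 s s0; have := cs0 s1 s10; rewrite /K; move: le1.
  by move: (s1 * eps / _) (s * eps / _) => u u' h u0 u'0; rewrite lef_pV2 ?posrE.
transitivity (\int[mu]_s \int[mu]_r F s r); last first.
  apply: eq_Rintegral => s _; have [z|nz] := eqVneq (chi s1 s2 s) 0.
    rewrite z mul0r; under eq_Rintegral do rewrite /F z mul0r.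
    by rewrite (Rintegral_cst _ measurableT) mul0r.
  have [hi ->] := DE s (lt_le_trans s10 (chi_s s nz)).
  have e1 := RintegralZ measurableT pi^-1 hi.
  have e2 := RintegralZ measurableT (chi s1 s2 s) (rintegrableZ measurableT pi^-1 hi).
  by rewrite -e1; exact: e2.
rewrite e; apply: eq_Rintegral => r _.
have b0 := Im_low r.
have gE : (fun s => complex.Im (s%:C + low_edge r)^-1) = (fun s => - complex.Im (low_edge r) /
    ((s + complex.Re (low_edge r)) ^+ 2 + (- complex.Im (low_edge r)) ^+ 2)).
  by apply/funext => s; exact: Im_low_inv.
have [||hi he] := @chi_FTC R (fun s => complex.Im (s%:C + low_edge r)^-1)
  (fun s => atan ((s + complex.Re (low_edge r)) / (- complex.Im (low_edge r)))) s1 s2 s10 s20.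
- by move=> s _; rewrite Im_low_inv; exact: is_derive_atan_line.
- by move=> s _; rewrite gE; exact: continuous_atan_line.
transitivity (\int[mu]_s (pi^-1 * k x r * (chi s1 s2 s * complex.Im (s%:C + low_edge r)^-1))).
  by rewrite (RintegralZ measurableT _ hi) he /w /c /k; ring.
by apply: eq_Rintegral => s _; rewrite /F; ring.
Qed.


(** * The curve on which [E] is positive *)

Let th_exists r : exists t, `|t| < pi / 2 /\ complex.Im (E (r +i* t)) = 0.
Proof.
have p0 := pihalf_gt0 R.
have cont : {within `[- (pi / 2), pi / 2], continuous (fun t => complex.Im (E (r +i* t)))}.
  apply: continuous_in_subspaceT => t; rewrite inE /= in_itv /= => ht.
  by have [] := rder_continuous (rder_cder_vline (dE r (t := t) _)); rewrite // ler_norml.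
have [||t] := @IVT R _ _ _ 0 _ cont; first lra.
  have h1 := ltW (E_lower r); have h2 := ltW (E_upper r).
  by rewrite ge_min h1 /= le_max h2 orbT.
rewrite in_itv /= -ler_norml => ht h0; exists t; split => //.
by have [] := E_real ht h0.
Qed.

Let th r := projT1 (cid (th_exists r)).

Let th_lt r : `|th r| < pi / 2.
Proof. by have [] := projT2 (cid (th_exists r)). Qed.

Let th0 r : complex.Im (E (r +i* th r)) = 0.
Proof. by have [] := projT2 (cid (th_exists r)). Qed.

(** The derivative of [Im E] in [t] is [Re E'], which [E_real] makes positive at zeros. Hence the
    zero [th r] chosen on each vertical segment is unique and separates the signs. *)
Let E_incr r t1 t2 : t1 < t2 -> `|t1| <= pi / 2 -> `|t2| <= pi / 2 ->
  0 <= complex.Im (E (r +i* t1)) -> 0 < complex.Im (E (r +i* t2)).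
Proof.
rewrite !ler_norml => t12 /andP[h1 _] /andP[_ h2].
have ht t : t1 <= t <= t2 -> `|t| <= pi / 2.
  by move=> /andP[k1 k2]; rewrite ler_norml (le_trans h1 k1) (le_trans k2 h2).
apply: (@increasing_zeros R (fun t => complex.Im (E (r +i* t))) (fun t => complex.Re (E' (r +i* t))) t1 t2 t12).
  move=> t /ht tt; have [_] := rder_cder_vline (dE r tt).
  by rewrite Im_mul /= mulr1 mulr0 addr0.
move=> t /ht tt h0; have [_ e0 h] := E_real tt h0.
by apply: lt_le_trans h; rewrite mulr_gt0 // subr_gt0.
Qed.

Let E_neg r t : `|t| <= pi / 2 -> t < th r -> complex.Im (E (r +i* t)) < 0.
Proof.
move=> ht tt; rewrite ltNge; apply/negP => h.
by have := E_incr tt ht (ltW (th_lt r)) h; rewrite th0 ltxx.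
Qed.

Let E_pos r t : `|t| <= pi / 2 -> th r < t -> 0 < complex.Im (E (r +i* t)).
Proof. by move=> ht tt; apply: E_incr tt (ltW (th_lt r)) ht _; rewrite th0. Qed.

(** [Im E] is negative just below the zero and positive just above it; both signs persist for nearby
    [s] and trap [th s] in between. *)
Let th_near r e : 0 < e -> exists2 d : R, 0 < d & forall s, `|s - r| < d -> `|th s - th r| < e.
Proof.
move=> e0; have tr := th_lt r.
pose e1 := Num.min (e / 2) ((pi / 2 - `|th r|) / 2).
have e10 : 0 < e1 by rewrite lt_min !divr_gt0 ?subr_gt0.
have e1e : e1 <= e / 2 by rewrite ge_min lexx.
have e1p : e1 <= (pi / 2 - `|th r|) / 2 by rewrite ge_min lexx orbT.
have bd u : `|u| <= e1 -> `|th r + u| <= pi / 2.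
  by move=> hu; apply: (le_trans (ler_normD _ _)); lra.
have b1 : `|th r - e1| <= pi / 2 by apply: bd; rewrite normrN gtr0_norm.
have b2 : `|th r + e1| <= pi / 2 by apply: bd; rewrite gtr0_norm.
have n1 : 0 < - complex.Im (E (r +i* (th r - e1))) by rewrite oppr_gt0; apply: E_neg => //; lra.
have n2 : 0 < complex.Im (E (r +i* (th r + e1))) by apply: E_pos => //; lra.
have [d1 d10 h1] := cder_cont (dE r b1) n1; have [d2 d20 h2] := cder_cont (dE r b2) n2.
exists (Num.min d1 d2); first by rewrite lt_min d10.
move=> s; rewrite lt_min => /andP[k1 k2].
have nms t : nm ((s +i* t) - (r +i* t)) = `|s - r|.
  rewrite -nm_real; congr nm; apply: complex_ext; rewrite !ReImE /=; ring.
have := h1 (s +i* (th r - e1)); rewrite nms => /(_ k1) m1.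
have := h2 (s +i* (th r + e1)); rewrite nms => /(_ k2) m2.
have {}m1 : complex.Im (E (s +i* (th r - e1))) < 0.
  have := le_lt_trans (Im_nm _) m1; rewrite Im_add Im_opp ltr_norml => /andP[_]; lra.
have {}m2 : 0 < complex.Im (E (s +i* (th r + e1))).
  have := le_lt_trans (Im_nm _) m2; rewrite Im_add Im_opp ltr_norml => /andP[]; lra.
have u1 : th r - e1 < th s.
  rewrite ltNge le_eqVlt; apply/negP => /orP[/eqP h|h].
    by move: m1; rewrite -h th0 ltxx.
  by have := E_pos b1 h; rewrite ltNge (ltW m1).
have u2 : th s < th r + e1.
  rewrite ltNge le_eqVlt; apply/negP => /orP[/eqP h|h].
    by move: m2; rewrite h th0 ltxx.
  by have := E_neg b2 h; rewrite ltNge (ltW m2).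
by rewrite ltr_norml; apply/andP; split; lra.
Qed.

Let vr r : R[i] := r +i* th r.
Let lam r := complex.Re (E (vr r)).
Let p r := complex.Re (E' (vr r)).
Let q r := complex.Im (E' (vr r)).

Let lam_gt0 r : 0 < lam r.
Proof. by have [] := E_real (ltW (th_lt r)) (th0 r). Qed.

Let p_gt0 r : 0 < p r.
Proof.
have [_ h] := E_real (ltW (th_lt r)) (th0 r); apply: lt_le_trans.
by rewrite mulr_gt0 // subr_gt0.
Qed.

Let Elam r : E (vr r) = (lam r)%:C.
Proof. by apply: complex_ext => //=; exact: th0. Qed.

(** Implicit differentiation of [Im E (r + i th r) = 0]: the linear part of the increment is
    [p Th + q D] with [p > 0]. A Lipschitz bound with constant [B] comes first and turns the error
    term into a multiple of [|D|]. *)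
Let dth r : is_derive r 1 th (- (q r / p r)).
Proof.
apply/is_deriveP => e e0; have p0 := p_gt0 r; have p00 : p r != 0 by rewrite gt_eqF.
pose B := 2 * `|q r| / p r + 1.
have B0 : 0 <= B by rewrite addr_ge0 // mulr_ge0 ?invr_ge0 ?(ltW p0) // mulr_ge0.
pose eta := Num.min (p r / 2) (e * p r / (1 + B)).
have eta0 : 0 < eta by rewrite lt_min !divr_gt0 ?mulr_gt0 //; lra.
have [d1 d10 h1] := (cderP _ _ _).1 (dE r (ltW (th_lt r))) eta eta0.
have [d2 d20 h2] := th_near r (divr_gt0 d10 (ltr0Sn R 1)).
exists (Num.min (d1 / 2) d2); first by rewrite lt_min d20 andbT divr_gt0.
move=> s; rewrite lt_min => /andP[k1 /h2 k2].
have dv : nm (vr s - vr r) <= `|s - r| + `|th s - th r|.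
  by apply: (le_trans (nm_le_ReIm _)); rewrite !ReImE /=.
have := h1 (vr s) (le_lt_trans dv _); have -> : `|s - r| + `|th s - th r| < d1 by lra.
move=> /(_ isT) h3; have := le_trans (Im_nm _) h3.
rewrite !Im_add !Im_opp !th0 Im_mul -/(p r) -/(q r).
have -> : complex.Re (vr s - vr r) = s - r by rewrite !ReImE.
have -> : complex.Im (vr s - vr r) = th s - th r by rewrite !ReImE.
have h4 : eta * nm (vr s - vr r) <= eta * (`|s - r| + `|th s - th r|) by rewrite ler_wpM2l // ltW.
move=> h5; have {h3 h4 h5} := le_trans h5 h4.
rewrite subrr sub0r normrN; set D := s - r; set Th := th s - th r => h.
have eta1 : eta <= p r / 2 by rewrite ge_min lexx.
have eta2 : eta * (1 + B) <= e * p r.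
  by rewrite -ler_pdivlMr ?ge_min ?lexx ?orbT //; lra.
have hT : p r * `|Th| <= `|q r| * `|D| + p r / 2 * (`|D| + `|Th|).
  have -> : p r * `|Th| = `|(p r * Th + q r * D) - q r * D| by rewrite addrK normrM (gtr0_norm p0).
  apply: (le_trans (ler_normB _ _)); rewrite [X in _ + X]normrM addrC lerD2l.
  by apply: (le_trans h); rewrite ler_wpM2r // addr_ge0.
have hB : `|Th| <= B * `|D|.
  rewrite -(ler_pM2l p0); have -> : p r * (B * `|D|) = 2 * (`|q r| * `|D|) + p r * `|D| by rewrite /B; field.
  lra.
have -> : Th - - (q r / p r) * D = (p r * Th + q r * D) / p r by field.
rewrite normrM normfV (gtr0_norm p0) ler_pdivrMr //; apply: (le_trans h).
apply: le_trans (_ : eta * ((1 + B) * `|D|) <= _).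
  by rewrite ler_wpM2l ?(ltW eta0) // mulrDl mul1r lerD2l.
by rewrite mulrA [leRHS]mulrAC ler_wpM2r.
Qed.

Let vr' r : R[i] := 1 +i* (- (q r / p r)).

Let dvr r : rder vr r (vr' r).
Proof. by split => /=; [exact: is_derive_id|exact: dth]. Qed.

(** [Re (E' v')] with [v' = 1 - i q / p], that is [p + q^2 / p]. It is positive, so [lam] increases
    along the curve. *)
Let lam' r := (p r ^+ 2 + q r ^+ 2) / p r.

Let dlam r : is_derive r 1 lam (lam' r).
Proof.
have [h _] := rder_comp (dE r (ltW (th_lt r))) (dvr r).
apply: is_derive_eq1 h _; rewrite Re_mul -/(p r) -/(q r) /lam' /=.
by field; rewrite gt_eqF ?p_gt0.
Qed.

Let E'_near r e : 0 < e -> exists2 d : R, 0 < d & forall s, `|s - r| < d ->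
  nm (E' (vr s) - E' (vr r)) < e.
Proof.
move=> e0; have tr := th_lt r; have rho : 0 < pi / 2 - `|th r| by rewrite subr_gt0.
have hD w : nm (w - vr r) < pi / 2 - `|th r| -> cder E w (E' w).
  move=> hw; case: w hw => wr wi hw; apply: dE.
  have := le_lt_trans (Im_nm _) hw; rewrite Im_add Im_opp /= => h.
  by have := ler_normD (wi - th r) (th r); rewrite subrK; lra.
have [d d0 hd] := cder_continuous rho hD e0.
have [d2 d20 h2] := th_near r (divr_gt0 d0 (ltr0Sn R 1)).
exists (Num.min (d / 2) d2); first by rewrite lt_min d20 andbT divr_gt0.
move=> s; rewrite lt_min => /andP[k1 /h2 k2]; apply: hd.
apply: (le_lt_trans (nm_le_ReIm _)); rewrite !ReImE /=; lra.
Qed.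

Let p_cont : continuous p.
Proof.
move=> r; apply/cvgrPdist_lt => e e0; have [d d0 hd] := E'_near r e0.
apply/nbhs_ballP; exists d => //= s; rewrite /ball /= distrC => /hd h.
rewrite distrC; apply: le_lt_trans h; apply: le_trans (Re_nm _).
by rewrite Re_add Re_opp.
Qed.

Let q_cont : continuous q.
Proof.
move=> r; apply/cvgrPdist_lt => e e0; have [d d0 hd] := E'_near r e0.
apply/nbhs_ballP; exists d => //= s; rewrite /ball /= distrC => /hd h.
rewrite distrC; apply: le_lt_trans h; apply: le_trans (Im_nm _).
by rewrite Im_add Im_opp.
Qed.

Let lam'_cont : continuous lam'.
Proof.
move=> r; apply: cvgM; last by apply: cvgV; [rewrite gt_eqF|exact: p_cont].
under eq_fun do rewrite !expr2; rewrite !expr2.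
by apply: cvgD; apply: cvgM; try exact: p_cont; exact: q_cont.
Qed.

Let lam'_ge0 r : 0 <= lam' r.
Proof. by rewrite divr_ge0 ?(ltW (p_gt0 r)) // addr_ge0 ?sqr_ge0. Qed.


Let ii : R[i] := 0 +i* 1.
Let Z r := cexp (vr r).
(* Up to a constant, [- arg (x + i e^v)] on the curve. *)
Let ang x r := atan ((x - complex.Im (Z r)) / complex.Re (Z r)).

Let Z_gt0 r : 0 < complex.Re (Z r).
Proof. by apply: strip_Re_gt0; exact: th_lt. Qed.

Let dZ r : rder Z r (Z r * vr' r).
Proof. exact: rder_comp (cder_cexp _) (dvr r). Qed.

Let dang x r : is_derive r 1 (ang x) (- complex.Re (Z r * vr' r / (x%:C + ii * Z r))).
Proof.
have z0 := Z_gt0 r; have [dX dY] := dZ r.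
have dXV := @is_deriveV1 R (fun r => complex.Re (Z r)) r _ (negbT (gt_eqF z0)) dX.
have dN : is_derive r 1 (fun r => x - complex.Im (Z r)) (0 - complex.Im (Z r * vr' r)).
  exact: is_deriveB.
have dQ := is_deriveM1 dN dXV.
apply: is_derive_eq1 (@is_derive_comp1 R (@atan R)
  (fun r => (x - complex.Im (Z r)) / complex.Re (Z r)) r _ _ (is_derive1_atan _) dQ) _.
rewrite [complex.Re (_ / _)]Re_mul Re_inv Im_inv nm_sq Re_shift Im_shift.
move: (complex.Re (Z r * _)) (complex.Im (Z r * _)) (complex.Re (Z r)) (complex.Im (Z r)) z0.
move=> X' Y' X Y X0.
have d0 : 0 < (x - Y) ^+ 2 + X ^+ 2 by rewrite ltr_wpDl ?sqr_ge0 ?exprn_gt0.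
have -> : 1 + ((x - Y) / X) ^+ 2 = ((x - Y) ^+ 2 + X ^+ 2) / X ^+ 2 by field; rewrite gt_eqF.
by field; rewrite !gt_eqF.
Qed.


(** * Integration by parts along the curve *)

Section angle.
Variables x1 x2 : R.
Hypotheses (x10 : 0 < x1) (x12 : x1 <= x2).

Let x20 : 0 < x2. Proof. exact: lt_le_trans x12. Qed.

Let A r := ang x2 r - ang x1 r.

(** Makes [A] a primitive of [Re (kerK dv)] along the curve, the function to be integrated by parts
    against [1 / (s + lam)]. *)
Let dA r : is_derive r 1 A (complex.Re (kerK x1 x2 (vr r) * vr' r)).
Proof.
apply: is_derive_eq1 (is_deriveB (dang x2 r) (dang x1 r)) _.
rewrite opprK addrC -Re_opp -Re_add /kerK -/(Z r); congr complex.Re.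
ring.
Qed.

Let A_ge0 r : 0 <= A r.
Proof.
rewrite subr_ge0 /ang.
have : (x1 - complex.Im (Z r)) / complex.Re (Z r) <= (x2 - complex.Im (Z r)) / complex.Re (Z r).
  by rewrite ler_pM2r ?invr_gt0 // lerD2r.
by rewrite le_eqVlt => /orP[/eqP ->//|h]; rewrite ltW // lt_atan.
Qed.

Let A_lepi r : A r <= pi.
Proof.
have h1 := atan_ltpi2 ((x2 - complex.Im (Z r)) / complex.Re (Z r)).
have h2 := atan_gtNpi2 ((x1 - complex.Im (Z r)) / complex.Re (Z r)).
by rewrite /A /ang; lra.
Qed.

Let A_cont : continuous A.
Proof. by move=> r; exact: is_derive_cont (dA r). Qed.

Let Z_le r : complex.Re (Z r) <= expR r /\ complex.Im (Z r) <= expR r.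
Proof.
have h1 := le_trans (ler_norm _) (Re_nm (Z r)).
have h2 := le_trans (ler_norm _) (Im_nm (Z r)).
by rewrite nm_cexp in h1 h2.
Qed.

(** The arctangent for [x1] is [pi / 2] minus that of the inverse, and the one for [x2] is below
    [pi / 2]. Hence [A <= Re Z / (x1 - Im Z)] when the denominator is positive, which is of order
    [e^r] at minus infinity. *)
Let A_small r : A r * (x1 - expR r) <= expR r.
Proof.
have [h1 h2] := Z_le r; have z0 := Z_gt0 r; have a0' := A_ge0 r.
have h3 : A r * (x1 - expR r) <= A r * (x1 - complex.Im (Z r)) by rewrite ler_wpM2l //; lra.
apply: (le_trans h3); have [y0|y0] := ltP 0 (x1 - complex.Im (Z r)); last first.
  by apply: le_trans (expR_ge0 r); rewrite mulr_ge0_le0.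
apply: le_trans h1; rewrite -ler_pdivlMr //.
have q0 : 0 < (x1 - complex.Im (Z r)) / complex.Re (Z r) by rewrite divr_gt0.
have h4 := atan_inv q0; have h5 := atan_ltpi2 ((x2 - complex.Im (Z r)) / complex.Re (Z r)).
have q1 := q0; rewrite -invr_gt0 in q1; have := atan_le_id (ltW q1).
by rewrite invf_div in h4 *; rewrite /A /ang; lra.
Qed.

(** The curve may enter the upper half of the strip, where [kerK] has no uniform bound when [e^r] is
    close to [x1] or [x2]. Multiplication by the two distances gives a bound on the whole strip, and
    it is used only as [r] tends to plus or minus infinity. *)
Let kerK_far r t : `|t| < pi / 2 ->
  nm (kerK x1 x2 (r +i* t)) * (`|x1 - expR r| * `|x2 - expR r|) <= (x2 - x1) * expR r.
Proof.
move=> ht; have z0 := strip_Re_gt0 r ht.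
have n1 := shift_neq0 x1 z0; have n2 := shift_neq0 x2 z0.
rewrite (kerKE n1 n2); move: n1 n2; set z := cexp _ => n1 n2.
have low x : `|x - expR r| <= nm (x%:C + ii * z) \/ x < 0.
  have [x0|x0] := ltP x 0; [by right|left].
  have e1 : nm (ii * z) = expR r by rewrite nmM nm_i normr1 mul1r nm_cexp_line.
  have h1 := nmDB (x%:C + ii * z) (ii * z); have h2 := nmDB (x%:C + ii * z) x%:C.
  rewrite addrK e1 nm_real ger0_norm // in h1.
  rewrite addrAC subrr add0r e1 nm_real ger0_norm // in h2.
  by rewrite ler_norml; apply/andP; split; lra.
have low1 : `|x1 - expR r| <= nm (x1%:C + ii * z) by case: (low x1) => // h; have := x10; lra.
have low2 : `|x2 - expR r| <= nm (x2%:C + ii * z) by case: (low x2) => // h; have := x20; lra.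
rewrite !nmM nmV nmM nm_real nm_cexp_line ger0_norm ?subr_ge0 //.
have p1 : 0 < nm (x1%:C + ii * z) by rewrite nm_gt0.
have p2 : 0 < nm (x2%:C + ii * z) by rewrite nm_gt0.
rewrite mulrAC ler_pdivrMr ?mulr_gt0 // ler_wpM2l ?mulr_ge0 ?subr_ge0 ?expR_ge0 //.
exact: ler_pM.
Qed.

Section resolvent.
Variable s : R.
Hypothesis s0 : 0 < s.

Let cs := s * eps / (C + 2 * eps).

Let cs0 : 0 < cs.
Proof. by rewrite divr_gt0 ?mulr_gt0 // ltr_wpDl // mulr_gt0. Qed.

Let inv_le r t : `|t| <= pi / 2 -> nm (s%:C + E (r +i* t))^-1 <= cs^-1.
Proof.
move=> ht; rewrite nmV lef_pV2 ?posrE ?cs0 ?nm_gt0 ?E_neq0 ?(ltW s0) //.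
exact: E_low.
Qed.

Let Phi v := kerK x1 x2 v * (s%:C + E v)^-1.

Let Phi_strip : strip_holomorphic Phi.
Proof.
move=> r t ht; have [b hb] := kerK_strip x1 x2 r ht.
have [c hc] := dEinv r (ltW ht) (ltW s0).
by eexists; exact: cderM hb hc.
Qed.

Let W := projT1 (cid (strip_primitive Phi_strip)).
Let dW r t : `|t| < pi / 2 -> cder W (r +i* t) (Phi (r +i* t)).
Proof. exact: projT2 (cid (strip_primitive Phi_strip)) r t. Qed.

Let Phi_far r t : `|t| < pi / 2 ->
  nm (Phi (r +i* t)) * (`|x1 - expR r| * `|x2 - expR r|) <= (x2 - x1) * expR r / cs.
Proof.
move=> ht; rewrite nmM mulrAC; apply: ler_pM; rewrite ?nm_ge0 //.
- by rewrite mulr_ge0 ?nm_ge0 // mulr_ge0.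
- exact: kerK_far.
- exact: inv_le (ltW ht).
Qed.

(** Bounds what the vertical segment from the real line to the curve contributes; its length is
    below [pi / 2]. *)
Let W_far r : `|complex.Re (W (vr r)) - complex.Re (W (r +i* 0))| *
  (`|x1 - expR r| * `|x2 - expR r|) <= (x2 - x1) * expR r / cs * pi.
Proof.
set b := _ * `|_|; have b0 : 0 <= b by rewrite mulr_ge0.
have tr := th_lt r; have K0 : 0 <= (x2 - x1) * expR r / cs.
  by rewrite divr_ge0 ?(ltW cs0) // mulr_ge0 ?expR_ge0 // subr_ge0.
have := @rder_affine_le R (fun t => W (r +i* t) * b%:C)
  (fun t => Phi (r +i* t) * (0 +i* 1) * b%:C) 0 0 (th r) ((x2 - x1) * expR r / cs).
have ht u : Num.min 0 (th r) <= u <= Num.max 0 (th r) -> `|u| < pi / 2.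
  move=> /andP[h1 h2]; move: tr; rewrite !ltr_norml => /andP[k1 k2].
  have p0 := pihalf_gt0 R; apply/andP; split.
    by apply: lt_le_trans h1; rewrite lt_min k1 andbT; lra.
  by apply: le_lt_trans h2 _; rewrite gt_max k2 andbT.
move=> h; have {h} := h _ _.
have -> : (forall u, Num.min 0 (th r) <= u <= Num.max 0 (th r) ->
   rder (fun t => W (r +i* t) * b%:C) u (Phi (r +i* u) * (0 +i* 1) * b%:C)) = True.
  apply/propext; split=> // _ u /ht hu.
  have := rderZ b%:C (rder_cder_vline (dW r hu)).
  rewrite [X in rder _ _ X]mulrC; under eq_fun do rewrite mulrC; exact.
have -> : (forall u, Num.min 0 (th r) <= u <= Num.max 0 (th r) ->
   nm (Phi (r +i* u) * (0 +i* 1) * b%:C - 0) <= (x2 - x1) * expR r / cs) = True.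
  apply/propext; split=> // _ u /ht hu.
  by rewrite subr0 nmM nmM nm_i normr1 mulr1 nm_real ger0_norm //; exact: Phi_far.
move=> /(_ I I); rewrite mul0r !subr0 -mulrBl nmM nm_real (ger0_norm b0) => h.
apply: le_trans (_ : nm (W (r +i* th r) - W (r +i* 0)) * b <= _).
  by rewrite ler_wpM2r // -Re_opp -Re_add; exact: Re_nm.
apply: (le_trans h); rewrite ler_wpM2l //; have := pi_gt0 R; lra.
Qed.

Let g r := A r * lam' r / (s + lam r) ^+ 2.

Let slam r : 0 < s + lam r. Proof. by rewrite addr_gt0. Qed.

Let lam_cont : continuous lam. Proof. by move=> r; exact: is_derive_cont (dlam r). Qed.

Let inv2_cont : continuous (fun r => ((s + lam r) ^+ 2)^-1).
Proof.
move=> r; apply: cvgV; first by rewrite gt_eqF // exprn_gt0.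
have h : (fun r => s + lam r) @ r --> s + lam r by apply: cvgD; [exact: cvg_cst|exact: lam_cont].
by under eq_fun do rewrite expr2; rewrite expr2; exact: cvgM.
Qed.

Let g_cont : continuous g.
Proof.
move=> r; apply: cvgM; last exact: inv2_cont.
by apply: cvgM; [exact: A_cont|exact: lam'_cont].
Qed.

Let dinv r : is_derive r 1 (fun r => (s + lam r)^-1) (- lam' r / (s + lam r) ^+ 2).
Proof.
have n := negbT (gt_eqF (slam r)).
have h := @is_deriveV1 R (fun r => s + lam r) r _ n (is_deriveD (is_derive_cst s r (1 : R)) (dlam r)).
by apply: is_derive_eq1 h _; rewrite add0r.
Qed.

Lemma curve_integrable : rintegrable mu setT (fun r => lam' r / (s + lam r) ^+ 2).
Proof.
have [||r||] // := @Rintegral_ge0_FTC R (fun r => lam' r / (s + lam r) ^+ 2)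
  (fun r => - (s + lam r)^-1) s^-1.
- by move=> r; apply: cvgM; [exact: lam'_cont|exact: inv2_cont].
- by move=> r; rewrite divr_ge0 // sqr_ge0.
- have h := dinv r; apply: is_derive_eq1 (is_deriveN h) _; ring.
move=> x y; have h1 : 0 < (s + lam x)^-1 by rewrite invr_gt0.
have h2 : (s + lam y)^-1 <= s^-1 by rewrite lef_pV2 ?posrE // lerDl ltW.
lra.
Qed.

Lemma apD_curve_integrable : rintegrable mu setT g.
Proof.
have h := rintegrableZ measurableT pi curve_integrable; apply: rintegrable_le h => //.
  exact: continuous_measurable_fun.
move=> r _; rewrite /g -mulrA normrM; apply: ler_pM => //; first by rewrite ger0_norm.
by rewrite ger0_norm // divr_ge0 // sqr_ge0.
Qed.

(** On the curve [E = lam] is real, so [Re (Phi v') = A' / (s + lam)]. Subtracting [A / (s + lam)]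
    performs the integration by parts, and the derivative that remains is [g]. *)
Let H r := complex.Re (W (vr r)) - A r * (s + lam r)^-1.

Let dH r : is_derive r 1 H (g r).
Proof.
have [h _] := rder_comp (dW r (th_lt r)) (dvr r).
apply: is_derive_eq1 (is_deriveB h (is_deriveM1 (dA r) (dinv r))) _.
rewrite -/(vr r) /Phi Elam -rmorphD -(fmorphV (real_complex R)) /g.
rewrite -mulrA (mulrC (_%:C)) mulrA [complex.Re (_ * _%:C)]Re_mul /= mulr0 subr0.
ring.
Qed.

(** The increments of [H] are those of the integral over the real line plus boundary terms. These
    vanish: the vertical segments by [W_far], and [A / (s + lam)] because [lam >= eps e^r] at plus
    infinity and [A = O(e^r)] at minus infinity. *)
Lemma apD_curve : apD x1 x2 s = pi^-1 * \int[mu]_r g r.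
Proof.
rewrite /apD; congr (_ * _); apply/esym.
have t0 : `|0 : R| < pi / 2 by rewrite normr0 pihalf_gt0.
have iPhi : rintegrable mu setT (fun r => complex.Re (Phi (r +i* 0))).
  apply: (@hline_integrable R Phi 0 1 (kerKC x1 x2 / cs)) => //.
    by move=> r; exact: Phi_strip.
  move=> r; rewrite nmM mulrAC; apply: ler_pM; rewrite ?nm_ge0 //; first exact: kerK_line_bound.
  exact: inv_le (ltW t0).
apply: (Rintegral_FTC apD_curve_integrable g_cont dH).
have hi := Rintegral_centered_cvg iPhi.
have e n := @hline_integral_itv R Phi W 0 n (fun r => dW r t0) (fun r => Phi_strip r t0).
have q0 := @expR_nat_cvg R.
(* Division by [e^(2 n)] turns the two distances into factors with limit 1 and the right side into a
   multiple of [e^(-n)]. *)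
have Wp : `|complex.Re (W (vr n%:R)) - complex.Re (W (n%:R +i* 0))| @[n --> \oo] --> (0 : R).
  apply: (@cvg0_of_mul_le R _
    (fun n => `|x1 * (expR n%:R)^-1 - 1| * `|x2 * (expR n%:R)^-1 - 1|)
    (fun n => (x2 - x1) / cs * pi * (expR n%:R)^-1) 1) => //.
  - move=> n; have := W_far n%:R; have := expR_gt0 (n%:R : R).
    move: (`|_ - _|) (expR _) => u y y0 h.
    have f x : `|x * y^-1 - 1| = `|x - y| / y.
      have -> : x * y^-1 - 1 = (x - y) / y by field; rewrite gt_eqF.
      by rewrite normrM normfV (gtr0_norm y0).
    rewrite !f.
    have -> : u * (`|x1 - y| / y * (`|x2 - y| / y)) = u * (`|x1 - y| * `|x2 - y|) / y ^+ 2.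
      by field; rewrite gt_eqF.
    rewrite ler_pdivrMr ?exprn_gt0 //; apply: (le_trans h).
    by have -> : (x2 - x1) / cs * pi / y * y ^+ 2 = (x2 - x1) * y / cs * pi
      by field; rewrite !gt_eqF.
  - have f x : `|x * (expR n%:R)^-1 - 1| @[n --> \oo] --> (1 : R).
      suff : `|x * (expR n%:R)^-1 - 1| @[n --> \oo] --> `|x * 0 - 1|.
        by rewrite mulr0 sub0r normrN normr1.
      apply: cvg_norm; apply: cvgB; last exact: cvg_cst.
      by apply: cvgM => //; exact: cvg_cst.
    by rewrite -[X in _ --> X](mulr1 1); apply: cvgM.
  by rewrite -(mulr0 ((x2 - x1) / cs * pi)); apply: cvgM => //; exact: cvg_cst.
have Wm : `|complex.Re (W (vr (- n%:R))) - complex.Re (W ((- n%:R) +i* 0))| @[n --> \oo] --> (0 : R).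
  apply: (@cvg0_of_mul_le R _ (fun n => `|x1 - (expR n%:R)^-1| * `|x2 - (expR n%:R)^-1|)
    (fun n => (x2 - x1) / cs * pi * (expR n%:R)^-1) (x1 * x2)) => //.
  - exact: mulr_gt0.
  - move=> n; have := W_far (- n%:R); rewrite expRN => h; apply: (le_trans h).
    by rewrite le_eqVlt; apply/orP; left; apply/eqP; ring.
  - have f x : 0 < x -> `|x - (expR n%:R)^-1| @[n --> \oo] --> x.
      move=> x0; suff : `|x - (expR n%:R)^-1| @[n --> \oo] --> `|x - 0|.
        by rewrite subr0 gtr0_norm.
      by apply: cvg_norm; apply: cvgB => //; exact: cvg_cst.
    by apply: cvgM; exact: f.
  by rewrite -(mulr0 ((x2 - x1) / cs * pi)); apply: cvgM => //; exact: cvg_cst.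
have u0 r : 0 <= A r * (s + lam r)^-1 by rewrite mulr_ge0 // invr_ge0 ltW.
have Ap : A n%:R * (s + lam n%:R)^-1 @[n --> \oo] --> (0 : R).
  apply: (@cvg0_of_mul_le R _ (fun=> 1) (fun n => pi / eps * (expR n%:R)^-1) 1) => //.
  - move=> n; rewrite mulr1 -mulrA -invfM; apply: ler_pM => //; first by rewrite invr_ge0 ltW.
    have h := E_low1 n%:R (ltW (th_lt n%:R)) (lexx (0 : R)).
    rewrite add0r -/(vr _) Elam nm_real gtr0_norm // in h.
    have e0 := expR_gt0 (n%:R : R).
    rewrite lef_pV2 ?posrE ?mulr_gt0 //; apply: (le_trans h); by rewrite lerDr ltW.
  - exact: cvg_cst.
  by rewrite -(mulr0 (pi / eps)); apply: cvgM => //; exact: cvg_cst.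
have Am : A (- n%:R) * (s + lam (- n%:R))^-1 @[n --> \oo] --> (0 : R).
  apply: (@cvg0_of_mul_le R _ (fun n => x1 - (expR n%:R)^-1) (fun n => s^-1 * (expR n%:R)^-1) x1) => //.
  - move=> n; have := A_small (- n%:R); rewrite expRN => h.
    rewrite mulrAC mulrC; apply: (@le_trans _ _ ((s + lam (- n%:R))^-1 * (expR n%:R)^-1)).
      by rewrite ler_wpM2l // invr_ge0 ltW.
    by rewrite ler_wpM2r ?invr_ge0 ?expR_ge0 // lef_pV2 ?posrE // lerDl ltW.
  - by rewrite -[X in _ --> X]subr0; apply: cvgB => //; exact: cvg_cst.
  by rewrite -(mulr0 s^-1); apply: cvgM => //; exact: cvg_cst.
move/norm_cvg0P : Wp => Wp; move/norm_cvg0P : Wm => Wm.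
have h : (complex.Re (W (vr n%:R)) - complex.Re (W (n%:R +i* 0))) -
    (complex.Re (W (vr (- n%:R))) - complex.Re (W ((- n%:R) +i* 0))) +
    (A (- n%:R) * (s + lam (- n%:R))^-1 - A n%:R * (s + lam n%:R)^-1) @[n --> \oo] --> (0 - 0 + (0 - 0) : R).
  by apply: cvgD; apply: cvgB.
rewrite !subrr addr0 in h.
rewrite -[X in _ --> X]addr0.
suff : (fun n : nat => H n%:R - H (- n%:R)) = (fun n => \int[mu]_(r in centered_itv n) complex.Re (Phi (r +i* 0)) +
    ((complex.Re (W (vr n%:R)) - complex.Re (W (n%:R +i* 0))) -
    (complex.Re (W (vr (- n%:R))) - complex.Re (W ((- n%:R) +i* 0))) +
    (A (- n%:R) * (s + lam (- n%:R))^-1 - A n%:R * (s + lam n%:R)^-1))).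
  by move=> ->; apply: cvgD.
by apply/funext => n; rewrite e /H; ring.
Qed.

End resolvent.

(** By [apD_curve] the integrand is an integral of [w / (s + lam)^2] with [w = A lam' / pi].
    Integrating in [s] from 1 to [tau] gives [1 / (1 + lam) - 1 / (tau + lam)], the Stieltjes kernel
    in [tau], and [A <= pi] gives [w <= lam']. *)
Lemma approx_tau : cbf_log (fun tau => \int[mu]_s (chi 1 tau s * apD x1 x2 s)).
Proof.
have pp : 0 < pi^-1 :> R by rewrite invr_gt0 pi_gt0.
pose w r := pi^-1 * A r * lam' r.
have cw : continuous w.
  by move=> r; apply: cvgM; [apply: cvgM; [exact: cvg_cst|exact: A_cont]|exact: lam'_cont].
have hw r : 0 <= w r <= lam' r.
  have a0' := A_ge0 r; have l0 := lam'_ge0 r; rewrite /w; apply/andP; split.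
    by rewrite mulr_ge0 // mulr_ge0 // ltW.
  apply: ler_piMl => //.
  by rewrite mulrC ler_pdivrMr ?pi_gt0 // mul1r.
have lam_cont : continuous lam by move=> r; exact: is_derive_cont (dlam r).
apply: cbf_log_eq (cbf_log_stieltjes lam_gt0 dlam lam'_cont cw hw) _ => x x0.
have m0 : 0 < Num.min 1 x by rewrite lt_min ltr01.
pose F s r := chi 1 x s * (pi^-1 * (A r * lam' r * ((s + lam r) ^+ 2)^-1)).
have [||||_ _ e] := @Rfubini _ _ _ _ R mu mu setT setT F (fun s => `|chi 1 x s|)
    (fun r => lam' r / (Num.min 1 x + lam r) ^+ 2) measurableT measurableT.
- rewrite setXTT; apply: measurable_Rmul.
    by apply: measurable_chi_comp; exact: measurable_fst.
  apply: measurable_Rmul; first exact: measurable_cst.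
  apply: measurable_Rmul.
    apply: (measurable_continuous_comp (h := fun r => A r * lam' r)); last exact: measurable_snd.
    by move=> r; apply: cvgM; [exact: A_cont|exact: lam'_cont].
  apply: measurable_funVr.
  have h : measurable_fun [set: R * R] (fun p : R * R => p.1 + lam p.2).
    apply: measurable_Rsum; first exact: measurable_fst.
    by apply: (measurable_continuous_comp (h := lam)); [exact: lam_cont|exact: measurable_snd].
  by under eq_fun do rewrite expr2; apply: measurable_Rmul; exact: h.
- exact: chi_integrable.
- exact: curve_integrable.
- move=> s r _ _; rewrite /F normrM; have [->|nz] := eqVneq (chi 1 x s) 0.
    by rewrite normr0 !mul0r.
  have /andP[ms _] := chi_supp nz; have s0 := lt_le_trans m0 ms.
  rewrite ler_wpM2l // normrM gtr0_norm // (normrM (A r * lam' r)) (normrM (A r)) (ger0_norm (A_ge0 r)) (ger0_norm (lam'_ge0 r)).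
  have k1 : 0 < Num.min 1 x + lam r by rewrite addr_gt0.
  have k2 : 0 < s + lam r by rewrite addr_gt0.
  rewrite gtr0_norm ?invr_gt0 ?exprn_gt0 //.
  have -> : pi^-1 * (A r * lam' r * ((s + lam r) ^+ 2)^-1) = w r * ((s + lam r) ^+ 2)^-1.
    by rewrite /w; ring.
  have /andP[w0 w1] := hw r.
  apply: ler_pM => //; first by rewrite invr_ge0 sqr_ge0.
  by rewrite lef_pV2 ?posrE ?exprn_gt0 // ler_sqr ?nnegrE ?(ltW k1) ?(ltW k2) // lerD2r.
transitivity (\int[mu]_s \int[mu]_r F s r); last first.
  apply: eq_Rintegral => s _; have [z|nz] := eqVneq (chi 1 x s) 0.
    rewrite z mul0r; under eq_Rintegral do rewrite /F z mul0r.
    by rewrite (Rintegral_cst _ measurableT) mul0r.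
  have s0 := chi_gt0 ltr01 x0 nz; rewrite (apD_curve s0).
  have gi := apD_curve_integrable s0.
  have e1 := RintegralZ measurableT pi^-1 gi.
  have e2 := RintegralZ measurableT (chi 1 x s) (rintegrableZ measurableT pi^-1 gi).
  by rewrite -e1; exact: e2.
rewrite e; apply: eq_Rintegral => r _; have l0 := lam_gt0 r.
have [hi he] := chi_inv_sq l0 x0.
transitivity (\int[mu]_s (w r * (chi 1 x s * ((s + lam r) ^+ 2)^-1))).
  by rewrite (RintegralZ measurableT _ hi) he.
by apply: eq_Rintegral => s _; rewrite /F /w; ring.
Qed.
End angle.
End approximant.

(** * Rogers functions *)

Section complex_limits.
Variable R : realType.
Implicit Types (u v : nat -> R[i]) (z w : R[i]).

Definition ccvg u z := complex.Re (u n) @[n --> \oo] --> complex.Re z /\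
  complex.Im (u n) @[n --> \oo] --> complex.Im z.

Lemma ccvg_cst z : ccvg (fun=> z) z.
Proof. by split; exact: cvg_cst. Qed.

Lemma ccvg_real (x : nat -> R) (y : R) : x @ \oo --> y -> ccvg (fun n => (x n)%:C) y%:C.
Proof. by move=> h; split => //=; exact: cvg_cst. Qed.

Lemma ccvgD u v z w : ccvg u z -> ccvg v w -> ccvg (fun n => u n + v n) (z + w).
Proof.
move=> [a1 a2] [b1 b2]; split.
  by rewrite Re_add; under eq_fun do rewrite Re_add; exact: cvgD.
by rewrite Im_add; under eq_fun do rewrite Im_add; exact: cvgD.
Qed.

Lemma ccvgM u v z w : ccvg u z -> ccvg v w -> ccvg (fun n => u n * v n) (z * w).
Proof.
move=> [a1 a2] [b1 b2]; split.
  by rewrite Re_mul; under eq_fun do rewrite Re_mul; apply: cvgB; exact: cvgM.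
by rewrite Im_mul; under eq_fun do rewrite Im_mul; apply: cvgD; exact: cvgM.
Qed.

Lemma ccvgV u z : z != 0 -> ccvg u z -> ccvg (fun n => (u n)^-1) z^-1.
Proof.
move=> z0 [a1 a2].
have h : (nm (u n) ^+ 2)^-1 @[n --> \oo] --> (nm z ^+ 2)^-1.
  apply: cvgV; first by rewrite expf_neq0 // nm_eq0.
  rewrite nm_sq; under eq_fun do rewrite nm_sq.
  by under eq_fun do rewrite !expr2; rewrite !expr2; apply: cvgD; exact: cvgM.
split; first by rewrite Re_inv; under eq_fun do rewrite Re_inv; exact: cvgM.
by rewrite Im_inv; under eq_fun do rewrite Im_inv; apply: cvgM => //; exact: cvgN.
Qed.

Lemma ccvg_nm u z : (forall e : R, 0 < e -> \forall n \near \oo, nm (u n - z) < e) -> ccvg u z.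
Proof.
move=> h; split; apply/cvgrPdist_lt => e e0; have := h e e0; apply: filterS => n;
  rewrite distrC; apply: le_lt_trans.
  by rewrite -Re_opp -Re_add Re_nm.
by rewrite -Im_opp -Im_add Im_nm.
Qed.

Lemma ccvg_cder (f : R[i] -> R[i]) u z c : cder f z c -> ccvg u z -> ccvg (fun n => f (u n)) (f z).
Proof.
move=> hf [a1 a2]; apply: ccvg_nm => e e0; have [d d0 hd] := cder_cont hf e0.
have d2 : 0 < d / 2 by rewrite divr_gt0.
have /cvgrPdist_lt /(_ _ d2) b1 := a1; have /cvgrPdist_lt /(_ _ d2) b2 := a2.
near=> n; apply: hd; apply: (le_lt_trans (nm_le_ReIm _)).
have h1 : `|complex.Re z - complex.Re (u n)| < d / 2 by near: n.
have h2 : `|complex.Im z - complex.Im (u n)| < d / 2 by near: n.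
by rewrite !ReImE /= distrC (distrC _ (complex.Im z)); lra.
Unshelve. all: by end_near. Qed.

End complex_limits.

(** * Dependence of the resolvent integral on the symbol *)

Section resolvent_kernel.
Variable R : realType.
Notation mu := (@lebesgue_measure R).
Implicit Types (F : R -> R[i]) (x r s : R).

Definition resK F x1 x2 s :=
  pi^-1 * \int[mu]_r complex.Re (kerK x1 x2 (r +i* 0) * (s%:C + F r)^-1).

(** Holomorphy is left out: [Re F >= 0] gives [|1 / (s + F)| <= 1 / s], so the bounds below are
    uniform in the symbol and symbols can be approximated pointwise. *)
Definition right_symbol F := [/\ continuous (fun r => complex.Re (F r)),
  continuous (fun r => complex.Im (F r)) & forall r, 0 <= complex.Re (F r)].

Lemma kerK_line_continuous x1 x2 : 0 < x1 -> 0 < x2 ->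
  continuous (fun r => complex.Re (kerK x1 x2 (r +i* 0))) /\
  continuous (fun r => complex.Im (kerK x1 x2 (r +i* 0))).
Proof.
have t0 : `|0 : R| < pi / 2 by rewrite normr0 pihalf_gt0.
move=> x10 x20; split=> r; have [a ha] := kerK_strip x1 x2 r t0;
  by have [] := rder_continuous (rder_cder_hline ha).
Qed.

Lemma resolvent_le F r s : right_symbol F -> 0 < s -> nm (s%:C + F r)^-1 <= s^-1.
Proof.
move=> [_ _ F0] s0; have h : s <= nm (s%:C + F r).
  by apply: le_trans (le_trans (ler_norm _) (Re_nm _)); rewrite Re_add /= lerDl.
by rewrite nmV lef_pV2 // posrE // (lt_le_trans s0).
Qed.

Lemma resK_integrand_le F x1 x2 s r : right_symbol F -> 0 < x1 -> 0 < x2 -> 0 < s ->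
  `|complex.Re (kerK x1 x2 (r +i* 0) * (s%:C + F r)^-1)| <= s^-1 * (kerKC x1 x2 * sech 1 r).
Proof.
move=> hF x10 x20 s0; apply: (le_trans (Re_nm _)); rewrite nmM mulrC.
by apply: ler_pM; rewrite ?nm_ge0 ?resolvent_le // kerK_line_bound.
Qed.

Lemma resK_measurable d (T : measurableType d) F x1 x2 (s r : T -> R) : right_symbol F ->
  0 < x1 -> 0 < x2 -> measurable_fun setT s -> measurable_fun setT r ->
  measurable_fun setT (fun t => complex.Re (kerK x1 x2 (r t +i* 0) * ((s t)%:C + F (r t))^-1)).
Proof.
move=> [c1 c2 _] x10 x20 ms mr; have [k1 k2] := kerK_line_continuous x10 x20.
have m1 : measurable_fun setT (fun t => complex.Re (F (r t))) by exact: measurable_continuous_comp c1 mr.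
have m2 : measurable_fun setT (fun t => complex.Im (F (r t))) by exact: measurable_continuous_comp c2 mr.
have n1 : measurable_fun setT (fun t => complex.Re (kerK x1 x2 (r t +i* 0))).
  exact: (measurable_continuous_comp k1 mr).
have n2 : measurable_fun setT (fun t => complex.Im (kerK x1 x2 (r t +i* 0))).
  exact: (measurable_continuous_comp k2 mr).
have e t : complex.Re (kerK x1 x2 (r t +i* 0) * ((s t)%:C + F (r t))^-1) =
  (complex.Re (kerK x1 x2 (r t +i* 0)) * (s t + complex.Re (F (r t))) +
   complex.Im (kerK x1 x2 (r t +i* 0)) * complex.Im (F (r t))) *
  ((s t + complex.Re (F (r t))) * (s t + complex.Re (F (r t))) +
    complex.Im (F (r t)) * complex.Im (F (r t)))^-1.
  rewrite Re_mul Re_inv Im_inv nm_sq (Re_add (s t)%:C) (Im_add (s t)%:C) [complex.Re (s t)%:C]/= [complex.Im (s t)%:C]/= add0r !expr2; ring.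
have m3 := measurable_Rsum ms m1.
under eq_fun do rewrite e; apply: measurable_Rmul.
  by apply: measurable_Rsum; exact: measurable_Rmul.
by apply: measurable_funVr; apply: measurable_Rsum; exact: measurable_Rmul.
Qed.

Lemma resK_integrand_integrable F x1 x2 s : right_symbol F -> 0 < x1 -> 0 < x2 -> 0 < s ->
  rintegrable mu setT (fun r => complex.Re (kerK x1 x2 (r +i* 0) * (s%:C + F r)^-1)).
Proof.
move=> hF x10 x20 s0.
have h := rintegrableZ measurableT s^-1 (rintegrableZ measurableT (kerKC x1 x2) (sech_integrable (ltr01 : 0 < 1 :> R))).
apply: rintegrable_le h => //; last by move=> r _; exact: resK_integrand_le.
by apply: (resK_measurable (s := fun=> s) (r := id)).
Qed.

Lemma resK_integrable F x1 x2 a b : right_symbol F -> 0 < x1 -> 0 < x2 -> 0 < a -> 0 < b ->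
  rintegrable mu setT (fun s => chi a b s * resK F x1 x2 s).
Proof.
move=> hF x10 x20 a0 b0; pose m := Num.min a b.
have m0 : 0 < m by rewrite lt_min a0.
pose G s r := chi a b s * complex.Re (kerK x1 x2 (r +i* 0) * (s%:C + F r)^-1).
have [||||h _ _] := @Rfubini _ _ _ _ R mu mu setT setT G (fun s => `|chi a b s|)
    (fun r => m^-1 * (kerKC x1 x2 * sech 1 r)) measurableT measurableT.
- rewrite setXTT; apply: measurable_Rmul; first by apply: measurable_chi_comp; exact: measurable_fst.
  by apply: resK_measurable.
- exact: chi_integrable.
- by apply: rintegrableZ => //; apply: rintegrableZ => //; exact: sech_integrable.
- move=> s r _ _; rewrite /G normrM; have [->|nz] := eqVneq (chi a b s) 0.
    by rewrite normr0 !mul0r.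
  have /andP[ms _] := chi_supp nz; have s0 := lt_le_trans m0 ms.
  rewrite ler_wpM2l //; apply: (le_trans (resK_integrand_le r hF x10 x20 s0)).
  have C0 : 0 <= kerKC x1 x2 * sech 1 r.
    by apply: le_trans (kerK_line_bound r x10 x20); exact: nm_ge0.
  by apply: ler_wpM2r => //; rewrite lef_pV2 ?posrE.
have := rintegrableZ measurableT pi^-1 h; apply: rintegrable_eq => // s _.
have [z|nz] := eqVneq (chi a b s) 0.
  rewrite z mul0r /G z; under eq_Rintegral do rewrite mul0r.
  by rewrite (Rintegral_cst _ measurableT) mul0r mulr0.
have s0 := chi_gt0 a0 b0 nz.
have e := RintegralZ measurableT (chi a b s) (resK_integrand_integrable hF x10 x20 s0).
by rewrite /G e /resK; ring.
Qed.

Definition resKC x1 x2 := pi^-1 * \int[mu]_r (kerKC x1 x2 * sech 1 r).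

Lemma resK_le F x1 x2 s : right_symbol F -> 0 < x1 -> 0 < x2 -> 0 < s ->
  `|resK F x1 x2 s| <= resKC x1 x2 / s.
Proof.
move=> hF x10 x20 s0; have pp : 0 < pi^-1 :> R by rewrite invr_gt0 pi_gt0.
rewrite normrM gtr0_norm // -mulrA ler_wpM2l ?(ltW pp) //.
have iK := rintegrableZ measurableT (kerKC x1 x2) (sech_integrable (ltr01 : 0 < 1 :> R)).
have h := rintegrableZ measurableT s^-1 iK.
rewrite mulrC -(RintegralZ measurableT s^-1 iK).
apply: Rintegral_norm_le => //; first exact: resK_integrand_integrable.
by move=> r _; exact: resK_integrand_le.
Qed.

Lemma resK_cvg (F_ : nat -> R -> R[i]) F x1 x2 s : (forall n, right_symbol (F_ n)) ->
  right_symbol F -> 0 < x1 -> 0 < x2 -> 0 < s ->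
  (forall r, ccvg (F_ ^~ r) (F r)) -> resK (F_ n) x1 x2 s @[n --> \oo] --> resK F x1 x2 s.
Proof.
move=> hF_ hF x10 x20 s0 cF; apply: cvgM; first exact: cvg_cst.
have iK := rintegrableZ measurableT s^-1
  (rintegrableZ measurableT (kerKC x1 x2) (sech_integrable (ltr01 : 0 < 1 :> R))).
apply: (Rdominated_cvg measurableT _ _ iK).
- by move=> n; apply: rintegrable_meas; exact: resK_integrand_integrable.
- by apply: rintegrable_meas; exact: resK_integrand_integrable.
- by move=> n r _; exact: resK_integrand_le.
move=> r _; have n0 : s%:C + F r != 0.
  have [_ _ F0] := hF; apply/negP => /eqP /(congr1 (@complex.Re R)); rewrite Re_add /= => h.
  by have := F0 r; lra.
by have [] := ccvgM (ccvg_cst (kerK x1 x2 (r +i* 0))) (ccvgV n0 (ccvgD (ccvg_cst s%:C) (cF r))).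
Qed.

(** On the support of [chi] one has [s >= min(a, b)], where [resK_le] bounds all the integrands by
    the same constant. *)
Lemma resK_chi_cvg (F_ : nat -> R -> R[i]) F x1 x2 a b : (forall n, right_symbol (F_ n)) ->
  right_symbol F -> 0 < x1 -> 0 < x2 -> 0 < a -> 0 < b ->
  (forall r, ccvg (F_ ^~ r) (F r)) ->
  \int[mu]_s (chi a b s * resK (F_ n) x1 x2 s) @[n --> \oo] -->
  \int[mu]_s (chi a b s * resK F x1 x2 s).
Proof.
move=> hF_ hF x10 x20 a0 b0 cF; pose m := Num.min a b.
have m0 : 0 < m by rewrite lt_min a0.
have ig := rintegrableZ measurableT (resKC x1 x2 / m) (chi_integrable a0 b0).
apply: (Rdominated_cvg measurableT _ _ ig).
- by move=> n; apply: rintegrable_meas; exact: resK_integrable.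
- by apply: rintegrable_meas; exact: resK_integrable.
- move=> n s _; rewrite normrM mulrC; have [->|nz] := eqVneq (chi a b s) 0.
    by rewrite normr0 !mulr0.
  have /andP[ms _] := chi_supp nz; have s0 := lt_le_trans m0 ms.
  apply: ler_wpM2r => //; apply: (le_trans (resK_le (hF_ n) x10 x20 s0)).
  have C0 : 0 <= resKC x1 x2 by have := resK_le hF x10 x20 ltr01; rewrite divr1; apply: le_trans.
  by apply: ler_wpM2l => //; rewrite lef_pV2 ?posrE.
move=> s _; have [->|nz] := eqVneq (chi a b s) 0.
  by rewrite mul0r; under eq_fun do rewrite mul0r; exact: cvg_cst.
by apply: cvgM; [exact: cvg_cst|apply: resK_cvg => //; exact: chi_gt0 nz].
Qed.

End resolvent_kernel.

(** * Approximation of a Rogers function by regularised symbols *)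

Section rogers_resolvent.
Variable R : realType.
Notation mu := (@lebesgue_measure R).
Implicit Types (x r s t : R) (z v : R[i]).
Variable f : R[i] -> R[i].
Hypothesis hf : rogers f.

Let N z := f z / z.

Let RHP_neq0 z : 0 < complex.Re z -> z != 0.
Proof. by apply: contraTneq => ->; rewrite ltxx. Qed.

Let df z : 0 < complex.Re z -> exists c, cder f z c.
Proof. by move=> z0; apply: derivable_cder; exact: hf.1. Qed.

Let dN z : 0 < complex.Re z -> exists c, cder N z c.
Proof.
move=> z0; have [c hc] := df z0; have n := RHP_neq0 z0.
by eexists; exact: cderM hc (cderV n (cder_id z)).
Qed.

Let N_ge0 z : 0 < complex.Re z -> 0 <= complex.Re (N z).
Proof. exact: hf.2. Qed.

Definition rogers_line r := f (expR r)%:C.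

Let expR_RHP r : 0 < complex.Re (expR r)%:C.
Proof. exact: expR_gt0. Qed.

Let lineE r : rogers_line r = (expR r)%:C * N (expR r)%:C.
Proof. by rewrite /N mulrCA divff ?mulr1 // RHP_neq0. Qed.

Let d_expR r : rder (fun r => (expR r)%:C) r (expR r)%:C.
Proof. by split => /=; [exact: is_derive_expR|exact: is_derive_cst]. Qed.

Lemma rogers_line_symbol : right_symbol rogers_line.
Proof.
have h r : exists c, rder rogers_line r c.
  by have [c hc] := df (expR_RHP r); eexists; exact: (@rder_comp R f (fun r => (expR r)%:C) r _ _ hc (d_expR r)).
split.
- by move=> r; have [c /rder_continuous[]] := h r.
- by move=> r; have [c /rder_continuous[]] := h r.
- move=> r; rewrite lineE Re_mul /= mul0r subr0.
  by rewrite mulr_ge0 ?expR_ge0 //; exact: N_ge0 (expR_RHP r).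
Qed.

Section regularised.
Variables a eta : R.
Hypotheses (a0 : 0 < a) (a1 : a < 1) (eta0 : 0 < eta).

Let den z := 1 + eta%:C * N z.

Let Re_den z : 0 < complex.Re z -> 1 <= complex.Re (den z).
Proof.
move=> /N_ge0 h; rewrite Re_add Re_mul [complex.Re eta%:C]/= [complex.Im eta%:C]/= mul0r subr0 /=.
by rewrite lerDl mulr_ge0 // ltW.
Qed.

Let den_ge1 z : 0 < complex.Re z -> 1 <= nm (den z).
Proof. by move=> /Re_den h; apply: le_trans (le_trans h (ler_norm _)) (Re_nm _). Qed.

Let den_neq0 z : 0 < complex.Re z -> den z != 0.
Proof. by move=> /den_ge1 h; rewrite -nm_gt0 (lt_le_trans ltr01). Qed.

(* This has a nonnegative real part like [N], but it is bounded. *)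
Definition regN z := N z / den z.

Let d_regN z : 0 < complex.Re z -> exists c, cder regN z c.
Proof.
move=> z0; have [c hc] := dN z0.
have hd := cderD (cder_cst 1 z) (cderM (cder_cst eta%:C z) hc).
by eexists; exact: cderM hc (@cderV R den z _ (den_neq0 z0) hd).
Qed.

(** Where [N] is nonzero, [regN] is [1 / (1 / N + eta)] and inversion preserves the half-plane; the
    explicit computation also covers the zeros of [N]. *)
Let regN_ge0 z : 0 < complex.Re z -> 0 <= complex.Re (regN z).
Proof.
move=> z0; have h := N_ge0 z0; have n0 := lt_le_trans ltr01 (den_ge1 z0).
rewrite /regN Re_mul Re_inv Im_inv.
have -> : complex.Re (den z) = 1 + eta * complex.Re (N z).
  by rewrite Re_add Re_mul [complex.Re eta%:C]/= [complex.Im eta%:C]/= mul0r subr0.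
have -> : complex.Im (den z) = eta * complex.Im (N z).
  by rewrite Im_add Im_mul [complex.Re eta%:C]/= [complex.Im eta%:C]/= mul0r addr0 /= add0r.
move: (complex.Re (N z)) (complex.Im (N z)) h => u w u0.
have -> : u * ((1 + eta * u) / nm (den z) ^+ 2) - w * (- (eta * w) / nm (den z) ^+ 2) =
  (u + eta * (u ^+ 2 + w ^+ 2)) / nm (den z) ^+ 2 by ring.
by rewrite divr_ge0 ?sqr_ge0 // addr_ge0 // mulr_ge0 ?(ltW eta0) // addr_ge0 ?sqr_ge0.
Qed.

(** [eta N = den - 1] and [|den| >= 1] give [eta |N| <= 2 |den|]. *)
Let regN_le z : 0 < complex.Re z -> nm (regN z) <= 2 / eta.
Proof.
move=> z0; have h := den_ge1 z0; have n0 := lt_le_trans ltr01 h.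
rewrite nmM nmV ler_pdivrMr // mulrAC ler_pdivlMr //.
have : nm (eta%:C * N z) <= nm (den z) + 1.
  have -> : eta%:C * N z = den z - 1 by rewrite /den addrAC subrr add0r.
  by apply: (le_trans (nmDB _ _)); rewrite nm1.
by rewrite nmM nm_real gtr0_norm // mulrC; lra.
Qed.

Let regN' z := if pselect (0 < complex.Re z) is left h then projT1 (cid (d_regN h)) else 0.

Let regN'P z : 0 < complex.Re z -> cder regN z (regN' z).
Proof.
move=> z0; rewrite /regN'; case: pselect => // h.
exact: projT2 (cid (d_regN h)).
Qed.

Let at_lt t : `|t| <= pi / 2 -> `|a * t| < pi / 2.
Proof.
move=> ht; rewrite normrM gtr0_norm //; have p0 := pihalf_gt0 R.
apply: (@le_lt_trans _ _ (a * (pi / 2))); first by rewrite ler_wpM2l // ltW.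
by rewrite gtr_pMl.
Qed.

Let scaleE r t : a%:C * (r +i* t) = (a * r) +i* (a * t).
Proof. by apply: complex_ext; rewrite !ReImE /=; ring. Qed.

Let in_RHP r t : `|t| <= pi / 2 -> 0 < complex.Re (cexp (a%:C * (r +i* t))).
Proof. by move=> ht; rewrite scaleE; apply: strip_Re_gt0; exact: at_lt. Qed.

Definition regM v := regN (cexp (a%:C * v)).

Let regM' v := regN' (cexp (a%:C * v)) * (cexp (a%:C * v) * a%:C).

Let d_regM r t : `|t| <= pi / 2 -> cder regM (r +i* t) (regM' (r +i* t)).
Proof.
move=> ht; have h : cder (fun v => cexp (a%:C * v)) (r +i* t) (cexp (a%:C * (r +i* t)) * a%:C).
  apply: cder_eq (@cder_comp R (@cexp R) (fun v => a%:C * v) _ _ _ (cder_cexp _)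
    (cderM (cder_cst a%:C (r +i* t)) (cder_id (r +i* t)))) _.
  by rewrite mulr1 mulr0 addr0.
exact: (@cder_comp R regN (fun v => cexp (a%:C * v)) _ _ _ (regN'P (in_RHP r ht)) h).
Qed.

Let cos_scale t : `|t| <= pi / 2 -> cos t <= cos (a * t).
Proof.
move=> ht; have p0 := pihalf_gt0 R; have := pi_gt0 R => pp.
rewrite -cos_norm -[leRHS]cos_norm normrM gtr0_norm //.
have t0 : 0 <= `|t| by [].
have h : a * `|t| <= `|t| by rewrite ler_piMl // ltW.
have h0 : 0 <= a * `|t| by rewrite mulr_ge0 // ltW.
move: h; rewrite le_eqVlt => /orP[/eqP ->//|h]; rewrite ltW // ltr_cos ?in_itv /= ?t0 ?h0 /=; lra.
Qed.

(** For [z = e^(a v)], Schwarz-Pick bounds [|regN'(z)| Re z] by [Re regN(z)]. The chain rule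
    contributes the factor [a], and [Re z = e^(a r) cos (a t)] is at least [e^(a r) cos t]. *)
Let sM r t : `|t| <= pi / 2 -> nm (regM' (r +i* t)) * cos t <= a * complex.Re (regM (r +i* t)).
Proof.
move=> ht; have z0 := in_RHP r ht.
have := schwarz_pick_half_plane z0 d_regN regN_ge0 (regN'P z0).
rewrite /regM' /regM !nmM nm_real gtr0_norm // nm_cexp => h.
rewrite (mulrC _ a) !mulrA (mulrC _ a) -!mulrA ler_wpM2l ?(ltW a0) //.
apply: le_trans h; rewrite scaleE Re_cexp ler_wpM2l ?nm_ge0 //.
by rewrite ler_wpM2l ?expR_ge0 // cos_scale.
Qed.

Definition reg_symbol eps r := cexp (r +i* 0) * (regM (r +i* 0) + eps%:C).

Lemma reg_symbol_right eps : 0 <= eps -> right_symbol (reg_symbol eps).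
Proof.
move=> e0; have t0 : `|0 : R| <= pi / 2 by rewrite normr0 ltW // pihalf_gt0.
have h r : cder (fun v => cexp v * (regM v + eps%:C)) (r +i* 0) _ :=
  cderM (cder_cexp _) (cderD (d_regM r t0) (cder_cst eps%:C _)).
split.
- by move=> r; have [] := rder_continuous (rder_cder_hline (h r)).
- by move=> r; have [] := rder_continuous (rder_cder_hline (h r)).
move=> r; rewrite /reg_symbol expR_line Re_mul Re_add /= mul0r subr0.
rewrite mulr_ge0 ?expR_ge0 // addr_ge0 //.
by apply: regN_ge0; apply: in_RHP.
Qed.

Lemma reg_xi eps s1 s2 : 0 < eps -> 0 < s1 -> s1 <= s2 ->
  cbf_log (fun x => \int[mu]_s (chi s1 s2 s * resK (reg_symbol eps) 1 x s)).
Proof.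
move=> e0 s10 s12.
exact: (@approx_xi R regM regM' eps (2 / eta) e0 d_regM (fun r t ht => regN_ge0 (in_RHP r ht))
  (fun r t ht => regN_le (in_RHP r ht)) s1 s2 s10 s12).
Qed.

Lemma reg_tau eps x1 x2 : 0 < eps -> 0 < x1 -> x1 <= x2 ->
  cbf_log (fun tau => \int[mu]_s (chi 1 tau s * resK (reg_symbol eps) x1 x2 s)).
Proof.
move=> e0 x10 x12.
exact: (@approx_tau R regM regM' a eps (2 / eta) a0 a1 e0 d_regM (fun r t ht => regN_ge0 (in_RHP r ht))
  (fun r t ht => regN_le (in_RHP r ht)) sM x1 x2 x10 x12).
Qed.

End regularised.

(** The shift [n.+2] keeps [a_ 0] positive. In [F_] the same [e_ n] serves as [eta] and as [eps]. *)
Let a_ n : R := 1 - (n.+2%:R)^-1.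
Let e_ n : R := (n.+1%:R)^-1.

Let a_0 n : 0 < a_ n.
Proof. by rewrite subr_gt0 invf_lt1 ?ltr0n // ltr1n. Qed.

Let a_1 n : a_ n < 1.
Proof. by rewrite ltrBlDr ltrDl invr_gt0 ltr0n. Qed.

Let e_0 n : 0 < e_ n. Proof. by rewrite invr_gt0 ltr0n. Qed.

Let e_cvg : e_ @ \oo --> (0 : R). Proof. exact: cvg_harmonic. Qed.

Let a_cvg : a_ @ \oo --> (1 : R).
Proof.
rewrite -[X in _ --> X]subr0; apply: cvgB; first exact: cvg_cst.
by have := @cvg_harmonic R; rewrite -(cvg_shiftS _).
Qed.

Let F_ n := reg_symbol (a_ n) (e_ n) (e_ n).

Let F_cvg r : ccvg (F_ ^~ r) (rogers_line r).
Proof.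
have -> : rogers_line r = cexp (r +i* 0) * (N (expR r)%:C / (1 + (0 : R)%:C * N (expR r)%:C) + 0%:C).
  by rewrite expR_line lineE mul0r !addr0 divr1.
have hN : ccvg (fun n => N (cexp ((a_ n)%:C * (r +i* 0)))) (N (expR r)%:C).
  have [c hc] := dN (expR_RHP r); apply: ccvg_cder hc _.
  have e n : cexp ((a_ n)%:C * (r +i* 0)) = (expR (a_ n * r))%:C.
    have -> : (a_ n)%:C * (r +i* 0) = (a_ n * r)%:C by rewrite rmorphM.
    by rewrite cexp_real.
  under eq_fun do rewrite e; apply: ccvg_real.
  apply: (continuous_cvg _ (@continuous_expR R r)).
  by rewrite -[X in _ --> X]mul1r; apply: cvgM => //; exact: cvg_cst.
apply: ccvgM; first exact: ccvg_cst.
apply: ccvgD; last exact: ccvg_real.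
apply: ccvgM => //; apply: ccvgV; first by rewrite mul0r addr0 oner_neq0.
apply: ccvgD; first exact: ccvg_cst.
by apply: ccvgM => //; exact: ccvg_real.
Qed.

Let F_right n : right_symbol (F_ n).
Proof. by apply: reg_symbol_right => //; exact: ltW. Qed.

Lemma rogers_xi s1 s2 : 0 < s1 -> s1 <= s2 ->
  cbf_log (fun x => \int[mu]_s (chi s1 s2 s * resK rogers_line 1 x s)).
Proof.
move=> s10 s12; apply: (@cbf_log_limit R
  (fun n x => \int[mu]_s (chi s1 s2 s * resK (F_ n) 1 x s))).
  by move=> n; apply: reg_xi.
move=> x x0; apply: resK_chi_cvg => //; first exact: rogers_line_symbol.
exact: lt_le_trans s12.
Qed.

Lemma rogers_tau x1 x2 : 0 < x1 -> x1 <= x2 ->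
  cbf_log (fun tau => \int[mu]_s (chi 1 tau s * resK rogers_line x1 x2 s)).
Proof.
move=> x10 x12; apply: (@cbf_log_limit R
  (fun n tau => \int[mu]_s (chi 1 tau s * resK (F_ n) x1 x2 s))).
  by move=> n; apply: reg_tau.
move=> tau t0; apply: resK_chi_cvg => //; first exact: rogers_line_symbol.
exact: lt_le_trans x12.
Qed.

(* Gronwall's inequality for [N (e^r)], whose logarithmic derivative is at most 1 by
   the Schwarz-Pick estimate. *)
Lemma rogers_line_growth : exists2 B : R, 0 <= B &
  forall r, nm (rogers_line r) <= B * (1 + expR (2 * r)).
Proof.
pose n r := N (expR r)%:C.
have dn r : exists2 c, rder n r c & nm c <= nm (n r).
  have [c hc] := dN (expR_RHP r); exists (c * (expR r)%:C).
    exact: (@rder_comp R N (fun r => (expR r)%:C) r _ _ hc (d_expR r)).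
  have := schwarz_pick_half_plane (expR_RHP r) dN N_ge0 hc.
  rewrite nmM nm_real gtr0_norm ?expR_gt0 // => h; apply: (le_trans h).
  exact: le_trans (ler_norm _) (Re_nm _).
pose h r := complex.Re (n r) ^+ 2 + complex.Im (n r) ^+ 2.
have h0 r : 0 <= h r by rewrite addr_ge0 ?sqr_ge0.
have dh r : exists2 c : R, is_derive r 1 h c & `|c| <= 2 * h r.
  have [c [d1 d2] hc] := dn r.
  exists (2 * (complex.Re (n r) * complex.Re c + complex.Im (n r) * complex.Im c)).
    rewrite /h; under eq_fun do rewrite !expr2.
    apply: is_derive_eq1 (is_deriveD (is_deriveM1 d1 d1) (is_deriveM1 d2 d2)) _; ring.
  have : nm c ^+ 2 <= h r by rewrite /h -nm_sq ler_sqr ?nnegrE ?nm_ge0.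
  rewrite nm_sq /h ler_norml; move: (complex.Re c) (complex.Im c) (complex.Re (n r)) (complex.Im (n r)).
  move=> x' y' x y k; have k1 := sqr_ge0 (x - x'); have k2 := sqr_ge0 (y - y').
  have k3 := sqr_ge0 (x + x'); have k4 := sqr_ge0 (y + y').
  by apply/andP; split; nra.
have up (r : R) : 0 <= r -> h r <= h 0 * expR (2 * r).
  move=> r0; pose u t := expR (-2 * t) * h t.
  have du t : exists2 c, is_derive t 1 u c & c <= 0.
    have [c d hc] := dh t; exists (expR (-2 * t) * c + h t * (expR (-2 * t) * -2)).
      exact: (@is_deriveM1 R (fun t => expR (-2 * t)) h t _ _ (is_derive_expRM (-2) t) d).
    have -> : expR (-2 * t) * c + h t * (expR (-2 * t) * -2) = expR (-2 * t) * (c - 2 * h t) by ring.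
    by rewrite mulr_ge0_le0 ?expR_ge0 // subr_le0; apply: le_trans hc; exact: ler_norm.
  have [t _ e] := @real_mvt R u (fun t => projT1 (cid2 (du t))) 0 r r0
    (fun t _ => let: conj a _ := projT2 (cid2 (du t)) in a).
  have : u r - u 0 <= 0.
    rewrite e; case: (cid2 (du t)) => c /= _ c0; rewrite subr0.
    by rewrite mulr_le0_ge0.
  rewrite /u mulr0 expR0 mul1r subr_le0 mulNr expRN.
  by rewrite mulrC ler_pdivrMr ?expR_gt0.
have down (r : R) : r <= 0 -> h r * expR (2 * r) <= h 0.
  move=> r0; pose u t := expR (2 * t) * h t.
  have du t : exists2 c, is_derive t 1 u c & 0 <= c.
    have [c d hc] := dh t; exists (expR (2 * t) * c + h t * (expR (2 * t) * 2)).
      exact: (@is_deriveM1 R (fun t => expR (2 * t)) h t _ _ (is_derive_expRM 2 t) d).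
    have -> : expR (2 * t) * c + h t * (expR (2 * t) * 2) = expR (2 * t) * (c + 2 * h t) by ring.
    rewrite mulr_ge0 ?expR_ge0 //; move: hc; rewrite ler_norml => /andP[]; lra.
  have [t _ e] := @real_mvt R u (fun t => projT1 (cid2 (du t))) r 0 r0
    (fun t _ => let: conj a _ := projT2 (cid2 (du t)) in a).
  have : 0 <= u 0 - u r.
    rewrite e; case: (cid2 (du t)) => c /= _ c0; rewrite sub0r.
    by rewrite mulr_ge0 // oppr_ge0.
  by rewrite /u mulr0 expR0 mul1r subr_ge0 mulrC.
have nE r : nm (n r) ^+ 2 = h r by rewrite nm_sq.
exists (nm (n 0)); first exact: nm_ge0.
move=> r; rewrite lineE nmM nm_real gtr0_norm ?expR_gt0 // -/(n r).
have er := expR_gt0 r; have e2 : expR (2 * r) = expR r ^+ 2 by rewrite expRM_natl.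
have n0 := nm_ge0 (n 0); have nr := nm_ge0 (n r).
rewrite e2; have [r0|/ltW r0] := leP 0 r.
  have k : nm (n r) <= nm (n 0) * expR r.
    rewrite -(@ler_pXn2r _ 2) ?nnegrE ?mulr_ge0 ?(ltW er) // exprMn !nE -e2; exact: up.
  have := ler_wpM2l (ltW er) k; nra.
have k : nm (n r) * expR r <= nm (n 0).
  rewrite -(@ler_pXn2r _ 2) ?nnegrE ?mulr_ge0 ?(ltW er) // exprMn !nE -e2; exact: down.
have := mulr_ge0 n0 (sqr_ge0 (expR r)); nra.
Qed.

End rogers_resolvent.

(** * Integrals over the positive half-line *)

Section positive_half_line.
Variable R : realType.
Notation mu := (@lebesgue_measure R).
Implicit Types (f F : R -> R) (x t a : R).

Definition posR : set R := [set t | 0 < t].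

Lemma measurable_posR : measurable (posR : set (measurableTypeR R)).
Proof.
have -> : posR = `]0, +oo[%classic by apply/seteqP; split=> x; rewrite /= in_itv /= andbT.
exact: measurable_itv.
Qed.

Definition pos_itv (n : nat) : set R := `[(n.+1%:R)^-1, n.+1%:R]%classic.

Lemma measurable_pos_itv n : measurable (pos_itv n : set (measurableTypeR R)).
Proof. exact: measurable_itv. Qed.

Lemma pos_itv_gt0 n x : (n.+1%:R)^-1 <= x <= n.+1%:R -> 0 < x.
Proof. by move=> /andP[h _]; apply: lt_le_trans h; rewrite invr_gt0 ltr0n. Qed.

Lemma pos_itv_le n : (n.+1%:R)^-1 <= n.+1%:R :> R.
Proof. by apply: (@le_trans _ _ 1); rewrite ?invf_le1 ?ltr0n ?ler1n. Qed.

Lemma pos_itv_sub n : pos_itv n `<=` posR.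
Proof. by move=> x; rewrite /pos_itv /= in_itv /=; exact: pos_itv_gt0. Qed.

Lemma pos_itv_in x : 0 < x -> \forall n \near \oo, pos_itv n x.
Proof.
move=> x0; exists (maxn (Num.bound x) (Num.bound x^-1)) => // n /=.
rewrite geq_max => /andP[n1 n2]; rewrite /pos_itv /= in_itv /=.
have h y : 0 < y -> (Num.bound y <= n)%N -> y <= n.+1%:R.
  move=> y0 hn; apply: (le_trans (ltW (archi_boundP (ltW y0)))).
  by rewrite ler_nat ltnW // ltnS.
apply/andP; split; last exact: h.
by rewrite -[leRHS]invrK lef_pV2 ?posrE ?invr_gt0 ?ltr0n // h // invr_gt0.
Qed.

Lemma pos_itv_bigcup : \bigcup_n pos_itv n = posR.
Proof.
apply/seteqP; split=> x; first by move=> [n _]; exact: pos_itv_sub.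
by move=> /pos_itv_in [N _ h]; exists N => //; apply: h => /=.
Qed.

Lemma Rintegral_pos_cvg f : rintegrable mu posR f ->
  \int[mu]_(x in pos_itv n) f x @[n --> \oo] --> \int[mu]_(x in posR) f x.
Proof.
move=> hf; have mP := measurable_posR.
under eq_fun do rewrite Rintegral_mkcond; rewrite Rintegral_mkcond.
have hfT : rintegrable mu setT (f \_ posR).
  have := (@integrable_mkcond _ (measurableTypeR R) R mu posR (EFin \o f) mP).1 hf.
  by congr (_.-integrable _ _); apply/funext => s; rewrite /= restrict_EFin.
apply: (@Rdominated_cvg _ _ _ mu setT measurableT _ _ (fun x => `|(f \_ posR) x|)) => //.
- move=> n; apply: (measurable_restrictT _ (measurable_pos_itv n)).1.
  by apply: measurable_funS (rintegrable_meas hf) => //; exact: pos_itv_sub.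
- exact: rintegrable_meas hfT.
- exact: rintegrable_abs.
- move=> n x _; rewrite !patchE; case: ifP => h; last by rewrite normr0.
  by rewrite mem_set //; apply: (@pos_itv_sub n); rewrite inE in h.
move=> x _; have [x0|x0] := ltP 0 x; last first.
  rewrite patchE memNset; last by rewrite /posR /= ltNge x0.
  have e n : (f \_ (pos_itv n)) x = 0.
    rewrite patchE memNset // => /(@pos_itv_sub n); rewrite /posR /= ltNge x0 //.
  by under eq_fun do rewrite e; exact: cvg_cst.
apply: cvg_near_cst; have := pos_itv_in x0; apply: filterS => n h.
by rewrite !patchE !mem_set.
Qed.

Lemma pos_FTC f F (l : R) : rintegrable mu posR f ->
  (forall x, 0 < x -> {for x, continuous f}) ->
  (forall x, 0 < x -> is_derive x 1 F (f x)) ->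
  (F n.+1%:R - F (n.+1%:R)^-1 @[n --> \oo] --> l) -> \int[mu]_(x in posR) f x = l.
Proof.
move=> hf cf dF hl; have h := Rintegral_pos_cvg hf.
have e : (fun n => \int[mu]_(x in pos_itv n) f x) = (fun n => F n.+1%:R - F (n.+1%:R)^-1).
  apply/funext => n; apply: (@Rintegral_itv_FTC R f F); first exact: pos_itv_le.
    by move=> x /pos_itv_gt0; exact: dF.
  by move=> x /pos_itv_gt0; exact: cf.
by rewrite e in h; rewrite -(cvg_lim _ hl) // (cvg_lim _ h).
Qed.

Lemma measurable_pos f : (forall x, 0 < x -> {for x, continuous f}) -> measurable_fun posR f.
Proof.
move=> cf; apply: open_continuous_measurable_fun.
  have -> : posR = `]0, +oo[%classic by apply/seteqP; split=> x; rewrite /= in_itv /= andbT.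
  exact: interval_open.
by move=> x; rewrite inE; exact: cf.
Qed.

Lemma pos_ge0_FTC f F (C : R) : (forall x, 0 < x -> 0 <= f x) ->
  (forall x, 0 < x -> {for x, continuous f}) ->
  (forall x, 0 < x -> is_derive x 1 F (f x)) ->
  (forall x y, 0 < x -> 0 < y -> F x - F y <= C) -> rintegrable mu posR f.
Proof.
move=> f0 cf dF FC; have mf := measurable_pos cf.
have h := @ge0_nondecreasing_set_cvg_integral _ (measurableTypeR R) R pos_itv (EFin \o f) mu _
  measurable_pos_itv _ _.
have {}h : (\int[mu]_(x in pos_itv n) (f x)%:E @[n --> \oo] --> \int[mu]_(x in posR) (f x)%:E)%E.
  rewrite -pos_itv_bigcup; apply: h.
  - apply/nondecreasing_seqP => n; apply/subsetPset => x.
    rewrite /pos_itv /= !in_itv /= => /andP[x1 x2]; apply/andP; split.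
      by apply: le_trans x1; rewrite lef_pV2 ?posrE ?ltr0n // ler_nat.
    by apply: (le_trans x2); rewrite ler_nat.
  - by move=> n; apply/measurable_EFinP; apply: measurable_funS mf => //; [exact: measurable_posR|exact: pos_itv_sub].
  - by move=> n x /pos_itv_sub x0 /=; rewrite lee_fin f0.
have hC : (\int[mu]_(x in posR) (f x)%:E <= C%:E)%E.
  rewrite -(cvg_lim _ h) //; apply: lime_le; first by apply/cvg_ex; eexists; exact: h.
  apply: nearW => n; rewrite /pos_itv.
  rewrite (@integral_itv_FTC R f F _ _ (pos_itv_le n) (fun x hx => dF x (pos_itv_gt0 hx))
    (fun x hx => cf x (pos_itv_gt0 hx))).
  by rewrite lee_fin; apply: FC; rewrite ?invr_gt0 ltr0n.
apply/integrableP; split; first exact/measurable_EFinP.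
apply: le_lt_trans (ltry C); apply: le_trans hC.
rewrite le_eqVlt; apply/orP; left; apply/eqP; apply: eq_integral => x.
by rewrite inE => x0; rewrite /= ger0_norm // f0.
Qed.

Lemma exp_integrable a : 0 < a -> rintegrable mu posR (fun t => expR (- (a * t))).
Proof.
move=> a0; have d x : is_derive x 1 (fun t => - (a^-1 * expR (- a * t))) (expR (- (a * x))).
  have h := is_deriveN (is_deriveM1 (is_derive_cst a^-1 x (1 : R)) (is_derive_expRM (- a) x)).
  by apply: is_derive_eq1 h _; rewrite mulr0 addr0 mulNr /cst /=; field; rewrite gt_eqF.
apply: (@pos_ge0_FTC _ (fun t => - (a^-1 * expR (- a * t))) a^-1) => //.
- move=> x _; apply: (continuous_cvg _ (@continuous_expR R _)); apply: cvgN.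
  by apply: cvgM; [exact: cvg_cst|exact: cvg_id].
move=> x y x0 y0; have a1 : 0 < a^-1 by rewrite invr_gt0.
have h1 : 0 <= a^-1 * expR (- a * x) by rewrite mulr_ge0 ?expR_ge0 // ltW.
have h2 : a^-1 * expR (- a * y) <= a^-1.
  by rewrite ler_piMr ?(ltW a1) // expR_le1 mulNr oppr_le0 mulr_ge0 // ltW.
lra.
Qed.

(** A positive exponent is needed against [1 / t] at 0, and 1/4 is small enough for
    [|f(e^r)|^(1/4) = O(1 + e^(r/2))] to be integrable against the Poisson kernel. *)
Definition root4 (t : R) : R := Num.sqrt (Num.sqrt t).

Lemma root4_gt0 t : 0 < t -> 0 < root4 t.
Proof. by move=> t0; rewrite !sqrtr_gt0. Qed.

Lemma root4_sq t : root4 t ^+ 2 = Num.sqrt t.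
Proof. by rewrite sqr_sqrtr // sqrtr_ge0. Qed.

Lemma root4_pow t : 0 <= t -> root4 t ^+ 4 = t.
Proof. by move=> t0; rewrite (exprM _ 2 2) root4_sq sqr_sqrtr. Qed.

Lemma continuous_root4 : continuous root4.
Proof.
move=> t; apply: (continuous_cvg _ (@sqrt_continuous R _)); exact: sqrt_continuous.
Qed.

(** Comparison with the derivative [t^(-3/4) / (4 (1 + sqrt t))] of [atan (t^(1/4))]: the constant 4
    comes from there, and [2 + 1/a] from [e^(-a t) (1 + sqrt t) <= 2 + 1/a]. *)
Lemma root4_exp_integrable a : 0 < a ->
  rintegrable mu posR (fun t => expR (- (a * t)) * root4 t / t).
Proof.
move=> a0; pose g t := (1 + root4 t ^+ 2)^-1 * ((2 * root4 t)^-1 * (2 * Num.sqrt t)^-1).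
have cr := continuous_root4.
have csq : continuous (fun t => root4 t ^+ 2).
  by move=> t; under eq_fun do rewrite expr2; apply: cvgM; exact: cr.
have ig : rintegrable mu posR g.
  apply: (@pos_ge0_FTC g (fun t => atan (root4 t)) pi).
  - move=> x x0; rewrite /g mulr_ge0 ?invr_ge0 ?addr_ge0 ?sqr_ge0 //.
    by rewrite mulr_ge0 // invr_ge0 mulr_ge0 // sqrtr_ge0.
  - move=> x x0; have y0 := root4_gt0 x0; apply: cvgM.
      apply: cvgV; first by rewrite gt_eqF // ltr_wpDr // sqr_ge0.
      by apply: cvgD; [exact: cvg_cst|exact: csq].
    apply: cvgM; apply: cvgV; rewrite ?gt_eqF ?mulr_gt0 ?sqrtr_gt0 //.
      by apply: cvgM; [exact: cvg_cst|exact: cr].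
    by apply: cvgM; [exact: cvg_cst|exact: sqrt_continuous].
  - move=> x x0; have s0 : 0 < Num.sqrt x by rewrite sqrtr_gt0.
    have h1 := @is_derive_comp1 R (@Num.sqrt R) (@Num.sqrt R) x _ _ (is_derive1_sqrt s0) (is_derive1_sqrt x0).
    have h2 := @is_derive_comp1 R (@atan R) root4 x _ _ (is_derive1_atan _) h1.
    exact: h2.
  - move=> x y _ _; have := atan_ltpi2 (root4 x); have := atan_gtNpi2 (root4 y); lra.
have K0 : 0 < 4 * (2 + a^-1) by rewrite mulr_gt0 // addr_gt0 // invr_gt0.
have := rintegrableZ measurable_posR (4 * (2 + a^-1)) ig.
apply: rintegrable_le; first exact: measurable_posR.
  apply: measurable_pos => x x0; apply: cvgM; last first.
    by apply: cvgV; [rewrite gt_eqF|exact: cvg_id].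
  apply: cvgM; last exact: cr.
  apply: (continuous_cvg _ (@continuous_expR R _)); apply: cvgN.
  by apply: cvgM; [exact: cvg_cst|exact: cvg_id].
move=> x x0; have y0 := root4_gt0 x0; rewrite /g root4_sq.
have e1 : x = root4 x ^+ 4 by rewrite root4_pow // ltW.
have e2 : Num.sqrt x = root4 x ^+ 2 by rewrite root4_sq.
rewrite ger0_norm; last by rewrite !mulr_ge0 ?expR_ge0 ?invr_ge0 ?(ltW y0) // ltW.
have key : expR (- (a * x)) * (1 + root4 x ^+ 2) <= 2 + a^-1.
  rewrite expRN mulrC ler_pdivrMr ?expR_gt0 //.
  apply: (@le_trans _ _ ((2 + a^-1) * (1 + a * x))); last first.
    by rewrite ler_wpM2l ?expR_ge1Dx // addr_ge0 // invr_ge0 ltW.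
  have -> : (2 + a^-1) * (1 + a * x) = 2 + x + (a^-1 + 2 * (a * x)) by field; rewrite gt_eqF.
  have h1 : 0 <= a^-1 + 2 * (a * x) by rewrite addr_ge0 ?invr_ge0 ?mulr_ge0 ?(ltW a0) // ltW.
  have h2 : root4 x ^+ 2 <= 1 + x.
    by rewrite [in leRHS]e1; have := sqr_ge0 (root4 x ^+ 2 - 1); nra.
  lra.
rewrite e2; set y := root4 x in y0 e1 key *; rewrite [X in _ / X]e1.
have y2 : 0 < 1 + y ^+ 2 by rewrite ltr_wpDr // sqr_ge0.
have -> : expR (- (a * x)) * y / y ^+ 4 = (expR (- (a * x)) * (1 + y ^+ 2)) / ((1 + y ^+ 2) * y ^+ 3).
  by field; rewrite !gt_eqF.
have -> : 4 * (2 + a^-1) * ((1 + y ^+ 2)^-1 * ((2 * y)^-1 * (2 * y ^+ 2)^-1)) =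
  (2 + a^-1) / ((1 + y ^+ 2) * y ^+ 3) by field; rewrite !gt_eqF.
by rewrite ler_wpM2r // invr_ge0 mulr_ge0 ?(ltW y2) // exprn_ge0 // ltW.
Qed.

End positive_half_line.

(** * Ladder exponents *)

Section laplace.
Variable R : realType.
Notation mu := (@lebesgue_measure R).
Notation posR := (@posR R).
Implicit Types (t s a b x r : R) (k w : R[i]).

Lemma RintegralB2 d (T : measurableType d) (nu : {measure set T -> \bar R}) (D : set T)
    (f g : T -> R) : measurable D -> rintegrable nu D f -> rintegrable nu D g ->
  \int[nu]_(x in D) (f x - g x) = \int[nu]_(x in D) f x - \int[nu]_(x in D) g x.
Proof.
move=> mD hf hg; have := Rintegral_lin mD 1 (-1) hf hg; rewrite mul1r mulN1r => <-.
by apply: eq_Rintegral => x _; rewrite mul1r mulN1r.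
Qed.

Lemma measurable_expRM a : measurable_fun posR (fun t => expR (- (a * t))).
Proof.
apply: measurable_pos => x _; apply: (continuous_cvg _ (@continuous_expR R _)); apply: cvgN.
by apply: cvgM; [exact: cvg_cst|exact: cvg_id].
Qed.

Lemma measurable_inv_pos : measurable_fun posR (fun t : R => t^-1).
Proof. by apply: measurable_pos => x x0; apply: cvgV; [rewrite gt_eqF|exact: cvg_id]. Qed.

Lemma expR_scale_cvg s : 0 < s -> expR (- (s * n.+1%:R)) @[n --> \oo] --> (0 : R).
Proof.
move=> s0; apply: (@squeeze_cvgr _ _ _ _ (fun=> 0) (fun n => s^-1 * (n.+1%:R)^-1)).
- apply: nearW => n; rewrite expR_ge0 /= expRN -invfM.
  have h : 0 < s * n.+1%:R by rewrite mulr_gt0.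
  rewrite lef_pV2 ?posrE ?expR_gt0 //.
  by apply: le_trans (expR_ge1Dx _); rewrite lerDr.
- exact: cvg_cst.
by rewrite -(mulr0 s^-1); apply: cvgM; [exact: cvg_cst|exact: cvg_harmonic].
Qed.

Lemma laplace_exp k w s : 0 < s -> 0 <= complex.Re w ->
  \int[mu]_(t in posR) (expR (- (s * t)) * complex.Re (k * cexp (- (t%:C * w)))) =
  complex.Re (k * (s%:C + w)^-1).
Proof.
move=> s0 w0; pose z := - (s%:C + w).
have rz : complex.Re z <= - s by rewrite Re_opp Re_add /=; lra.
have nz : z != 0.
  by apply/negP => /eqP e; move: rz; rewrite e /=; lra.
have fE t : expR (- (s * t)) * complex.Re (k * cexp (- (t%:C * w))) = complex.Re (k * cexp (t%:C * z)).
  have -> : t%:C * z = (- (s * t))%:C + - (t%:C * w).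
    rewrite /z rmorphN rmorphM /=; ring.
  rewrite cexpD cexp_real mulrCA [RHS]Re_mul [complex.Re (_%:C)]/= [complex.Im (_%:C)]/= mul0r subr0 //.
under eq_Rintegral do rewrite fE.
pose G t := complex.Re (k / z * cexp (t%:C * z)).
have dG t : is_derive t 1 G (complex.Re (k * cexp (t%:C * z))).
  have [h _] := rderZ (k / z) (rder_cexp_line z t).
  by apply: is_derive_eq1 h _; rewrite mulrA divfK.
have cont t : {for t, continuous (fun t => complex.Re (k * cexp (t%:C * z)))}.
  by have [] := rder_continuous (rderZ k (rder_cexp_line z t)).
have zt t : complex.Re (t%:C * z) = t * complex.Re z by rewrite !ReImE /=; ring.
have nmE t : 0 <= t -> nm (cexp (t%:C * z)) <= expR (- (s * t)).
  move=> t0; rewrite nm_cexp ler_expR zt.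
  have : t * complex.Re z <= t * - s by rewrite ler_wpM2l.
  lra.
have int : rintegrable mu posR (fun t => complex.Re (k * cexp (t%:C * z))).
  have := rintegrableZ (@measurable_posR R) (nm k) (exp_integrable s0).
  apply: rintegrable_le; first exact: measurable_posR.
    by apply: measurable_pos => t _; exact: cont.
  move=> t t0; apply: (le_trans (Re_nm _)); rewrite nmM ler_wpM2l ?nm_ge0 //.
  by apply: nmE; exact: ltW.
apply: (pos_FTC int (fun t _ => cont t) (fun t _ => dG t)).
have -> : complex.Re (k * (s%:C + w)^-1) = 0 - G 0.
  have -> : (s%:C + w)^-1 = - z^-1 by rewrite /z invrN opprK.
  by rewrite /G mul0r cexp0 mulr1 mulrN Re_opp sub0r.
apply: cvgB; last first.
  apply: (continuous_cvg _ (is_derive_cont (dG 0))); exact: cvg_harmonic.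
apply/norm_cvg0P; apply: (@squeeze_cvgr _ _ _ _ (fun=> 0) (fun n => nm (k / z) * expR (- (s * n.+1%:R)))).
- apply: nearW => n; rewrite normr_ge0 /=; apply: (le_trans (Re_nm _)); rewrite nmM.
  by rewrite ler_wpM2l ?nm_ge0 // nmE.
- exact: cvg_cst.
by rewrite -(mulr0 (nm (k / z))); apply: cvgM; [exact: cvg_cst|exact: expR_scale_cvg].
Qed.

(** The Frullani form of the factor [1 / t]: a difference of exponentials over [t] becomes an
    integral over the Laplace variable [s]. *)
Lemma chi_exp a b t : 0 < a -> 0 < b -> 0 < t ->
  rintegrable mu setT (fun s => chi a b s * expR (- (s * t))) /\
  \int[mu]_s (chi a b s * expR (- (s * t))) = (expR (- (a * t)) - expR (- (b * t))) / t.
Proof.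
move=> a0 b0 t0.
have -> : (expR (- (a * t)) - expR (- (b * t))) / t =
  - (t^-1 * expR (- t * b)) - - (t^-1 * expR (- t * a)).
  by rewrite !mulNr !(mulrC t); field; rewrite gt_eqF.
apply: (@chi_FTC R (fun s => expR (- (s * t))) (fun s => - (t^-1 * expR (- t * s)))) => //.
  move=> s _; have h := is_deriveN (is_deriveM1 (is_derive_cst t^-1 s (1 : R)) (is_derive_expRM (- t) s)).
  by apply: is_derive_eq1 h _; rewrite mulr0 addr0 mulNr (mulrC t) /cst /=; field; rewrite gt_eqF.
move=> s _; apply: (continuous_cvg _ (@continuous_expR R _)); apply: cvgN.
by apply: cvgM; [exact: cvg_id|exact: cvg_cst].
Qed.

Lemma chi_exp_le a b t : 0 < a -> 0 < b -> 0 < t ->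
  `|(expR (- (a * t)) - expR (- (b * t))) / t| <=
  \int[mu]_s `|chi a b s| * expR (- (Num.min a b * t)).
Proof.
move=> a0 b0 t0; have [h1 <-] := chi_exp a0 b0 t0.
rewrite mulrC -(RintegralZ measurableT _ (chi_integrable a0 b0)).
apply: Rintegral_norm_le => //; first by apply: rintegrableZ => //; exact: chi_integrable.
move=> s _; rewrite normrM mulrC (gtr0_norm (expR_gt0 _)); have [->|nz] := eqVneq (chi a b s) 0.
  by rewrite normr0 !mulr0.
rewrite ler_wpM2r // ler_expR lerN2 ler_wpM2r ?(ltW t0) //.
by have /andP[] := chi_supp nz.
Qed.

Lemma measurable_fst_comp d1 d2 (T1 : measurableType d1) (T2 : measurableType d2) (D : set T1) (h : T1 -> R) :
  measurable D -> measurable_fun D h -> measurable_fun (D `*` [set: T2]) (fun q => h q.1).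
Proof.
move=> mD mh; apply: (@measurable_comp _ _ _ _ _ _ D h (D `*` [set: T2]) fst) => //.
  by move=> x [q [Dq _] <-].
by apply: measurable_funTS; exact: measurable_fst.
Qed.

End laplace.

(** * Ladder exponents from an abstract family of half-line transforms *)

Section ladder.
Variable R : realType.
Notation mu := (@lebesgue_measure R).
Notation posR := (@posR R).
Let mP := @measurable_posR R.
Implicit Types (t s a b x y r tau xi : R).
(** [F r] stands for [f(e^r)] and [p t x] for [E(e^(-x X_t); X_t > 0)], so that [p t 0] is
    [P(X_t > 0)]. *)
Variables (F : R -> R[i]) (p : R -> R -> R).
Hypothesis hF : right_symbol F.
Hypothesis p_ge0 : forall t x, 0 < t -> 0 <= x -> 0 <= p t x.
Hypothesis p_le1 : forall t x, 0 < t -> 0 <= x -> p t x <= 1.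
Hypothesis p_mono : forall t x y, 0 < t -> 0 <= x -> x <= y -> p t y <= p t x.
Hypothesis p_inf : forall t, 0 < t -> p t n%:R @[n --> \oo] --> (0 : R).
Hypothesis p_zero : forall t, 0 < t -> p t (n.+1%:R)^-1 @[n --> \oo] --> p t 0.
Hypothesis p_fourier : forall t x y, 0 < t -> 0 < x -> 0 < y ->
  pi * (p t x - p t y) = \int[mu]_r complex.Re (kerK x y (r +i* 0) * cexp (- (t%:C * F r))).
Hypothesis p_holder : forall x, 0 < x -> exists2 B : R, 0 <= B &
  forall t, 0 < t -> p t 0 - p t x <= B * root4 t.
Hypothesis F_xi : forall s1 s2, 0 < s1 -> s1 <= s2 ->
  cbf_log (fun x => \int[mu]_s (chi s1 s2 s * resK F 1 x s)).
Hypothesis F_tau : forall x1 x2, 0 < x1 -> x1 <= x2 ->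
  cbf_log (fun tau => \int[mu]_s (chi 1 tau s * resK F x1 x2 s)).

Let pn : pi != 0 :> R.
Proof. exact: lt0r_neq0 (pi_gt0 R). Qed.

Let heat x y t r := complex.Re (kerK x y (r +i* 0) * cexp (- (t%:C * F r))).

Let heat_le x y t r : 0 < x -> 0 < y -> 0 <= t -> `|heat x y t r| <= kerKC x y * sech 1 r.
Proof.
move=> x0 y0 t0; apply: (le_trans (Re_nm _)); rewrite nmM.
apply: le_trans (kerK_line_bound r x0 y0); rewrite ler_piMr ?nm_ge0 // nm_cexp expR_le1.
have [_ _ F0] := hF; rewrite Re_opp Re_mul /= mul0r subr0 oppr_le0 mulr_ge0 //; exact: F0.
Qed.

Let heat_meas x y : 0 < x -> 0 < y -> measurable_fun setT (fun q : R * R => heat x y q.1 q.2).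
Proof.
move=> x0 y0; have [c1 c2 _] := hF; have [k1 k2] := kerK_line_continuous x0 y0.
have e q : heat x y q.1 q.2 =
  complex.Re (kerK x y (q.2 +i* 0)) * (expR (- (q.1 * complex.Re (F q.2))) * cos (- (q.1 * complex.Im (F q.2)))) -
  complex.Im (kerK x y (q.2 +i* 0)) * (expR (- (q.1 * complex.Re (F q.2))) * sin (- (q.1 * complex.Im (F q.2)))).
  rewrite /heat Re_mul.
  have -> : - (q.1%:C * F q.2) = (- (q.1 * complex.Re (F q.2))) +i* (- (q.1 * complex.Im (F q.2))).
    by apply: complex_ext; rewrite !ReImE [complex.Re _%:C]/= [complex.Im _%:C]/= ?mul0r ?subr0 ?addr0.
  by rewrite Re_cexp Im_cexp.
have m1 : measurable_fun setT (fun q : R * R => - (q.1 * complex.Re (F q.2))).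
  apply: measurable_Ropp; apply: measurable_Rmul; first exact: measurable_fst.
  by apply: (measurable_continuous_comp c1); exact: measurable_snd.
have m2 : measurable_fun setT (fun q : R * R => - (q.1 * complex.Im (F q.2))).
  apply: measurable_Ropp; apply: measurable_Rmul; first exact: measurable_fst.
  by apply: (measurable_continuous_comp c2); exact: measurable_snd.
have n1 : measurable_fun setT (fun q : R * R => complex.Re (kerK x y (q.2 +i* 0))).
  by apply: (measurable_continuous_comp k1); exact: measurable_snd.
have n2 : measurable_fun setT (fun q : R * R => complex.Im (kerK x y (q.2 +i* 0))).
  by apply: (measurable_continuous_comp k2); exact: measurable_snd.
have mE := measurable_continuous_comp (@continuous_expR R) m1.
under eq_fun do rewrite e; apply: measurable_Rsum; last apply: measurable_Ropp;
  apply: measurable_Rmul => //; apply: measurable_Rmul => //.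
  exact: measurable_continuous_comp (@continuous_cos R) m2.
exact: measurable_continuous_comp (@continuous_sin R) m2.
Qed.

Let heat_fubini s x y : 0 < s -> 0 < x -> 0 < y ->
  [/\ rintegrable mu posR (fun t => \int[mu]_r (expR (- (s * t)) * heat x y t r)),
      rintegrable mu setT (fun r => \int[mu]_(t in posR) (expR (- (s * t)) * heat x y t r)) &
      \int[mu]_(t in posR) \int[mu]_r (expR (- (s * t)) * heat x y t r) =
      \int[mu]_r \int[mu]_(t in posR) (expR (- (s * t)) * heat x y t r)].
Proof.
move=> s0 x0 y0; have mE : measurable_fun posR (fun t => expR (- (s * t))) by exact: measurable_expRM.
apply: (@Rfubini _ _ _ _ R mu mu posR setT (fun t r => expR (- (s * t)) * heat x y t r)
  (fun t => expR (- (s * t))) (fun r => kerKC x y * sech 1 r)) => //.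
- apply: measurable_Rmul; first exact: (@measurable_fst_comp R _ _ (measurableTypeR R) (measurableTypeR R) posR (fun t => expR (- (s * t)))  mP mE).
  by apply: measurable_funTS; exact: heat_meas.
- exact: exp_integrable.
- by apply: rintegrableZ => //; exact: sech_integrable.
- move=> t r t0 _; rewrite normrM gtr0_norm ?expR_gt0 // ler_wpM2l ?expR_ge0 //.
  by apply: heat_le => //; exact: ltW.
Qed.

Let heat_integrable x y t : 0 < x -> 0 < y -> 0 <= t -> rintegrable mu setT (heat x y t).
Proof.
move=> x0 y0 t0.
have := rintegrableZ measurableT (kerKC x y) (sech_integrable (ltr01 : 0 < 1 :> R)).
apply: rintegrable_le => //; last by move=> r _; exact: heat_le.
have h := measurableT_comp (heat_meas x0 y0) (measurable_pair1 t); exact: h.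
Qed.

Let heat_int s x y t : 0 < x -> 0 < y -> 0 < t ->
  \int[mu]_r (expR (- (s * t)) * heat x y t r) = pi * (expR (- (s * t)) * (p t x - p t y)).
Proof.
move=> x0 y0 t0; rewrite (RintegralZ measurableT _ (heat_integrable x0 y0 (ltW t0))).
by rewrite mulrCA p_fourier.
Qed.

Let pB_integrable s x y : 0 < s -> 0 < x -> 0 < y ->
  rintegrable mu posR (fun t => expR (- (s * t)) * (p t x - p t y)).
Proof.
move=> s0 x0 y0; have [h _ _] := heat_fubini s0 x0 y0.
have := rintegrableZ mP pi^-1 h; apply: rintegrable_eq; first exact: mP.
by move=> t t0; rewrite (heat_int s x0 y0 t0); exact: mulKf.
Qed.

(** The Laplace transform in [t], taken inside the Fourier integral, turns [e^(-t F)] into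
    [1 / (s + F)]. *)
Let laplace_p s x y : 0 < s -> 0 < x -> 0 < y ->
  \int[mu]_(t in posR) (expR (- (s * t)) * (p t x - p t y)) = resK F x y s.
Proof.
move=> s0 x0 y0; have [h _ e] := heat_fubini s0 x0 y0.
transitivity (pi^-1 * \int[mu]_(t in posR) \int[mu]_r (expR (- (s * t)) * heat x y t r)).
  rewrite -(RintegralZ mP _ h); apply: eq_Rintegral => t; rewrite inE => t0.
  by rewrite (heat_int s x0 y0 t0); exact: (esym (mulKf pn _)).
rewrite e /resK; congr (_ * _); apply: eq_Rintegral => r _.
by have [_ _ F0] := hF; rewrite /heat laplace_exp.
Qed.

(** Measurability in [t] is extracted from Fubini, as an integral over [r] of a jointly measurable
    function; the factor [e^t] undoes the damping. [p_measurable] then lets [y] tend to infinity. *)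
Let pB_measurable x y : 0 < x -> 0 < y -> measurable_fun posR (fun t => p t x - p t y).
Proof.
move=> x0 y0; have h := rintegrable_meas (pB_integrable ltr01 x0 y0).
have := measurable_Rmul (measurable_expRM (-1)) h; apply: eq_measurable_fun => t _.
by rewrite mulrA -expRD mulN1r opprK mul1r subrr expR0 mul1r.
Qed.

Let p_measurable x : 0 <= x -> measurable_fun posR (p ^~ x).
Proof.
have pos y : 0 < y -> measurable_fun posR (p ^~ y).
  move=> y0; apply: (@measurable_fun_cvg _ (measurableTypeR R) R posR (fun n t => p t y - p t n.+1%:R)).
    by move=> n; apply: pB_measurable; rewrite ?ltr0n.
  move=> t t0; rewrite -[X in _ --> X]subr0; apply: cvgB; first exact: cvg_cst.
  by have := p_inf t0; rewrite -(cvg_shiftS _).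
rewrite le_eqVlt => /orP[/eqP <-|]; last exact: pos.
apply: (@measurable_fun_cvg _ (measurableTypeR R) R posR (fun n t => p t (n.+1%:R)^-1)).
  by move=> n; apply: pos; rewrite invr_gt0 ltr0n.
by move=> t; exact: p_zero.
Qed.

Let p_norm t x y : 0 < t -> 0 <= x -> 0 <= y -> `|p t x - p t y| <= 1.
Proof.
move=> t0 x0 y0; have := p_ge0 t0 x0; have := p_ge0 t0 y0; have := p_le1 t0 x0; have := p_le1 t0 y0.
by rewrite ler_norml => *; apply/andP; split; lra.
Qed.

(** Both sides are the double integral of [e^(-s t) (p t x - p t y)] over [t > 0] and over [s]
    between [a] and [b]. *)
Let double_difference a b x y : 0 < a -> 0 < b -> 0 < x -> 0 < y ->
  \int[mu]_s (chi a b s * resK F x y s) =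
  \int[mu]_(t in posR) ((expR (- (a * t)) - expR (- (b * t))) / t * (p t x - p t y)).
Proof.
move=> a0 b0 x0 y0; have m0 : 0 < Num.min a b by rewrite lt_min a0.
pose G t s := chi a b s * expR (- (s * t)) * (p t x - p t y).
have [||||_ _ e] := @Rfubini _ _ _ _ R mu mu posR setT G (fun t => expR (- (Num.min a b * t)))
    (fun s => `|chi a b s|) mP measurableT.
- apply: measurable_Rmul; last first.
    by apply: (@measurable_fst_comp R _ _ _ _ posR (fun t => p t x - p t y)) => //; exact: pB_measurable.
  apply: measurable_funTS; apply: measurable_Rmul.
    by apply: measurable_chi_comp; exact: measurable_snd.
  apply: (measurable_continuous_comp (@continuous_expR R)); apply: measurable_Ropp.
  by apply: measurable_Rmul; [exact: measurable_snd|exact: measurable_fst].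
- exact: exp_integrable.
- exact: chi_integrable.
- move=> t s t0 _; rewrite /G !normrM (gtr0_norm (expR_gt0 _)); have [->|nz] := eqVneq (chi a b s) 0.
    by rewrite normr0 !mul0r mulr0.
  rewrite -mulrA mulrC ler_wpM2r //.
  apply: (@le_trans _ _ (expR (- (s * t)) * 1)).
    by rewrite ler_wpM2l ?expR_ge0 // p_norm // ltW.
  rewrite mulr1 ler_expR lerN2 ler_wpM2r ?(ltW t0) //.
  by have /andP[] := chi_supp nz.
transitivity (\int[mu]_s \int[mu]_(t in posR) G t s).
  apply: eq_Rintegral => s _; have [z|nz] := eqVneq (chi a b s) 0.
    rewrite z mul0r; under eq_Rintegral do rewrite /G z !mul0r.
    by rewrite (Rintegral_cst _ mP) mul0r.
  have s0 := chi_gt0 a0 b0 nz.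
  rewrite -laplace_p // -(RintegralZ mP _ (pB_integrable s0 x0 y0)).
  by apply: eq_Rintegral => t _; rewrite /G mulrA.
rewrite -e; apply: eq_Rintegral => t; rewrite inE => t0.
have [h1 h2] := chi_exp a0 b0 t0.
rewrite -h2 mulrC -(RintegralZ measurableT _ h1).
by apply: eq_Rintegral => s _; rewrite /G mulrC.
Qed.


Definition ladder_integrand tau xi t :=
  (expR (- t) * p t 0 - expR (- (tau * t)) * p t xi) / t.

(* For [tau = 0] the integral may be [-oo], and then [ladder 0 xi = 0]. *)
Definition ladder tau xi : R :=
  fine (expeR (\int[mu]_(t in posR) (ladder_integrand tau xi t)%:E)%E).

Let g := ladder_integrand.
Let Q tau xi := \int[mu]_(t in posR) g tau xi t.

Let holder x : 0 <= x -> exists2 B : R, 0 <= B & forall t, 0 < t -> p t 0 - p t x <= B * root4 t.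
Proof.
rewrite le_eqVlt => /orP[/eqP <-|x0]; last exact: p_holder.
by exists 0 => // t t0; rewrite subrr mul0r.
Qed.

(** The bound [p_holder] leaves [t^(-3/4)] at 0, and the exponential takes care of infinity. *)
Let pdiff_integrable a x y : 0 < a -> 0 <= x -> 0 <= y ->
  rintegrable mu posR (fun t => expR (- (a * t)) * (p t x - p t y) / t).
Proof.
move=> a0 x0 y0; have [B B0 hB] := holder x0; have [B' B'0 hB'] := holder y0.
have := rintegrableZ mP (B + B') (root4_exp_integrable a0); apply: rintegrable_le; first exact: mP.
  apply: measurable_Rmul; last exact: measurable_inv_pos.
  apply: measurable_Rmul; first exact: measurable_expRM.
  by apply: measurable_Rsum; [|apply: measurable_Ropp]; exact: p_measurable.
move=> t t0; have h1 := hB t t0; have h2 := hB' t t0.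
have h3 := p_mono t0 (lexx 0) x0; have h4 := p_mono t0 (lexx 0) y0.
have r0 := root4_gt0 t0; have ti : 0 < t^-1 by rewrite invr_gt0.
rewrite !normrM (gtr0_norm (expR_gt0 _)) (gtr0_norm ti) !mulrA ler_wpM2r ?(ltW ti) //.
rewrite (mulrC (B + B')) -mulrA ler_wpM2l ?expR_ge0 //.
rewrite ler_norml; apply/andP; split; rewrite mulrDl;
  have k1 := mulr_ge0 B0 (ltW r0); have k2 := mulr_ge0 B'0 (ltW r0); lra.
Qed.

Let ediff_integrable a b x : 0 < a -> 0 < b -> 0 <= x ->
  rintegrable mu posR (fun t => (expR (- (a * t)) - expR (- (b * t))) / t * p t x).
Proof.
move=> a0 b0 x0; have m0 : 0 < Num.min a b by rewrite lt_min a0.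
have := rintegrableZ mP (\int[mu]_s `|chi a b s|) (exp_integrable m0).
apply: rintegrable_le; first exact: mP.
  apply: measurable_Rmul; last exact: p_measurable.
  apply: measurable_Rmul; last exact: measurable_inv_pos.
  by apply: measurable_Rsum; [|apply: measurable_Ropp]; exact: measurable_expRM.
move=> t t0; rewrite normrM -[leRHS]mulr1; apply: ler_pM => //; first exact: chi_exp_le.
by rewrite ger0_norm ?p_ge0 ?p_le1.
Qed.

(** Separates the two reasons for convergence at [t = 0]: the difference in [xi] is small by
    [p_holder], the difference in [tau] by cancellation of exponentials. *)
Let gE tau xi t : g tau xi t = expR (- (1 * t)) * (p t 0 - p t xi) / t +
  (expR (- (1 * t)) - expR (- (tau * t))) / t * p t xi.
Proof. by rewrite /g /ladder_integrand mul1r; ring. Qed.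

Let g_integrable tau xi : 0 < tau -> 0 <= xi -> rintegrable mu posR (g tau xi).
Proof.
move=> t0 x0.
have := rintegrableD mP (pdiff_integrable ltr01 (lexx 0) x0) (ediff_integrable ltr01 t0 x0).
by apply: rintegrable_eq; [exact: mP|move=> t _; rewrite gE].
Qed.

Let Q_xi b x y : 0 < b -> 0 <= x -> 0 <= y ->
  Q b x - Q b y = \int[mu]_(t in posR) (expR (- (b * t)) * (p t y - p t x) / t).
Proof.
move=> b0 x0 y0; rewrite /Q -(RintegralB2 mP (g_integrable b0 x0) (g_integrable b0 y0)).
by apply: eq_Rintegral => t _; rewrite /g /ladder_integrand; ring.
Qed.

Let Q_tau a b x : 0 < a -> 0 < b -> 0 <= x ->
  Q b x - Q a x = \int[mu]_(t in posR) ((expR (- (a * t)) - expR (- (b * t))) / t * p t x).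
Proof.
move=> a0 b0 x0; rewrite /Q -(RintegralB2 mP (g_integrable b0 x0) (g_integrable a0 x0)).
by apply: eq_Rintegral => t _; rewrite /g /ladder_integrand; ring.
Qed.

(** The bridge to [F_xi] and [F_tau]: it determines a ratio of exponents up to its value at 1, which
    becomes the constant of [cbf]. *)
Let Q_double a b x y : 0 < a -> 0 < b -> 0 < x -> 0 < y ->
  (Q b x - Q a x) - (Q b y - Q a y) = \int[mu]_s (chi a b s * resK F x y s).
Proof.
move=> a0 b0 x0 y0; rewrite double_difference // !Q_tau ?ltW //.
rewrite -(RintegralB2 mP (ediff_integrable a0 b0 (ltW x0)) (ediff_integrable a0 b0 (ltW y0))).
by apply: eq_Rintegral => t _; ring.
Qed.

Let ladderE tau xi : 0 < tau -> 0 <= xi -> ladder tau xi = expR (Q tau xi).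
Proof. by move=> t0 x0; rewrite /ladder Rintegral_EFin //; exact: g_integrable. Qed.

Lemma ladder_gt0 tau xi : 0 < tau -> 0 <= xi -> 0 < ladder tau xi.
Proof. by move=> t0 x0; rewrite ladderE // expR_gt0. Qed.

Let cbf_eq (h h' : R -> R) : cbf h -> (forall x, 0 < x -> h x = h' x) -> cbf h'.
Proof. by move=> [c [l [c0 hl e]]] hh; exists c, l; split => // x x0; rewrite -hh // e. Qed.

Let cbf_scale (c : R) (h : R -> R) : 0 <= c -> cbf h -> cbf (fun x => c * h x).
Proof.
move=> c0 [c' [l [c'0 hl e]]]; exists (c * c'), l; split => //; first exact: mulr_ge0.
by move=> x x0; rewrite e // mulrA.
Qed.

Let cbf_cst (c : R) : 0 <= c -> cbf (fun=> c).
Proof.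
move=> c0; exists c, (fun=> 0); split => //; last by move=> x _; rewrite expR0 mulr1.
by exists (fun=> 0), (fun=> 0); split; first exact: tame0.
Qed.

Let ratio_xi a b : 0 < a -> a <= b -> cbf (fun x => ladder a x / ladder b x).
Proof.
move=> a0 ab; have b0 := lt_le_trans a0 ab.
exists (expR (Q a 1 - Q b 1)), (fun x => \int[mu]_s (chi a b s * resK F 1 x s)).
split; [exact: expR_ge0|exact: F_xi|].
move=> x x0; rewrite !ladderE ?(ltW x0) // -expRN -!expRD -Q_double //; congr expR; ring.
Qed.

Let ratio_tau x y : 0 < x -> x <= y -> cbf (fun tau => ladder tau x / ladder tau y).
Proof.
move=> x0 xy; have y0 := lt_le_trans x0 xy.
exists (expR (Q 1 x - Q 1 y)), (fun tau => \int[mu]_s (chi 1 tau s * resK F x y s)).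
split; [exact: expR_ge0|exact: F_tau|].
move=> t t0; rewrite !ladderE ?(ltW x0) ?(ltW y0) // -expRN -!expRD -Q_double //; congr expR; ring.
Qed.

Let natV_gt0 n : 0 < (n.+1%:R)^-1 :> R. Proof. by rewrite invr_gt0 ltr0n. Qed.

Let exp_cvg (u : nat -> R) l : u @ \oo --> l -> expR (u n) @[n --> \oo] --> expR l.
Proof. exact: (continuous_cvg _ (@continuous_expR R l)). Qed.

Let dominated_cvg0 (f_ : nat -> R -> R) (G : R -> R) :
  (forall n, measurable_fun posR (f_ n)) -> rintegrable mu posR G ->
  (forall n t, 0 < t -> `|f_ n t| <= G t) -> (forall t, 0 < t -> f_ ^~ t @ \oo --> (0 : R)) ->
  \int[mu]_(t in posR) f_ n t @[n --> \oo] --> (0 : R).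
Proof.
move=> mf iG h c; have := Rdominated_cvg mP mf (measurable_cst (0 : R)) iG h c.
by rewrite (Rintegral_cst _ mP) mul0r.
Qed.

(** As [b] tends to infinity, [ladder b 1 / ladder b x] tends to 1, since its logarithm is an
    integral with the factor [e^(-b t)]. The ratio, rescaled by [ladder b 1], thus converges to
    [ladder a x]. *)
Let xi_cbf_pos a : 0 < a -> cbf (ladder a).
Proof.
move=> a0; have an n : 0 < a + n%:R by rewrite ltr_wpDr.
apply: (@cbf_limit R (fun n x => ladder (a + n%:R) 1 * (ladder a x / ladder (a + n%:R) x))).
  move=> n; apply: cbf_scale; first by rewrite ltW // ladder_gt0.
  by apply: ratio_xi => //; rewrite lerDl.
move=> x x0; have x0' := ltW x0.
have e n : ladder (a + n%:R) 1 * (ladder a x / ladder (a + n%:R) x) =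
    expR (Q a x) * expR (Q (a + n%:R) 1 - Q (a + n%:R) x).
  by rewrite !ladderE // expRD expRN; ring.
suff h : Q (a + n%:R) 1 - Q (a + n%:R) x @[n --> \oo] --> (0 : R).
  have : expR (Q a x) * expR (Q (a + n%:R) 1 - Q (a + n%:R) x) @[n --> \oo] --> expR (Q a x) * expR 0.
    by apply: cvgM; [exact: cvg_cst|exact: exp_cvg h].
  by rewrite expR0 mulr1 (ladderE a0 x0') => hh; apply: cvg_trans hh; apply: near_eq_cvg; apply: nearW => n; have := esym (e n); rewrite (ladderE a0 x0').
under eq_fun do rewrite Q_xi //.
have ig := rintegrable_abs mP (pdiff_integrable a0 x0' ler01).
apply: (dominated_cvg0 _ ig).
- by move=> n; exact: (rintegrable_meas (pdiff_integrable (an n) x0' ler01)).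
- move=> n t t0; rewrite -!mulrA !normrM !(gtr0_norm (expR_gt0 _)) ler_wpM2r ?mulr_ge0 //.
  by rewrite ler_expR lerN2 ler_wpM2r ?(ltW t0) // lerDl.
move=> t t0 /=.
have e2 n : expR (- ((a + n%:R) * t)) * (p t x - p t 1) / t =
    (expR (- (a * t)) * (p t x - p t 1) / t) * (expR (n%:R * t))^-1.
  by rewrite mulrDl opprD expRD expRN [X in _ * X * _ / _]expRN; ring.
under eq_fun do rewrite e2.
rewrite -(mulr0 (expR (- (a * t)) * (p t x - p t 1) / t)); apply: cvgM; first exact: cvg_cst.
rewrite -(cvg_shiftS _) /=; apply: cvg_trans (expR_scale_cvg t0).
by apply: near_eq_cvg; apply: nearW => n; rewrite expRN mulrC.
Qed.

(** The same with the other parameter: [p t (x + n)] tends to 0, so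
    [ladder 1 (x + n) / ladder a (x + n)] tends to 1. *)
Let tau_cbf_pos x : 0 < x -> cbf (ladder ^~ x).
Proof.
move=> x0; have xn n : 0 < x + n%:R by rewrite ltr_wpDr.
apply: (@cbf_limit R (fun n t => ladder 1 (x + n%:R) * (ladder t x / ladder t (x + n%:R)))).
  move=> n; apply: cbf_scale; first by rewrite ltW // ladder_gt0 // ltW.
  by apply: ratio_tau => //; rewrite lerDl.
move=> a a0.
have e n : ladder 1 (x + n%:R) * (ladder a x / ladder a (x + n%:R)) =
    expR (Q a x) * expR (Q 1 (x + n%:R) - Q a (x + n%:R)).
  by rewrite !ladderE ?(ltW x0) ?(ltW (xn n)) // expRD expRN; ring.
suff h : Q 1 (x + n%:R) - Q a (x + n%:R) @[n --> \oo] --> (0 : R).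
  have : expR (Q a x) * expR (Q 1 (x + n%:R) - Q a (x + n%:R)) @[n --> \oo] --> expR (Q a x) * expR 0.
    by apply: cvgM; [exact: cvg_cst|exact: exp_cvg h].
  by rewrite expR0 mulr1 (ladderE a0 (ltW x0)) => hh; apply: cvg_trans hh; apply: near_eq_cvg; apply: nearW => n; have := esym (e n); rewrite (ladderE a0 (ltW x0)).
have e3 n : Q 1 (x + n%:R) - Q a (x + n%:R) =
  \int[mu]_(t in posR) ((expR (- (a * t)) - expR (- (1 * t))) / t * p t (x + n%:R)).
  by apply: Q_tau => //; exact: ltW.
under eq_fun do rewrite e3.
have ig := rintegrable_abs mP (ediff_integrable a0 ltr01 (ltW x0)).
apply: (dominated_cvg0 _ ig).
- by move=> n; exact: (rintegrable_meas (ediff_integrable a0 ltr01 (ltW (xn n)))).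
- move=> n t t0; rewrite !normrM ler_wpM2l ?mulr_ge0 //.
  rewrite !ger0_norm ?p_ge0 ?(ltW x0) ?(ltW (xn n)) //.
  by apply: p_mono => //; [exact: ltW|rewrite lerDl].
move=> t t0; rewrite -(mulr0 ((expR (- (a * t)) - expR (- (1 * t))) / t)).
apply: cvgM; first exact: cvg_cst.
apply: (@squeeze_cvgr _ _ _ _ (fun=> 0) (fun n => p t n%:R)); last exact: p_inf.
  apply: nearW => n; rewrite p_ge0 ?(ltW (xn n)) //=.
  by apply: p_mono => //; rewrite lerDr ltW.
exact: cvg_cst.
Qed.

Let ladder_xi0 tau : 0 < tau -> ladder tau (n.+1%:R)^-1 @[n --> \oo] --> ladder tau 0.
Proof.
move=> t0; under eq_fun do rewrite (ladderE t0 (ltW (natV_gt0 _))).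
rewrite ladderE //.
have e n : Q tau (n.+1%:R)^-1 = Q tau 0 - (Q tau 0 - Q tau (n.+1%:R)^-1) by rewrite opprB addrC subrK.
under eq_fun do rewrite e; apply: exp_cvg.
suff h : Q tau 0 - Q tau (n.+1%:R)^-1 @[n --> \oo] --> (0 : R).
  have : Q tau 0 - (Q tau 0 - Q tau (n.+1%:R)^-1) @[n --> \oo] --> Q tau 0 - 0.
    by apply: cvgB; [exact: cvg_cst|exact: h].
  by rewrite subr0.
have e3 n : Q tau 0 - Q tau (n.+1%:R)^-1 =
  \int[mu]_(t in posR) (expR (- (tau * t)) * (p t (n.+1%:R)^-1 - p t 0) / t).
  by apply: Q_xi => //; exact: ltW.
under eq_fun do rewrite e3.
have ig := rintegrable_abs mP (pdiff_integrable t0 ler01 (lexx 0)).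
apply: (dominated_cvg0 _ ig).
- by move=> n; exact: (rintegrable_meas (pdiff_integrable t0 (ltW (natV_gt0 n)) (lexx 0))).
- move=> n t t1; rewrite !normrM ler_wpM2r // ler_wpM2l //.
  have n1 : (n.+1%:R)^-1 <= 1 :> R by rewrite invf_le1 ?ler1n ?ltr0n.
  have h1 := p_mono t1 (ltW (natV_gt0 n)) n1; have h2 := p_mono t1 (lexx 0) (ltW (natV_gt0 n)).
  by rewrite !ler0_norm; lra.
move=> t t1; have : expR (- (tau * t)) * (p t (n.+1%:R)^-1 - p t 0) / t @[n --> \oo] -->
    expR (- (tau * t)) * (p t 0 - p t 0) / t.
  apply: cvgM; last exact: cvg_cst.
  apply: cvgM; first exact: cvg_cst.
  by apply: cvgB; [exact: p_zero|exact: cvg_cst].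
by rewrite subrr mulr0 mul0r.
Qed.

(** [g 0 = g 1 - h0], where [h0 >= 0] is the increasing limit of [h n]. If [h0] is integrable,
    dominated convergence applies; otherwise monotone convergence sends the exponents to minus
    infinity, in agreement with [ladder 0 xi = 0]. *)
Let ladder_tau0 xi : 0 < xi -> ladder (n.+1%:R)^-1 xi @[n --> \oo] --> ladder 0 xi.
Proof.
move=> x0; have x0' := ltW x0.
pose h0 t := (1 - expR (- (1 * t))) / t * p t xi.
pose h n t := (expR (- ((n.+1%:R)^-1 * t)) - expR (- (1 * t))) / t * p t xi.
have natV1 n : (n.+1%:R)^-1 <= 1 :> R by rewrite invf_le1 ?ler1n ?ltr0n.
have g0E t : g 0 xi t = g 1 xi t - h0 t.
  by rewrite /g /ladder_integrand /h0 mul0r oppr0 expR0 mul1r; ring.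
have ih n : rintegrable mu posR (h n) by apply: ediff_integrable.
have QE n : Q (n.+1%:R)^-1 xi = Q 1 xi - \int[mu]_(t in posR) h n t.
  by rewrite -(Q_tau (natV_gt0 n) ltr01 x0'); ring.
have exp1 t u : 0 < t -> 0 <= u -> expR (- (u * t)) <= 1.
  by move=> t0 u0; rewrite expR_le1 oppr_le0 mulr_ge0 // ltW.
have h_ge0 n t : 0 < t -> 0 <= h n t.
  move=> t0; rewrite mulr_ge0 ?p_ge0 // divr_ge0 ?(ltW t0) // subr_ge0.
  by rewrite ler_expR lerN2 ler_wpM2r // ltW.
have h0_ge0 t : 0 < t -> 0 <= h0 t.
  by move=> t0; rewrite mulr_ge0 ?p_ge0 // divr_ge0 ?(ltW t0) // subr_ge0 exp1.
have h_le n t : 0 < t -> h n t <= h0 t.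
  move=> t0; rewrite ler_wpM2r ?p_ge0 // ler_wpM2r ?invr_ge0 ?(ltW t0) //.
  by rewrite lerD2r exp1 // ltW.
have h_mono t : 0 < t -> {homo h ^~ t : n m / (n <= m)%N >-> n <= m}.
  move=> t0 n m nm; rewrite ler_wpM2r ?p_ge0 // ler_wpM2r ?invr_ge0 ?(ltW t0) //.
  rewrite lerD2r ler_expR lerN2 ler_wpM2r ?(ltW t0) //.
  by rewrite lef_pV2 ?posrE ?ltr0n // ler_nat.
have h_cvg t : 0 < t -> h ^~ t @ \oo --> h0 t.
  move=> t0; apply: cvgM; last exact: cvg_cst.
  apply: cvgM; last exact: cvg_cst.
  apply: cvgB; last exact: cvg_cst.
  have : expR (- ((n.+1%:R)^-1 * t)) @[n --> \oo] --> expR (- (0 * t)).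
    apply: exp_cvg; apply: cvgN; apply: cvgM; [exact: cvg_harmonic|exact: cvg_cst].
  by rewrite mul0r oppr0 expR0.
have mh0 : measurable_fun posR h0.
  by apply: (@measurable_fun_cvg _ (measurableTypeR R) R posR h) => // n; exact: rintegrable_meas (ih n).
have mg0 : measurable_fun posR (g 0 xi).
  have := measurable_Rsum (rintegrable_meas (g_integrable ltr01 x0')) (measurable_Ropp mh0).
  by apply: eq_measurable_fun => t _; rewrite g0E.
have lE n : ladder (n.+1%:R)^-1 xi = expR (Q 1 xi - \int[mu]_(t in posR) h n t).
  by rewrite ladderE // QE.
under eq_fun do rewrite lE.
have [ih0|nih0] := boolP (rintegrable mu posR h0).
  have -> : ladder 0 xi = expR (Q 1 xi - \int[mu]_(t in posR) h0 t).
    have e : \int[mu]_(t in posR) g 0 xi t = Q 1 xi - \int[mu]_(t in posR) h0 t.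
      rewrite -(RintegralB2 mP (g_integrable ltr01 x0') ih0).
      by apply: eq_Rintegral => t _; exact: g0E.
    rewrite -e /ladder Rintegral_EFin //.
    have := rintegrableB mP (g_integrable ltr01 x0') ih0.
    by apply: rintegrable_eq; [exact: mP|move=> t _; exact: (esym (g0E t))].
  apply: exp_cvg; apply: cvgB; first exact: cvg_cst.
  apply: (Rdominated_cvg mP _ mh0 ih0).
  - by move=> n; exact: (rintegrable_meas (ih n)).
  - by move=> n t t0; rewrite ger0_norm ?h_ge0 ?h_le.
  - by move=> t t0; exact: h_cvg.
have h_inf : (\int[mu]_(t in posR) (h0 t)%:E = +oo)%E.
  apply/eqP; rewrite -leye_eq leNgt; apply: contra nih0 => lt.
  apply/integrableP; split; first exact/measurable_EFinP.
  apply: le_lt_trans lt; rewrite le_eqVlt; apply/orP; left; apply/eqP.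
  by apply: eq_integral => t; rewrite inE => t0; rewrite /= ger0_norm // h0_ge0.
have mct : (\int[mu]_(t in posR) (h n t)%:E @[n --> \oo] --> +oo)%E.
  rewrite -h_inf.
  have := @cvg_monotone_convergence _ (measurableTypeR R) R mu posR mP (fun n t => (h n t)%:E).
  have -> : (\int[mu]_(t in posR) limn (fun n => (h n t)%:E) = \int[mu]_(t in posR) (h0 t)%:E)%E.
    apply: eq_integral => t; rewrite inE => t0; apply/cvg_lim => //.
    by apply: cvg_EFin; [exact: nearW|exact: h_cvg].
  apply.
  - by move=> n; apply/measurable_EFinP; exact: (rintegrable_meas (ih n)).
  - by move=> n t t0; rewrite lee_fin h_ge0.
  - by move=> t t0 n m nm; rewrite lee_fin h_mono.
(* The positive part has a finite integral because [g 0 <= |g 1|], and the negative part an infinite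
   one, so the integral is [-oo]. *)
have -> : ladder 0 xi = 0.
  rewrite /ladder integralE.
  have fin : (\int[mu]_(t in posR) ((EFin \o g 0 xi)^\+ t) < +oo)%E.
    have /integrableP[_] := rintegrable_abs mP (g_integrable ltr01 x0').
    apply: le_lt_trans; apply: ge0_le_integral => //.
    - by apply: measurable_funepos; exact/measurable_EFinP.
    - apply/measurable_EFinP; apply: measurableT_comp => //.
      by have := rintegrable_meas (rintegrable_abs mP (g_integrable ltr01 x0')).
    move=> t t0; rewrite funeposE /= -EFin_max lee_fin ge_max normr_id normr_ge0 andbT.
    by rewrite g0E; apply: le_trans (ler_norm _); rewrite gerDl oppr_le0 h0_ge0.
  have inf : (\int[mu]_(t in posR) ((EFin \o g 0 xi)^\- t) = +oo)%E.
    apply/eqP; rewrite -leye_eq leNgt; apply: contra nih0 => lt.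
    have i0 : rintegrable mu posR (g 0 xi).
      apply/integrableP; split; first exact/measurable_EFinP.
      have -> : (\int[mu]_(t in posR) `|(EFin \o g 0 xi) t| = \int[mu]_(t in posR)
          ((EFin \o g 0 xi)^\+ t + (EFin \o g 0 xi)^\- t))%E.
        by apply: eq_integral => t _; exact: (congr1 (@^~ t) (fune_abse (EFin \o g 0 xi))).
      rewrite ge0_integralD //; first exact: lte_add_pinfty.
        by apply: measurable_funepos; exact/measurable_EFinP.
      by apply: measurable_funeneg; exact/measurable_EFinP.
    have := rintegrableB mP (g_integrable ltr01 x0') i0.
    by apply: rintegrable_eq; [exact: mP|move=> t _; rewrite g0E opprB addrC subrK].
  rewrite [X in (_ - X)%E]inf.
  by move: fin; case: (\int[mu]_(t in posR) _)%E.
have ch : \int[mu]_(t in posR) h n t @[n --> \oo] --> +oo.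
  apply/cvgeryP; apply: cvg_trans mct; apply: near_eq_cvg; apply: nearW => n.
  by rewrite Rintegral_EFin.
have : expR (Q 1 xi) * expR (- \int[mu]_(t in posR) h n t) @[n --> \oo] --> expR (Q 1 xi) * 0.
  apply: cvgM; first exact: cvg_cst.
  exact: (@cvg_comp _ _ _ _ (fun x => expR (- x)) _ _ _ ch (@cvgr_expR R)).
rewrite mulr0; apply: cvg_trans; apply: near_eq_cvg; apply: nearW => n.
by rewrite expRD.
Qed.

Theorem ladder_cbf_xi tau : 0 <= tau -> cbf (ladder tau).
Proof.
rewrite le_eqVlt => /orP[/eqP <-|]; last exact: xi_cbf_pos.
apply: (@cbf_limit R (fun n => ladder (n.+1%:R)^-1)); first by move=> n; exact: xi_cbf_pos.
by move=> x x0; exact: ladder_tau0.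
Qed.

Theorem ladder_cbf_tau xi : 0 <= xi -> cbf (ladder ^~ xi).
Proof.
rewrite le_eqVlt => /orP[/eqP <-|]; last exact: tau_cbf_pos.
apply: (@cbf_limit R (fun n => ladder ^~ (n.+1%:R)^-1)); first by move=> n; exact: tau_cbf_pos.
by move=> x x0; exact: ladder_xi0.
Qed.

Theorem ladder_ratio_xi a b : 0 <= a -> a <= b -> cbf (fun x => ladder a x / ladder b x).
Proof.
rewrite le_eqVlt => /orP[/eqP <-|a0 ab]; last exact: ratio_xi.
rewrite le_eqVlt => /orP[/eqP <-|b0].
  (* For [a = b = 0] the ratio is the constant 1, or the constant [0 / 0 = 0] when [ladder 0]
     vanishes identically. *)
  have [c [l [c0 hl e]]] := ladder_cbf_xi (lexx 0); have [c1|c1] := eqVneq c 0.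
    apply: cbf_eq (cbf_cst (lexx 0)) _ => x x0.
    by rewrite e // c1 mul0r invr0 mulr0.
  apply: cbf_eq (cbf_cst ler01) _ => x x0; rewrite e // divff // mulf_neq0 //.
  by rewrite gt_eqF // expR_gt0.
(* The minimum keeps the first index at most [b], as [ratio_xi] requires; it is eventually
   inactive. *)
have bn n : 0 < Num.min b (n.+1%:R)^-1 by rewrite lt_min b0 natV_gt0.
apply: (@cbf_limit R (fun n x => ladder (Num.min b (n.+1%:R)^-1) x / ladder b x)).
  by move=> n; apply: ratio_xi => //; rewrite ge_min lexx.
move=> x x0; apply: cvgM; last exact: cvg_cst.
have h := ladder_tau0 x0; apply: cvg_trans h; apply: near_eq_cvg.
have := @cvg_harmonic R; move=> /cvgrPdist_lt /(_ _ b0); apply: filterS => n.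
rewrite sub0r normrN ger0_norm ?(ltW (natV_gt0 n)) // => h.
by rewrite (min_idPr _) // ltW.
Qed.

Theorem ladder_ratio_tau x y : 0 <= x -> x <= y -> cbf (fun tau => ladder tau x / ladder tau y).
Proof.
rewrite le_eqVlt => /orP[/eqP <-|x0 xy]; last exact: ratio_tau.
rewrite le_eqVlt => /orP[/eqP <-|y0].
  apply: cbf_eq (cbf_cst ler01) _ => t t0; rewrite divff //.
  by rewrite gt_eqF // ladder_gt0.
have yn n : 0 < Num.min y (n.+1%:R)^-1 by rewrite lt_min y0 natV_gt0.
apply: (@cbf_limit R (fun n tau => ladder tau (Num.min y (n.+1%:R)^-1) / ladder tau y)).
  by move=> n; apply: ratio_tau => //; rewrite ge_min lexx.
move=> t t0; apply: cvgM; last exact: cvg_cst.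
have h := ladder_xi0 t0; apply: cvg_trans h; apply: near_eq_cvg.
have := @cvg_harmonic R; move=> /cvgrPdist_lt /(_ _ y0); apply: filterS => n.
rewrite sub0r normrN ger0_norm ?(ltW (natV_gt0 n)) // => h.
by rewrite (min_idPr _) // ltW.
Qed.

End ladder.

(** * Half-line Laplace transforms *)

Section half_line_transform.
Context d (T : measurableType d) (R : realType) (P : probability T R).
Notation mu := (@lebesgue_measure R).
Implicit Types (t x y z r : R) (w : T).

Lemma bounded_rintegrable (h : T -> R) (C : R) : measurable_fun setT h ->
  (forall w, `|h w| <= C) -> rintegrable P setT h.
Proof.
move=> mh hC; have : rintegrable P setT (fun=> C) by exact: finite_measure_integrable_cst.
by apply: rintegrable_le.
Qed.

(** The indicator of the half-line is part of the integrand, so that all expectations run over the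
    whole probability space. *)
Definition pexp x z := (0 < z)%R%:R * expR (- (x * z)).

Lemma measurable_pexp x (h : T -> R) : measurable_fun setT h ->
  measurable_fun setT (fun w => pexp x (h w)).
Proof.
move=> mh; apply: measurable_Rmul; last first.
  apply: (measurable_continuous_comp (@continuous_expR R)); apply: measurable_Ropp.
  by apply: measurable_Rmul => //; exact: measurable_cst.
have m : measurable_fun setT (fun z : R => (0 < z)%R%:R : R).
  have := @measurable_indic _ _ R setT `](0 : R), +oo[%classic (measurable_itv _).
  congr (measurable_fun _ _); apply/funext => z; rewrite indicE; congr (nat_of_bool _)%:R.
  by rewrite mem_setE in_itv /= andbT.
exact: measurableT_comp m mh.
Qed.

Lemma pexp_ge0 x z : 0 <= pexp x z.
Proof. by rewrite mulr_ge0 ?ler0n ?expR_ge0. Qed.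

Lemma pexp_le1 x z : 0 <= x -> pexp x z <= 1.
Proof.
rewrite /pexp => x0; have [z0|z0] := ltP 0 z; last by rewrite mul0r.
by rewrite mul1r expR_le1 oppr_le0 mulr_ge0 // ltW.
Qed.

Lemma pexp_mono x y z : x <= y -> pexp y z <= pexp x z.
Proof.
rewrite /pexp => xy; have [z0|z0] := ltP 0 z; last by rewrite !mul0r.
by rewrite !mul1r ler_expR lerN2 ler_wpM2r // ltW.
Qed.

Lemma pexp_half_line x y z : pexp x z - pexp y z = half_line_exp x y z.
Proof. by rewrite /pexp /half_line_exp; case: ltP => _; rewrite ?mul1r // !mul0r subrr. Qed.

(** The left side is at most 2 and at most [|v|], and [min(2, y^4) <= 2 y] for [y >= 0]. *)
Lemma one_sub_Re_cexp (v : R[i]) : 0 <= complex.Re v ->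
  1 - complex.Re (cexp (- v)) <= 2 * root4 (nm v).
Proof.
move=> v0; have n0 := nm_ge0 v.
have h : `|1 - complex.Re (cexp (- v))| <= nm v.
  have v1 : complex.Re (- v) <= 0 by rewrite Re_opp oppr_le0.
  have h := @cexp_lipschitz R 0 (- v) (lexx 0) v1.
  by have := le_trans (Re_nm _) h; rewrite cexp0 subr0 nmN Re_add Re_opp distrC.
have h2 : 1 - complex.Re (cexp (- v)) <= 2.
  have : `|complex.Re (cexp (- v))| <= 1.
    by apply: (le_trans (Re_nm _)); rewrite nm_cexp expR_le1 Re_opp oppr_le0.
  by rewrite ler_norml => /andP[]; lra.
have y0 : 0 <= root4 (nm v) by exact: sqrtr_ge0.
have e := root4_pow n0; set y := root4 _ in y0 e *.
have [y1|y1] := leP 1 y; first by apply: (le_trans h2); lra.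
apply: (le_trans (le_trans (ler_norm _) h)); rewrite -e.
have : y ^+ 4 <= y by rewrite -[leRHS]expr1; apply: ler_wiXn2l => //; exact: ltW.
lra.
Qed.

Variable Z : R -> T -> R.
Hypothesis mZ : forall t, measurable_fun setT (Z t).
Variables (F : R -> R[i]) (B : R).
Hypothesis hF : right_symbol F.
Hypothesis B0 : 0 <= B.
Hypothesis F_growth : forall r, nm (F r) <= B * (1 + expR (2 * r)).
Hypothesis Z_cos : forall t r, 0 < t ->
  \int[P]_w cos (expR r * Z t w) = complex.Re (cexp (- (t%:C * F r))).
Hypothesis Z_sin : forall t r, 0 < t ->
  \int[P]_w sin (expR r * Z t w) = complex.Im (cexp (- (t%:C * F r))).

Definition half_transform t x := \int[P]_w pexp x (Z t w).
Let p := half_transform.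

Let pexp_integrable t x : 0 <= x -> rintegrable P setT (fun w => pexp x (Z t w)).
Proof.
move=> x0; apply: (@bounded_rintegrable _ 1); first exact: measurable_pexp.
by move=> w; rewrite ger0_norm ?pexp_ge0 ?pexp_le1.
Qed.

Let Pcst (c : R) : \int[P]_w c = c.
Proof. rewrite (Rintegral_cst _ measurableT) [X in fine X](_ : _ = 1%E) ?mulr1 //.
exact: (probability_setT P). Qed.

Lemma half_transform_ge0 t x : 0 <= x -> 0 <= p t x.
Proof. by move=> x0; apply: Rintegral_ge0 => w _; exact: pexp_ge0. Qed.

Lemma half_transform_mono t x y : 0 <= x -> x <= y -> p t y <= p t x.
Proof.
move=> x0 xy; apply: le_Rintegral => //; [|exact: pexp_integrable|].
  by apply: pexp_integrable; exact: le_trans xy.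
by move=> w _; exact: pexp_mono.
Qed.

Lemma half_transform_le1 t x : 0 <= x -> p t x <= 1.
Proof.
move=> x0; rewrite -[leRHS](Pcst 1); apply: le_Rintegral => //; first exact: pexp_integrable.
  exact: finite_measure_integrable_cst.
by move=> w _; exact: pexp_le1.
Qed.

Let p_cvg t (u : nat -> R) (h : T -> R) : (forall n, 0 <= u n) -> measurable_fun setT h ->
  (forall w, pexp (u n) (Z t w) @[n --> \oo] --> h w) ->
  p t (u n) @[n --> \oo] --> \int[P]_w h w.
Proof.
move=> u0 mh c; apply: (@Rdominated_cvg _ _ _ P setT measurableT _ _ (fun=> 1)) => //.
- by move=> n; exact: measurable_pexp.
- exact: finite_measure_integrable_cst.
- by move=> n w _; rewrite ger0_norm ?pexp_ge0 ?pexp_le1.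
Qed.

Lemma half_transform_inf t : p t n%:R @[n --> \oo] --> (0 : R).
Proof.
rewrite -(Pcst 0); apply: p_cvg => //.
move=> w; rewrite /pexp; have [z0|z0] := ltP 0 (Z t w); last first.
  by under eq_fun do rewrite mul0r; exact: cvg_cst.
rewrite -(cvg_shiftS _) /=; apply: cvg_trans (expR_scale_cvg z0).
by apply: near_eq_cvg; apply: nearW => n; rewrite mul1r mulrC.
Qed.

Lemma half_transform_zero t : p t (n.+1%:R)^-1 @[n --> \oo] --> p t 0.
Proof.
apply: p_cvg.
- by move=> n; rewrite invr_ge0.
- exact: measurable_pexp.
move=> w; apply: cvgM; first exact: cvg_cst.
apply: (continuous_cvg _ (@continuous_expR R _)); apply: cvgN.
by apply: cvgM; [exact: cvg_harmonic|exact: cvg_cst].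
Qed.

Let Z_measurable t : measurable_fun setT (fun q : T * R => Z t q.1).
Proof. exact: measurableT_comp (mZ t) measurable_fst. Qed.

Let arg_measurable t : measurable_fun setT (fun q : T * R => expR q.2 * Z t q.1).
Proof.
apply: measurable_Rmul => //.
by apply: (measurable_continuous_comp (@continuous_expR R)); exact: measurable_snd.
Qed.

Let cos_measurable t : measurable_fun setT (fun q : T * R => cos (expR q.2 * Z t q.1)).
Proof. exact: (measurable_continuous_comp (@continuous_cos R) (arg_measurable t)). Qed.

Let sin_measurable t : measurable_fun setT (fun q : T * R => sin (expR q.2 * Z t q.1)).
Proof. exact: (measurable_continuous_comp (@continuous_sin R) (arg_measurable t)). Qed.

Let cos_integrable t r : rintegrable P setT (fun w => cos (expR r * Z t w)).
Proof.
apply: (@bounded_rintegrable _ 1).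
  by apply: (measurable_continuous_comp (@continuous_cos R)); apply: measurable_Rmul => //; exact: measurable_cst.
by move=> w; rewrite ler_norml cos_geN1 cos_le1.
Qed.

Let sin_integrable t r : rintegrable P setT (fun w => sin (expR r * Z t w)).
Proof.
apply: (@bounded_rintegrable _ 1).
  by apply: (measurable_continuous_comp (@continuous_sin R)); apply: measurable_Rmul => //; exact: measurable_cst.
by move=> w; rewrite ler_norml sin_geN1 sin_le1.
Qed.

(** The expectation of [kerK_fourier] at [Z t]: Fubini moves it onto the oscillating factor, where
    it becomes the characteristic function. *)
Lemma half_transform_fourier t x y : 0 < t -> 0 < x -> 0 < y ->
  pi * (p t x - p t y) = \int[mu]_r complex.Re (kerK x y (r +i* 0) * cexp (- (t%:C * F r))).
Proof.
move=> t0 x0 y0; have [k1 k2] := kerK_line_continuous x0 y0.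
pose G w r := complex.Re (kerK x y (r +i* 0)) * cos (expR r * Z t w) -
  complex.Im (kerK x y (r +i* 0)) * sin (expR r * Z t w).
have GE w r : G w r = complex.Re (kerK x y (r +i* 0) * cexp ((Z t w)%:C * ((0 +i* 1) * cexp (r +i* 0)))).
  by rewrite Re_osc /G mulrC (mulrC (expR r)) [in LHS]mulrC.
have i1 : rintegrable P setT (fun=> 1 : R) by exact: finite_measure_integrable_cst.
have [|||_ _ e] := @Rfubini _ _ _ _ R P mu setT setT G (fun=> 1) (fun r => kerKC x y * sech 1 r)
    measurableT measurableT _ i1.
- rewrite setXTT; apply: measurable_Rsum.
    apply: measurable_Rmul; last exact: cos_measurable.
    by apply: (measurable_continuous_comp k1); exact: measurable_snd.
  apply: measurable_Ropp; apply: measurable_Rmul; last exact: sin_measurable.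
  by apply: (measurable_continuous_comp k2); exact: measurable_snd.
- by apply: rintegrableZ => //; exact: sech_integrable.
- move=> w r _ _; rewrite mul1r GE; apply: (le_trans (Re_nm _)); rewrite nmM.
  apply: le_trans (kerK_line_bound r x0 y0); rewrite ler_piMr ?nm_ge0 //.
  by apply: nm_cexp_le1; rewrite expR_line /= mulr0.
transitivity (\int[P]_w \int[mu]_r G w r).
  rewrite /p /half_transform -(RintegralB2 measurableT (pexp_integrable t (ltW x0)) (pexp_integrable t (ltW y0))).
  rewrite -RintegralZ //; last first.
    by apply: rintegrableB => //; apply: pexp_integrable; exact: ltW.
  apply: eq_Rintegral => w _; rewrite pexp_half_line -kerK_fourier //.
  by apply: eq_Rintegral => r _; rewrite GE.
rewrite e; apply: eq_Rintegral => r _.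
rewrite Re_mul -Z_cos // -Z_sin // -!RintegralZ //.
rewrite -RintegralB2 //; first exact: rintegrableZ.
exact: rintegrableZ.
Qed.

(** In [u = e^(r/2)] the growth bound gives [|F|^(1/4) = O(1 + u)] and the kernel is of order
    [u^2 / (1 + u^4)]; the product is at most a multiple of [u / (1 + u^2)], which is
    [sech 2^-1 r]. *)
Let poisson_growth x : 0 < x -> exists2 C : R, 0 <= C &
  forall r, poisson x r * root4 (nm (F r)) <= C * sech 2^-1 r.
Proof.
move=> x0; pose m := Num.min x 1.
have m0 : 0 < m by rewrite lt_min x0 ltr01.
pose C := 4 * (x / m ^+ 2) * root4 B.
have rB : 0 <= root4 B by exact: sqrtr_ge0.
have C0 : 0 <= C by rewrite !mulr_ge0 // ?invr_ge0 ?sqr_ge0 // ltW.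
exists C => // r; set u := expR (2^-1 * r).
have u0 : 0 < u by exact: expR_gt0.
have ue : expR r = u ^+ 2 by rewrite /u -expRM_natl mulrA divff // mul1r.
have ue2 : expR (2 * r) = u ^+ 4 by rewrite expRM_natl ue -exprM.
have p4 : 0 < 1 + u ^+ 4 by rewrite ltr_pwDl // exprn_ge0 // ltW.
have r4 : root4 (nm (F r)) <= root4 B * (1 + u).
  have y0 : 0 <= root4 (1 + u ^+ 4) by exact: sqrtr_ge0.
  have h1 : root4 (1 + u ^+ 4) <= 1 + u.
    rewrite -(@ler_pXn2r _ 4) ?nnegrE // ?addr_ge0 // ?(ltW u0) // root4_pow ?(ltW p4) //.
    have := mulr_ge0 (ltW u0) (ltW u0); have := exprn_ge0 3 (ltW u0); nra.
  apply: (@le_trans _ _ (root4 (B * (1 + u ^+ 4)))).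
    by rewrite /root4 !ler_wsqrtr // -ue2; exact: F_growth.
  by rewrite /root4 sqrtrM // sqrtrM ?sqrtr_ge0 // ler_wpM2l.
have pois : poisson x r <= x / m ^+ 2 * (u ^+ 2 / (1 + u ^+ 4)).
  rewrite /poisson ue -exprM; have m2 : 0 < m ^+ 2 * (1 + u ^+ 4) by rewrite mulr_gt0 ?exprn_gt0.
  have -> : x / m ^+ 2 * (u ^+ 2 / (1 + u ^+ 4)) = x * u ^+ 2 / (m ^+ 2 * (1 + u ^+ 4)).
    by field; rewrite !gt_eqF.
  apply: ler_wpM2l; first by rewrite mulr_ge0 ?sqr_ge0 // ltW.
  have mx : m <= x by rewrite ge_min lexx.
  have m1 : m <= 1 by rewrite ge_min lexx orbT.
  have h1 : m ^+ 2 <= x ^+ 2 by rewrite ler_sqr ?nnegrE ?(ltW m0) ?(ltW x0).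
  have h2 : m ^+ 2 <= 1 by rewrite expr_le1 // ltW.
  have u4 : 0 <= u ^+ 4 by rewrite exprn_ge0 // ltW.
  have h3 : m ^+ 2 * u ^+ 4 <= u ^+ 4 by rewrite ler_piMl.
  have d0 : 0 < x ^+ 2 + u ^+ (2 * 2) by rewrite addr_gt0 // exprn_gt0.
  rewrite lef_pV2 ?posrE // mulrDr mulr1; exact: lerD.
have se : sech 2^-1 r = u / (1 + u ^+ 2).
  rewrite /sech expRN -/u; have h : 0 < 1 + u ^+ 2 by rewrite ltr_pwDl // sqr_ge0.
  by field; rewrite !gt_eqF // addrC.
apply: (@le_trans _ _ (x / m ^+ 2 * (u ^+ 2 / (1 + u ^+ 4)) * (root4 B * (1 + u)))).
  by apply: ler_pM => //; [exact: poisson_ge0|exact: sqrtr_ge0].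
have p2 : 0 < 1 + u ^+ 2 by rewrite ltr_pwDl // sqr_ge0.
rewrite se /C.
have -> : x / m ^+ 2 * (u ^+ 2 / (1 + u ^+ 4)) * (root4 B * (1 + u)) =
  (x / m ^+ 2 * root4 B) * (u ^+ 2 * (1 + u) / (1 + u ^+ 4)) by ring.
have -> : 4 * (x / m ^+ 2) * root4 B * (u / (1 + u ^+ 2)) =
  (x / m ^+ 2 * root4 B) * (4 * u / (1 + u ^+ 2)) by ring.
rewrite ler_wpM2l //; first by rewrite !mulr_ge0 // ?invr_ge0 ?sqr_ge0 // ltW.
rewrite ler_pdivrMr // [leRHS]mulrAC ler_pdivlMr //.
have -> : u ^+ 2 * (1 + u) * (1 + u ^+ 2) = u * (u + u ^+ 2 + u ^+ 3 + u ^+ 4) by ring.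
have -> : 4 * u * (1 + u ^+ 4) = u * (4 * (1 + u ^+ 4)) by ring.
rewrite ler_wpM2l ?(ltW u0) //.
have q1 := sqr_ge0 (u - 1); have q2 := sqr_ge0 (u ^+ 2 - 1); have q3 := sqr_ge0 (u ^+ 2 - u).
have e4 : u ^+ 4 = (u ^+ 2) ^+ 2 by rewrite -exprM.
have e3 : u ^+ 3 = u ^+ 2 * u by rewrite -exprSr.
rewrite e4 e3; nra.
Qed.

(** The one-sided difference is dominated by the symmetric function [k = 1 - e^(-x |Z|)], a Poisson
    average of [1 - cos (e^r Z)]. In expectation this cosine term is
    [1 - Re e^(-t F) <= 2 (t |F|)^(1/4)], from which [t^(1/4)] factors out. *)
Lemma half_transform_holder x : 0 < x -> exists2 C : R, 0 <= C &
  forall t, 0 < t -> p t 0 - p t x <= C * root4 t.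
Proof.
move=> x0; have [C C0 hC] := poisson_growth x0.
have pp := pi_gt0 R; have ip := poisson_integrable x0.
have is2 : rintegrable mu setT (sech (2^-1 : R)) by apply: sech_integrable; rewrite invr_gt0.
pose S := \int[mu]_r sech (2^-1 : R) r.
have S0 : 0 <= S by apply: Rintegral_ge0 => r _; rewrite ltW // sech_gt0.
exists (2 / pi * (2 * C * S)).
  by rewrite !mulr_ge0 // invr_ge0 ltW.
move=> t t0; pose k w := 1 - expR (- (x * `|Z t w|)).
have mk : measurable_fun setT k.
  apply: measurable_Rsum; first exact: measurable_cst.
  apply: measurable_Ropp; apply: (measurable_continuous_comp (@continuous_expR R)).
  apply: measurable_Ropp; apply: measurable_Rmul; first exact: measurable_cst.
  by apply: measurableT_comp (mZ t).
have k0 w : 0 <= k w <= 1.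
  rewrite subr_ge0 expR_le1 oppr_le0 mulr_ge0 ?(ltW x0) //=.
  by rewrite gerDl oppr_le0 expR_ge0.
have ik : rintegrable P setT k.
  by apply: (@bounded_rintegrable _ 1) => // w; have /andP[h1 h2] := k0 w; rewrite ger0_norm.
have le1 : p t 0 - p t x <= \int[P]_w k w.
  have i0 := pexp_integrable t (lexx 0); have ix := pexp_integrable t (ltW x0).
  rewrite /p /half_transform -(RintegralB2 measurableT i0 ix).
  apply: le_Rintegral => //; first exact: (rintegrableB measurableT i0 ix).
  move=> w _; have /andP[k1 _] := k0 w; rewrite pexp_half_line /half_line_exp.
  have [z0|//] := ltP 0 (Z t w).
  by rewrite mul0r oppr0 expR0 /k gtr0_norm.
pose G w r := (1 - cos (expR r * Z t w)) * poisson x r.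
have mG : measurable_fun setT (fun q : T * R => G q.1 q.2).
  apply: measurable_Rmul; first apply: measurable_Rsum; first exact: measurable_cst.
    by apply: measurable_Ropp; exact: cos_measurable.
  apply: (measurable_continuous_comp (continuous_poisson x0)); exact: measurable_snd.
have kE w : k w = 2 / pi * \int[mu]_r G w r.
  have [ic ec] := poisson_fourier x0 (normr_ge0 (Z t w)).
  have -> : \int[mu]_r G w r = \int[mu]_r (poisson x r - cos (`|Z t w| * expR r) * poisson x r).
    apply: eq_Rintegral => r _; rewrite /G mulrBl mul1r; congr (_ - _ * _).
    by rewrite -[RHS]cos_norm -[LHS]cos_norm !normrM normr_id mulrC.
  rewrite (RintegralB2 measurableT ip ic) ec poisson_integral // /k.
  by move: (expR _) (pi : R) pp => y q q0; field; rewrite gt_eqF.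
have i2 : rintegrable P setT (fun=> 2 : R) by exact: finite_measure_integrable_cst.
have G2 w r : `|G w r| <= 2 * poisson x r.
  rewrite normrM (ger0_norm (poisson_ge0 r x0)) ler_wpM2r ?poisson_ge0 //.
  have := cos_geN1 (expR r * Z t w); have := cos_le1 (expR r * Z t w).
  by rewrite ler_norml => *; apply/andP; split; lra.
have [||h1 h2 e] := @Rfubini _ _ _ _ R P mu setT setT G (fun=> 2) (poisson x) measurableT measurableT _ i2 ip.
- by rewrite setXTT.
- by move=> w r _ _; exact: G2.
have inner r : \int[P]_w G w r = poisson x r * (1 - complex.Re (cexp (- (t%:C * F r)))).
  have i1 : rintegrable P setT (fun=> 1 : R) by exact: finite_measure_integrable_cst.
  have ic := cos_integrable t r.
  rewrite -Z_cos // -[in RHS](Pcst 1) -(RintegralB2 measurableT i1 ic).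
  rewrite -(RintegralZ measurableT _ (rintegrableB measurableT i1 ic)).
  by apply: eq_Rintegral => w _; rewrite /G mulrC.
apply: (le_trans le1); have -> : \int[P]_w k w = 2 / pi * \int[P]_w \int[mu]_r G w r.
  by rewrite -(RintegralZ measurableT _ h1); apply: eq_Rintegral => w _; exact: kE.
rewrite -[leRHS]mulrA ler_wpM2l ?divr_ge0 ?(ltW pp) // e.
have is3 := rintegrableZ measurableT (2 * C * root4 t) is2.
have -> : 2 * C * S * root4 t = \int[mu]_r (2 * C * root4 t * sech 2^-1 r).
  by rewrite (RintegralZ measurableT _ is2) mulrAC.
apply: le_Rintegral => // r _; rewrite inner.
have [_ _ F0] := hF.
have w0 : 0 <= complex.Re (t%:C * F r).
  by rewrite Re_mul [complex.Re t%:C]/= [complex.Im t%:C]/= mul0r subr0 mulr_ge0 // ltW.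
apply: (@le_trans _ _ (poisson x r * (2 * root4 (nm (t%:C * F r))))).
  by rewrite ler_wpM2l ?poisson_ge0 // one_sub_Re_cexp.
have -> : root4 (nm (t%:C * F r)) = root4 t * root4 (nm (F r)).
  by rewrite nmM nm_real gtr0_norm // /root4 sqrtrM ?(ltW t0) // sqrtrM // sqrtr_ge0.
have r0 := root4_gt0 t0; have h := ler_wpM2l (mulr_ge0 (ler0n R 2) (ltW r0)) (hC r).
by move: h; congr (_ <= _); ring.
Qed.

End half_line_transform.

(** * The ladder processes of the process *)

Section conjugate_symbol.
Variable R : realType.
Implicit Types (z w : R[i]) (f : R[i] -> R[i]).

Definition cj z : R[i] := complex.Re z +i* (- complex.Im z).

Lemma Re_cj z : complex.Re (cj z) = complex.Re z.
Proof. by []. Qed.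

Lemma Im_cj z : complex.Im (cj z) = - complex.Im z.
Proof. by []. Qed.

Lemma cjM z w : cj (z * w) = cj z * cj w.
Proof. by case: z w => [a b] [c e]; apply: complex_ext => /=; ring. Qed.

Lemma cjB z w : cj (z - w) = cj z - cj w.
Proof. by case: z w => [a b] [c e]; apply: complex_ext => /=; ring. Qed.

Lemma cjK z : cj (cj z) = z.
Proof. by apply: complex_ext; rewrite /= ?opprK. Qed.

Lemma nm_cj z : nm (cj z) = nm z.
Proof. by rewrite /nm /= sqrrN. Qed.

Lemma cjV z : cj z^-1 = (cj z)^-1.
Proof.
apply: complex_ext.
  by change (complex.Re z^-1 = complex.Re (cj z)^-1); rewrite !Re_inv nm_cj.
by change (- complex.Im z^-1 = complex.Im (cj z)^-1); rewrite !Im_inv nm_cj -mulNr.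
Qed.

Lemma cj_cexp z : cj (cexp z) = cexp (cj z).
Proof. by apply: complex_ext; rewrite /cexp /= ?cosN ?sinN ?mulrN //. Qed.

(** Reflecting the process conjugates its exponent on the real line; this is the holomorphic
    extension of that conjugate. It carries the descending ladder process to the ascending one. *)
Lemma rogers_cj f : rogers f -> rogers (fun z => cj (f (cj z))).
Proof.
move=> [hf h0]; split=> z z0.
  have [c hc] := derivable_cder (hf (cj z) z0).
  apply: (@cder_derivable _ _ _ (cj c)); apply/cderP => e e0.
  have [d d0 hd] := (cderP _ _ _).1 hc e e0; exists d => // w wd.
  have := hd (cj w); rewrite -cjB nm_cj => /(_ wd).
  by rewrite -[X in X <= _ -> _]nm_cj !cjB cjM cjB !cjK.
have := h0 (cj z) z0.
have -> : cj (f (cj z)) / z = cj (f (cj z) / cj z).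
  by rewrite cjM cjV cjK.
by [].
Qed.

End conjugate_symbol.

Section process.
Context d (T : measurableType d) (R : realType) (P : probability T R).
Notation mu := (@lebesgue_measure R).
Variable X : R -> {RV P >-> R}.
Implicit Types (t tau xi x : R).

Lemma complete_bernstein_eq (h h' : R -> R[i]) : (forall x, 0 < x -> h x = h' x) ->
  is_complete_bernstein h -> is_complete_bernstein h'.
Proof. by move=> hh [g hg e]; exists g => // x x0; rewrite e // hh. Qed.

Lemma distribution_integral (Y : {RV P >-> R}) (sg : R) (D : set R) (h : R -> R) (k : T -> R) :
  measurable D -> continuous h -> rintegrable P setT k ->
  (forall w, k w = if 0 < sg * Y w then h (Y w) else 0) ->
  (forall x, D x <-> 0 < sg * x) ->
  (\int[distribution P Y]_(x in D) (h x)%:E)%E = (\int[P]_w k w)%:E.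
Proof.
move=> mD ch ik kE hD.
have mh : measurable_fun setT h by exact: continuous_measurable_fun.
have rE : ((fun w => (h (Y w))%:E) \_ (Y @^-1` D)) = (fun w => (k w)%:E).
  apply/funext => w; rewrite patchE kE; case: ifPn => [|].
    by rewrite inE /= => /hD ->.
  rewrite notin_setE /= => n; case: ifP => // h0; exfalso; apply: n; exact/hD.
have mYD : measurable (Y @^-1` D) by rewrite -[X in measurable X]setTI; exact: measurable_funPT.
have ip : P.-integrable (Y @^-1` D) (fun w => (h (Y w))%:E).
  by apply/(integrable_mkcond _ mYD); rewrite rE.
have mhE : measurable_fun setT (EFin \o h) by exact/measurable_EFinP.
have e := @integral_pushforward _ _ _ _ R Y (measurable_funPT Y) P D (EFin \o h) mhE ip mD.
rewrite -(Rintegral_EFin measurableT ik).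
transitivity (\int[P]_(w in Y @^-1` D) (h (Y w))%:E)%E; first exact: e.
rewrite [LHS]integral_mkcond; apply: eq_integral => w _; exact: (congr1 (@^~ w) rE).
Qed.

(* [sg = 1] and [sg = -1] give the ascending and the descending ladder process. *)
Variables (sg : R) (D : set R).
Hypothesis mD : measurable D.
Hypothesis hD : forall x, D x <-> 0 < sg * x.

Let Z t w := sg * X t w.

Let mZ t : measurable_fun setT (Z t).
Proof. by apply: measurable_Rmul; [exact: measurable_cst|exact: measurable_funPT]. Qed.

Let p := half_transform P Z.

(** At real [xi] the integrand is real, so the oscillating factor of [exp_integral] is 1. The inner
    integral over the law of [X t] is an expectation, which gives [ladder_integrand]. *)
Lemma exp_integral_ladder tau xi (G : R -> R -> R[i]) : 0 <= xi ->
  (forall t x, G t x = ((expR (- t))%:C - cexp (- (tau * t)%:C - xi%:C * (sg * x)%:C)) / t%:C) ->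
  exp_integral X D G = (ladder p tau xi)%:C.
Proof.
move=> xi0 hG.
have GE t x : G t x = ((expR (- t) - expR (- (tau * t)) * expR (- (xi * (sg * x)))) / t)%:C.
  rewrite hG -expRD.
  have -> : - (tau * t)%:C - xi%:C * (sg * x)%:C = (- (tau * t) - xi * (sg * x))%:C.
    by apply: complex_ext; rewrite !ReImE /=; ring.
  by rewrite cexp_real rmorphM rmorphB /= fmorphV.
have re : (\int[mu]_(t in [set t : R | (0 < t)%R])
    \int[distribution P (X t)]_(x in D) (complex.Re (G t x))%:E =
    \int[mu]_(t in @posR R) (ladder_integrand p tau xi t)%:E)%E.
  apply: eq_integral => t _.
  pose k w := (expR (- t) * pexp 0 (Z t w) - expR (- (tau * t)) * pexp xi (Z t w)) / t.
  have i0 : rintegrable P setT (fun w => pexp 0 (Z t w)).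
    apply: (@bounded_rintegrable _ _ _ _ _ 1); first exact: measurable_pexp.
    by move=> w; rewrite ger0_norm ?pexp_ge0 ?pexp_le1.
  have ix : rintegrable P setT (fun w => pexp xi (Z t w)).
    apply: (@bounded_rintegrable _ _ _ _ _ 1); first exact: measurable_pexp.
    by move=> w; rewrite ger0_norm ?pexp_ge0 ?pexp_le1.
  have kE w : k w = expR (- t) / t * pexp 0 (Z t w) + - (expR (- (tau * t)) / t) * pexp xi (Z t w).
    by rewrite /k; ring.
  have ik : rintegrable P setT k.
    have := rintegrable_lin measurableT (expR (- t) / t) (- (expR (- (tau * t)) / t)) i0 ix.
    by apply: rintegrable_eq => // w _; rewrite kE.
  have -> : ladder_integrand p tau xi t = \int[P]_w k w.
    under [RHS]eq_Rintegral do rewrite kE.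
    rewrite (Rintegral_lin measurableT _ _ i0 ix) /ladder_integrand /p /half_transform; ring.
  pose h x := (expR (- t) - expR (- (tau * t)) * expR (- (xi * (sg * x)))) / t.
  have ch : continuous h.
    move=> x; apply: cvgM; last exact: cvg_cst.
    apply: cvgB; first exact: cvg_cst.
    apply: cvgM; first exact: cvg_cst.
    apply: (continuous_cvg _ (@continuous_expR R _)); apply: cvgN.
    apply: cvgM; first exact: cvg_cst.
    by apply: cvgM; [exact: cvg_cst|exact: cvg_id].
  rewrite -(@distribution_integral (X t) sg D h k mD ch ik) //.
    by apply: eq_integral => x _; rewrite GE.
  move=> w; rewrite /k /pexp -/(Z t w) /h; case: ifP => _; last by rewrite !mul0r !mulr0 subrr mul0r.
  by rewrite !mul1r mul0r oppr0 expR0 mulr1.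
have im : (\int[mu]_(t in [set t : R | (0 < t)%R])
    \int[distribution P (X t)]_(x in D) (complex.Im (G t x))%:E = 0)%E.
  apply: integral0_eq => t _; apply: integral0_eq => x _.
  by rewrite GE.
rewrite /exp_integral re im /ladder.
have -> : 0 +i* fine (0 : \bar R)%E = 0%:C by [].
by rewrite cexp_real expR0 mulr1.
Qed.

Variables (f : R[i] -> R[i]).
Hypothesis hf : rogers f.
Hypothesis Z_cos : forall t r, 0 < t ->
  \int[P]_w cos (expR r * Z t w) = complex.Re (cexp (- (t%:C * rogers_line f r))).
Hypothesis Z_sin : forall t r, 0 < t ->
  \int[P]_w sin (expR r * Z t w) = complex.Im (cexp (- (t%:C * rogers_line f r))).
Variable kap : R -> R -> R[i].
Hypothesis kapE : forall tau xi, 0 <= tau -> 0 <= xi -> kap tau xi = (ladder p tau xi)%:C.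

Lemma ladder_complete_bernstein :
  [/\ forall tau, 0 <= tau -> is_complete_bernstein (kap tau),
      forall xi, 0 <= xi -> is_complete_bernstein (kap ^~ xi),
      forall tau1 tau2, 0 <= tau1 -> tau1 <= tau2 ->
        is_complete_bernstein (fun xi => kap tau1 xi / kap tau2 xi)
    & forall xi1 xi2, 0 <= xi1 -> xi1 <= xi2 ->
        is_complete_bernstein (fun tau => kap tau xi1 / kap tau xi2)].
Proof.
have hF := rogers_line_symbol hf; have [B B0 hB] := rogers_line_growth hf.
have h1 t x : 0 < t -> 0 <= x -> 0 <= p t x by move=> _; exact: half_transform_ge0.
have h2 t x : 0 < t -> 0 <= x -> p t x <= 1 by move=> _; exact: half_transform_le1.
have h3 t x y : 0 < t -> 0 <= x -> x <= y -> p t y <= p t x by move=> _; exact: half_transform_mono.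
have h4 t : 0 < t -> p t n%:R @[n --> \oo] --> (0 : R) by move=> _; exact: half_transform_inf.
have h5 t : 0 < t -> p t (n.+1%:R)^-1 @[n --> \oo] --> p t 0 by move=> _; exact: half_transform_zero.
have h6 := half_transform_fourier mZ Z_cos Z_sin.
have h7 := half_transform_holder mZ hF B0 hB Z_cos.
have h8 := rogers_xi hf; have h9 := rogers_tau hf.
have quot (u v : R) : u%:C / v%:C = (u / v)%:C :> R[i] by rewrite rmorphM /= fmorphV.
split.
- move=> tau t0; apply: complete_bernstein_eq (cbf_complete_bernstein (ladder_cbf_xi hF h1 h2 h3 h4 h5 h6 h7 h8 t0)).
  by move=> x x0; rewrite kapE // ltW.
- move=> xi x0; apply: complete_bernstein_eq (cbf_complete_bernstein (ladder_cbf_tau hF h1 h2 h3 h4 h5 h6 h7 h9 x0)).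
  by move=> t t0; rewrite kapE // ltW.
- move=> a b a0 ab; apply: complete_bernstein_eq
    (cbf_complete_bernstein (ladder_ratio_xi hF h1 h2 h3 h4 h5 h6 h7 h8 a0 ab)).
  by move=> x x0; rewrite !kapE ?(ltW x0) ?(le_trans a0 ab) // quot.
- move=> a b a0 ab; apply: complete_bernstein_eq
    (cbf_complete_bernstein (ladder_ratio_tau hF h1 h2 h3 h4 h5 h6 h7 h9 a0 ab)).
  by move=> x x0; rewrite !kapE ?(ltW x0) ?(le_trans a0 ab) // quot.
Qed.

End process.

Unset Implicit Arguments.
Set Strict Implicit.

Theorem theorem1p1 (R : realType) (d : measure_display) (T : measurableType d)
    (P : probability T R) (X : R -> {RV P >-> R}) (Psi : R -> R[i])
    (hX : levy_process X) (hPsi : levy_khintchine_exponent X Psi)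
    (hR : exists2 f : R[i] -> R[i], nearly_balanced f &
            forall xi : R, 0 < xi -> Psi xi = f xi%:C) :
  [/\ (forall tau : R, 0 <= tau ->
         is_complete_bernstein (fun xi => kappa_up X tau xi%:C) /\
         is_complete_bernstein (fun xi => kappa_down X tau xi%:C)),
      (forall xi : R, 0 <= xi ->
         is_complete_bernstein (fun tau => kappa_up X tau xi%:C) /\
         is_complete_bernstein (fun tau => kappa_down X tau xi%:C))
    & (forall tau1 tau2 xi1 xi2 : R,
         0 <= tau1 -> tau1 <= tau2 -> 0 <= xi1 -> xi1 <= xi2 ->
         [/\ is_complete_bernstein
               (fun xi => kappa_up X tau1 xi%:C / kappa_up X tau2 xi%:C),
             is_complete_bernstein
               (fun xi => kappa_down X tau1 xi%:C / kappa_down X tau2 xi%:C),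
             is_complete_bernstein
               (fun tau => kappa_up X tau xi1%:C / kappa_up X tau xi2%:C)
           & is_complete_bernstein
               (fun tau => kappa_down X tau xi1%:C / kappa_down X tau xi2%:C)])].
Proof.
have [f nb hf] := hR; have rf : rogers f := nb.1.1.
(* Every positive frequency is some [e^r], where [Psi] agrees with [f]. *)
have lineE r t : 0 < t -> char_fun (X t) (expR r) = cexp (- (t%:C * rogers_line f r)).
  by move=> t0; rewrite hPsi ?ltW // hf ?expR_gt0.
have char_cos r t : 0 < t -> Rintegral P setT (fun w => cos (expR r * X t w)) =
    complex.Re (cexp (- (t%:C * rogers_line f r))).
  by move=> t0; rewrite -lineE // /char_fun /= expectation.unlock.
have char_sin r t : 0 < t -> Rintegral P setT (fun w => sin (expR r * X t w)) =
    complex.Im (cexp (- (t%:C * rogers_line f r))).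
  by move=> t0; rewrite -lineE // /char_fun /= expectation.unlock.
have [u1 u2 u3 u4] : [/\ forall tau, 0 <= tau -> is_complete_bernstein (fun xi => kappa_up X tau xi%:C),
    forall xi, 0 <= xi -> is_complete_bernstein (fun tau => kappa_up X tau xi%:C),
    forall tau1 tau2, 0 <= tau1 -> tau1 <= tau2 ->
      is_complete_bernstein (fun xi => kappa_up X tau1 xi%:C / kappa_up X tau2 xi%:C)
  & forall xi1 xi2, 0 <= xi1 -> xi1 <= xi2 ->
      is_complete_bernstein (fun tau => kappa_up X tau xi1%:C / kappa_up X tau xi2%:C)].
  apply: (@ladder_complete_bernstein _ _ R P X 1 f rf _ _ (fun tau xi => kappa_up X tau xi%:C)).
  - by move=> t r t0; rewrite -char_cos //; apply: eq_Rintegral => w _; rewrite mul1r.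
  - by move=> t r t0; rewrite -char_sin //; apply: eq_Rintegral => w _; rewrite mul1r.
  move=> tau xi _ xi0; apply: exp_integral_ladder => //.
  - exact: measurable_posR.
  - by move=> x; rewrite mul1r.
  - by move=> t x; rewrite mul1r.
have [d1 d2 d3 d4] : [/\ forall tau, 0 <= tau -> is_complete_bernstein (fun xi => kappa_down X tau xi%:C),
    forall xi, 0 <= xi -> is_complete_bernstein (fun tau => kappa_down X tau xi%:C),
    forall tau1 tau2, 0 <= tau1 -> tau1 <= tau2 ->
      is_complete_bernstein (fun xi => kappa_down X tau1 xi%:C / kappa_down X tau2 xi%:C)
  & forall xi1 xi2, 0 <= xi1 -> xi1 <= xi2 ->
      is_complete_bernstein (fun tau => kappa_down X tau xi1%:C / kappa_down X tau xi2%:C)].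
  (* [- X] has the conjugate characteristic function, hence the symbol [cj (f (cj z))]; at the
     positive point [e^r] the inner [cj] does nothing. *)
  have cE r t : cexp (- (t%:C * rogers_line (fun z => cj (f (cj z))) r)) =
      cj (cexp (- (t%:C * rogers_line f r))).
    rewrite cj_cexp /rogers_line; congr cexp.
    have -> : cj (expR r)%:C = (expR r)%:C by apply: complex_ext; rewrite //= oppr0.
    by case: (f _) => a b; apply: complex_ext => /=; ring.
  apply: (@ladder_complete_bernstein _ _ R P X (-1) _ (rogers_cj rf) _ _ (fun tau xi => kappa_down X tau xi%:C)).
  - move=> t r t0; rewrite cE Re_cj -char_cos //; apply: eq_Rintegral => w _.
    by rewrite mulN1r mulrN cosN.
  - move=> t r t0; rewrite cE Im_cj -char_sin //.
    have is1 : rintegrable P setT (fun w => sin (expR r * X t w)).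
      apply: (@bounded_rintegrable _ _ _ _ _ 1).
        apply: (measurable_continuous_comp (@continuous_sin R)); apply: measurable_Rmul.
          exact: measurable_cst.
        exact: measurable_funPT.
      by move=> w; rewrite ler_norml sin_geN1 sin_le1.
    rewrite -[RHS]mulN1r -(RintegralZ measurableT _ is1).
    by apply: eq_Rintegral => w _; rewrite mulN1r mulrN sinN mulN1r.
  move=> tau xi _ xi0; apply: exp_integral_ladder => //.
  - have -> : [set x : R | x < 0] = `]-oo, 0[%classic by apply/seteqP; split=> x; rewrite /= in_itv.
    exact: measurable_itv.
  - by move=> x; rewrite mulN1r oppr_gt0.
  - by move=> t x; rewrite mulN1r rmorphN mulrN opprK.
split.
- by move=> tau t0; split; [exact: u1|exact: d1].
- by move=> xi x0; split; [exact: u2|exact: d2].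
by move=> tau1 tau2 xi1 xi2 t1 t12 x1 x12; split; [exact: u3|exact: d3|exact: u4|exact: d4].
Qed.
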